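(* Let $a_1<a_2<b_1<b_2$ be real, $A=(a_1,a_2)$, $B=(b_1,b_2)$, $\eta=\frac{(a_2-a_1)(b_2-b_1)}{(b_1-a_1)(b_2-a_2)}$, and let $s_1<s_2<\cdots$ be the positive zeros of $s\mapsto P_{-is-\frac12}\left(\frac{1+\eta}{1-\eta}\right)$. Put $\omega(x)=\ln\left(-\frac{x-a_1}{x-a_2}\frac{x-b_2}{x-b_1}\right)$ and $D(x)=\sqrt{-(x-a_1)(x-a_2)(x-b_1)(x-b_2)}$ for $x\in A\cup B$. For $C_n\in\mathbb{C}\setminus\{0\}$ let $$\tilde v_{nA}(x)=\frac{C_n e^{-is_n\omega(x)}}{D(x)}\ (x\in A),\qquad \tilde v_{nB}(x)=-\frac{C_n e^{-is_n\omega(b_1+b_2-x)}}{D(b_1+b_2-x)}\ (x\in B),$$ each extended by zero, and $\tilde v_n=\tilde v_{nA}+\tilde v_{nB}$. Then for each $n$ there is a $C_n$, unique up to a phase, such that $\Omega(\tilde v_n^*,\tilde v_n)=i$. With such a choice of $C_n$ for every $n$, the following hold. (1) (Local symplectic orthogonality) For all $n,n'$, $$\Omega(\tilde v_{nA}^*,\tilde v_{n'A})=\Omega(\tilde v_{nB}^*,\tilde v_{n'B})=\tfrac{i}{2}\delta_{nn'},\qquad \Omega(\tilde v_{nA},\tilde v_{n'A})=\Omega(\tilde v_{nB},\tilde v_{n'B})=0 .$$ (2) (Core mode pairs) The functions $$v_{nA}(x)=\frac{\sqrt2\,C_n e^{-is_n\omega(x)}}{D(x)}\ (x\in A),\qquad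 v_{nB}(x)=-\frac{\sqrt2\,C_n^* e^{is_n\omega(x)}}{D(x)}\ (x\in B)$$ define normalized, mutually commuting modes in $A$ and in $B$, i.e. $\Omega(v_{nX}^*,v_{n'X})=i\delta_{nn'}$ and $\Omega(v_{nX},v_{n'X})=0$ for $X\in\{A,B\}$ and all $n,n'$; and for each $n$ the logarithmic negativity of the two-mode Gaussian state of the pair $(v_{nA},v_{nB})$ is carried by the partially transposed symplectic eigenvalue $\tanh(\pi s_n)$, i.e. it equals $$-\log_2\tanh(\pi s_n).$$
   Context: The setting is the right-moving sector of the vacuum of the $(1+1)$-dimensional massless scalar field; an observable is a smearing function $f$ on $A\cup B$ whose integrals over $A$ and over $B$ each vanish. $^*$ denotes complex conjugation. Legendre (conical) function: for $y>1$, $P_{-is-\frac12}(y)={}_2F_1\left(\tfrac12+is,\tfrac12-is;1;\tfrac{1-y}{2}\right)$. Commutator form (complex bilinear): $\Omega(f,g)=\frac14\iint \mathrm{sgn}(x-x')f(x)g(x')\,dx\,dx'$. Covariance form (complex bilinear): $G(f,g)=\int\frac{dk}{2\pi}\frac{1}{2|k|}\iint e^{ik(x-x')}f(x)g(x')\,dx\,dx'$, which on functions of vanishing integral equals $-\frac1{2\pi}\iint\ln|x-x'|\,f(x)g(x')\,dx\,dx'$. Two-mode state of a pair: given normalized $v_A$ supported in $A$ and $v_B$ supported in $B$ (that is, $\Omega(v_X^*,v_X)=i$), set $Q_X=\sqrt2\,\mathrm{Re}\,v_X$ and $P_X=\sqrt2\,\mathrm{Im}\,v_X$. Its covariance matrix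 is the $4\times4$ Gram matrix of $G$ on $(Q_A,Q_B,P_A,P_B)$, and its symplectic form is the canonical one, with $\Omega(Q_X,P_X)=1$. The partially transposed covariance matrix is obtained by replacing $P_B$ by $-P_B$ in the Gram matrix. Its symplectic eigenvalues are the two positive numbers $\nu$ such that $\pm i\nu$ are eigenvalues of $\Omega_{\mathrm{can}}G^\Gamma$ with $\Omega_{\mathrm{can}}=\begin{bmatrix}0&\mathbb I_2\\-\mathbb I_2&0\end{bmatrix}$. The logarithmic negativity of the pair is $\sum_{\nu<1}(-\log_2\nu)$ over these symplectic eigenvalues. *)

(* Defs.v *)
From HB Require Import structures.
From mathcomp Require Import all_boot all_order all_algebra.
From mathcomp Require Import complex.
From mathcomp Require Import all_classical all_reals all_analysis.
Set Implicit Arguments.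
Unset Strict Implicit.
Unset Printing Implicit Defensive.
Import Order.TTheory GRing.Theory Num.Theory numFieldNormedType.Exports.
Local Open Scope classical_set_scope.
Local Open Scope ring_scope.
Local Open Scope complex_scope.

Section Hypergeometric.
Context {R : realType}.
Implicit Types (a b c w : R[i]) (u : nat -> R[i]) (F : R -> R[i]) (x y s : R).

(* Convergence of a complex series, through real and imaginary parts. *)
Definition csums u w : Prop :=
  (series (fun k => complex.Re (u k)) @ \oo --> complex.Re w) /\
  (series (fun k => complex.Im (u k)) @ \oo --> complex.Im w).

Definition pochhammer a (k : nat) : R[i] := \prod_(j < k) (a + j%:R).

Definition gauss_term a b c x (k : nat) : R[i] :=
  pochhammer a k * pochhammer b k / (pochhammer c k * k`!%:R) * x%:C ^+ k.

Definition analytic_below1 F : Prop :=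
  forall x, x < 1 -> exists (r : R) (u : nat -> R[i]), 0 < r /\
    forall h : R, `|h| < r -> csums (fun k => u k * h%:C ^+ k) (F (x + h)).

Definition gauss_continuation a b c F : Prop :=
  analytic_below1 F /\
  forall x, `|x| < 1 -> csums (gauss_term a b c x) (F x).

(* 2F1(a, b; c; x) for real x < 1: the value of the (unique) analytic
   continuation along ]-oo, 1[ of the Gauss series. The continuation is needed:
   the argument of conicalP below is at most -1 as soon as y >= 3. *)
Definition hyp2F1 a b c x : R[i] :=
  xget 0 [set w | exists F, gauss_continuation a b c F /\ F x = w].

(* The conical function P_{-is-1/2}(y), for y > 1. *)
Definition conicalP s y : R[i] :=
  hyp2F1 (2^-1 +i* s) (2^-1 -i* s) 1 ((1 - y) / 2).

End Hypergeometric.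

Section Forms.
Context {R : realType}.
Implicit Types (f g : R -> R[i]) (I J : interval R).

Definition cexpi (t : R) : R[i] := cos t +i* sin t.

Definition cintegral (E : set R) f : R[i] :=
  (\int[lebesgue_measure]_(x in E) complex.Re (f x)) +i*
  (\int[lebesgue_measure]_(x in E) complex.Im (f x)).

Definition cintegrable f : Prop :=
  lebesgue_measure.-integrable setT (fun x : R => (complex.Re (f x))%:E) /\
  lebesgue_measure.-integrable setT (fun x : R => (complex.Im (f x))%:E).

(* Complex smearing functions on I `|` J with vanishing integral over each. *)
Definition observable I J f : Prop :=
  [/\ forall x, x \notin I -> x \notin J -> f x = 0,
      cintegrable f,
      cintegral [set` I] f = 0 &
      cintegral [set` J] f = 0].

Definition conjf f : R -> R[i] := fun x => conjc (f x).

Definition Omega f g : R[i] :=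
  4^-1 * cintegral setT (fun x =>
           cintegral setT (fun x' => (Num.sg (x - x'))%:C * f x * g x')).

Definition G f g : R[i] :=
  cintegral setT (fun k =>
    ((2 * pi)^-1 * (2 * `|k|)^-1)%:C *
    cintegral setT (fun x =>
      cintegral setT (fun x' => cexpi (k * (x - x')) * f x * g x'))).

End Forms.

Section TwoModes.
Context {R : realType}.
Implicit Types (v : R -> R[i]) (q : 'I_(2 + 2) -> R -> R[i]).

Definition quadQ v : R -> R[i] := fun x => (Num.sqrt 2 * complex.Re (v x))%:C.
Definition quadP v : R -> R[i] := fun x => (Num.sqrt 2 * complex.Im (v x))%:C.

Definition gram q : 'M[R[i]]_(2 + 2) := \matrix_(i, j) G (q i) (q j).

Definition covariance_pt vA vB : 'M[R[i]]_(2 + 2) :=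
  gram (fun i => nth (fun=> 0)
    [:: quadQ vA; quadQ vB; quadP vA; (fun x => - quadP vB x)] i).

Definition Omega_can : 'M[R[i]]_(2 + 2) := block_mx 0 1%:M (- 1%:M) 0.

(* nu lists the two symplectic eigenvalues of M: the eigenvalues of
   Omega_can *m M, with multiplicity, are the +- i nu_j. *)
Definition symplectic_eigenvalues (M : 'M[R[i]]_(2 + 2)) (nu : 'I_2 -> R) : Prop :=
  (forall j, 0 < nu j) /\
  char_poly (Omega_can *m M) =
    \prod_(j < 2) (('X - (0 +i* nu j)%:P) * ('X - (0 -i* nu j)%:P)).

Definition log2 (x : R) : R := ln x / ln 2.

Definition log_negativity (nu : 'I_2 -> R) : R :=
  \sum_(j < 2 | nu j < 1) - log2 (nu j).

Definition tanh (x : R) : R := (expR x - expR (- x)) / (expR x + expR (- x)).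

End TwoModes.

Section TwoIntervals.
Context {R : realType}.
Variables a1 a2 b1 b2 : R.
Implicit Types (s x : R) (C : R[i]).

Definition cross_ratio : R :=
  ((a2 - a1) * (b2 - b1)) / ((b1 - a1) * (b2 - a2)).

Definition omega x : R :=
  ln (- ((x - a1) / (x - a2) * ((x - b2) / (x - b1)))).

Definition Dfun x : R :=
  Num.sqrt (- ((x - a1) * (x - a2) * (x - b1) * (x - b2))).

Definition tvA s C : R -> R[i] := fun x =>
  if x \in `]a1, a2[ then C * cexpi (- (s * omega x)) / (Dfun x)%:C else 0.

Definition tvB s C : R -> R[i] := fun x =>
  if x \in `]b1, b2[ then
    - (C * cexpi (- (s * omega (b1 + b2 - x))) / (Dfun (b1 + b2 - x))%:C)
  else 0.

Definition tv s C : R -> R[i] := fun x => tvA s C x + tvB s C x.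

Definition vA s C : R -> R[i] := fun x =>
  if x \in `]a1, a2[ then
    (Num.sqrt 2)%:C * C * cexpi (- (s * omega x)) / (Dfun x)%:C
  else 0.

Definition vB s C : R -> R[i] := fun x =>
  if x \in `]b1, b2[ then
    - ((Num.sqrt 2)%:C * conjc C * cexpi (s * omega x) / (Dfun x)%:C)
  else 0.

End TwoIntervals.

(* Main.v *)
(* Put k^2 = 1 - eta and w(u) = (1 + k^2 sinh^2(u/2))^(-1/2). Up to a shift omega is a coordinate u
   on each of the two intervals, x = A(u) and x = B(u), in which dx / D(x) is proportional to
   w(u) du; A increases and B decreases. The modes become the charges cos(su) w du and
   sin(su) w du. The function of z equal to
   int cos(su) / (cosh^2(u/2) - z)^(1/2) du is analytic below 1 and proportional to the Gauss series
   near 0, so both charges have integral 0 when s is a zero of the conical function.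

   On charges of integral 0 the covariance form is -1/(2 pi) times the logarithmic energy, by
   Laplace regularization of the k-integral. Moreover
     ln|A(u) - A(v)| = ln|A(u) - B(v)| + L(u, v) + c(v)
   with L symmetric and c invisible on charges; likewise with A and B exchanged. Since
   dL/du = w(u) / (2 w(v) sinh((u - v)/2)) and
   int sin(sv) / sinh(v/2) dv is a multiple of tanh(pi s), integration by parts shows that the
   form with kernel L maps cos(su) w to tanh(pi s) times the symplectic pairing with sin(su) w.
   Symmetry of L then makes modes with different s orthogonal, and the partially transposed
   covariance matrix of a pair has tanh(pi s) as symplectic eigenvalue. The uncertainty relation,
   applied to one quadrature on both intervals and the difference of the conjugate quadratures,
   shows that the other eigenvalue is at least 1 / tanh(pi s). The same relation gives the sign
   of the symplectic norm of the modes, hence their normalization. *)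
Require Import Defs.
From HB Require Import structures.
From mathcomp Require Import all_boot all_order all_algebra.
From mathcomp Require Import complex ring lra.
From mathcomp Require Import all_classical all_reals all_analysis.
From mathcomp Require Import measurable_realfun.
Set Implicit Arguments.
Unset Strict Implicit.
Unset Printing Implicit Defensive.
Import Order.TTheory GRing.Theory Num.Theory numFieldNormedType.Exports.
Local Open Scope classical_set_scope.
Local Open Scope ring_scope.

(** * Real-valued Lebesgue integrals *)

(** No entry of the covariance matrix is computed. The energy of a density is known only relative to
    the energy between this density and its copy on the other interval; the difference is a value of
    the form with kernel L. This suffices because the partially transposed matrix is invariant under
    exchange of the intervals: on one combination of corresponding quadratures the unknown energies
    cancel and T = tanh (pi s) remains; on the other a determinant stays unknown, and a lower bound
    for it shows that the second eigenvalue does not contribute.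

    The k-integral is singular at 0 and does not converge absolutely in all variables together.
    Vanishing charge removes the singularity. A factor e^(-ek) is inserted and removed again by
    monotone convergence, since the spectral density of a single charge is nonnegative; polarization
    then treats two charges.

    The derivative of L has a nonintegrable singularity on the diagonal. The integration by parts
    therefore pairs the points y + v and y - v and cuts v off at a positive e. *)

Section RealIntegral.
Context d (T : measurableType d) (R : realType) (mu : {measure set T -> \bar R}).
Implicit Types (D : set T) (f g : T -> R).
Local Notation intg D f := (mu.-integrable D (EFin \o f)).

Lemma integrable_le D f g : measurable D -> measurable_fun D f ->
  (forall x, D x -> `|f x| <= g x) -> intg D g -> intg D f.
Proof.
move=> mD mf fg ig; apply: le_integrable ig => //; first exact/measurable_EFinP.
by move=> x Dx /=; rewrite lee_fin (le_trans (fg _ Dx))// ler_norm.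
Qed.

Lemma integrable_measurable D f : measurable D -> intg D f -> measurable_fun D f.
Proof. by move=> mD /integrableP[/measurable_EFinP]. Qed.

Lemma integrableDr D f g : measurable D -> intg D f -> intg D g ->
  intg D (fun x => f x + g x).
Proof. by move=> mD fi gi; apply: (integrableD mD fi gi). Qed.

Lemma integrableBr D f g : measurable D -> intg D f -> intg D g ->
  intg D (fun x => f x - g x).
Proof. by move=> mD fi gi; apply: (integrableB mD fi gi). Qed.

Lemma integrableNr D f : intg D f -> intg D (fun x => - f x).
Proof. by move=> fi; apply: (integrableN fi). Qed.

Lemma integrableZr D (k : R) f : measurable D -> intg D f ->
  intg D (fun x => k * f x).
Proof. by move=> mD fi; apply: (integrableZl mD k fi). Qed.

Lemma integrable_eq D f g : measurable D -> (forall x, D x -> f x = g x) -> intg D f -> intg D g.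
Proof.
by move=> mD fg; apply: eq_integrable => // x /set_mem Dx /=; rewrite fg.
Qed.

Lemma eq_Rint D f g : (forall x, D x -> f x = g x) ->
  \int[mu]_(x in D) f x = \int[mu]_(x in D) g x.
Proof. by move=> fg; apply: eq_Rintegral => x /set_mem Dx; exact: fg. Qed.

Lemma RintegralN D f : measurable D -> intg D f ->
  \int[mu]_(x in D) - f x = - \int[mu]_(x in D) f x.
Proof.
move=> mD fi; under eq_Rintegral do rewrite -mulN1r.
by rewrite RintegralZl// mulN1r.
Qed.

Lemma EFin_Rintegral D f : measurable D -> intg D f ->
  (\int[mu]_(x in D) f x)%:E = (\int[mu]_(x in D) (f x)%:E)%E.
Proof. by move=> mD fi; rewrite /Rintegral fineK//; exact: integrable_fin_num. Qed.

Lemma dominated_cvg_Rintegral D (f_ : nat -> T -> R) f g : measurable D ->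
  (forall n, measurable_fun D (f_ n)) ->
  (forall x, D x -> f_ n x @[n --> \oo] --> f x) -> intg D g ->
  (forall n x, D x -> `|f_ n x| <= g x) ->
  intg D f /\ \int[mu]_(x in D) f_ n x @[n --> \oo] --> \int[mu]_(x in D) f x.
Proof.
move=> mD mf ff ig fg.
have mf' : measurable_fun D f.
  by apply: (measurable_fun_cvg mf); exact: ff.
have fgx x : D x -> `|f x| <= g x.
  move=> Dx; have := ff _ Dx => /(@cvg_norm _ R^o) h.
  have /cvg_lim <- := h => //.
  by apply: limr_le; [apply/cvg_ex; eexists; exact: h|apply: nearW => n; exact: fg].
have if_ n : intg D (f_ n) by apply: integrable_le ig => //; exact: fg.
have fi : intg D f by apply: integrable_le ig.
split=> //.
have := @dominated_cvg _ _ _ mu D mD (fun n => EFin \o f_ n) (EFin \o f) (EFin \o g).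
have Hm n : measurable_fun D (EFin \o f_ n) by exact/measurable_EFinP.
move=> /(_ Hm).
have Hc x : D x -> (EFin \o f_ n) x @[n --> \oo] --> (EFin \o f) x.
  by move=> Dx; apply: cvg_EFin; [exact: nearW|exact: ff].
move=> /(_ Hc (fun _ _ => erefl) ig).
have Hd n x : D x -> (`|(EFin \o f_ n) x| <= (EFin \o g) x)%E.
  by move=> Dx; rewrite /= lee_fin; exact: fg.
move=> /(_ Hd); rewrite /= -[X in _ --> X](EFin_Rintegral mD fi).
by move=> /fine_cvgP[].
Qed.

(** Monotone convergence with integrability of the limit as a conclusion. It serves to remove a
    damping factor from an integrand such as [N k / k], for which no majorant is known
    beforehand. *)
Lemma monotone_cvg_Rintegral D (f_ : nat -> T -> R) f (l : R) : measurable D ->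
  (forall n x, D x -> 0 <= f_ n x) -> (forall n, intg D (f_ n)) ->
  (forall x, D x -> nondecreasing_seq (fun n => f_ n x)) ->
  (forall x, D x -> f_ n x @[n --> \oo] --> f x) ->
  \int[mu]_(x in D) f_ n x @[n --> \oo] --> l ->
  intg D f /\ \int[mu]_(x in D) f x = l.
Proof.
move=> mD f0 fi nd ff fl.
have mf n : measurable_fun D (f_ n) by exact: integrable_measurable.
have mf' : measurable_fun D f by apply: (measurable_fun_cvg mf); exact: ff.
have f0' x : D x -> 0 <= f x.
  move=> Dx; have /cvg_lim <- := ff _ Dx => //.
  by apply: limr_ge; [apply/cvg_ex; eexists; exact: ff|apply: nearW => n; exact: f0].
have E : (\int[mu]_(x in D) (f x)%:E = l%:E)%E.
  have := @cvg_monotone_convergence _ _ _ mu D mD (fun n => EFin \o f_ n).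
  have Hm n : measurable_fun D (EFin \o f_ n) by exact/measurable_EFinP.
  move=> /(_ Hm).
  have H0 n x : D x -> (0 <= (EFin \o f_ n) x)%E.
    by move=> Dx; rewrite /= lee_fin; exact: f0.
  move=> /(_ H0).
  have Hn x : D x -> {homo (fun n => (EFin \o f_ n) x) : n m / (n <= m)%N >-> (n <= m)%E}.
    by move=> Dx n m nm; rewrite /= lee_fin; exact: nd.
  move=> /(_ Hn) H.
  have Ef : (\int[mu]_(x in D) (f x)%:E =
      \int[mu]_(x in D) limn (fun n => (EFin \o f_ n) x))%E.
    apply: eq_integral => x /set_mem Dx; apply/esym/cvg_lim => //.
    by apply: cvg_EFin; [exact: nearW|exact: ff].
  rewrite Ef; apply: (cvg_unique _ H) => //=.
  rewrite (_ : (fun n => _) = (fun n => (\int[mu]_(x in D) f_ n x)%:E)).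
    by apply: cvg_EFin => //; exact: nearW.
  by apply/funext => n; rewrite EFin_Rintegral.
split; last by rewrite /Rintegral E.
apply/integrableP; split; first exact/measurable_EFinP.
rewrite (eq_integral (fun x => (f x)%:E)) ?E ?ltry//.
by move=> x /set_mem Dx /=; rewrite ger0_norm// f0'.
Qed.

(** A uniform bound on the integrals takes the place of a majorant: this is how integrability is
    obtained when only a bounded primitive is known. *)
Lemma fatou_integrable D (f_ : nat -> T -> R) f (M : R) : measurable D ->
  (forall n x, D x -> 0 <= f_ n x) -> (forall n, intg D (f_ n)) ->
  (forall x, D x -> f_ n x @[n --> \oo] --> f x) ->
  (forall n, \int[mu]_(x in D) f_ n x <= M) ->
  intg D f /\ \int[mu]_(x in D) f x <= M.
Proof.
move=> mD f0 fi ff fM.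
have mf n : measurable_fun D (f_ n) by exact: integrable_measurable.
have mf' : measurable_fun D f by apply: (measurable_fun_cvg mf); exact: ff.
have f0' x : D x -> 0 <= f x.
  move=> Dx; have /cvg_lim <- := ff _ Dx => //.
  by apply: limr_ge; [apply/cvg_ex; eexists; exact: ff|apply: nearW => n; exact: f0].
have Hm n : measurable_fun D (EFin \o f_ n) by exact/measurable_EFinP.
have H0 n x : D x -> (0 <= (EFin \o f_ n) x)%E.
  by move=> Dx; rewrite /= lee_fin; exact: f0.
have E : (\int[mu]_(x in D) (f x)%:E <= M%:E)%E.
  have := fatou mu mD Hm H0.
  rewrite (eq_integral (EFin \o f)); last first.
    move=> x /set_mem Dx.
    have H : (EFin \o f_ n) x @[n --> \oo] --> (EFin \o f) x.
      by apply: cvg_EFin; [exact: nearW|exact: ff].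
    rewrite is_cvg_limn_einfE; last by apply/cvg_ex; eexists; exact: H.
    exact/cvg_lim.
  move/le_trans; apply.
  rewrite limn_einf_lim; apply: lime_le.
    exact: is_cvg_einfs.
  apply: nearW => n; apply: (@le_trans _ _ (\int[mu]_(x in D) (f_ n x)%:E)%E).
    by apply: ereal_inf_lbound; exists n => //=.
  by rewrite -EFin_Rintegral// lee_fin.
have I : intg D f.
  apply/integrableP; split; first exact/measurable_EFinP.
  rewrite (eq_integral (fun x => (f x)%:E)); first by rewrite (le_lt_trans E)// ltry.
  by move=> x /set_mem Dx /=; rewrite ger0_norm// f0'.
by split=> //; rewrite -lee_fin EFin_Rintegral.
Qed.

Lemma ge0_integrable_lty D f : measurable D -> measurable_fun D f ->
  (forall x, D x -> 0 <= f x) -> (\int[mu]_(x in D) (f x)%:E < +oo)%E -> intg D f.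
Proof.
move=> mD mf f0 h; apply/integrableP; split; first exact/measurable_EFinP.
rewrite (eq_integral (fun x => (f x)%:E))// => x /set_mem Dx /=.
by rewrite ger0_norm// f0.
Qed.

Lemma ler_Rintegral D f g : measurable D -> intg D f -> intg D g ->
  (forall x, D x -> f x <= g x) ->
  \int[mu]_(x in D) f x <= \int[mu]_(x in D) g x.
Proof. by move=> mD fi gi fg; exact: le_Rintegral. Qed.

Lemma norm_Rintegral_le D f g : measurable D -> measurable_fun D f ->
  (forall x, D x -> `|f x| <= g x) -> intg D g ->
  `|\int[mu]_(x in D) f x| <= \int[mu]_(x in D) g x.
Proof.
move=> mD mf fg ig; have fi := integrable_le mD mf fg ig.
apply: (le_trans (le_normr_Rintegral mD fi)); apply: ler_Rintegral => //.
exact: integrable_norm.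
Qed.

End RealIntegral.
Notation intg mu D f := (mu.-integrable D (EFin \o f)).

(** * Change of variables along an increasing parametrization of an interval *)

Section ChangeOfVariables.
Context (R : realType).
Local Notation leb := (@lebesgue_measure R).
Variables (X dX Xi : R -> R) (I : interval R).
Hypothesis XI : forall u, X u \in I.
Hypothesis XK : forall u, Xi (X u) = u.
Hypothesis XiK : forall x, x \in I -> X (Xi x) = x.
Hypothesis mXi : measurable_fun setT Xi.
Hypothesis dXE : forall u, is_derive u (1 : R) X (dX u).
Hypothesis cdX : continuous dX.
Hypothesis dX0 : forall u, 0 <= dX u.

Let cX : continuous X.
Proof.
move=> u; apply/differentiable_continuous/derivable1_diffP.
by have [] := dXE u.
Qed.

Let mX : measurable_fun setT X.
Proof. exact: continuous_measurable_fun. Qed.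

Let mdX : measurable_fun setT dX.
Proof. exact: continuous_measurable_fun. Qed.

Let Xmono : {mono X : u v / u <= v}.
Proof.
apply: le_mono => u v uv; rewrite lt_neqAle; apply/andP; split.
  by apply/eqP => /(congr1 Xi); rewrite !XK => /eqP; rewrite lt_eqF.
have H : {in `[u, v] &, {homo X : x y / x <= y}}.
  apply: ger0_derive1_le_cc.
  - by move=> z _; have [] := dXE z.
  - by move=> z _; rewrite derive1E; have [_ ->] := dXE z.
  - by apply: continuous_subspaceT.
by apply: H; rewrite ?in_itv/= ?lexx ?(ltW uv).
Qed.

Let Xlt : {mono X : u v / u < v} := leW_mono Xmono.

Let ndX : nondecreasing X. Proof. by move=> u v; rewrite -Xmono. Qed.

Let rcX : right_continuous X.
Proof. by move=> u; apply: cvg_at_right_filter; exact: cX. Qed.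

(** The measure with density [dX] and the image under [Xi] of the Lebesgue measure of [I] are
    compared through the Stieltjes measure of [X], which is determined by its values on half-open
    intervals. *)
Let cum : cumulative R R := HB.pack X (isCumulative.Build R _ R X ndX rcX).

Let ftcX u v : u < v -> (\int[leb]_(t in `[u, v]) (dX t)%:E = (X v)%:E - (X u)%:E)%E.
Proof.
move=> uv; apply: continuous_FTC2 => //.
- exact: continuous_subspaceT.
- split; [by move=> z _; have [] := dXE z | |].
  + by apply: cvg_at_right_filter; exact: cX.
  + by apply: cvg_at_left_filter; exact: cX.
- by move=> z _; rewrite derive1E; have [_ ->] := dXE z.
Qed.

Let nu1 (A : set (measurableTypeR R)) : \bar R := (\int[leb]_(t in A) (dX t)%:E)%E.

Let nu1_0 : nu1 set0 = 0%E. Proof. exact: integral_set0. Qed.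
Let nu1_ge0 A : (0 <= nu1 A)%E.
Proof. by apply: integral_ge0 => x _; rewrite lee_fin. Qed.
Let nu1_add : semi_sigma_additive nu1.
Proof. by apply: semi_sigma_additive_nng_induced => //; exact/measurable_EFinP. Qed.

HB.instance Definition _ := isMeasure.Build _ _ _ nu1 nu1_0 nu1_ge0 nu1_add.

Let nu2 (A : set (measurableTypeR R)) : \bar R := leb ([set` I] `&` Xi @^-1` A).

Let mpre (Y : R -> R) (A : set (measurableTypeR R)) : measurable_fun setT Y ->
  measurable A -> measurable (Y @^-1` A : set (measurableTypeR R)).
Proof. by move=> mY mA; rewrite -[X in measurable X]setTI; exact: mY. Qed.

Let nu2_0 : nu2 set0 = 0%E. Proof. by rewrite /nu2 preimage_set0 setI0. Qed.
Let nu2_ge0 A : (0 <= nu2 A)%E. Proof. exact: measure_ge0. Qed.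
Let nu2_add : semi_sigma_additive nu2.
Proof.
move=> F mF tF mUF; rewrite /nu2 preimage_bigcup setI_bigcupr.
apply: measure_semi_sigma_additive.
- by move=> n; apply: measurableI => //; apply: mpre.
- apply/trivIsetP => /= i j _ _ ij; rewrite -setIIr -preimage_setI.
  by move/trivIsetP : tF => /(_ _ _ _ _ ij) ->//; rewrite preimage_set0 setI0.
- by apply: bigcup_measurable => n _; apply: measurableI => //; apply: mpre.
Qed.

HB.instance Definition _ := isMeasure.Build _ _ _ nu2 nu2_0 nu2_ge0 nu2_add.

(** On ]a, b] both sides are [X b - X a], the right one by the fundamental theorem of calculus. *)
Let nu1E A : measurable A -> lebesgue_stieltjes_measure cum A = nu1 A.
Proof.
apply: lebesgue_stieltjes_measure_unique => _ /ocitvP[->|[[a b] /= ab ->]].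
  by rewrite !measure0.
rewrite [LHS]measurable_mu_extE/=; last exact: is_ocitv.
rewrite wlength_itv_bnd ?(ltW ab)//= /nu1.
by rewrite integral_itv_obnd_cbnd ?ftcX//; apply/measurable_EFinP; exact: measurable_funTS.
Qed.

Let nu2E A : measurable A -> lebesgue_stieltjes_measure cum A = nu2 A.
Proof.
apply: lebesgue_stieltjes_measure_unique => _ /ocitvP[->|[[a b] /= ab ->]].
  by rewrite !measure0.
rewrite [LHS]measurable_mu_extE/=; last exact: is_ocitv.
rewrite wlength_itv_bnd ?(ltW ab)//= /nu2.
rewrite (_ : _ `&` _ = `]X a, X b]%classic).
  by rewrite lebesgue_measure_itv/= lte_fin Xlt ab.
apply/seteqP; split => x.
  move=> [xI /=]; rewrite !in_itv/= => /andP[ax xb].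
  by have {}xI : x \in I := xI; rewrite -(XiK xI) Xlt Xmono ax xb.
rewrite /= in_itv /= => /andP[ax xb].
have xI : x \in I.
  by apply: (@interval_is_interval _ I (X a) (X b)) => //=; rewrite (ltW ax) xb.
by split => //; rewrite /= in_itv /= -Xlt -Xmono (XiK xI) ax xb.
Qed.

Let setE (A : set R) : measurable A ->
  leb ([set` I] `&` A) = (\int[leb]_(t in X @^-1` A) (dX t)%:E)%E.
Proof.
move=> mA.
have mXA := mpre mX mA.
rewrite -/(nu1 (X @^-1` A)) -nu1E// nu2E// /nu2; congr (leb _).
apply/seteqP; split => x [xI] /=; rewrite XiK//.
Qed.

Import HBNNSimple.

Let nnsfunE (g : {nnsfun measurableTypeR R >-> R}) :
  (\int[leb]_(x in [set` I]) (g x)%:E = \int[leb]_u ((g (X u))%:E * (dX u)%:E))%E.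
Proof.
have mg k : measurable (g @^-1` [set k] : set (measurableTypeR R)).
  by rewrite -[X in measurable X]setTI; exact: measurable_funP.
have mXg k := mpre mX (mg k).
have mI k : measurable_fun setT ((fun x => \1_(g @^-1` [set k]) (X x)) : measurableTypeR R -> R).
  have H : measurable_fun setT (\1_(X @^-1` (g @^-1` [set k])) : measurableTypeR R -> R).
    exact: measurable_indic.
  exact: H.
have k0 k : k \in range g -> 0 <= k.
  by rewrite inE => -[x _ <-].
under eq_integral do rewrite fimfunE -fsumEFin//.
rewrite ge0_integral_fsum//; last 2 first.
- by move=> r; apply/measurable_EFinP; apply: measurable_funM => //; apply: measurable_funTS.
- by move=> n x _; rewrite EFinM; exact: nnfun_muleindic_ge0.
under [in RHS]eq_integral => x _.
  rewrite fimfunE -fsumEFin// ge0_mule_fsuml; last first.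
    by move=> i; rewrite EFinM; exact: nnfun_muleindic_ge0.
  over.
rewrite ge0_integral_fsum//; last 2 first.
- by move=> r; apply/measurable_EFinP; apply: measurable_funM => //; apply: measurable_funM => //.
- move=> n x _; apply: mule_ge0; last by rewrite lee_fin.
  by rewrite EFinM; exact: nnfun_muleindic_ge0.
apply: eq_fsbigr => r rg.
under eq_integral do rewrite EFinM.
rewrite ge0_integralZl ?lee_fin ?k0//; last first.
  by apply/measurable_EFinP; apply: measurable_funTS; exact: measurable_indic.
under [in RHS]eq_integral do rewrite EFinM -muleA.
rewrite [RHS]ge0_integralZl ?lee_fin ?k0//; last 2 first.
- by apply/measurable_EFinP; apply: measurable_funM => //.
- by move=> x _; rewrite mule_ge0// lee_fin.
congr (_ * _)%E.
rewrite integral_indic// setIC.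
rewrite [LHS](setE (A := g @^-1` [set r]) (mg r)) [LHS]integral_mkcond.
apply: eq_integral => x _; rewrite patchE indicE /=.
rewrite (_ : (x \in X @^-1` (g @^-1` [set r])) = (X x \in g @^-1` [set r]))//.
by case: ifP => _; rewrite ?mul1e ?mul0e.
Qed.

(** For the indicator of a set this is [setE]; simple functions follow by linearity, and the general
    case by monotone convergence. *)
Lemma ge0_change_of_variables (F : R -> \bar R) : measurable_fun setT F ->
  (forall x, 0 <= F x)%E ->
  (\int[leb]_(x in [set` I]) F x = \int[leb]_u (F (X u) * (dX u)%:E))%E.
Proof.
move=> mF F0.
have mF' : measurable_fun setT (F : measurableTypeR R -> \bar R) by exact: mF.
pose g := nnsfun_approx measurableT mF'.
have mg n : measurable_fun setT (g n : measurableTypeR R -> R) by exact: measurable_funP.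
have mX' : measurable_fun setT (X : measurableTypeR R -> measurableTypeR R) by exact: mX.
have gF x : (g n x)%:E @[n --> \oo] --> F x by apply: cvg_nnsfun_approx.
have ndg x : {homo (fun n => (g n x)%:E) : n m / (n <= m)%N >-> (n <= m)%E}.
  by move=> n m nm; rewrite lee_fin; exact/lefP/nd_nnsfun_approx.
have L : (\int[leb]_(x in [set` I]) (g n x)%:E @[n --> \oo] -->
   \int[leb]_(x in [set` I]) F x)%E.
  rewrite (_ : (\int[leb]_(x in [set` I]) F x)%E =
      \int[leb]_(x in [set` I]) limn (fun n => (g n x)%:E))%E; last first.
    by apply: eq_integral => x _; apply/esym/cvg_lim.
  apply: cvg_monotone_convergence => //.
  - by move=> n; apply/measurable_EFinP; apply: measurable_funTS.
  - by move=> n x _; rewrite lee_fin.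
have gX u : ((g n (X u))%:E * (dX u)%:E)%E @[n --> \oo] --> (F (X u) * (dX u)%:E)%E.
  by apply: cvgeZr.
have Rr : (\int[leb]_u ((g n (X u))%:E * (dX u)%:E) @[n --> \oo] -->
   \int[leb]_u (F (X u) * (dX u)%:E))%E.
  rewrite (_ : (\int[leb]_u (F (X u) * (dX u)%:E))%E =
      \int[leb]_u limn (fun n => (g n (X u))%:E * (dX u)%:E))%E; last first.
    by apply: eq_integral => x _; apply/esym/cvg_lim => //; exact: gX.
  apply: cvg_monotone_convergence => //.
  - move=> n; apply/measurable_EFinP; apply: measurable_funM => //.
    exact: (measurableT_comp (mg n) mX').
  - by move=> n x _; rewrite lee_fin mulr_ge0.
  - by move=> u _ n m nm; rewrite lee_wpmul2r ?lee_fin//; exact: ndg.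
apply: (cvg_unique _ L) => //.
rewrite (_ : (fun n => _) = (fun n => \int[leb]_u ((g n (X u))%:E * (dX u)%:E))%E)//.
by apply/funext => n; rewrite nnsfunE.
Qed.

End ChangeOfVariables.

(** * Integrals in a chart of an interval *)

Section Charts.
Context (R : realType).
Local Notation leb := (@lebesgue_measure R).
Implicit Types (X dX : R -> R) (I : interval R).

(* [X] maps the line onto [I], monotonically or not, with Jacobian [dX]. *)
Definition is_chart X dX I : Prop :=
  [/\ measurable_fun setT X, measurable_fun setT dX,
      forall u, X u \in I /\ 0 <= dX u,
      forall x, x \in I -> exists u, X u = x &
      forall F : R -> \bar R, measurable_fun setT F -> (forall x, 0 <= F x)%E ->
        (\int[leb]_(x in [set` I]) F x = \int[leb]_u (F (X u) * (dX u)%:E))%E].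

Lemma increasing_chart X dX Xi I : (forall u, X u \in I) -> (forall u, Xi (X u) = u) ->
  (forall x, x \in I -> X (Xi x) = x) -> measurable_fun setT Xi ->
  (forall u, is_derive u (1 : R) X (dX u)) -> continuous dX -> (forall u, 0 <= dX u) ->
  is_chart X dX I.
Proof.
move=> XI XK XiK mXi dXE cdX dX0; split => //.
- apply: continuous_measurable_fun => u; apply/differentiable_continuous/derivable1_diffP.
  by have [] := dXE u.
- exact: continuous_measurable_fun.
- by move=> x xI; exists (Xi x); exact: XiK.
- by move=> F mF F0; exact: (ge0_change_of_variables XI XK XiK mXi dXE cdX dX0).
Qed.

Variables (X dX : R -> R) (I : interval R).
Hypothesis cX : is_chart X dX I.

Let mX : measurable_fun setT X. Proof. by have [] := cX. Qed.
Let mdX : measurable_fun setT dX. Proof. by have [] := cX. Qed.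
Let dX0 u : 0 <= dX u. Proof. by have [_ _ /(_ u)[]] := cX. Qed.

Let chart_ge0 (F : R -> \bar R) : measurable_fun setT F -> (forall x, 0 <= F x)%E ->
  (\int[leb]_(x in [set` I]) F x = \int[leb]_u (F (X u) * (dX u)%:E))%E.
Proof. by have [_ _ _ _ h] := cX; exact: h. Qed.

Lemma integrable_chart (f : R -> R) : measurable_fun setT f ->
  intg leb setT (fun u => f (X u) * dX u) <-> intg leb [set` I] f.
Proof.
move=> mf.
have E : (\int[leb]_(x in [set` I]) `|(f x)%:E| = \int[leb]_u `|(f (X u) * dX u)%:E|)%E.
  rewrite (chart_ge0 (F := fun x => `|(f x)%:E|%E))//; last first.
    by apply: measurableT_comp => //; exact/measurable_EFinP.
  by apply: eq_integral => u _; rewrite EFinM abseM (gee0_abs (x:=(dX u)%:E))// lee_fin.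
split=> /integrableP[_ h]; apply/integrableP; split.
- by apply/measurable_EFinP; apply: measurable_funTS.
- by rewrite E.
- by apply/measurable_EFinP; apply: measurable_funM => //; exact: measurableT_comp.
- by rewrite -E.
Qed.

(** Positive and negative parts are transported separately by the nonnegative case, so the identity
    holds between default values as well. *)
Lemma Rintegral_chart (f : R -> R) : measurable_fun setT f ->
  \int[leb]_(x in [set` I]) f x = \int[leb]_u (f (X u) * dX u).
Proof.
move=> mf; have mf' : measurable_fun setT (EFin \o f) by exact/measurable_EFinP.
rewrite /Rintegral; congr fine.
rewrite integralE [RHS]integralE; congr (_ - _)%E.
  rewrite chart_ge0//; last exact: measurable_funepos.
  apply: eq_integral => u _.
  by rewrite !funeposE /= -!EFin_max -EFinM maxr_pMl// mul0r.
rewrite chart_ge0//; last exact: measurable_funeneg.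
apply: eq_integral => u _.
by rewrite !funenegE /= -!EFin_max -EFinM maxr_pMl// mul0r mulNr.
Qed.

End Charts.

(** * Derivatives and measurability of explicit functions *)

Section DeriveLambda.
Context (R : realType).
Implicit Types (f g : R -> R) (x a b : R).
Local Notation D1 x f a := (is_derive (x : R) (1 : R) (f : R -> R) (a : R)).

Lemma der_cst x a : D1 x (fun=> a) 0.
Proof. exact: is_derive_cst. Qed.
Lemma der_id x : D1 x (fun y => y) 1.
Proof. exact: is_derive_id. Qed.
Lemma derD x f g a b : D1 x f a -> D1 x g b -> D1 x (fun y => f y + g y) (a + b).
Proof. by move=> fa gb; exact: is_deriveD. Qed.
Lemma derN x f a : D1 x f a -> D1 x (fun y => - f y) (- a).
Proof. by move=> fa; exact: is_deriveN. Qed.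
Lemma derM x f g a b : D1 x f a -> D1 x g b ->
  D1 x (fun y => f y * g y) (a * g x + f x * b).
Proof.
move=> fa gb; have := is_deriveM fa gb; rewrite /GRing.scale /= addrC.
by rewrite (mulrC _ a).
Qed.
Lemma derV x f a : f x != 0 -> D1 x f a -> D1 x (fun y => (f y)^-1) (- (a / f x ^+ 2)).
Proof.
move=> fx fa; have := is_deriveV fx fa; rewrite /GRing.scale /=.
by rewrite mulNr mulrC.
Qed.
Lemma der_comp x f g a b : D1 (f x) g b -> D1 x f a -> D1 x (fun y => g (f y)) (b * a).
Proof. by move=> gb fa; exact: is_derive1_comp. Qed.
Lemma der_exp x f a : D1 x f a -> D1 x (fun y => expR (f y)) (expR (f x) * a).
Proof. by move=> fa; apply: der_comp => //; exact: is_derive_expR. Qed.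
Lemma der_sin x f a : D1 x f a -> D1 x (fun y => sin (f y)) (cos (f x) * a).
Proof. by move=> fa; apply: der_comp => //; exact: is_derive_sin. Qed.
Lemma der_cos x f a : D1 x f a -> D1 x (fun y => cos (f y)) (- sin (f x) * a).
Proof. by move=> fa; apply: der_comp => //; exact: is_derive_cos. Qed.
Lemma der_ln x f a : 0 < f x -> D1 x f a -> D1 x (fun y => ln (f y)) (a / f x).
Proof.
by move=> fx fa; rewrite mulrC; apply: der_comp => //; exact: is_derive1_ln.
Qed.
Lemma der_sqrt x f a : 0 < f x -> D1 x f a ->
  D1 x (fun y => Num.sqrt (f y)) (a / (2 * Num.sqrt (f x))).
Proof.
by move=> fx fa; rewrite mulrC; apply: der_comp => //; exact: is_derive1_sqrt.
Qed.
Lemma der_atan x f a : D1 x f a -> D1 x (fun y => atan (f y)) (a / (1 + f x ^+ 2)).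
Proof.
by move=> fa; rewrite mulrC; apply: der_comp => //; exact: is_derive1_atan.
Qed.
Lemma der_eq x f a b : D1 x f a -> a = b -> D1 x f b.
Proof. by move=> fa <-. Qed.
Lemma der_expn x f a n : D1 x f a -> D1 x (fun y => f y ^+ n.+1) (n.+1%:R * f x ^+ n * a).
Proof.
move=> fa; elim: n => [|n IH].
  by apply: der_eq fa _; rewrite expr0 !mul1r.
apply: der_eq (derM fa IH) _; rewrite -natr1 (exprS (f x) n); ring.
Qed.
Lemma der_continuous x f a : D1 x f a -> {for x, continuous f}.
Proof.
by move=> [fx _]; apply/differentiable_continuous/derivable1_diffP.
Qed.

Lemma der_eqfun x f g a : (forall y, f y = g y) -> D1 x f a -> D1 x g a.
Proof. by move=> /funext <-. Qed.

End DeriveLambda.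

Ltac der_eta := match goal with
  | |- is_derive _ _ (fun _ => _) _ => fail 1
  | |- is_derive ?x ?v ?f ?a => change (is_derive x v (fun y => f y) a)
  end.
Ltac der1 := lazymatch goal with
  | |- is_derive _ _ (fun _ => ?c) _ => notypeclasses refine (der_cst _ _)
  | |- is_derive _ _ (fun y => y) _ => notypeclasses refine (der_id _)
  | |- is_derive _ _ (@expR _) _ => notypeclasses refine (is_derive_expR _)
  | |- is_derive _ _ (@sin _) _ => notypeclasses refine (is_derive_sin _)
  | |- is_derive _ _ (@cos _) _ => notypeclasses refine (is_derive_cos _)
  | |- is_derive _ _ (fun y => - (@?f y)) _ => notypeclasses refine (derN _)
  | |- is_derive _ _ (fun y => (@?f y) + (@?g y)) _ => notypeclasses refine (derD _ _)
  | |- is_derive _ _ (fun y => (@?f y) * (@?g y)) _ => notypeclasses refine (derM _ _)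
  | |- is_derive _ _ (fun y => (@?f y) ^+ _.+1) _ => notypeclasses refine (der_expn _ _)
  | |- is_derive _ _ (fun y => (@?f y)^-1) _ => notypeclasses refine (derV _ _)
  | |- is_derive _ _ (fun y => expR (@?f y)) _ => notypeclasses refine (der_exp _)
  | |- is_derive _ _ (fun y => sin (@?f y)) _ => notypeclasses refine (der_sin _)
  | |- is_derive _ _ (fun y => cos (@?f y)) _ => notypeclasses refine (der_cos _)
  | |- is_derive _ _ (fun y => ln (@?f y)) _ => notypeclasses refine (der_ln _ _)
  | |- is_derive _ _ (fun y => Num.sqrt (@?f y)) _ => notypeclasses refine (der_sqrt _ _)
  | |- is_derive _ _ (fun y => atan (@?f y)) _ => notypeclasses refine (der_atan _)
  end.
Ltac der_hyp := match goal with H : is_derive _ _ _ _ |- is_derive _ _ _ _ => notypeclasses refine H end.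
Ltac der := repeat first [ der_hyp | der1 | der_eta ].
Ltac derive_by := notypeclasses refine (der_eq _ _).

Section MeasurableLambda.
Context d (T : measurableType d) (R : realType).
Implicit Types (f g : T -> R) (D : set T).

Lemma ms_exp D f : measurable_fun D f -> measurable_fun D (fun x => expR (f x)).
Proof. by move=> mf; apply: measurableT_comp. Qed.
Lemma ms_continuous D f (h : R -> R) : continuous h -> measurable_fun D f ->
  measurable_fun D (fun x => h (f x)).
Proof.
by move=> ch mf; apply: (measurableT_comp (f := h)) => //; exact: continuous_measurable_fun.
Qed.
Lemma ms_sin D f : measurable_fun D f -> measurable_fun D (fun x => sin (f x)).
Proof. exact/ms_continuous/continuous_sin. Qed.
Lemma ms_cos D f : measurable_fun D f -> measurable_fun D (fun x => cos (f x)).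
Proof. exact/ms_continuous/continuous_cos. Qed.
Lemma ms_atan D f : measurable_fun D f -> measurable_fun D (fun x => atan (f x)).
Proof. exact/ms_continuous/continuous_atan. Qed.
Lemma ms_sqrt D f : measurable_fun D f -> measurable_fun D (fun x => Num.sqrt (f x)).
Proof. by move=> mf; apply: (ms_continuous (h := Num.sqrt)) => //; exact: sqrt_continuous. Qed.
Lemma ms_ln D f : measurable_fun D f -> measurable_fun D (fun x => ln (f x)).
Proof. by move=> mf; apply: (measurableT_comp (f := @ln R)) => //; exact: measurable_ln. Qed.
Lemma ms_norm D f : measurable_fun D f -> measurable_fun D (fun x => `|f x|).
Proof. by move=> mf; apply: measurableT_comp. Qed.
Lemma ms_V D f : measurable_fun D f -> measurable_fun D (fun x => (f x)^-1).
Proof.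
move=> mf; apply: (measurableT_comp (f := (fun y : R => y^-1))) => //.
(* These continuous functions converge pointwise to the inverse, including its default value 0 at
   0. *)
pose h n (y : R) := y / (y ^+ 2 + n.+1%:R^-1).
have p n (y : R) : 0 < y ^+ 2 + n.+1%:R^-1.
  by rewrite ltr_wpDl ?sqr_ge0 ?invr_gt0.
have mh n : measurable_fun setT (h n).
  apply: continuous_measurable_fun => y; apply: cvgM; first exact: cvg_id.
  apply: cvgV; first by rewrite gt_eqF.
  by apply: cvgD; [apply: cvgM; exact: cvg_id|exact: cvg_cst].
apply: (measurable_fun_cvg mh) => y _; rewrite /h.
have [->|y0] := eqVneq y 0.
  by rewrite invr0; under eq_fun do rewrite mul0r; exact: cvg_cst.
have -> : y^-1 = y / (y ^+ 2 + 0) by rewrite addr0; field.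
apply: cvgM; first exact: cvg_cst.
apply: cvgV; first by rewrite addr0 expf_neq0.
by apply: cvgD; [exact: cvg_cst|exact: cvg_harmonic].
Qed.
Lemma ms_N D f : measurable_fun D f -> measurable_fun D (fun x => - f x).
Proof. by move=> mf; apply: measurable_funN. Qed.
Lemma ms_D D f g : measurable_fun D f -> measurable_fun D g ->
  measurable_fun D (fun x => f x + g x).
Proof. exact: measurable_funD. Qed.
Lemma ms_M D f g : measurable_fun D f -> measurable_fun D g ->
  measurable_fun D (fun x => f x * g x).
Proof. exact: measurable_funM. Qed.
Lemma ms_X D f n : measurable_fun D f -> measurable_fun D (fun x => f x ^+ n).
Proof. exact: measurable_funX. Qed.
Lemma ms_cst D (a : R) : measurable_fun D (fun _ : T => a).
Proof. exact: measurable_cst. Qed.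
Lemma ms_sg D f : measurable_fun D f -> measurable_fun D (fun x => Num.sg (f x)).
Proof.
move=> mf; apply: (measurableT_comp (f := @Num.sg R)) => //.
have -> : @Num.sg R = (fun x => \1_(`]0, +oo[%classic) x - \1_(`]-oo, 0[%classic) x).
  apply/funext => x; rewrite !indicE.
  rewrite !mem_setE !in_itv /= andbT.
  have [x0|x0|->] := ltrgtP x 0.
  - by rewrite ltr0_sg// sub0r.
  - by rewrite gtr0_sg// subr0.
  - by rewrite sgr0 subr0.
by apply: measurable_funB; exact: measurable_indic.
Qed.

End MeasurableLambda.

Ltac ms1 := lazymatch goal with
  | |- measurable_fun _ (fun _ => ?c) => exact: ms_cst
  | |- measurable_fun _ (fun y => y) => exact: measurable_id
  | |- measurable_fun _ (fun y => y.1) => exact: measurable_fst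
  | |- measurable_fun _ (fun y => y.2) => exact: measurable_snd
  | |- measurable_fun _ (fun y => - (@?f y)) => apply: ms_N
  | |- measurable_fun _ (fun y => (@?f y) + (@?g y)) => apply: ms_D
  | |- measurable_fun _ (fun y => (@?f y) * (@?g y)) => apply: ms_M
  | |- measurable_fun _ (fun y => (@?f y) ^+ _) => apply: ms_X
  | |- measurable_fun _ (fun y => (@?f y)^-1) => apply: ms_V
  | |- measurable_fun _ (@expR _) => exact: measurable_expR
  | |- measurable_fun _ (fun y => expR (@?f y)) => apply: ms_exp
  | |- measurable_fun _ (fun y => sin (@?f y)) => apply: ms_sin
  | |- measurable_fun _ (fun y => cos (@?f y)) => apply: ms_cos
  | |- measurable_fun _ (fun y => ln (@?f y)) => apply: ms_ln
  | |- measurable_fun _ (fun y => Num.sqrt (@?f y)) => apply: ms_sqrt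
  | |- measurable_fun _ (fun y => atan (@?f y)) => apply: ms_atan
  | |- measurable_fun _ (fun y => `|@?f y|) => apply: ms_norm
  | |- measurable_fun _ (fun y => Num.sg (@?f y)) => apply: ms_sg
  end.
Ltac ms := repeat first [ assumption | ms1 ].

(** * Improper integrals of derivatives, by exhaustion *)

Section FTC.
Context (R : realType).
Local Notation leb := (@lebesgue_measure R).
Implicit Types (D : set (measurableTypeR R)) (f F : R -> R) (a b l m : R).

Lemma Rintegral_itv_FTC f F a b : a < b ->
  (forall x, a <= x <= b -> is_derive (x : R) (1 : R) F (f x)) ->
  (forall x, a <= x <= b -> {for x, continuous f}) ->
  intg leb `[a, b] f /\ \int[leb]_(x in `[a, b]) f x = F b - F a.
Proof.
move=> ab dF cf.
have cf' : {within `[a, b], continuous f}.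
  apply/subspace_continuousP => x xab; apply: cvg_within_filter.
  by apply: cf; move: xab; rewrite /= in_itv.
have cF x : a <= x <= b -> {for x, continuous F} by move=> /dF/der_continuous.
split; first by apply: continuous_compact_integrable => //; exact: segment_compact.
rewrite /Rintegral (@continuous_FTC2 _ f F)//.
- split.
  + by move=> z; rewrite in_itv => /andP[az zb]; case: (dF z) => //; rewrite !ltW.
  + by apply: cvg_at_right_filter; apply: cF; rewrite lexx ltW.
  + by apply: cvg_at_left_filter; apply: cF; rewrite lexx ltW.
- move=> z; rewrite in_itv => /andP[az zb]; rewrite derive1E.
  by case: (dF z) => [|//]; rewrite !ltW.
Qed.

Section exhaustion.
Variables (D : set (measurableTypeR R)) (f F : R -> R) (a b : nat -> R).
Hypothesis mD : measurable D.
Hypothesis ab : forall n, a n < b n.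
Hypothesis abD : forall n x, a n <= x <= b n -> D x.
Hypothesis Dab : forall x, D x -> \forall n \near \oo, a n <= x <= b n.
Hypothesis dF : forall x, D x -> is_derive (x : R) (1 : R) F (f x).
Hypothesis cf : forall x, D x -> {for x, continuous f}.

Let g n x := f x * \1_(`[a n, b n]%classic) x.

Let gE n : g n = f \_ (`[a n, b n]%classic).
Proof.
by apply/funext => x; rewrite /g patchE indicE; case: ifP; rewrite ?mulr1 ?mulr0.
Qed.

Let subD n : `[a n, b n]%classic `<=` D.
Proof. by move=> x /=; rewrite in_itv; exact: abD. Qed.

Let ftc n : intg leb `[a n, b n] f /\
  \int[leb]_(x in `[a n, b n]) f x = F (b n) - F (a n).
Proof. by apply: Rintegral_itv_FTC => // x /abD; [exact: dF|exact: cf]. Qed.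

Let ig n : intg leb D (g n).
Proof.
rewrite gE.
apply: (integrableS measurableT) => //.
rewrite -restrict_EFin; apply/(integrable_mkcond _ _).1 => //.
by have [] := ftc n.
Qed.

Let Ig n : \int[leb]_(x in D) g n x = F (b n) - F (a n).
Proof.
by rewrite gE -Rintegral_mkcondr setIidr//; have [] := ftc n.
Qed.

Let gf x : D x -> g n x @[n --> \oo] --> f x.
Proof.
move=> Dx; apply: cvg_near_cst; near=> n.
rewrite /g indicE mem_set ?mulr1//= in_itv; near: n; exact: Dab.
Unshelve. all: by end_near. Qed.

Let mf : measurable_fun D f.
Proof.
apply: (measurable_fun_cvg (h := g)) => // n.
by apply: integrable_measurable (ig n).
Qed.

(** The truncations of [f] to [a n, b n] have integral [F (b n) - F (a n)] and are dominated by the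
    absolute value of [f]. *)
Lemma Rintegral_exhaust_FTC (l m : R) : intg leb D f ->
  F (b n) @[n --> \oo] --> l -> F (a n) @[n --> \oo] --> m ->
  \int[leb]_(x in D) f x = l - m.
Proof.
move=> fi Fl Fm.
have H n x : D x -> `|g n x| <= `|f x|.
  move=> _; rewrite /g indicE normrM.
  by case: (_ \in _); rewrite ?normr1 ?normr0 ?mulr1 ?mulr0.
have [_] := dominated_cvg_Rintegral mD
  (fun n => integrable_measurable mD (ig n)) gf (integrable_norm fi) H.
under eq_fun do rewrite Ig.
move=> /cvg_lim <- //; apply/cvg_lim => //; exact: cvgB.
Qed.

(** The integrals of the truncations are increments of the bounded primitive [F], so Fatou's lemma
    applies. *)
Lemma exhaust_integrable (M : R) : (forall x, D x -> 0 <= f x) ->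
  (forall x, D x -> `|F x| <= M) -> intg leb D f.
Proof.
move=> f0 FM.
have H0 n x : D x -> 0 <= g n x.
  by move=> Dx; rewrite /g mulr_ge0 ?f0.
have HM n : \int[leb]_(x in D) g n x <= M + M.
  rewrite Ig; apply: (le_trans (ler_norm _)); apply: (le_trans (ler_normB _ _)).
  by apply: lerD; apply: FM; apply: (abD (n := n)); rewrite lexx ltW.
by have [] := fatou_integrable mD H0 ig gf HM.
Qed.

End exhaustion.

Lemma Rintegral_ray_FTC f F (c l m : R) :
  (forall x, c < x -> is_derive (x : R) (1 : R) F (f x)) ->
  (forall x, c < x -> {for x, continuous f}) ->
  intg leb `]c, +oo[ f ->
  F x @[x --> +oo] --> l -> F x @[x --> c^'+] --> m ->
  \int[leb]_(x in `]c, +oo[) f x = l - m.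
Proof.
move=> dF cf fi Fl Fm.
apply: (@Rintegral_exhaust_FTC `]c, +oo[ f F (fun n => c + n.+1%:R^-1)
  (fun n => c + 1 + n.+1%:R)) => //.
- move=> n; rewrite -addrA ltrD2l (@le_lt_trans _ _ 1) ?ltrDl//.
  by rewrite invf_le1 ?ler1n.
- move=> n x /andP[h _]; rewrite /= in_itv/= andbT (lt_le_trans _ h)// ltrDl invr_gt0//.
- move=> x /=; rewrite in_itv/= andbT => cx; near=> n; apply/andP; split.
    rewrite -lerBrDl -[leRHS]invrK lef_pV2 ?posrE ?invr_gt0 ?subr_gt0//.
    rewrite (@le_trans _ _ n%:R) ?ler_nat//; near: n; exact: nbhs_infty_ger.
  rewrite (@le_trans _ _ (c + 1 + n%:R)) ?lerD2l ?ler_nat//.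
  by rewrite -lerBlDl; near: n; exact: nbhs_infty_ger.
- by move=> x /=; rewrite in_itv/= andbT; exact: dF.
- by move=> x /=; rewrite in_itv/= andbT; exact: cf.
- have /cvg_pinftyP := Fl; apply; apply/cvgryPge => A; near=> n.
  rewrite -lerBlDl (@le_trans _ _ n%:R) ?ler_nat//; near: n; exact: nbhs_infty_ger.
- have /cvg_at_rightP := Fm; apply; split; first by move=> n; rewrite ltrDl invr_gt0.
  rewrite -[X in _ --> X]addr0; apply: cvgD; [exact: cvg_cst|exact: cvg_harmonic].
Unshelve. all: by end_near. Qed.

Lemma ray_integrable f F (c M : R) :
  (forall x, c < x -> is_derive (x : R) (1 : R) F (f x)) ->
  (forall x, c < x -> {for x, continuous f}) ->
  (forall x, c < x -> 0 <= f x) -> (forall x, c < x -> `|F x| <= M) ->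
  intg leb `]c, +oo[ f.
Proof.
move=> dF cf f0 FM.
apply: (@exhaust_integrable `]c, +oo[ f F (fun n => c + n.+1%:R^-1)
  (fun n => c + 1 + n.+1%:R) _ _ _ _ _ _ M) => //.
- move=> n; rewrite -addrA ltrD2l (@le_lt_trans _ _ 1) ?ltrDl//.
  by rewrite invf_le1 ?ler1n.
- move=> n x /andP[h _]; rewrite /= in_itv/= andbT (lt_le_trans _ h)// ltrDl invr_gt0//.
- move=> x /=; rewrite in_itv/= andbT => cx; near=> n; apply/andP; split.
    rewrite -lerBrDl -[leRHS]invrK lef_pV2 ?posrE ?invr_gt0 ?subr_gt0//.
    rewrite (@le_trans _ _ n%:R) ?ler_nat//; near: n; exact: nbhs_infty_ger.
  rewrite (@le_trans _ _ (c + 1 + n%:R)) ?lerD2l ?ler_nat//.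
  by rewrite -lerBlDl; near: n; exact: nbhs_infty_ger.
- by move=> x /=; rewrite in_itv/= andbT; exact: dF.
- by move=> x /=; rewrite in_itv/= andbT; exact: cf.
- by move=> x /=; rewrite in_itv/= andbT; exact: f0.
- by move=> x /=; rewrite in_itv/= andbT; exact: FM.
Unshelve. all: by end_near. Qed.

Lemma Rintegral_line_FTC f F (l m : R) :
  (forall x, is_derive (x : R) (1 : R) F (f x)) -> continuous f ->
  intg leb setT f ->
  F x @[x --> +oo] --> l -> F x @[x --> -oo] --> m ->
  \int[leb]_x f x = l - m.
Proof.
move=> dF cf fi Fl Fm.
apply: (@Rintegral_exhaust_FTC setT f F (fun n => - n.+1%:R) (fun n => n.+1%:R)) => //.
- by move=> n; rewrite (@lt_trans _ _ 0) ?oppr_lt0.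
- move=> x _; near=> n; rewrite -ler_norml (@le_trans _ _ n%:R) ?ler_nat//.
  near: n; exact: nbhs_infty_ger.
- by move=> x _; exact: cf.
- have /cvg_pinftyP := Fl; apply; apply/cvgryPge => A; near=> n.
  rewrite (@le_trans _ _ n%:R) ?ler_nat//; near: n; exact: nbhs_infty_ger.
- have /cvg_ninftyP := Fm; apply; apply/cvgrNyPle => A; near=> n.
  rewrite lerNl (@le_trans _ _ n%:R) ?ler_nat//; near: n; exact: nbhs_infty_ger.
Unshelve. all: by end_near. Qed.

Lemma line_integrable f F (M : R) :
  (forall x, is_derive (x : R) (1 : R) F (f x)) -> continuous f ->
  (forall x, 0 <= f x) -> (forall x, `|F x| <= M) -> intg leb setT f.
Proof.
move=> dF cf f0 FM.
apply: (@exhaust_integrable setT f F (fun n => - n.+1%:R) (fun n => n.+1%:R)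
  _ _ _ _ _ _ M) => //.
- by move=> n; rewrite (@lt_trans _ _ 0) ?oppr_lt0.
- move=> x _; near=> n; rewrite -ler_norml (@le_trans _ _ n%:R) ?ler_nat//.
  near: n; exact: nbhs_infty_ger.
- by move=> x _; exact: cf.
Unshelve. all: by end_near. Qed.

End FTC.

(** * Translation, reflection and folding of integrals over the line *)

Section Invariance.
Context (R : realType).
Local Notation leb := (@lebesgue_measure R).
Implicit Types (f : R -> R) (a : R).

Let shift_chart a : is_chart (fun u : R => u + a) (fun=> 1) `]-oo, +oo[.
Proof.
apply: (@increasing_chart _ _ _ (fun x => x - a)) => //.
- by move=> u; rewrite addrK.
- by move=> x _; rewrite subrK.
- by ms.
- by move=> u; notypeclasses refine (der_eq _ _); [der|rewrite addr0].
- by move=> x; exact: cvg_cst.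
Qed.

Lemma integrable_shift f a : measurable_fun setT f ->
  intg leb setT (fun u => f (u + a)) <-> intg leb setT f.
Proof.
move=> mf; rewrite -[in X in _ <-> X]set_itvNyy -(integrable_chart (shift_chart a) mf).
by under [in X in _ <-> X]eq_fun do rewrite mulr1.
Qed.

Lemma Rintegral_shift f a : measurable_fun setT f ->
  \int[leb]_u f (u + a) = \int[leb]_x f x.
Proof.
move=> mf; rewrite -[in RHS]set_itvNyy (Rintegral_chart (shift_chart a) mf).
by under [in RHS]eq_Rintegral do rewrite mulr1.
Qed.

Lemma ge0_integral_opp (F : R -> \bar R) : measurable_fun setT F ->
  (forall x, 0 <= F x)%E -> (\int[leb]_u F (- u)%R = \int[leb]_x F x)%E.
Proof.
move=> mF F0.
have mN : measurable_fun setT (-%R : measurableTypeR R -> measurableTypeR R).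
  have : measurable_fun setT (fun x : R => - x) by ms.
  exact.
have := @ge0_integral_pushforward _ _ _ _ R _ mN leb setT F measurableT mF (fun x _ => F0 x).
rewrite preimage_setT => <-.
by apply: eq_measure_integral => A mA _; exact: lebesgue_measureN.
Qed.

Lemma integrable_opp f : measurable_fun setT f ->
  intg leb setT (fun u => f (- u)) <-> intg leb setT f.
Proof.
move=> mf.
have mf' : measurable_fun setT (fun u : R => f (- u)).
  apply: (measurableT_comp mf).
  have : measurable_fun setT (fun x : R => - x) by ms.
  exact.
have E : (\int[leb]_x `|(f (- x))%:E| = \int[leb]_x `|(f x)%:E|)%E.
  rewrite -(@ge0_integral_opp (fun x => `|(f x)%:E|%E))//.
  by apply: measurableT_comp => //; exact/measurable_EFinP.
split=> /integrableP[_ h]; apply/integrableP; split.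
- exact/measurable_EFinP.
- by rewrite -E.
- exact/measurable_EFinP.
- by rewrite E.
Qed.

Lemma Rintegral_opp f : measurable_fun setT f ->
  \int[leb]_u f (- u) = \int[leb]_x f x.
Proof.
move=> mf; have mf' : measurable_fun setT (EFin \o f) by exact/measurable_EFinP.
rewrite /Rintegral; congr fine; rewrite integralE [RHS]integralE; congr (_ - _)%E.
  rewrite -(ge0_integral_opp (measurable_funepos mf'))//.
  by apply: eq_integral => u _; rewrite !funeposE.
rewrite -(ge0_integral_opp (measurable_funeneg mf'))//.
by apply: eq_integral => u _; rewrite !funenegE.
Qed.

(** Reflection of the parameter turns an increasing chart into a decreasing one, as needed on the
    second interval. *)
Lemma chart_opp (X dX : R -> R) (I : interval R) : is_chart X dX I ->
  is_chart (fun u => X (- u)) (fun u => dX (- u)) I.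
Proof.
have mN : measurable_fun setT (fun x : R => - x) by ms.
case=> mX mdX XI Xs E; split.
- exact: (measurableT_comp mX).
- exact: (measurableT_comp mdX).
- by move=> u; exact: XI.
- by move=> x /Xs[u ux]; exists (- u); rewrite opprK.
- move=> F mF F0; rewrite E//.
  rewrite -(@ge0_integral_opp (fun u => F (X u) * (dX u)%:E)%E)//.
    apply: emeasurable_funM; first exact: (measurableT_comp mF).
    exact/measurable_EFinP.
  by move=> u; rewrite mule_ge0// lee_fin; have [_] := XI u.
Qed.

Lemma integrable_fold f : measurable_fun setT f -> intg leb `]0, +oo[ f ->
  intg leb `]0, +oo[ (fun v => f (- v)) -> intg leb setT f.
Proof.
move=> mf fp fn.
set P := `]0, +oo[%classic : set (measurableTypeR R).
have mP : measurable P by exact: measurable_itv.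
have mNf : measurable_fun setT (fun v : R => f (- v)).
  apply: (measurableT_comp mf); have : measurable_fun setT (fun x : R => - x) by ms.
  exact.
have i1 : intg leb setT (f \_ P) by rewrite -restrict_EFin; apply/(integrable_mkcond _ _).1.
have i2 : intg leb setT ((fun v => f (- v)) \_ P).
  by rewrite -restrict_EFin; apply/(integrable_mkcond _ _).1.
have i3 : intg leb setT (fun x => ((fun v => f (- v)) \_ P) (- x)).
  apply/integrable_opp => //.
  by apply/(measurable_restrictT _ _).1 => //; exact: measurable_funTS.
(* Both open rays miss the origin; the value there is carried by a multiple of the indicator of this
   point. *)
have i4 := integrableZr `|f 0| measurableT (integrable_indic_itv (0:R) 0 true false).
have i5 : intg leb setT (fun x => `|(f \_ P) x| +
    `|((fun v => f (- v)) \_ P) (- x)| + `|f 0| * \1_(`[0, 0]%classic) x).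
  apply: integrableDr => //; apply: integrableDr => //.
    exact: (integrable_norm i1).
  exact: (integrable_norm i3).
apply: (integrable_le _ _ _ i5) => //.
move=> x _; rewrite /= !patchE indicE /P.
rewrite !mem_setE !in_itv /= !andbT opprK oppr_gt0.
by have [x0|x0|->] := ltrgtP x 0; rewrite /= ?normr0 ?add0r ?addr0 ?mulr1 ?lerDl ?mulr0 ?addr0.
Qed.

Lemma Rintegral_fold f : intg leb setT f ->
  \int[leb]_x f x = \int[leb]_(v in `]0, +oo[) (f v + f (- v)).
Proof.
move=> fi; have mf := integrable_measurable measurableT fi.
have mNf : measurable_fun setT (fun v : R => f (- v)).
  apply: (measurableT_comp mf); have : measurable_fun setT (fun x : R => - x) by ms.
  exact.
have fNi : intg leb setT (fun v => f (- v)) by apply/integrable_opp.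
rewrite RintegralD//; last 2 first.
- exact: integrableS fi.
- exact: integrableS fNi.
have H := @Rintegral_itvB R f (BInfty _ true) (BInfty _ false) 0.
move: H; rewrite set_itvNyy => /(_ fi isT isT) <-.
rewrite -[LHS](subrK (\int[leb]_(x in `]-oo, 0]) f x)); congr (_ + _).
rewrite -Rintegral_itv_bndo_bndc; last exact: integrableS fi.
rewrite Rintegral_mkcond [RHS]Rintegral_mkcond -[RHS]Rintegral_opp; last first.
  apply/(measurable_restrictT _ _).1 => //; exact: measurable_funTS.
apply: eq_Rint => x _; rewrite !patchE opprK !mem_setE !in_itv /= andbT.
by rewrite oppr_gt0.
Qed.

End Invariance.

(** * Iterated integrals of kernels dominated by a product *)

Section FubiniProduct.
Context d1 d2 (T1 : measurableType d1) (T2 : measurableType d2) (R : realType).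
Variables (m1 : {sigma_finite_measure set T1 -> \bar R})
  (m2 : {sigma_finite_measure set T2 -> \bar R}).
Variables (D1 : set T1) (D2 : set T2).
Hypotheses (mD1 : measurable D1) (mD2 : measurable D2).
Variables (a : T1 -> R) (b : T2 -> R).
Hypotheses (ia : intg m1 D1 a) (ib : intg m2 D2 b).

Lemma integrable_tensor_setT (a' : T1 -> R) (b' : T2 -> R) :
  intg m1 setT a' -> intg m2 setT b' ->
  intg (m1 \x m2)%E setT (fun z => a' z.1 * b' z.2).
Proof.
move=> ia' ib'.
have ma := integrable_measurable measurableT ia'.
have mb := integrable_measurable measurableT ib'.
have mab : measurable_fun setT (fun z : T1 * T2 => a' z.1 * b' z.2).
  by apply: ms_M; [apply: (measurableT_comp ma)|apply: (measurableT_comp mb)].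
apply/(integrable12ltyP); first exact/measurable_EFinP.
rewrite (eq_integral (fun x => `|(a' x)%:E| * \int[m2]_y `|(b' y)%:E|)%E); last first.
  move=> x _ /=; rewrite -ge0_integralZl//; last first.
    by apply/measurable_EFinP; exact: ms_norm.
  by apply: eq_integral => y _; rewrite normrM EFinM.
have /integrableP[_ hb] := ib'; have /integrableP[_ ha] := ia'.
rewrite ge0_integralZr//.
- by rewrite lte_mul_pinfty ?integral_ge0// ge0_fin_numE ?integral_ge0.
- by apply/measurable_EFinP; exact: ms_norm.
- exact: integral_ge0.
Qed.

Variable f : T1 * T2 -> R.
Hypothesis mf : measurable_fun setT f.
Hypothesis fab : forall x y, D1 x -> D2 y -> `|f (x, y)| <= a x * b y.

Let F := f \_ (D1 `*` D2).

Let mF : measurable_fun setT F.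
Proof.
apply/(measurable_restrictT _ _).1; first exact: measurableX.
exact: measurable_funTS.
Qed.

Lemma integrable_tensor : intg (m1 \x m2)%E setT F.
Proof.
apply: (@integrable_le _ _ _ _ setT F (fun z => (a \_ D1) z.1 * (b \_ D2) z.2)) => //.
  move=> [x y] _ /=; rewrite /F patchE in_setX !patchE /=.
  case: ifP => [/andP[h1 h2]|].
    by rewrite h1 h2; apply: fab; exact: set_mem.
  by case: ifP => _; case: ifP => _; rewrite // ?mulr0 ?mul0r normr0.
apply: (@integrable_tensor_setT (a \_ D1) (b \_ D2)).
  by rewrite -restrict_EFin; apply/(integrable_mkcond _ _).1.
by rewrite -restrict_EFin; apply/(integrable_mkcond _ _).1.
Qed.

Let inner2 x : D1 x -> (fun y => F (x, y)) = (fun y => f (x, y)) \_ D2.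
Proof.
by move=> D1x; apply/funext => y; rewrite /F !patchE in_setX /= (mem_set D1x).
Qed.

Let inner1 y : D2 y -> (fun x => F (x, y)) = (fun x => f (x, y)) \_ D1.
Proof.
by move=> D2y; apply/funext => x; rewrite /F !patchE in_setX /= (mem_set D2y) andbT.
Qed.

Lemma tensor_integrable2 x : D1 x -> intg m2 D2 (fun y => f (x, y)).
Proof.
move=> D1x; apply: (@integrable_le _ _ _ _ D2 _ (fun y => a x * b y)) => //.
- apply: measurable_funTS; apply: (measurableT_comp mf); exact: pair1_measurable.
- by move=> y D2y; exact: fab.
- exact: integrableZr.
Qed.

Lemma tensor_integrable1 y : D2 y -> intg m1 D1 (fun x => f (x, y)).
Proof.
move=> D2y; apply: (@integrable_le _ _ _ _ D1 _ (fun x => b y * a x)) => //.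
- apply: measurable_funTS; apply: (measurableT_comp mf); exact: pair2_measurable.
- by move=> x D1x; rewrite mulrC; exact: fab.
- exact: integrableZr.
Qed.

Let G12 x : D1 x -> \int[m2]_(y in D2) f (x, y) = \int[m2]_y F (x, y).
Proof. by move=> D1x; rewrite Rintegral_mkcond inner2. Qed.

Let G12' x : ~ D1 x -> \int[m2]_y F (x, y) = 0.
Proof.
move=> D1x; rewrite (@eq_Rint _ _ _ _ _ _ (fun=> 0)); first by rewrite Rintegral_cst// mul0r.
by move=> y _; rewrite /F patchE in_setX /= (memNset D1x).
Qed.

Let E12 : (fun x => \int[m2]_y F (x, y)) = (fun x => \int[m2]_(y in D2) f (x, y)) \_ D1.
Proof.
apply/funext => x; rewrite patchE; case: ifPn => [/set_mem D1x|].
  by rewrite G12.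
by rewrite notin_setE => D1x; rewrite G12'.
Qed.

Let E21 : (fun y => \int[m1]_x F (x, y)) = (fun y => \int[m1]_(x in D1) f (x, y)) \_ D2.
Proof.
apply/funext => y; rewrite patchE; case: ifPn => [/set_mem D2y|].
  by rewrite [in RHS]Rintegral_mkcond -inner1.
rewrite notin_setE => D2y.
rewrite (@eq_Rint _ _ _ _ _ _ (fun=> 0)); first by rewrite Rintegral_cst// mul0r.
by move=> x _; rewrite /F patchE in_setX /= (memNset D2y) andbF.
Qed.

Let Fx x : intg m2 setT (fun y => F (x, y)).
Proof.
have [D1x|D1x] := pselect (D1 x).
  rewrite inner2// -restrict_EFin; apply/(integrable_mkcond _ _).1 => //.
  exact: tensor_integrable2.
apply: (@integrable_eq _ _ _ _ setT (fun=> 0)) => //; last exact: integrable0.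
by move=> y _; rewrite /F patchE in_setX /= (memNset D1x).
Qed.

Let Fy y : intg m1 setT (fun x => F (x, y)).
Proof.
have [D2y|D2y] := pselect (D2 y).
  rewrite inner1// -restrict_EFin; apply/(integrable_mkcond _ _).1 => //.
  exact: tensor_integrable1.
apply: (@integrable_eq _ _ _ _ setT (fun=> 0)) => //; last exact: integrable0.
by move=> x _; rewrite /F patchE in_setX /= (memNset D2y) andbF.
Qed.

Lemma tensor_integrable12 : intg m1 D1 (fun x => \int[m2]_(y in D2) f (x, y)).
Proof.
apply/(integrable_mkcond _ _).2 => //; rewrite restrict_EFin -E12.
have := integrable_fubini_F integrable_tensor.
by apply: eq_integrable => // x _; rewrite /fubini_F /= EFin_Rintegral.
Qed.

Lemma tensor_Fubini :
  \int[m1]_(x in D1) \int[m2]_(y in D2) f (x, y) =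
  \int[m2]_(y in D2) \int[m1]_(x in D1) f (x, y).
Proof.
rewrite Rintegral_mkcond [RHS]Rintegral_mkcond -E12 -E21 /Rintegral; congr fine.
under eq_integral do rewrite -/(Rintegral _ _ _) EFin_Rintegral//.
under [RHS]eq_integral do rewrite -/(Rintegral _ _ _) EFin_Rintegral//.
exact: (Fubini integrable_tensor).
Qed.

End FubiniProduct.

Lemma tensor_integrable21 d1 d2 (T1 : measurableType d1) (T2 : measurableType d2)
    (R : realType) (m1 : {sigma_finite_measure set T1 -> \bar R})
    (m2 : {sigma_finite_measure set T2 -> \bar R}) (D1 : set T1) (D2 : set T2)
    (a : T1 -> R) (b : T2 -> R) (f : T1 * T2 -> R) :
  measurable D1 -> measurable D2 -> intg m1 D1 a -> intg m2 D2 b ->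
  measurable_fun setT f ->
  (forall x y, D1 x -> D2 y -> `|f (x, y)| <= a x * b y) ->
  intg m2 D2 (fun y => \int[m1]_(x in D1) f (x, y)).
Proof.
move=> mD1 mD2 ia ib mf fab.
apply: (@tensor_integrable12 _ _ _ _ _ m2 m1 D2 D1 mD2 mD1 b a ib ia
  (fun z => f (z.2, z.1))).
  by apply: (measurableT_comp mf); apply: measurable_fun_pair.
by move=> y x D2y D1x /=; rewrite mulrC; exact: fab.
Qed.

Section UnderIntegral.
Context d (T : measurableType d) (R : realType) (mu : {measure set T -> \bar R}).

Lemma der_Rintegral (D : set T) (f df : R -> T -> R) (G : T -> R) (u v x0 : R) :
  measurable D -> u < x0 < v ->
  (forall x, u < x < v -> intg mu D (f x)) ->
  (forall x y, u < x < v -> D y -> is_derive (x : R) (1 : R) (f ^~ y) (df x y)) ->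
  (forall x y, u < x < v -> D y -> `|df x y| <= G y) -> intg mu D G ->
  is_derive (x0 : R) (1 : R) (fun x => \int[mu]_(y in D) f x y)
    (\int[mu]_(y in D) df x0 y).
Proof.
move=> mD ux0v fi fd dfG iG.
have I0 : `]u, v[%classic x0 by rewrite /= in_itv.
have h1 x : `]u, v[%classic x -> intg mu D (f x) by rewrite /= in_itv; exact: fi.
have h2 x y : `]u, v[%classic x -> D y -> derivable (f ^~ y) x 1.
  by rewrite /= in_itv => h Dy; case: (fd x y h Dy).
have E x y : `]u, v[%classic x -> D y -> partial1of2 f x y = df x y.
  by rewrite /= in_itv => h Dy; rewrite partial1of2E; case: (fd x y h Dy).
have h3 x y : `]u, v[%classic x -> D y -> `|partial1of2 f x y| <= `|G y|.
  move=> h Dy; rewrite E//; move: h; rewrite /= in_itv => h.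
  by rewrite (le_trans (dfG _ _ h Dy))// ler_norm.
have iG' : intg mu D (fun y => `|G y|) by exact: integrable_norm.
have K1 := @derivable_under_integral R _ T mu f D mD x0 u v I0 h1 h2 _
  (fun y => normr_ge0 (G y)) iG' h3.
have K2 := @differentiation_under_integral R _ T mu f D mD x0 u v I0 h1 h2 _
  (fun y => normr_ge0 (G y)) iG' h3.
split => //; rewrite -derive1E K2; apply: eq_Rint => y Dy; exact: E.
Qed.

End UnderIntegral.

Section MeanValue.
Context (R : realType).
Implicit Types (f g : R -> R) (a b : R).

Lemma der_MVT f g a b : a < b -> (forall x, a <= x <= b -> is_derive (x : R) (1 : R) f (g x)) ->
  exists2 c, a < c < b & f b - f a = g c * (b - a).
Proof.
move=> ab fg.
have h1 x : x \in `]a, b[ -> is_derive (x : R) (1 : R) f (g x).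
  by rewrite in_itv => /andP[ax xb]; apply: fg; rewrite !ltW.
have h2 : {within `[a, b], continuous f}.
  apply/subspace_continuousP => x xab; apply: cvg_within_filter.
  by apply/der_continuous; apply: fg; move: xab; rewrite /= in_itv.
have [c cab E] := MVT ab h1 h2.
by exists c => //; move: cab; rewrite in_itv.
Qed.

Lemma der_ge0_le f g a b : a <= b -> (forall x, a <= x <= b -> is_derive (x : R) (1 : R) f (g x)) ->
  (forall x, a < x < b -> 0 <= g x) -> f a <= f b.
Proof.
rewrite le_eqVlt => /predU1P[->//|ab] fg g0.
have [c cab E] := der_MVT ab fg.
by rewrite -subr_ge0 E mulr_ge0 ?g0// subr_ge0 ltW.
Qed.

Lemma der_gt0_lt f g a b : a < b -> (forall x, a <= x <= b -> is_derive (x : R) (1 : R) f (g x)) ->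
  (forall x, a < x < b -> 0 < g x) -> f a < f b.
Proof.
move=> ab fg g0; have [c cab E] := der_MVT ab fg.
by rewrite -subr_gt0 E mulr_gt0 ?g0// subr_gt0.
Qed.

Lemma der_0_const f a b : (forall x, Num.min a b <= x <= Num.max a b -> is_derive (x : R) (1 : R) f 0) ->
  f a = f b.
Proof.
wlog ab : a b / a < b => [H|] fg.
  have [ab|ba|->//] := ltgtP a b; first exact: H.
  by apply/esym/H => // x; rewrite minC maxC; exact: fg.
have [x|c _ E] := @der_MVT f (fun=> 0) a b ab.
  by rewrite -{1}(min_l (ltW ab)) -{2}(max_r (ltW ab)); exact: fg.
by apply/esym/eqP; rewrite -subr_eq0 E mul0r.
Qed.

Lemma der_norm_le f g a b M : a <= b -> (forall x, a <= x <= b -> is_derive (x : R) (1 : R) f (g x)) ->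
  (forall x, a < x < b -> `|g x| <= M) -> `|f b - f a| <= M * (b - a).
Proof.
rewrite le_eqVlt => /predU1P[->|ab] fg gM; first by rewrite !subrr normr0 mulr0.
have [c cab ->] := der_MVT ab fg.
by rewrite normrM ler_pM// ?gM// gtr0_norm// subr_gt0.
Qed.

End MeanValue.

(** * Hyperbolic functions of the argument v / 2 *)

HB.lock Definition ch (R : realType) (v : R) : R := (expR (v / 2) + expR (- (v / 2))) / 2.
HB.lock Definition sh (R : realType) (v : R) : R := (expR (v / 2) - expR (- (v / 2))) / 2.
Arguments ch {R} v.
Arguments sh {R} v.

Section HalfHyperbolic.
Context (R : realType).
Local Notation leb := (@lebesgue_measure R).
Implicit Types (u v x : R).

Lemma chN v : ch (- v) = ch v.
Proof. by rewrite ch.unlock mulNr opprK addrC. Qed.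
Lemma shN v : sh (- v) = - sh v.
Proof. by rewrite sh.unlock mulNr opprK; field. Qed.
Lemma sh0 : sh 0 = 0 :> R.
Proof. by rewrite sh.unlock mul0r oppr0 subrr mul0r. Qed.
Lemma ch2_sh2 v : ch v ^+ 2 - sh v ^+ 2 = 1.
Proof.
have h : expR (v / 2) * expR (- (v / 2)) = 1 by rewrite -expRD subrr expR0.
by rewrite ch.unlock sh.unlock -[RHS]h; field.
Qed.
Lemma chE v : ch v ^+ 2 = 1 + sh v ^+ 2.
Proof. by rewrite -(ch2_sh2 v) subrK. Qed.
Lemma ch_gt0 v : 0 < ch v.
Proof. by rewrite ch.unlock divr_gt0// addr_gt0 ?expR_gt0. Qed.
Lemma ch_neq0 v : ch v != 0.
Proof. by rewrite gt_eqF ?ch_gt0. Qed.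
Lemma ch_ge1 v : 1 <= ch v.
Proof.
rewrite -(@ler_pXn2r _ 2)// ?nnegrE ?ler01 ?(ltW (ch_gt0 v))//.
by rewrite expr1n chE lerDl sqr_ge0.
Qed.
Lemma chD u v : ch (u + v) = ch u * ch v + sh u * sh v.
Proof. by rewrite ch.unlock sh.unlock !mulrDl !opprD !expRD; field. Qed.
Lemma shD u v : sh (u + v) = sh u * ch v + ch u * sh v.
Proof. by rewrite ch.unlock sh.unlock !mulrDl !opprD !expRD; field. Qed.
Lemma chB u v : ch (u - v) = ch u * ch v - sh u * sh v.
Proof. by rewrite chD chN shN mulrN. Qed.
Lemma shB u v : sh (u - v) = sh u * ch v - ch u * sh v.
Proof. by rewrite shD chN shN mulrN. Qed.

Lemma der_ch x f a : is_derive (x : R) (1 : R) f a ->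
  is_derive (x : R) (1 : R) (fun y => ch (f y)) (sh (f x) / 2 * a).
Proof. by move=> fa; rewrite ch.unlock; notypeclasses refine (der_eq _ _); [der|rewrite sh.unlock; field]. Qed.
Lemma der_sh x f a : is_derive (x : R) (1 : R) f a ->
  is_derive (x : R) (1 : R) (fun y => sh (f y)) (ch (f x) / 2 * a).
Proof. by move=> fa; rewrite sh.unlock; notypeclasses refine (der_eq _ _); [der|rewrite ch.unlock; field]. Qed.

Lemma der_ch1 x : is_derive (x : R) (1 : R) (@ch R) (sh x / 2).
Proof. by notypeclasses refine (der_eq _ _); [eapply (der_ch (f := id)); exact: der_id|rewrite mulr1]. Qed.
Lemma der_sh1 x : is_derive (x : R) (1 : R) (@sh R) (ch x / 2).
Proof. by notypeclasses refine (der_eq _ _); [eapply (der_sh (f := id)); exact: der_id|rewrite mulr1]. Qed.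

End HalfHyperbolic.

Ltac der2 := lazymatch goal with
  | |- is_derive _ _ (fun y => ch (@?f y)) _ => notypeclasses refine (der_ch _)
  | |- is_derive _ _ (fun y => sh (@?f y)) _ => notypeclasses refine (der_sh _)
  | |- is_derive _ _ (@ch _) _ => notypeclasses refine (der_ch1 _)
  | |- is_derive _ _ (@sh _) _ => notypeclasses refine (der_sh1 _)
  end.
Ltac der' := repeat first [ der_hyp | der1 | der2 | der_eta ].

Section HalfHyperbolicAnalysis.
Context (R : realType).
Local Notation leb := (@lebesgue_measure R).
Implicit Types (u v x : R).

Lemma continuous_ch : continuous (@ch R).
Proof. by move=> x; apply: der_continuous (der_ch (der_id x)). Qed.
Lemma continuous_sh : continuous (@sh R).
Proof. by move=> x; apply: der_continuous (der_sh (der_id x)). Qed.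

Lemma ms_ch d (T : measurableType d) (D : set T) (f : T -> R) :
  measurable_fun D f -> measurable_fun D (fun t => ch (f t)).
Proof. exact/ms_continuous/continuous_ch. Qed.
Lemma ms_sh d (T : measurableType d) (D : set T) (f : T -> R) :
  measurable_fun D f -> measurable_fun D (fun t => sh (f t)).
Proof. exact/ms_continuous/continuous_sh. Qed.

Lemma ms_ch1 (D : set R) : measurable_fun D (@ch R).
Proof. by apply: measurable_funTS; apply: (ms_ch (f := id)). Qed.
Lemma ms_sh1 (D : set R) : measurable_fun D (@sh R).
Proof. by apply: measurable_funTS; apply: (ms_sh (f := id)). Qed.

End HalfHyperbolicAnalysis.

Ltac ms2 := lazymatch goal with
  | |- measurable_fun _ (fun y => ch (@?f y)) => apply: ms_ch
  | |- measurable_fun _ (fun y => sh (@?f y)) => apply: ms_sh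
  | |- measurable_fun _ (@ch _) => apply: ms_ch1
  | |- measurable_fun _ (@sh _) => apply: ms_sh1
  end.
Ltac ms' := repeat first [ assumption | ms1 | ms2 |
  match goal with H : forall _, measurable_fun _ _ |- _ => apply: H end ].

Section HalfHyperbolicBounds.
Context (R : realType).
Local Notation leb := (@lebesgue_measure R).
Implicit Types (u v x : R).

Lemma sh_ge v : 0 <= v -> v / 2 <= sh v.
Proof.
move=> v0; rewrite -subr_ge0.
have := @der_ge0_le R (fun y => sh y - y / 2) (fun y => (ch y - 1) / 2) 0 v v0.
rewrite sh0 mul0r subrr; apply.
- by move=> x _; notypeclasses refine (der_eq _ _); [der'|rewrite /=; field].
- by move=> x _; rewrite divr_ge0// subr_ge0 ch_ge1.
Qed.

Lemma sh_gt0 v : 0 < v -> 0 < sh v.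
Proof. by move=> v0; rewrite (lt_le_trans _ (sh_ge (ltW v0)))// divr_gt0. Qed.

Lemma sh_sg v : Num.sg (sh v) = Num.sg v.
Proof.
have [v0|v0|->] := ltrgtP v 0.
- have h : sh v < 0 by rewrite -[v]opprK shN oppr_lt0 sh_gt0// oppr_gt0.
  by rewrite !ltr0_sg.
- by rewrite !gtr0_sg// sh_gt0.
- by rewrite sh0.
Qed.

Lemma norm_sh v : `|sh v| = sh `|v|.
Proof.
have [v0|v0] := leP 0 v.
  by rewrite !ger0_norm// (le_trans _ (sh_ge v0))// divr_ge0.
by rewrite (ltr0_norm v0) shN ltr0_norm// -[v]opprK shN oppr_lt0 sh_gt0// oppr_gt0.
Qed.

Lemma sh_neq0 v : v != 0 -> sh v != 0.
Proof. by rewrite -sgr_eq0 -sh_sg sgr_eq0. Qed.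

Lemma sh_lt_ch v : `|sh v| < ch v.
Proof.
rewrite -(@ltr_pXn2r _ 2)// ?nnegrE ?(ltW (ch_gt0 v))//.
by rewrite -normrX ger0_norm ?sqr_ge0// chE ltrDr.
Qed.

Lemma ch_le_1sh v : ch v <= 1 + `|sh v|.
Proof.
rewrite -(@ler_pXn2r _ 2)// ?nnegrE ?(ltW (ch_gt0 v)) ?addr_ge0//.
by rewrite chE sqrrD expr1n mul1r -normrX (ger0_norm (sqr_ge0 _)) addrAC lerDl mulrn_wge0.
Qed.

Lemma ch_ge_exp v : expR (v / 2) / 2 <= ch v.
Proof. by rewrite ch.unlock ler_pM2r ?invr_gt0// lerDl expR_ge0. Qed.

Lemma invch_le v : (ch v)^-1 <= 2 * expR (- (v / 2)).
Proof.
rewrite expRN -[X in _ <= X]invrK lef_pV2 ?posrE ?ch_gt0//; last first.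
  by rewrite invr_gt0 mulr_gt0// invr_gt0 expR_gt0.
by rewrite invfM invrK mulrC; exact: ch_ge_exp.
Qed.

(** The primitive [2 atan (sh v)] is the Gudermannian function, bounded by pi. *)
Lemma invch_integrable : intg leb setT (fun v => (ch v)^-1).
Proof.
apply: (@line_integrable R (fun v => (ch v)^-1) (fun v => 2 * atan (sh v)) (2 * pi)).
- move=> x; notypeclasses refine (der_eq _ _).
    by notypeclasses refine (derM _ _); [der|notypeclasses refine (der_atan _); notypeclasses refine (der_sh _); der].
  by rewrite -chE; field; rewrite ch_neq0.
- move=> x; apply: cvgV; first by rewrite ch_neq0.
  exact: continuous_ch.
- by move=> x; rewrite invr_ge0 ltW ?ch_gt0.
- move=> x; rewrite normrM ger0_norm// ler_pM2l// ler_norml.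
  have p0 := pi_gt0 R.
  have h1 := atan_gtNpi2 (sh x); have h2 := atan_ltpi2 (sh x).
  by rewrite (le_trans _ (ltW h1)) ?(le_trans (ltW h2))//; lra.
Qed.

(** The majorant is 8 times the derivative of the bounded function atan (sqrt (sh v)); the remaining
    factor [2 ch v / (1 + sh v)] is at least 1. *)
Lemma invsqrtsh_integrable : intg leb `]0, +oo[ (fun v => (Num.sqrt (sh v))^-1).
Proof.
have i1 : intg leb `]0, +oo[ (fun v => ch v / (4 * Num.sqrt (sh v) * (1 + sh v))).
  have cs x : 0 < x -> 0 < Num.sqrt (sh x) by move=> x0; rewrite sqrtr_gt0 sh_gt0.
  have c1 x : 0 < x -> 0 < 1 + sh x by move=> x0; rewrite addr_gt0// sh_gt0.
  apply: (@ray_integrable _ _ (fun v => atan (Num.sqrt (sh v))) 0 pi).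
  - move=> x x0; notypeclasses refine (der_eq _ _).
      by notypeclasses refine (der_atan _); notypeclasses refine (der_sqrt _ _); [exact: sh_gt0|notypeclasses refine (der_sh _); der].
    rewrite sqr_sqrtr ?ltW ?sh_gt0//; field.
    by rewrite gt_eqF ?c1// gt_eqF ?cs.
  - move=> x x0; eapply der_continuous; notypeclasses refine (derM _ _); first by notypeclasses refine (der_ch _); der.
    notypeclasses refine (derV _ _); first by rewrite !mulf_neq0// gt_eqF ?c1 ?cs.
    notypeclasses refine (derM _ _); [notypeclasses refine (derM _ _); [der|notypeclasses refine (der_sqrt _ _)]|notypeclasses refine (derD _ _)].
    + exact: sh_gt0.
    + by notypeclasses refine (der_sh _); der.
    + by der.
    + by notypeclasses refine (der_sh _); der.
  - move=> x x0; rewrite divr_ge0 ?(ltW (ch_gt0 x))// !mulr_ge0//.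
    by rewrite ltW ?c1.
  - move=> x _; rewrite ler_norml.
    have p0 := pi_gt0 R.
    have h1 := atan_gtNpi2 (Num.sqrt (sh x)); have h2 := atan_ltpi2 (Num.sqrt (sh x)).
    by rewrite (le_trans _ (ltW h1)) ?(le_trans (ltW h2))//; lra.
apply: (integrable_le _ _ _ (integrableZr 8 _ i1)) => //.
  apply: measurable_funTS; apply: ms_V; apply: ms_sqrt; apply: ms_sh; exact: measurable_id.
move=> x; rewrite /= in_itv /= andbT => x0.
have s0 := sh_gt0 x0; have q0 : 0 < Num.sqrt (sh x) by rewrite sqrtr_gt0.
rewrite ger0_norm ?invr_ge0 ?(ltW q0)//.
have -> : 8 * (ch x / (4 * Num.sqrt (sh x) * (1 + sh x))) =
    (Num.sqrt (sh x))^-1 * (2 * ch x / (1 + sh x)).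
  by field; rewrite !gt_eqF//; lra.
rewrite ler_peMr ?invr_ge0 ?(ltW q0)// ler_pdivlMr ?mul1r; last lra.
have := ch_ge1 x; have := sh_lt_ch x; rewrite ger0_norm ?(ltW s0)//; lra.
Qed.

(** With x = pi/2 - atan y, so that y = cot x, this is x cos x <= sin x, where the difference of the
    two sides has derivative x sin x. *)
Lemma atan_compl_le (y : R) : 0 < y -> (pi / 2 - atan y) * y <= 1.
Proof.
move=> y0; have p0 := pi_gt0 R.
have a1 := atan_gtNpi2 y; have a2 := atan_ltpi2 y.
have yt := atanK y; move: a1 a2 yt; set t := atan y => a1 a2 yt.
have ct : 0 < cos t by apply: cos_gt0_pihalf; rewrite a1 a2.
have st : sin t = y * cos t by rewrite -yt /tan mulfVK// gt_eqF.
have t0 : 0 <= t by rewrite /t -[X in X <= _]atan0 le_atan// ltW.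
have key : 0 <= sin (pi / 2 - t) - (pi / 2 - t) * cos (pi / 2 - t).
  have -> : 0 = sin 0 - 0 * cos 0 :> R by rewrite sin0 mul0r subrr.
  apply: (@der_ge0_le R (fun x => sin x - x * cos x) (fun x => x * sin x)); first lra.
    by move=> x _; derive_by; [der|rewrite /=; ring].
  move=> x /andP[x0 xt]; rewrite mulr_ge0 ?(ltW x0)// sin_ge0_pi//; apply/andP; lra.
rewrite sinB cosB sin_pihalf cos_pihalf in key.
rewrite -(@ler_pM2r _ (cos t))// mul1r -mulrA -st; lra.
Qed.

(** The left side is the tail integral of [1 / ch], which thus decays like [1 / ch] itself. It
    follows from [atan_compl_le] at [sh v] and [ch v <= 1 + sh v]. *)
Lemma atan_sh_tail v : 0 <= v -> pi - 2 * atan (sh v) <= (pi + 2) * (ch v)^-1.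
Proof.
rewrite le_eqVlt => /predU1P[<-|v0].
  have -> : ch 0 = 1 :> R.
    by apply/eqP; rewrite -(@eqrXn2 _ 2) ?(ltW (ch_gt0 _))// chE sh0 expr0n addr0 expr1n.
  by rewrite sh0 atan0 mulr0 subr0 invr1 mulr1 lerDl.
have S0 := sh_gt0 v0.
rewrite ler_pdivlMr ?ch_gt0//; have h := atan_compl_le S0.
have a0 : 0 <= pi - 2 * atan (sh v) by have := atan_ltpi2 (sh v); lra.
apply: (@le_trans _ _ ((pi - 2 * atan (sh v)) * (1 + sh v))).
  by rewrite ler_wpM2l//; have := ch_le_1sh v; rewrite gtr0_norm.
have : 0 <= atan (sh v) by rewrite -[X in X <= _]atan0 le_atan// ltW.
lra.
Qed.

Lemma cvgr_pinfty0 (f : R -> R) (K : R) :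
  (forall v, 0 < v -> `|f v| <= K * expR (- (v / 2))) -> f v @[v --> +oo] --> 0.
Proof.
move=> fK; apply/cvgr0Pnorm_le => e e0; near=> v.
have v0 : 0 < v by near: v; apply: nbhs_pinfty_gt; exact: num_real.
have Kv : `|K| * 2 / e <= v by near: v; apply: nbhs_pinfty_ge; exact: num_real.
apply: (le_trans (fK v v0)).
have h : expR (- (v / 2)) <= 2 / v.
  rewrite expRN -[X in _ <= X]invrK lef_pV2 ?posrE ?expR_gt0 ?invr_gt0 ?divr_gt0//.
  by rewrite invfM invrK mulrC (le_trans _ (expR_ge1Dx _))// lerDr.
apply: (@le_trans _ _ (`|K| * (2 / v))).
  apply: (le_trans (ler_norm _)); rewrite normrM ler_wpM2l// ger0_norm// expR_ge0.
by rewrite mulrA ler_pdivrMr// mulrC (mulrC e) -ler_pdivrMr// mulrC.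
Unshelve. all: by end_near. Qed.

Lemma cvg_atan_sh_pinfty : 2 * atan (sh v) @[v --> +oo] --> (pi : R).
Proof.
have : (2 * atan (sh v) - pi) @[v --> +oo] --> (0 : R).
  apply: (@cvgr_pinfty0 _ ((pi + 2) * 2)) => v v0; rewrite distrC ger0_norm.
    rewrite (le_trans (atan_sh_tail (ltW v0)))// -mulrA ler_wpM2l ?invch_le//.
    by rewrite addr_ge0// pi_ge0.
  by have := atan_ltpi2 (sh v); lra.
move=> h; have : (2 * atan (sh v) - pi + pi) @[v --> +oo] --> (0 + pi : R).
  by apply: cvgD => //; exact: cvg_cst.
by rewrite add0r; under eq_fun do rewrite subrK.
Qed.

Lemma Rintegral_invch_ray u : \int[leb]_(x in `]u, +oo[) (ch x)^-1 = pi - 2 * atan (sh u).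
Proof.
have dF x : is_derive (x : R) (1 : R) (fun v => 2 * atan (sh v)) (ch x)^-1.
  by derive_by; [der'|rewrite -chE; field; rewrite ch_neq0].
apply: (@Rintegral_ray_FTC _ _ (fun v => 2 * atan (sh v))) => //.
- move=> x _; apply: cvgV; [by rewrite ch_neq0|exact: continuous_ch].
- by apply: (integrableS measurableT) => //; exact: invch_integrable.
- exact: cvg_atan_sh_pinfty.
- by apply: cvg_at_right_filter; exact: der_continuous (dF u).
Qed.

Lemma Rintegral_invch : \int[leb]_x (ch x)^-1 = 2 * pi.
Proof.
have dF x : is_derive (x : R) (1 : R) (fun v => 2 * atan (sh v)) (ch x)^-1.
  by derive_by; [der'|rewrite -chE; field; rewrite ch_neq0].
rewrite (@Rintegral_line_FTC _ _ (fun v => 2 * atan (sh v)) pi (- pi))//.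
- by ring.
- move=> x; apply: cvgV; [by rewrite ch_neq0|exact: continuous_ch].
- exact: invch_integrable.
- exact: cvg_atan_sh_pinfty.
- apply/cvgNy_compNP.
  have -> : (fun v : R => 2 * atan (sh v)) \o -%R = (fun v => - (2 * atan (sh v))).
    by apply/funext => v /=; rewrite shN atanN mulrN.
  by apply: cvgN; exact: cvg_atan_sh_pinfty.
Qed.

Lemma invsqrtch_le v : (Num.sqrt (ch v))^-1 <= (ch (v / 2))^-1.
Proof.
rewrite lef_pV2 ?posrE ?sqrtr_gt0 ?ch_gt0//.
rewrite -[X in X <= _]gtr0_norm ?ch_gt0// -sqrtr_sqr ler_sqrt ?(ltW (ch_gt0 _))//.
rewrite -{2}(divrK (@unitf_gt0 _ 2 (ltr0n _ 2)) v) mulr_natr mulr2n chD -!expr2.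
by have := chE (v / 2); have := ch_ge1 (v / 2); have := sqr_ge0 (sh (v / 2)); lra.
Qed.

Lemma invsqrtch_integrable : intg leb setT (fun v => (Num.sqrt (ch v))^-1).
Proof.
have i1 : intg leb setT (fun v => (ch (v / 2))^-1).
  apply: (@line_integrable R (fun v => (ch (v / 2))^-1) (fun v => 4 * atan (sh (v / 2))) (4 * pi)).
  - move=> x; derive_by; first by der'.
    by rewrite /= -chE; field; rewrite ch_neq0.
  - move=> x; apply: der_continuous; der'; exact: ch_neq0.
  - by move=> x; rewrite invr_ge0 ltW ?ch_gt0.
  - move=> x; rewrite normrM ger0_norm// ler_pM2l// ler_norml.
    have p0 := pi_gt0 R.
    have h1 := atan_gtNpi2 (sh (x / 2)); have h2 := atan_ltpi2 (sh (x / 2)).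
    by rewrite (le_trans _ (ltW h1)) ?(le_trans (ltW h2))//; lra.
apply: (integrable_le _ _ _ i1) => //; first by ms'.
move=> v _; rewrite ger0_norm ?invsqrtch_le// invr_ge0 sqrtr_ge0//.
Qed.

(** Writing [ch u] as [ch ((u + v) - v)] and expanding, the product of the two [sh] is at most that
    of the two [ch]. *)
Lemma invch_shift u v : (ch (u + v))^-1 <= 2 * ch v * (ch u)^-1.
Proof.
rewrite ler_pdivlMr ?ch_gt0// mulrC ler_pdivrMr ?ch_gt0//.
rewrite -{1}(addrK v u) chB.
have : `|sh (u + v) * sh v| <= ch (u + v) * ch v by rewrite normrM ler_pM// ltW// sh_lt_ch.
by rewrite ler_norml => /andP[]; lra.
Qed.

End HalfHyperbolicBounds.

(** * The sine transform of 1 / sinh *)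

Section SineIntegral.
Context (R : realType).
Local Notation leb := (@lebesgue_measure R).
Variable s : R.
Hypothesis s0 : 0 < s.
Implicit Types (v th : R).

(* [angle th v] is the harmonic function [Im (ln (tanh ((v / 2 + i th) / 2)))]
   of [(v / 2, th)]; its sine transform in [v] solves an ODE in [th]. *)
Let angle th v := pi / 2 - atan (sh v / sin th).
Let den th v := sin th ^+ 2 + sh v ^+ 2.
Let angle1 th v := sh v * cos th / den th v.
Let angle2 th v := - (sin th * sh v * (2 + sh v ^+ 2 - sin th ^+ 2)) / den th v ^+ 2.
Let angle_v th v := - (ch v * sin th / (2 * den th v)).

Let den_gt0 th v : 0 < sin th -> 0 < den th v.
Proof. by move=> h; rewrite /den ltr_wpDr ?sqr_ge0// exprn_gt0. Qed.

Let den_ge th v m : 0 < m -> m <= sin th -> m ^+ 2 * ch v ^+ 2 <= den th v.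
Proof.
move=> m0 mth; have sth := lt_le_trans m0 mth.
have m1 : m <= 1 by rewrite (le_trans mth)// sin_le1.
have mm : m ^+ 2 <= sin th ^+ 2 by rewrite ler_pXn2r// nnegrE ltW.
have m11 : m ^+ 2 <= 1 by rewrite exprn_ile1 ?(ltW m0).
rewrite chE mulrDr mulr1 /den lerD// ler_piMl ?sqr_ge0//.
Qed.

Let der_angle th v : 0 < sin th -> is_derive (th : R) (1 : R) (angle ^~ v) (angle1 th v).
Proof.
move=> h; have h0 := lt0r_neq0 h; rewrite /angle; notypeclasses refine (der_eq _ _); first by der'.
have d0 := lt0r_neq0 (den_gt0 v h); rewrite /angle1 /den in d0 *; field.
by rewrite h0 d0.
Qed.

Let der_angle1 th v : 0 < sin th -> is_derive (th : R) (1 : R) (angle1 ^~ v) (angle2 th v).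
Proof.
move=> h; have d0 := lt0r_neq0 (den_gt0 v h); rewrite /angle1 /den in d0 *.
notypeclasses refine (der_eq _ _); first by der'.
rewrite /angle2 /den /=.
by have c2 := cos2sin2 th; field: c2.
Qed.

Let der_anglev th v : 0 < sin th -> is_derive (v : R) (1 : R) (angle th) (angle_v th v).
Proof.
move=> h; have h0 := lt0r_neq0 h; rewrite /angle; notypeclasses refine (der_eq _ _); first by der'.
have d0 := lt0r_neq0 (den_gt0 v h); rewrite /angle_v /den in d0 *; field.
by rewrite h0 d0.
Qed.

(** Harmonicity: the second derivative in [v] is minus a quarter of that in [th], the factor coming
    from the argument v / 2. *)
Let der_anglevv th v : 0 < sin th ->
  is_derive (v : R) (1 : R) (angle_v th) (- angle2 th v / 4).
Proof.
move=> h; have d0 := lt0r_neq0 (den_gt0 v h); rewrite /angle_v /den in d0 *.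
notypeclasses refine (der_eq _ _); first by der'; rewrite mulf_neq0.
rewrite /angle2 /den /=.
by have c2 := chE v; field: c2.
Qed.

Let angle_ge0 th v : 0 <= angle th v.
Proof. by rewrite /angle subr_ge0 ltW// atan_ltpi2. Qed.

Let angle_le th v : 0 < sin th -> 0 < v -> angle th v * sh v <= sin th.
Proof.
move=> h v0; have S0 := sh_gt0 v0.
have := atan_compl_le (divr_gt0 S0 h).
by rewrite mulrA ler_pdivrMr// mul1r.
Qed.

Let angle_lepi th v : angle th v <= pi.
Proof. by rewrite /angle; have := atan_gtNpi2 (sh v / sin th); lra. Qed.

Let angle_bound th v : 0 < sin th -> 0 < v -> `|sin (s * v) * angle th v| <= (pi + 1) * (ch v)^-1.
Proof.
move=> h v0; rewrite normrM; apply: (@le_trans _ _ (1 * angle th v)).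
  by rewrite (ger0_norm (angle_ge0 _ _)) ler_wpM2r ?angle_ge0// sin_max.
rewrite mul1r ler_pdivlMr ?ch_gt0//.
have S0 := sh_gt0 v0.
apply: (@le_trans _ _ (angle th v * (1 + sh v))).
  by rewrite ler_wpM2l ?angle_ge0//; have := ch_le_1sh v; rewrite gtr0_norm.
rewrite mulrDr mulr1 lerD ?angle_lepi// (le_trans (angle_le h v0))// sin_le1//.
Qed.

Let sin_sh v : 0 < v -> `|sin (s * v)| / sh v <= (2 * s + 1) * (ch v)^-1.
Proof.
move=> v0; have S0 := sh_gt0 v0.
rewrite ler_pdivlMr ?ch_gt0// mulrAC ler_pdivrMr//.
apply: (@le_trans _ _ (`|sin (s * v)| * (1 + sh v))).
  by rewrite ler_wpM2l//; have := ch_le_1sh v; rewrite gtr0_norm.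
have h1 : `|sin (s * v)| <= 1 by exact: sin_max.
have h2 : `|sin (s * v)| <= v * s.
  have := @der_norm_le R (fun x => sin x) (fun x => cos x) 0 (s * v) 1
    (ltW (mulr_gt0 s0 v0)) (fun x _ => is_derive_sin x) (fun x _ => cos_max x).
  by rewrite sin0 !subr0 mul1r [X in _ <= X]mulrC.
have h3 := sh_ge (ltW v0).
rewrite mulrDr mulr1 mulrDl mul1r lerD//; last by rewrite ler_piMl// ltW.
by rewrite (le_trans h2)// mulrAC ler_pM2r//; move: h3; lra.
Qed.

(** The zero of sin (s v) at 0 absorbs the singularity of 1 / sh. The bound is free of [th], so it
    remains a majorant in the limit where [th] tends to 0. *)
Let angle1_bound th v : 0 < sin th -> 0 < v ->
  `|sin (s * v) * angle1 th v| <= (2 * s + 1) * (ch v)^-1.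
Proof.
move=> h v0; apply: le_trans (sin_sh v0); have S0 := sh_gt0 v0.
rewrite normrM ler_wpM2l// /angle1 normrM normfV normrM.
have d0 := den_gt0 v h; rewrite (gtr0_norm d0) (gtr0_norm S0) ler_pdivrMr//.
apply: (@le_trans _ _ (sh v * 1)); first by rewrite ler_pM2l// cos_max.
by rewrite mulr1 ler_pdivlMl// /den expr2 lerDr sqr_ge0.
Qed.

Let angle2_bound th v m : 0 < m -> m <= sin th -> 0 < v ->
  `|sin (s * v) * angle2 th v| <= 2 / m ^+ 4 * (ch v)^-1.
Proof.
move=> m0 mth v0; have h := lt_le_trans m0 mth; have S0 := sh_gt0 v0.
have d0 := den_gt0 v h; have dg := den_ge v m0 mth; have C0 := ch_gt0 v.
have h1 : sin th <= 1 by exact: sin_le1.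
have C2 := chE v.
rewrite normrM; apply: (@le_trans _ _ (1 * `|angle2 th v|)).
  by rewrite ler_wpM2r// sin_max.
rewrite mul1r /angle2 normrM normrN normfV (ger0_norm (sqr_ge0 (den th v))).
have hs : sin th ^+ 2 <= 1 by rewrite exprn_ile1 ?(ltW h).
have sS : sh v <= ch v by have := sh_lt_ch v; rewrite gtr0_norm// => /ltW.
have N : `|sin th * sh v * (2 + sh v ^+ 2 - sin th ^+ 2)| <= 2 * ch v ^+ 3.
  have p : 0 <= 2 + sh v ^+ 2 - sin th ^+ 2 by have := sqr_ge0 (sh v); lra.
  rewrite ger0_norm; last by apply: mulr_ge0 => //; rewrite mulr_ge0 ?(ltW h) ?(ltW S0).
  rewrite (exprSr _ 2) [X in X <= _]mulrC mulrA; apply: ler_pM => //.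
  - by rewrite mulr_ge0 ?(ltW h) ?(ltW S0).
  - by rewrite C2; have := sqr_ge0 (sin th); have := sqr_ge0 (sh v); lra.
  - by rewrite (le_trans _ sS)// ler_piMl ?(ltW S0).
rewrite ler_pdivrMr ?exprn_gt0//; apply: (le_trans N).
have -> : 2 * ch v ^+ 3 = 2 / m ^+ 4 / ch v * (m ^+ 2 * ch v ^+ 2) ^+ 2.
  by field; rewrite !gt_eqF.
rewrite ler_pM2l ?divr_gt0// ?exprn_gt0//.
by rewrite ler_pXn2r// nnegrE ?(ltW d0)// mulr_ge0 ?sqr_ge0.
Qed.

Let D : set (measurableTypeR R) := `]0, +oo[%classic.
Let mD : measurable D. Proof. exact: measurable_itv. Qed.
Let Dv v : D v <-> 0 < v. Proof. by rewrite /D /= in_itv /= andbT. Qed.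
Let ich K : intg leb D (fun v => K * (ch v)^-1).
Proof.
apply: integrableZr => //; apply: (integrableS measurableT) => //.
exact: invch_integrable.
Qed.

Let mangle th : measurable_fun setT (angle th).
Proof. by rewrite /angle; ms'. Qed.
Let mangle1 th : measurable_fun setT (angle1 th).
Proof. by rewrite /angle1 /den; ms'. Qed.
Let mangle2 th : measurable_fun setT (angle2 th).
Proof. by rewrite /angle2 /den; ms'. Qed.

Let i0 th : 0 < sin th -> intg leb D (fun v => sin (s * v) * angle th v).
Proof.
move=> h; apply: (integrable_le mD _ _ (ich (pi + 1))).
  by apply: measurable_funTS; ms'.
by move=> v /Dv v0; exact: angle_bound.
Qed.
Let i1 th : 0 < sin th -> intg leb D (fun v => sin (s * v) * angle1 th v).
Proof.
move=> h; apply: (integrable_le mD _ _ (ich (2 * s + 1))).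
  by apply: measurable_funTS; ms'.
by move=> v /Dv v0; exact: angle1_bound.
Qed.
Let i2 th : 0 < sin th -> intg leb D (fun v => sin (s * v) * angle2 th v).
Proof.
move=> h; apply: (integrable_le mD _ _ (ich (2 / sin th ^+ 4))).
  by apply: measurable_funTS; ms'.
by move=> v /Dv v0; exact: angle2_bound.
Qed.

Let H th := \int[leb]_(v in D) (sin (s * v) * angle th v).
Let J th := \int[leb]_(v in D) (sin (s * v) * angle1 th v).

Let near_sin th : 0 < sin th -> exists2 e, 0 < e &
  forall x, th - e < x < th + e -> sin th / 2 <= sin x.
Proof.
move=> h; have /cvgrPdist_lt/(_ (sin th / 2)) := @continuous_sin R th.
rewrite divr_gt0// => /(_ isT) [e /= e0 He]; exists e => // x /andP[x1 x2].
have : `|th - x| < e by rewrite ltr_norml; apply/andP; split; lra.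
by move=> /He /=; rewrite ltr_norml => /andP[_]; lra.
Qed.

Let derH th : 0 < sin th -> is_derive (th : R) (1 : R) H (J th).
Proof.
move=> h; have [e e0 He] := near_sin h.
have He' x : th - e < x < th + e -> 0 < sin x.
  by move=> /He; apply: lt_le_trans; rewrite divr_gt0.
have k1 : th - e < th < th + e by apply/andP; split; lra.
have k2 x : th - e < x < th + e -> intg leb D (fun v => sin (s * v) * angle x v).
  by move=> /He'; exact: i0.
have k3 x v : th - e < x < th + e -> D v ->
    is_derive (x : R) (1 : R) (fun x => sin (s * v) * angle x v) (sin (s * v) * angle1 x v).
  move=> /He' x0 _; notypeclasses refine (der_eq _ _).
    by notypeclasses refine (derM _ _); [notypeclasses refine (der_cst _ _)|exact: der_angle].
  by rewrite mul0r add0r.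
have k4 x v : th - e < x < th + e -> D v ->
    `|sin (s * v) * angle1 x v| <= (2 * s + 1) * (ch v)^-1.
  by move=> /He' x0 /Dv v0; exact: angle1_bound.
exact: (der_Rintegral mD k1 k2 k3 k4 (ich _)).
Qed.

(** Harmonicity exchanges the two derivatives in [th] for derivatives in [v], which two integrations
    by parts move onto the sine. The only boundary term comes from v = 0, where [angle] is pi/2. *)
Let int_angle2 th : 0 < sin th ->
  \int[leb]_(v in D) (sin (s * v) * angle2 th v) = 4 * s ^+ 2 * H th - 2 * pi * s.
Proof.
move=> h.
pose f v := - (1/4) * (sin (s * v) * angle2 th v) + s ^+ 2 * (sin (s * v) * angle th v).
pose F v := sin (s * v) * angle_v th v - s * cos (s * v) * angle th v.
have dF v : is_derive (v : R) (1 : R) F (f v).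
  notypeclasses refine (der_eq _ _).
    by notypeclasses refine (derD _ _); [notypeclasses refine (derM _ _); [der|exact: der_anglevv]|
        notypeclasses refine (derN _); notypeclasses refine (derM _ _); [der|exact: der_anglev]].
  by rewrite /f /=; field.
have cf v : {for v, continuous f}.
  have d0 := lt0r_neq0 (den_gt0 v h).
  eapply der_continuous; notypeclasses refine (derD _ _); (notypeclasses refine (derM _ _); first by der); (notypeclasses refine (derM _ _); first by der).
    by rewrite /angle2 /den; der'; rewrite expf_neq0.
  exact: der_anglev.
have fi : intg leb D f.
  by apply: integrableDr => //; apply: integrableZr => //; [exact: i2|exact: i0].
have Fy : F v @[v --> +oo] --> 0.
  have s1 := den_ge.
  apply: (@cvgr_pinfty0 _ _ ((2 * (sin th)^-2 + s * (pi + 1)) * 2)) => v v0.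
  have C0 := ch_gt0 v.
  apply: (@le_trans _ _ ((2 * (sin th)^-2 + s * (pi + 1)) * (ch v)^-1)); last first.
    rewrite -mulrA ler_wpM2l ?invch_le// addr_ge0 ?mulr_ge0 ?invr_ge0 ?sqr_ge0 ?(ltW s0)//.
    by rewrite addr_ge0 ?pi_ge0.
  rewrite mulrDl; apply: (le_trans (ler_normB _ _)); apply: lerD.
    rewrite normrM; apply: (@le_trans _ _ (1 * `|angle_v th v|)).
      by rewrite ler_wpM2r// sin_max.
    have d0 := den_gt0 v h; have dg := den_ge v h (lexx _).
    rewrite mul1r /angle_v normrN ger0_norm; last first.
      by rewrite divr_ge0 ?mulr_ge0 ?(ltW h) ?(ltW C0) ?(ltW d0).
    rewrite ler_pdivrMr ?mulr_gt0//.
    apply: (@le_trans _ _ (ch v * 1)); first by rewrite ler_pM2l// sin_le1.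
    have -> : ch v * 1 = 2 / sin th ^+ 2 / ch v * (sin th ^+ 2 * ch v ^+ 2 / 2).
      by field; rewrite !gt_eqF.
    rewrite ler_pM2l; [lra|by rewrite !divr_gt0 ?exprn_gt0].
  rewrite -mulrA normrM (gtr0_norm s0) -mulrA ler_pM2l//.
  rewrite normrM; apply: (@le_trans _ _ (1 * `|angle th v|)).
    by rewrite ler_wpM2r// cos_max.
  rewrite mul1r (ger0_norm (angle_ge0 _ _)) ler_pdivlMr//; have S0 := sh_gt0 v0.
  apply: (@le_trans _ _ (angle th v * (1 + sh v))).
    by rewrite ler_wpM2l ?angle_ge0//; have := ch_le_1sh v; rewrite gtr0_norm.
  rewrite mulrDr mulr1 lerD ?angle_lepi// (le_trans (angle_le h v0))// sin_le1//.
have F0 : F v @[v --> 0^'+] --> - (s * (pi / 2)).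
  have -> : - (s * (pi / 2)) = F 0.
    by rewrite /F mulr0 sin0 cos0 mul0r /angle sh0 mul0r atan0 subr0; ring.
  by apply: cvg_at_right_filter; exact: der_continuous (dF 0).
have := Rintegral_ray_FTC (fun v _ => dF v) (fun v _ => cf v) fi Fy F0.
rewrite -/D /f RintegralD//; last 2 first.
- by apply: integrableZr => //; exact: i2.
- by apply: integrableZr => //; exact: i0.
rewrite (RintegralZl (- (1 / 4)) mD (i2 h)) (RintegralZl (s ^+ 2) mD (i0 h)).
by rewrite -/(H th); lra.
Qed.

Let derJ th : 0 < sin th ->
  is_derive (th : R) (1 : R) J (4 * s ^+ 2 * H th - 2 * pi * s).
Proof.
move=> h; have [e e0 He] := near_sin h; rewrite -int_angle2//.
have m0 : 0 < sin th / 2 by rewrite divr_gt0.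
have k1 : th - e < th < th + e by apply/andP; split; lra.
have k2 x : th - e < x < th + e -> intg leb D (fun v => sin (s * v) * angle1 x v).
  by move=> /He/(lt_le_trans m0); exact: i1.
have k3 x v : th - e < x < th + e -> D v ->
    is_derive (x : R) (1 : R) (fun x => sin (s * v) * angle1 x v) (sin (s * v) * angle2 x v).
  move=> /He/(lt_le_trans m0) x0 _; notypeclasses refine (der_eq _ _).
    by notypeclasses refine (derM _ _); [notypeclasses refine (der_cst _ _)|exact: der_angle1].
  by rewrite mul0r add0r.
have k4 x v : th - e < x < th + e -> D v ->
    `|sin (s * v) * angle2 x v| <= 2 / (sin th / 2) ^+ 4 * (ch v)^-1.
  by move=> /He x0 /Dv v0; exact: angle2_bound.
exact: (der_Rintegral mD k1 k2 k3 k4 (ich _)).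
Qed.

Let th_ n : R := n.+1%:R^-1.
Let th_gt0 n : 0 < th_ n. Proof. by rewrite invr_gt0. Qed.
Let th_le1 n : th_ n <= 1. Proof. by rewrite invf_le1 ?ler1n. Qed.
Let pi_ge2 : 2 <= pi :> R. Proof. exact: pi_ge2. Qed.
Let sin_th (x : R) : 0 < x -> x <= pi / 2 -> 0 < sin x.
Proof. by move=> x0 xp; apply: sin_gt0_pi; apply/andP; split => //; have := pi_gt0 R; lra. Qed.
Let sin_th_ n : 0 < sin (th_ n).
Proof. by apply: sin_th => //; have := th_le1 n; have := pi_ge2; lra. Qed.
Let cvg_th : th_ n @[n --> \oo] --> 0. Proof. exact: cvg_harmonic. Qed.
Let cvg_sin_th : sin (th_ n) @[n --> \oo] --> 0.
Proof. by rewrite -[X in _ --> X](@sin0 R); apply: continuous_cvg => //; exact: continuous_sin. Qed.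

Let J0 := \int[leb]_(v in D) (sin (s * v) / sh v).

Let cvgH : H (th_ n) @[n --> \oo] --> 0.
Proof.
have k1 n : measurable_fun D (fun v => sin (s * v) * angle (th_ n) v).
  by apply: measurable_funTS; ms'.
have k2 v : D v -> sin (s * v) * angle (th_ n) v @[n --> \oo] --> 0.
  move=> /Dv v0; rewrite -(mulr0 (sin (s * v))); apply: cvgM; first exact: cvg_cst.
  have S0 := sh_gt0 v0.
  apply: (@squeeze_cvgr _ _ _ _ (fun=> 0) (fun n => sin (th_ n) / sh v)).
  - apply: nearW => n; rewrite angle_ge0 /= ler_pdivlMr//; exact: angle_le.
  - exact: cvg_cst.
  - by rewrite -(mul0r (sh v)^-1); apply: cvgM => //; exact: cvg_cst.
have k3 n v : D v -> `|sin (s * v) * angle (th_ n) v| <= (pi + 1) * (ch v)^-1.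
  by move=> /Dv; exact: angle_bound.
have [_] := dominated_cvg_Rintegral mD k1 k2 (ich _) k3.
by rewrite Rintegral_cst// mul0r.
Qed.

Let cvgJ : intg leb D (fun v => sin (s * v) / sh v) /\ J (th_ n) @[n --> \oo] --> J0.
Proof.
have k1 n : measurable_fun D (fun v => sin (s * v) * angle1 (th_ n) v).
  by apply: measurable_funTS; ms'.
have k2 v : D v -> sin (s * v) * angle1 (th_ n) v @[n --> \oo] --> sin (s * v) / sh v.
  move=> /Dv v0; have S0 := sh_gt0 v0; apply: cvgM; first exact: cvg_cst.
  have -> : (sh v)^-1 = sh v * cos 0 / (0 ^+ 2 + sh v ^+ 2).
    by rewrite cos0; field; rewrite gt_eqF.
  apply: cvgM.
    apply: cvgM; first exact: cvg_cst.
    by apply: continuous_cvg => //; exact: continuous_cos.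
  apply: cvgV; first by rewrite expr0n add0r expf_neq0// gt_eqF.
  by apply: cvgD; [exact: cvgM|exact: cvg_cst].
have k3 n v : D v -> `|sin (s * v) * angle1 (th_ n) v| <= (2 * s + 1) * (ch v)^-1.
  by move=> /Dv; exact: angle1_bound.
exact: (dominated_cvg_Rintegral mD k1 k2 (ich _) k3).
Qed.

Lemma sin_over_sh_integrable : intg leb `]0, +oo[ (fun v => sin (s * v) / sh v).
Proof. by have [] := cvgJ. Qed.

(* [H - pi / (2 s)] and its derivative [J] satisfy [h' = J], [J' = (2 s)^2 h]. *)
Lemma integral_sin_over_sh :
  \int[leb]_(v in `]0, +oo[) (sin (s * v) / sh v) = pi * tanh (pi * s).
Proof.
pose h th := H th - pi / (2 * s).
have [_ cJ] := cvgJ.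
have s2 : s != 0 by rewrite gt_eqF.
(* For e = 1 and e = -1 the combination [f] of [J] and [h] is constant. As [th] tends to 0, [J]
   tends to [J0] and [h] to -pi/(2s); at pi/2 the function [J] vanishes because the cosine does.
   Each sign thus gives one linear equation between [J0] and [h (pi / 2)]. *)
have pq (e : R) : e ^+ 2 = 1 -> J0 - e * pi = expR (- (e * pi * s)) * (e * (2 * s * h (pi / 2))).
  move=> e2.
  pose f th := expR (- (2 * e * s * th)) * (J th + e * (2 * s) * h th).
  have df th : 0 < sin th -> is_derive (th : R) (1 : R) f 0.
    move=> sth; have dJ := derJ sth; have dH := derH sth.
    by rewrite /f /h; notypeclasses refine (der_eq _ _); [der|rewrite /=; field: e2].
  have fc n : f (th_ n) = f (pi / 2).
    apply: der_0_const => x /andP[x1 x2]; apply: df.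
    have a1 : th_ n <= pi / 2 by have := th_le1 n; have := pi_ge2; lra.
    move: x1 x2; rewrite (min_l a1) (max_r a1) => x1 x2.
    by apply: sin_th => //; exact: lt_le_trans x1.
  have L : f (th_ n) @[n --> \oo] --> expR (- (2 * e * s * 0)) * (J0 + e * (2 * s) * (0 - pi / (2 * s))).
    apply: cvgM.
      apply: continuous_cvg; first exact: continuous_expR.
      by apply: cvgN; apply: cvgM => //; exact: cvg_cst.
    apply: cvgD => //; apply: cvgM; first exact: cvg_cst.
    by apply: cvgB => //; exact: cvg_cst.
  have L' : f (th_ n) @[n --> \oo] --> f (pi / 2).
    by under eq_fun do rewrite fc; exact: cvg_cst.
  have := cvg_unique _ L L' => /(_ (@Rhausdorff R)).
  have Jp : J (pi / 2) = 0.
    rewrite /J (@eq_Rint _ _ _ _ _ _ (fun=> 0)) ?Rintegral_cst ?mul0r//.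
    by move=> v _; rewrite /angle1 cos_pihalf; ring.
  rewrite mulr0 oppr0 expR0 mul1r /f Jp add0r => E.
  have -> : - (e * pi * s) = - (2 * e * s * (pi / 2)) by field.
  have -> : J0 - e * pi = J0 + e * (2 * s) * - (pi / (2 * s)) by field.
  by rewrite E; ring.
have := pq 1 (expr1n _ _); have := pq (-1) (sqrr_sign _ 1).
rewrite !mul1r !mulN1r mulNr opprK opprK /tanh -/J0.
set X := 2 * s * h _; set A := expR _; set B := expR _.
have AB : A * B = 1 by rewrite -expRD subrr expR0.
have A0 : 0 < A by exact: expR_gt0.
have B0 : 0 < B by exact: expR_gt0.
move=> E1 E2; have AB0 : A + B != 0 by rewrite gt_eqF// addr_gt0.
apply: (mulIf AB0); rewrite -mulrA divfK// mulrDr.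
(* Elimination of the unknown [h (pi / 2)] between the two equations. *)
have : (J0 - pi) * A = - ((J0 + pi) * B).
  by rewrite E1 E2; ring.
by move=> E; lra.
Qed.

End SineIntegral.

(** * The logarithmic kernel in the coordinate u *)

Section Kernel.
Context (R : realType).
Variable k : R.
Implicit Types (u v y : R).

Definition cweight u : R := Num.sqrt (1 + k ^+ 2 * sh u ^+ 2).
Definition weight u : R := (cweight u)^-1.
(** Added to [cweight u * cweight y], it is the denominator that arises when the difference of two
    points of one interval is expressed through [sh (u - y)] and a difference of points of opposite
    intervals. *)
Definition crossq u y : R := ch u * ch y - (1 - k ^+ 2) * (sh u * sh y).
Definition logker u y : R := ln `|sh (u - y)| - ln (cweight u * cweight y + crossq u y).
Definition dlogker u y : R := cweight y / (2 * cweight u * sh (u - y)).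

Let W := cweight.

Lemma cweight_arg_gt0 u : 0 < 1 + k ^+ 2 * sh u ^+ 2.
Proof. by rewrite ltr_pwDl// mulr_ge0 ?sqr_ge0. Qed.

Lemma cweight_gt0 u : 0 < cweight u.
Proof. by rewrite sqrtr_gt0 cweight_arg_gt0. Qed.

Lemma cweight2 u : cweight u ^+ 2 = 1 + k ^+ 2 * sh u ^+ 2.
Proof. by rewrite sqr_sqrtr// ltW ?cweight_arg_gt0. Qed.

Lemma cweightN u : cweight (- u) = cweight u.
Proof. by rewrite /cweight shN sqrrN. Qed.

Lemma weight_gt0 u : 0 < weight u.
Proof. by rewrite invr_gt0 cweight_gt0. Qed.

Lemma weightN u : weight (- u) = weight u.
Proof. by rewrite /weight cweightN. Qed.

Lemma der_cweight u : is_derive (u : R) (1 : R) cweight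
  (k ^+ 2 * sh u * ch u / (2 * cweight u)).
Proof.
rewrite /cweight; derive_by; first by der'; exact: cweight_arg_gt0.
by rewrite /=; field; rewrite gt_eqF// sqrtr_gt0 cweight_arg_gt0.
Qed.

Lemma der_weight u : is_derive (u : R) (1 : R) weight
  (- (k ^+ 2 * sh u * ch u / (2 * cweight u ^+ 3))).
Proof.
have h := der_cweight u; have W0 := lt0r_neq0 (cweight_gt0 u).
by rewrite /weight; derive_by; [der'|rewrite /=; field].
Qed.

Lemma continuous_weight : continuous weight.
Proof. by move=> u; apply: der_continuous (der_weight u). Qed.

Lemma measurable_weight : measurable_fun setT weight.
Proof. exact: continuous_measurable_fun continuous_weight. Qed.

Hypotheses (k0 : 0 < k) (k1 : k <= 1).

Lemma cweight_ge_sh u : k * `|sh u| <= cweight u.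
Proof.
rewrite -(@ler_pXn2r _ 2)// ?nnegrE ?(ltW (cweight_gt0 u)) ?mulr_ge0 ?(ltW k0)//.
by rewrite cweight2 exprMn -normrX (ger0_norm (sqr_ge0 _)) lerDr.
Qed.

Let kk : k ^+ 2 <= 1. Proof. by rewrite exprn_ile1// ltW. Qed.

Lemma cweight_ge_ch u : k * ch u <= cweight u.
Proof.
rewrite -(@ler_pXn2r _ 2)// ?nnegrE ?(ltW (cweight_gt0 u)) ?mulr_ge0 ?(ltW k0) ?(ltW (ch_gt0 u))//.
by rewrite cweight2 exprMn chE mulrDr mulr1 lerD2r.
Qed.

Lemma cweight_le_ch u : cweight u <= ch u.
Proof.
rewrite -(@ler_pXn2r _ 2)// ?nnegrE ?(ltW (cweight_gt0 u)) ?(ltW (ch_gt0 u))//.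
by rewrite cweight2 chE lerD2l ler_piMl ?sqr_ge0.
Qed.

Lemma weight_le u : weight u <= k^-1 * (ch u)^-1.
Proof.
rewrite /weight -invfM lef_pV2 ?posrE ?cweight_gt0 ?mulr_gt0 ?ch_gt0//.
exact: cweight_ge_ch.
Qed.

Let shsh u y : `|sh u * sh y| <= ch u * ch y.
Proof. by rewrite normrM ler_pM// ltW// sh_lt_ch. Qed.

(** The right side minus the left is [cweight u * cweight y + k^2 sh u sh y], nonnegative by
    [cweight_ge_sh]. Consequently [logker] is at most 0. *)
Lemma crossq_ge u y : ch (u - y) <= cweight u * cweight y + crossq u y.
Proof.
rewrite chB /crossq.
have h : k ^+ 2 * `|sh u * sh y| <= cweight u * cweight y.
  rewrite normrM expr2 mulrACA ler_pM ?cweight_ge_sh ?mulr_ge0 ?(ltW k0)//.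
have : - (k ^+ 2 * `|sh u * sh y|) <= k ^+ 2 * (sh u * sh y).
  by rewrite -mulrN ler_pM2l ?exprn_gt0// lerNl -normrN ler_norm.
lra.
Qed.

Lemma crossq_gt0 u y : 0 < cweight u * cweight y + crossq u y.
Proof. by rewrite (lt_le_trans (ch_gt0 _) (crossq_ge u y)). Qed.

Lemma crossq_le u y : cweight u * cweight y + crossq u y <= 4 * (ch u * ch y).
Proof.
have h1 : cweight u * cweight y <= ch u * ch y.
  by rewrite ler_pM ?cweight_le_ch ?(ltW (cweight_gt0 _)).
have h2 := shsh u y.
have h3 : - ((1 - k ^+ 2) * (sh u * sh y)) <= ch u * ch y.
  apply: (le_trans (ler_norm _)); rewrite normrN normrM ger0_norm ?subr_ge0//.
  apply: le_trans h2; rewrite ler_piMl// gerBl sqr_ge0//.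
have : 0 < ch u * ch y by rewrite mulr_gt0 ?ch_gt0.
rewrite /crossq; lra.
Qed.

Lemma crossqC u y : crossq u y = crossq y u.
Proof. by rewrite /crossq; ring. Qed.

Lemma logkerC u y : logker u y = logker y u.
Proof.
by rewrite /logker crossqC (mulrC (cweight u)) -(opprB u) shN normrN.
Qed.

(** After differentiation this is a rational identity modulo the relations for [ch^2] and
    [cweight^2], at [u] and at [y]. *)
Lemma der_logker u y : u != y ->
  is_derive (u : R) (1 : R) (logker ^~ y) (dlogker u y).
Proof.
move=> uy; have s0 : sh (u - y) != 0 by rewrite sh_neq0// subr_eq0.
have q0 := crossq_gt0 u y; have hW := der_cweight u.
have W0 := lt0r_neq0 (cweight_gt0 u); have W1 := lt0r_neq0 (cweight_gt0 y).
have dln : is_derive (u : R) (1 : R) (fun u => ln `|sh (u - y)|) (ch (u - y) / (2 * sh (u - y))).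
  (* The absolute value is differentiated as the square root of a square. *)
  apply: (der_eqfun (f := fun u => ln (Num.sqrt (sh (u - y) ^+ 2)))).
    by move=> z; rewrite sqrtr_sqr.
  derive_by; first by der'; rewrite ?sqrtr_gt0 exprn_even_gt0.
  rewrite /= -[X in X = _]mulrA; set q := Num.sqrt _.
  have q2 : q ^+ 2 = sh (u - y) ^+ 2 by rewrite sqr_sqrtr// sqr_ge0.
  have qn : q != 0 by rewrite gt_eqF// sqrtr_gt0 exprn_even_gt0.
  rewrite expr1.
  have -> : (2 * q)^-1 * q^-1 = (2 * sh (u - y) ^+ 2)^-1.
    by rewrite -q2 -invfM; congr (_^-1); ring.
  by field.
rewrite /logker; derive_by.
  notypeclasses refine (derD dln _); rewrite /crossq; der'.
  exact: q0.
rewrite /= /dlogker /crossq; rewrite /crossq in q0.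
rewrite shB chB in s0 *.
have qn := lt0r_neq0 q0.
have Cu := chE u; have Cy := chE y.
have Wu := cweight2 u; have Wy := cweight2 y.
field: Cu Cy Wu Wy.
by rewrite W0 s0 qn.
Qed.

(** [- logker] is [ln z] with [z >= 1], and [ln z <= 2 sqrt z]. The logarithmic singularity is
    replaced by the power -1/2, still integrable, and the growth in each variable by [sqrt (ch)],
    which the decay [1 / ch] of charges dominates. *)
Lemma norm_logker_le u y : u != y ->
  `|logker u y| <= 4 * Num.sqrt (ch u) * Num.sqrt (ch y) / Num.sqrt (sh `|u - y|).
Proof.
move=> uy; have s0 : 0 < `|sh (u - y)| by rewrite normr_gt0 sh_neq0// subr_eq0.
have q0 := crossq_gt0 u y.
set z := (cweight u * cweight y + crossq u y) / `|sh (u - y)|.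
have z1 : 1 <= z.
  by rewrite ler_pdivlMr// mul1r (le_trans _ (crossq_ge u y))// ltW// sh_lt_ch.
have z0 : 0 < z by rewrite (lt_le_trans _ z1).
have -> : logker u y = - ln z by rewrite ln_div ?posrE// opprB.
rewrite normrN ger0_norm ?ln_ge0//.
have -> : ln z = 2 * ln (Num.sqrt z).
  by rewrite -{1}(sqr_sqrtr (ltW z0)) lnXn ?sqrtr_gt0// mulr_natl.
have h : ln (Num.sqrt z) <= Num.sqrt z.
  by rewrite ltW// -ltr_expR lnK ?posrE ?sqrtr_gt0// (lt_le_trans _ (expR_ge1Dx _))// ltrDr.
apply: (@le_trans _ _ (2 * Num.sqrt z)); first by rewrite ler_pM2l.
rewrite -norm_sh -mulrA -mulrA.
have -> : 4 = 2 * Num.sqrt (2 ^+ 2) :> R by rewrite sqrtr_sqr ger0_norm//; ring.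
rewrite -mulrA ler_pM2l// -sqrtrV// -!sqrtrM ?sqr_ge0//.
- rewrite ler_sqrt; last by rewrite mulr_ge0 ?sqr_ge0// !mulr_ge0 ?invr_ge0 ?(ltW (ch_gt0 _)).
  rewrite (_ : 2 ^+ 2 * _ = 4 * (ch u * ch y) / `|sh (u - y)|); last by ring.
    by rewrite ler_pM2r ?invr_gt0//; exact: crossq_le.
- by rewrite ltW ?ch_gt0.
- by rewrite ltW ?ch_gt0.
Qed.

End Kernel.

(** * Primitives of charges on the line *)

Definition prim (R : realType) (p : R -> R) (u : R) : R :=
  \int[@lebesgue_measure R]_(x in `]-oo, u]) p x.

Section Primitive.
Context (R : realType).
Local Notation leb := (@lebesgue_measure R).
Variables (p : R -> R) (M : R).
Hypotheses (cp : continuous p) (pM : forall u, `|p u| <= M * (ch u)^-1)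
  (p0 : \int[leb]_u p u = 0).

Lemma dominated_integrable : intg leb setT p.
Proof.
apply: (integrable_le _ _ _ (integrableZr M measurableT (@invch_integrable R))) => //.
exact: continuous_measurable_fun.
Qed.

Lemma der_prim u : is_derive (u : R) (1 : R) (prim p) (p u).
Proof.
have i1 : intg leb `]-oo, u + 1] p.
  by apply: (integrableS measurableT) => //; exact: dominated_integrable.
have uu : u < u + 1 by rewrite ltrDl.
have [||] := @continuous_FTC1 R p (BInfty _ true) u (u + 1) uu i1.
- by rewrite ltNyr.
- exact: cp.
move=> h1 h2.
apply: DeriveDef; first exact: h1.
by rewrite -derive1E; exact: h2.
Qed.

Lemma prim_tail u : prim p u = - \int[leb]_(x in `]u, +oo[) p x.
Proof.
have := @Rintegral_itvB R p (BInfty _ true) (BInfty _ false) u.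
rewrite set_itvNyy => /(_ dominated_integrable isT isT) <-.
by rewrite p0 sub0r opprK.
Qed.

(** To the left of 0 the primitive is a small tail. To the right, the vanishing total integral makes
    it minus the complementary tail, so it decays at both ends. *)
Lemma norm_prim_le u : `|prim p u| <= M * (pi + 2) * (ch u)^-1.
Proof.
have iM : intg leb setT (fun x => M * (ch x)^-1).
  by apply: integrableZr => //; exact: invch_integrable.
have mp (D : set (measurableTypeR R)) : measurable_fun D p.
  by apply: measurable_funTS; exact: continuous_measurable_fun.
have M0 : 0 <= M.
  have := pM 0; rewrite -ler_pdivrMr ?invr_gt0 ?ch_gt0// invrK.
  by apply: le_trans; rewrite mulr_ge0// ltW ?ch_gt0.
have ray x : \int[leb]_(y in `]x, +oo[) (M * (ch y)^-1) = M * (pi - 2 * atan (sh x)).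
  rewrite RintegralZl ?Rintegral_invch_ray//.
  by apply: (integrableS measurableT) => //; exact: invch_integrable.
have [u0|u0] := leP 0 u.
  rewrite prim_tail normrN -mulrA.
  apply: le_trans (ler_wpM2l M0 (atan_sh_tail u0)).
  by rewrite -ray; apply: norm_Rintegral_le => //; exact: integrableS iM.
apply: (@le_trans _ _ (\int[leb]_(x in `]-oo, u]) (M * (ch x)^-1))).
  by apply: norm_Rintegral_le => //; exact: integrableS iM.
have := @Rintegral_itvB R (fun x => M * (ch x)^-1) (BInfty _ true) (BInfty _ false) u.
rewrite set_itvNyy => /(_ iM isT isT); rewrite ray RintegralZl//; last exact: invch_integrable.
rewrite Rintegral_invch => E.
have -> : \int[leb]_(x in `]-oo, u]) (M * (ch x)^-1) = M * (pi - 2 * atan (sh (- u))).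
  by rewrite shN atanN; lra.
by rewrite -mulrA -(chN u) ler_wpM2l// atan_sh_tail// oppr_ge0 ltW.
Qed.

End Primitive.

(** * Limits at infinity and translated trigonometric functions *)

Section Limits.
Context (R : realType).
Local Notation leb := (@lebesgue_measure R).

Lemma cvgr_pinfty0_sqrtsh (f : R -> R) (K : R) :
  (forall v, 0 < v -> `|f v| <= K * (Num.sqrt (sh v))^-1) -> f v @[v --> +oo] --> 0.
Proof.
move=> fK; apply/cvgr0Pnorm_le => e e0; near=> v.
have v0 : 0 < v by near: v; apply: nbhs_pinfty_gt; exact: num_real.
have Kv : 2 * (`|K| / e) ^+ 2 <= v by near: v; apply: nbhs_pinfty_ge; exact: num_real.
apply: (le_trans (fK v v0)); have s0 := sh_gt0 v0.
apply: (@le_trans _ _ (`|K| * (Num.sqrt (sh v))^-1)).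
  by rewrite ler_wpM2r ?invr_ge0 ?sqrtr_ge0 ?ler_norm.
rewrite ler_pdivrMr ?sqrtr_gt0// mulrC -ler_pdivrMr//.
rewrite -[X in X <= _]ger0_norm ?divr_ge0 ?(ltW e0)// -sqrtr_sqr ler_sqrt ?(ltW s0)//.
by apply: le_trans (sh_ge (ltW v0)); rewrite ler_pdivlMr// mulrC.
Unshelve. all: by end_near. Qed.

Lemma Rintegral_ray_cvg (g : R -> R) : intg leb `]0, +oo[ g ->
  \int[leb]_(v in `]n.+1%:R^-1, +oo[) g v @[n --> \oo] --> \int[leb]_(v in `]0, +oo[) g v.
Proof.
move=> gi.
set P := `]0, +oo[%classic : set (measurableTypeR R).
have mP : measurable P by exact: measurable_itv.
pose D n := `]n.+1%:R^-1, +oo[%classic : set (measurableTypeR R).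
have mD n : measurable (D n) by exact: measurable_itv.
have DP n : D n `<=` P.
  move=> x; rewrite /D /P /= !in_itv /= !andbT; apply: lt_trans.
  by rewrite invr_gt0.
have E n : \int[leb]_(v in D n) g v = \int[leb]_(v in P) (g \_ (D n)) v.
  by rewrite -Rintegral_mkcondr setIidr.
under eq_fun do rewrite -/(D _) E.
have k1 n : measurable_fun P (g \_ (D n)).
  apply: measurable_funTS; apply/(measurable_restrictT _ _).1 => //.
  by apply: integrable_measurable (integrableS _ _ (DP n) gi).
have k2 x : P x -> (g \_ (D n)) x @[n --> \oo] --> g x.
  rewrite /P /= in_itv /= andbT => x0; apply: cvg_near_cst; near=> n.
  rewrite patchE mem_set// /D /= in_itv /= andbT.
  rewrite -[X in _ < X]invrK ltf_pV2 ?posrE ?invr_gt0//.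
  rewrite (@le_lt_trans _ _ n%:R) ?ltr_nat//; near: n; exact: nbhs_infty_ger.
have k3 n x : P x -> `|(g \_ (D n)) x| <= `|g x|.
  by move=> _; rewrite patchE; case: ifP => _; rewrite ?normr0.
by have [] := dominated_cvg_Rintegral mP k1 k2 (integrable_norm gi) k3.
Unshelve. all: by end_near. Qed.

Section ShiftCos.
Variables (h : R -> R) (s th v : R).
Hypothesis ih : intg leb setT h.

Let mh : measurable_fun setT h.
Proof. exact: integrable_measurable ih. Qed.

Let mhs c : measurable_fun setT (fun x : R => h (x + c)).
Proof. by apply: (measurableT_comp mh); ms'. Qed.

Let ic c : intg leb setT (fun x : R => cos (s * (x + c) + th) * h x).
Proof.
apply: (integrable_le _ _ _ (integrable_norm ih)) => //; first by ms'.
by move=> x _; rewrite normrM ler_piMl ?cos_max.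
Qed.

Let ics c : intg leb setT (fun y : R => cos (s * y + th) * h (y + c)).
Proof.
have := (integrable_shift c (integrable_measurable measurableT (ic (- c)))).2 (ic (- c)).
by apply: integrable_eq => // x _; rewrite addrK.
Qed.

Let Is c : \int[leb]_y (cos (s * y + th) * h (y + c)) =
  \int[leb]_x (cos (s * (x - c) + th) * h x).
Proof.
rewrite -(Rintegral_shift c (integrable_measurable measurableT (ic (- c)))).
by apply: eq_Rint => x _; rewrite addrK.
Qed.

Lemma shift_cos_integrable :
  intg leb setT (fun y => cos (s * y + th) * (h (y + v) - h (y - v))).
Proof.
have := integrableBr measurableT (ics v) (ics (- v)).
by apply: integrable_eq => // x _; rewrite mulrBr.
Qed.

(** Translation moves the shifts from [h] to the cosine, and the difference of the two cosines is
    twice a product of sines. *)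
Lemma Rintegral_shift_cos : \int[leb]_y (cos (s * y + th) * (h (y + v) - h (y - v))) =
  2 * sin (s * v) * \int[leb]_x (h x * sin (s * x + th)).
Proof.
have isn : intg leb setT (fun x => h x * sin (s * x + th)).
  apply: (integrable_le _ _ _ (integrable_norm ih)) => //; first by ms'.
  by move=> x _; rewrite normrM ler_piMr ?sin_max.
transitivity (\int[leb]_y (cos (s * y + th) * h (y + v) - cos (s * y + th) * h (y - v))).
  by apply: eq_Rint => x _; rewrite mulrBr.
rewrite (RintegralB measurableT (ics v) (ics (- v))) !Is -(RintegralB measurableT (ic _) (ic _)).
rewrite -(RintegralZl _ measurableT isn); apply: eq_Rint => x _.
have -> : s * (x - v) + th = s * x + th - s * v by ring.
have -> : s * (x - - v) + th = s * x + th + s * v by ring.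
set A := s * x + th; set B := s * v; clearbody A B.
by rewrite (cosB A B) (cosD A B); ring.
Qed.

End ShiftCos.

Lemma ch_le_ch1 (x : R) : 0 <= x <= 1 -> ch x <= ch 1.
Proof.
move=> /andP[x0 x1]; apply: (@der_ge0_le R (@ch R) (fun y => sh y / 2)) => //.
  by move=> y _; exact: der_ch1.
move=> y /andP[xy _]; rewrite divr_ge0// (le_trans _ (sh_ge _)) ?divr_ge0//.
  by rewrite (le_trans x0)// ltW.
by rewrite (le_trans x0)// ltW.
Qed.

End Limits.

(* With [F y v := q y (L (y - v) y P (y - v) - L (y + v) y P (y + v))], [q y = cos (s y + th) w y]
   and [P] the primitive of [p], the [v]-derivative of [F] splits into the integrand of the left-hand
   side and, as [L'] is the quotient of weights times [1 / sh], a part whose integral over [y] is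
   elementary; integrate over [v > e] and let [e] tend to [0]. *)
Section PotentialRelation.
Context (R : realType).
Local Notation leb := (@lebesgue_measure R).
Variables (k : R) (p : R -> R) (M s th : R).
Hypotheses (k0 : 0 < k) (k1 : k <= 1) (s0 : 0 < s).
Hypotheses (cp : continuous p) (pM : forall u, `|p u| <= M * (ch u)^-1)
  (p0 : \int[leb]_u p u = 0).

Let w := weight k.
Let L := logker k.
Let P := prim p.
Let q y := cos (s * y + th) * w y.
Let K := M * (pi + 2).

Let b v y := q y * (L (y - v) y * p (y - v) + L (y + v) y * p (y + v)).
Let m v y := cos (s * y + th) / (2 * sh v) * (w (y + v) * P (y + v) - w (y - v) * P (y - v)).
Let F y v := q y * (L (y - v) y * P (y - v) - L (y + v) y * P (y + v)).
Let Z := \int[leb]_y (P y * w y * sin (s * y + th)).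

Let M0 : 0 <= M.
Proof.
have := pM 0; rewrite -ler_pdivrMr ?invr_gt0 ?ch_gt0// invrK.
by apply: le_trans; rewrite mulr_ge0// ltW ?ch_gt0.
Qed.

Let K0 : 0 <= K. Proof. by rewrite /K mulr_ge0// addr_ge0 ?pi_ge0. Qed.

Let PK u : `|P u| <= K * (ch u)^-1. Proof. exact: norm_prim_le. Qed.

Let dP u : is_derive (u : R) (1 : R) P (p u). Proof. exact: der_prim. Qed.

Let mp : measurable_fun setT p. Proof. exact: continuous_measurable_fun. Qed.
Let mP : measurable_fun setT P.
Proof. by apply: continuous_measurable_fun => u; exact: der_continuous (dP u). Qed.
Let mw : measurable_fun setT w. Proof. exact: measurable_weight. Qed.

Let qk y : `|q y| <= k^-1 * (ch y)^-1.
Proof.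
apply: le_trans (weight_le k0 k1 y); rewrite /q normrM.
rewrite (ger0_norm (ltW (weight_gt0 k y))) ler_piMl ?cos_max//.
by rewrite ltW ?weight_gt0.
Qed.

Let ich (y : R) : 0 < (ch y)^-1. Proof. by rewrite invr_gt0 ch_gt0. Qed.
Let sc (y : R) : 0 < Num.sqrt (ch y). Proof. by rewrite sqrtr_gt0 ch_gt0. Qed.
Let scc (y : R) : Num.sqrt (ch y) * Num.sqrt (ch y) = ch y.
Proof. by rewrite -expr2 sqr_sqrtr ?ltW ?ch_gt0. Qed.
Let sc1 (y : R) : 1 <= Num.sqrt (ch y).
Proof. by rewrite -sqrtr1 ler_sqrt ?ch_ge1// ltW ?ch_gt0. Qed.

Let Lbound u y r (N : R) : u != y -> `|r| <= N * (ch u)^-1 ->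
  `|L u y * r| <= 4 * N * Num.sqrt (ch y) / Num.sqrt (sh `|u - y|) / Num.sqrt (ch u).
Proof.
move=> uy rN; rewrite normrM.
apply: (le_trans (ler_pM _ _ (norm_logker_le k0 k1 uy) rN)) => //.
rewrite le_eqVlt; apply/orP; left; apply/eqP.
rewrite -{2}(scc u); field.
have : 0 < sh `|u - y| by rewrite sh_gt0// normr_gt0 subr_eq0.
by move=> h; rewrite !gt_eqF ?sqrtr_gt0// ch_gt0.
Qed.

Let yv (y v : R) : 0 < v -> y - v != y /\ `|y - v - y| = v.
Proof.
move=> v0; rewrite addrAC subrr sub0r normrN gtr0_norm//; split => //.
by rewrite -subr_eq0 addrAC subrr sub0r oppr_eq0 gt_eqF.
Qed.

Let yv' (y v : R) : 0 < v -> y + v != y /\ `|y + v - y| = v.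
Proof.
move=> v0; rewrite addrAC subrr add0r gtr0_norm//; split => //.
by rewrite -subr_eq0 addrAC subrr add0r gt_eqF.
Qed.

Let qLbound y v r N : 0 <= N -> 0 < v -> `|r| <= N * (ch (y + v))^-1 ->
  `|q y * (L (y + v) y * r)| <= 4 * N / k * (Num.sqrt (sh v))^-1 * (Num.sqrt (ch y))^-1.
Proof.
move=> N0 v0 rN; have [yv1 yv2] := yv' y v0; have S0 := sh_gt0 v0.
have qs : 0 < Num.sqrt (sh v) by rewrite sqrtr_gt0.
have h := Lbound yv1 rN; rewrite yv2 in h.
rewrite normrM; apply: (le_trans (ler_pM _ _ (qk y) h)) => //.
rewrite -{1}(scc y).
have -> : k^-1 * (Num.sqrt (ch y) * Num.sqrt (ch y))^-1 *
   (4 * N * Num.sqrt (ch y) / Num.sqrt (sh v) / Num.sqrt (ch (y + v))) =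
   4 * N / k * (Num.sqrt (sh v))^-1 * (Num.sqrt (ch y))^-1 * (Num.sqrt (ch (y + v)))^-1.
  by field; rewrite !gt_eqF.
rewrite ler_piMr ?invf_le1 ?sc1 ?sc//.
by rewrite !mulr_ge0 ?invr_ge0 ?(ltW k0) ?sqrtr_ge0.
Qed.

Let qLbound' y v r N : 0 <= N -> 0 < v -> `|r| <= N * (ch (y - v))^-1 ->
  `|q y * (L (y - v) y * r)| <= 4 * N / k * (Num.sqrt (sh v))^-1 * (Num.sqrt (ch y))^-1.
Proof.
move=> N0 v0 rN; have [yv1 yv2] := yv y v0; have S0 := sh_gt0 v0.
have qs : 0 < Num.sqrt (sh v) by rewrite sqrtr_gt0.
have h := Lbound yv1 rN; rewrite yv2 in h.
rewrite normrM; apply: (le_trans (ler_pM _ _ (qk y) h)) => //.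
rewrite -{1}(scc y).
have -> : k^-1 * (Num.sqrt (ch y) * Num.sqrt (ch y))^-1 *
   (4 * N * Num.sqrt (ch y) / Num.sqrt (sh v) / Num.sqrt (ch (y - v))) =
   4 * N / k * (Num.sqrt (sh v))^-1 * (Num.sqrt (ch y))^-1 * (Num.sqrt (ch (y - v)))^-1.
  by field; rewrite !gt_eqF.
rewrite ler_piMr ?invf_le1 ?sc1 ?sc//.
by rewrite !mulr_ge0 ?invr_ge0 ?(ltW k0) ?sqrtr_ge0.
Qed.

(** The bounds on [b], [F] and [m] all separate into a function of [v] and the power -1/2 of [ch y],
    as Fubini's theorem requires: half of the decay of [q] pays for the growth of the kernel. *)
Let bbound v y : 0 < v -> `|b v y| <= (8 * M / k * (Num.sqrt (sh v))^-1) * (Num.sqrt (ch y))^-1.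
Proof.
move=> v0; rewrite /b mulrDr.
have h1 := qLbound M0 v0 (pM (y + v)); have h2 := qLbound' M0 v0 (pM (y - v)).
apply: (le_trans (ler_normD _ _)); apply: (le_trans (lerD h2 h1)).
by rewrite le_eqVlt; apply/orP; left; apply/eqP; ring.
Qed.

Let Fbound v y : 0 < v -> `|F y v| <= 8 * K / k * (Num.sqrt (sh v))^-1 * (Num.sqrt (ch y))^-1.
Proof.
move=> v0; rewrite /F mulrBr.
have h1 := qLbound K0 v0 (PK (y + v)); have h2 := qLbound' K0 v0 (PK (y - v)).
apply: (le_trans (ler_normB _ _)); apply: (le_trans (lerD h2 h1)).
by rewrite le_eqVlt; apply/orP; left; apply/eqP; ring.
Qed.

Let wP u : `|w u * P u| <= K / k * (Num.sqrt (ch u))^-1.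
Proof.
have zz : (ch u)^-1 = (Num.sqrt (ch u))^-1 * (Num.sqrt (ch u))^-1 by rewrite -invfM scc.
rewrite normrM (ger0_norm (ltW (weight_gt0 k u))).
apply: (le_trans (ler_pM (ltW (weight_gt0 k u)) (normr_ge0 _) (weight_le k0 k1 u) (PK u))).
have h : (Num.sqrt (ch u))^-1 <= 1 by rewrite invf_le1 ?sc1 ?sc.
have h0 : 0 < (Num.sqrt (ch u))^-1 by rewrite invr_gt0 sc.
rewrite zz; set z := (Num.sqrt (ch u))^-1 in h h0 *; clearbody z K.
have -> : k^-1 * (z * z) * (K * (z * z)) = K / k * (z * z ^+ 3) by ring.
rewrite ler_wpM2l ?(divr_ge0 K0 (ltW k0))//.
by rewrite ler_piMr ?(ltW h0)// exprn_ile1// ltW.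
Qed.

Let sqrt_shift (y v : R) : (Num.sqrt (ch (y + v)))^-1 <= Num.sqrt (2 * ch v) * (Num.sqrt (ch y))^-1.
Proof.
rewrite -!sqrtrV ?(ltW (ch_gt0 _))// -sqrtrM ?mulr_ge0 ?(ltW (ch_gt0 _))//.
by rewrite ler_wsqrtr//; exact: invch_shift.
Qed.

Let mbound v y : 0 < v ->
  `|m v y| <= (K / k * Num.sqrt (2 * ch v) / sh v) * (Num.sqrt (ch y))^-1.
Proof.
move=> v0; have S0 := sh_gt0 v0; have Kk : 0 <= K / k by rewrite divr_ge0 ?(ltW k0).
have h1 : `|w (y + v) * P (y + v)| <= K / k * (Num.sqrt (2 * ch v) * (Num.sqrt (ch y))^-1).
  by apply: (le_trans (wP _)); rewrite ler_wpM2l// sqrt_shift.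
have h2 : `|w (y - v) * P (y - v)| <= K / k * (Num.sqrt (2 * ch v) * (Num.sqrt (ch y))^-1).
  by apply: (le_trans (wP _)); rewrite ler_wpM2l// -(chN v) sqrt_shift.
have h3 : `|cos (s * y + th) / (2 * sh v)| <= (2 * sh v)^-1.
  rewrite normrM normfV (gtr0_norm (mulr_gt0 _ S0))// ler_piMl ?cos_max// invr_ge0.
  by rewrite mulr_ge0// ltW.
rewrite /m normrM.
apply: (le_trans (ler_pM _ _ h3 (le_trans (ler_normB _ _) (lerD h1 h2)))) => //.
rewrite le_eqVlt; apply/orP; left; apply/eqP; field.
by rewrite !gt_eqF ?sc.
Qed.

Let D (e : R) : set (measurableTypeR R) := `]e, +oo[%classic.
Let mD e : measurable (D e). Proof. exact: measurable_itv. Qed.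
Let De e v : D e v <-> e < v. Proof. by rewrite /D /= in_itv /= andbT. Qed.

Let isc : intg leb setT (fun y => (Num.sqrt (ch y))^-1).
Proof. exact: invsqrtch_integrable. Qed.

Let ib0 : intg leb (D 0) (fun v => 8 * M / k * (Num.sqrt (sh v))^-1).
Proof. by apply: integrableZr => //; exact: invsqrtsh_integrable. Qed.

Let ib e : 0 <= e -> intg leb (D e) (fun v => 8 * M / k * (Num.sqrt (sh v))^-1).
Proof.
move=> e0; apply: (integrableS _ _ _ ib0) => //.
by move=> x /De xe; apply/De; exact: le_lt_trans xe.
Qed.

(** The separated bound on [m] behaves like [1 / sh v] near 0, where it is not integrable; hence the
    cut-off [e]. *)
Let im e : 0 < e -> intg leb (D e) (fun v => K / k * Num.sqrt (2 * ch v) / sh v).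
Proof.
move=> e0; have S0 := sh_gt0 e0.
have i1 : intg leb (D e) (fun v => K / k * Num.sqrt 2 * (1 + (sh e)^-1) * (Num.sqrt (ch v))^-1).
  by apply: integrableZr => //; exact: (integrableS measurableT).
apply: (integrable_le _ _ _ i1) => //; first by apply: measurable_funTS; ms'.
move=> v /De ev; have v0 := lt_trans e0 ev; have Sv := sh_gt0 v0.
have shev : sh e <= sh v.
  apply: (@der_ge0_le R (@sh R) (fun y => ch y / 2)); first exact: ltW.
    by move=> x _; exact: der_sh1.
  by move=> x _; rewrite divr_ge0// ltW// ch_gt0.
rewrite ger0_norm; last first.
  exact: divr_ge0 (mulr_ge0 (divr_ge0 K0 (ltW k0)) (sqrtr_ge0 _)) (ltW Sv).
clearbody K; rewrite sqrtrM// -!mulrA ler_wpM2l// ler_wpM2l ?invr_ge0 ?(ltW k0)// ler_wpM2l ?sqrtr_ge0//.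
have -> : Num.sqrt (ch v) / sh v = ch v / sh v / Num.sqrt (ch v).
  by rewrite -{2}(scc v); field; rewrite !gt_eqF ?sc.
rewrite ler_pM2r ?invr_gt0 ?sc// ler_pdivrMr// mulrDl mul1r.
have := ch_le_1sh v; rewrite (gtr0_norm Sv) => /le_trans; apply.
by rewrite addrC lerD2l mulrC ler_pdivlMr// mul1r.
Qed.

Let mb : measurable_fun setT (fun z : measurableTypeR R * measurableTypeR R => b z.1 z.2).
Proof.
rewrite /b /q /w /L /weight /logker /crossq /cweight.
ms'; try (apply: (measurableT_comp mp); ms'); by [exact: measurable_fst|exact: measurable_snd].
Qed.

Let mm : measurable_fun setT (fun z : measurableTypeR R * measurableTypeR R => m z.1 z.2).
Proof.
rewrite /m; ms'; try (apply: (measurableT_comp mP); ms'); try (apply: (measurableT_comp mw); ms');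
  by [exact: measurable_fst|exact: measurable_snd].
Qed.

Let yvv v y : 0 < v -> is_derive (v : R) (1 : R) (fun v => L (y - v) y) (- dlogker k (y - v) y)
  /\ is_derive (v : R) (1 : R) (fun v => L (y + v) y) (dlogker k (y + v) y).
Proof.
move=> v0; have [n1 _] := yv y v0; have [n2 _] := yv' y v0; split.
  have d1 : is_derive (v : R) (1 : R) (fun v : R => y - v) (- 1).
    by derive_by; [der|rewrite add0r].
  have d0 := der_logker k0 n1.
  have d2 := @der_comp R v (fun v => y - v) (fun u => logker k u y) _ _ d0 d1.
  by derive_by; [exact: d2|ring].
have d1 : is_derive (v : R) (1 : R) (fun v : R => y + v) 1.
  by derive_by; [der|rewrite add0r].
have d0 := der_logker k0 n2.
  have d2 := @der_comp R v (fun v => y + v) (fun u => logker k u y) _ _ d0 d1.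
  by derive_by; [exact: d2|ring].
Qed.

Let Pvv (f g : R -> R) v y : (forall u, is_derive (u : R) (1 : R) f (g u)) ->
  is_derive (v : R) (1 : R) (fun v => f (y - v)) (- g (y - v))
  /\ is_derive (v : R) (1 : R) (fun v => f (y + v)) (g (y + v)).
Proof.
move=> dfg; split.
  have d1 : is_derive (v : R) (1 : R) (fun v : R => y - v) (- 1).
    by derive_by; [der|rewrite add0r].
  by derive_by; [exact: (der_comp (dfg _) d1)|ring].
have d1 : is_derive (v : R) (1 : R) (fun v : R => y + v) 1.
  by derive_by; [der|rewrite add0r].
by derive_by; [exact: (der_comp (dfg _) d1)|ring].
Qed.

(** The derivative of [P] yields [b]. In the derivative of the kernel the factor [cweight k y] is
    cancelled by the weight in [q], so the kernel no longer occurs in [m]. *)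
Let dF y v : 0 < v -> is_derive (v : R) (1 : R) (F y) (- (b v y + m v y)).
Proof.
move=> v0; have [d1 d2] := yvv y v0; have [d3 d4] := Pvv v y dP.
have S0 := sh_gt0 v0.
have e1 : F y = fun v => q y * (L (y - v) y * P (y - v) - L (y + v) y * P (y + v)) by [].
rewrite e1; derive_by; first by der.
cbv beta; rewrite /b /m /q /dlogker.
have -> : y - v - y = - v by ring.
have -> : y + v - y = v by ring.
rewrite shN /w /weight; clearbody L P; field.
by rewrite !gt_eqF ?cweight_gt0.
Qed.

Let cbm y v : 0 < v -> {for v, continuous (fun v => b v y + m v y)}.
Proof.
move=> v0; have [d1 d2] := yvv y v0; have [d3 d4] := Pvv v y dP.
have [d5 d6] := Pvv v y (der_weight k); rewrite -/w in d5 d6.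
have S0 := sh_gt0 v0; have dsh := der_sh1 v.
have cm : {for v, continuous (m^~ y)}.
  have cc : {for v, continuous (fun v : R => (2 * sh v)^-1)}.
    by apply: der_continuous; der; rewrite mulf_neq0 ?gt_eqF.
  have c3 := der_continuous d3; have c4 := der_continuous d4.
  have c5 := der_continuous d5; have c6 := der_continuous d6.
  apply: cvgM; first by apply: cvgM; [exact: cvg_cst|exact: cc].
  by apply: cvgB; apply: cvgM.
have cb1 := der_continuous d1; have cb2 := der_continuous d2.
have cb3 : {for v, continuous (fun v => p (y - v))}.
  apply: (@continuous_comp _ _ _ (fun v => y - v) p); last exact: cp.
  by apply: der_continuous; der.
have cb4 : {for v, continuous (fun v => p (y + v))}.
  apply: (@continuous_comp _ _ _ (fun v => y + v) p); last exact: cp.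
  by apply: der_continuous; der.
apply: cvgD; last exact: cm.
apply: cvgM; first exact: cvg_cst.
by apply: cvgD; apply: cvgM.
Qed.

Let mT : measurable [set: measurableTypeR R]. Proof. exact: measurableT. Qed.

Let intb e y : 0 <= e -> intg leb (D e) (fun v => b v y).
Proof.
move=> e0.
have bb x (z : measurableTypeR R) : D e x -> setT z -> `|b x z| <= (8 * M / k * (Num.sqrt (sh x))^-1) * (Num.sqrt (ch z))^-1.
  by move=> /De xe _; apply: bbound; exact: le_lt_trans xe.
have h := tensor_integrable1 (mD e) (ib e0) mb bb.
exact: (h y I).
Qed.

Let intm e y : 0 < e -> intg leb (D e) (fun v => m v y).
Proof.
move=> e0.
have bm x (z : measurableTypeR R) : D e x -> setT z ->
    `|m x z| <= (K / k * Num.sqrt (2 * ch x) / sh x) * (Num.sqrt (ch z))^-1.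
  by move=> /De xe _; apply: mbound; exact: lt_trans xe.
have h := tensor_integrable1 (mD e) (im e0) mm bm.
exact: (h y I).
Qed.

Let ftc e y : 0 < e ->
  \int[leb]_(v in D e) b v y + \int[leb]_(v in D e) m v y = F y e.
Proof.
move=> e0.
rewrite -RintegralD//; [|exact: intb (ltW e0)|exact: intm].
have h1 x : e < x -> is_derive (x : R) (1 : R) (fun v => - F y v) (b x y + m x y).
  move=> ex; have d1 := dF y (lt_trans e0 ex).
  by derive_by; [notypeclasses refine (derN d1)|rewrite opprK].
have h2 x : e < x -> {for x, continuous (fun v => b v y + m v y)}.
  by move=> ex; apply: cbm; exact: lt_trans ex.
have h3 : intg leb `]e, +oo[ (fun v => b v y + m v y).
  by apply: integrableDr; [exact: mD|exact: intb (ltW e0)|exact: intm].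
have h4 : - F y x @[x --> +oo] --> (0 : R).
  apply: (@cvgr_pinfty0_sqrtsh _ _ (8 * K / k * (Num.sqrt (ch y))^-1)) => v v0.
  rewrite normrN; apply: (le_trans (Fbound y v0)).
  by rewrite le_eqVlt; apply/orP; left; apply/eqP; ring.
have h5 : - F y x @[x --> e^'+] --> - F y e.
  by apply: cvgN; apply: cvg_at_right_filter; exact: der_continuous (dF y e0).
by rewrite (Rintegral_ray_FTC h1 h2 h3 h4 h5) sub0r opprK.
Qed.

Let beta v := \int[leb]_y b v y.

(** Translation by [v] and by [-v] brings both terms to the same density [w P], which leaves a
    constant times [sin (s v) / sh v]. *)
Let mint v : 0 < v -> \int[leb]_y m v y = sin (s * v) / sh v * Z.
Proof.
move=> v0; have S0 := sh_gt0 v0.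
have iwP : intg leb setT (fun x => w x * P x).
  apply: (integrable_le _ _ _ (integrableZr (K / k) _ isc)) => //.
  by ms'.
transitivity ((2 * sh v)^-1 * (2 * sin (s * v) * Z)); last first.
  by field; rewrite gt_eqF.
have -> : Z = \int[leb]_x (w x * P x * sin (s * x + th)).
  by apply: eq_Rint => x _; ring.
rewrite -(Rintegral_shift_cos s th v iwP).
rewrite -(RintegralZl _ measurableT (shift_cos_integrable s th v iwP)).
by apply: eq_Rint => x _; rewrite /m; ring.
Qed.

Let Fint e : 0 < e -> \int[leb]_(v in D e) beta v +
  Z * \int[leb]_(v in D e) (sin (s * v) / sh v) = \int[leb]_y F y e.
Proof.
move=> e0; have e0' := ltW e0.
have bb x y : D e x -> setT y -> `|b x y| <= (8 * M / k * (Num.sqrt (sh x))^-1) * (Num.sqrt (ch y))^-1.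
  by move=> /De xe _; apply: bbound; exact: lt_trans xe.
have bm x y : D e x -> setT y ->
    `|m x y| <= (K / k * Num.sqrt (2 * ch x) / sh x) * (Num.sqrt (ch y))^-1.
  by move=> /De xe _; apply: mbound; exact: lt_trans xe.
transitivity (\int[leb]_y (\int[leb]_(v in D e) b v y + \int[leb]_(v in D e) m v y)); last first.
  by apply: eq_Rint => y _; exact: ftc.
rewrite RintegralD//; first last.
- exact: (tensor_integrable21 (mD e) mT (im e0) isc mm bm).
- exact: (tensor_integrable21 (mD e) mT (ib e0') isc mb bb).
rewrite -(tensor_Fubini (mD e) mT (ib e0') isc mb bb).
rewrite -(tensor_Fubini (mD e) mT (im e0) isc mm bm); congr (_ + _).
rewrite -RintegralZl//; last first.
  apply: (integrableS _ _ _ (sin_over_sh_integrable s0)) => //.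
  by move=> x /De xe /=; rewrite in_itv /= andbT; exact: lt_trans xe.
by apply: eq_Rint => v /De ev; rewrite mint ?(lt_trans e0 ev)// mulrC.
Qed.

Let dq y : is_derive (y : R) (1 : R) q
  (- s * sin (s * y + th) * w y + cos (s * y + th) * - (k ^+ 2 * sh y * ch y / (2 * cweight k y ^+ 3))).
Proof.
have d1 := der_weight k y; rewrite -/w in d1.
have -> : q = fun y => cos (s * y + th) * w y by [].
by derive_by; [der|cbv beta; ring].
Qed.

Let dqk y : `|- s * sin (s * y + th) * w y +
    cos (s * y + th) * - (k ^+ 2 * sh y * ch y / (2 * cweight k y ^+ 3))| <=
  (s + 1) / k * (ch y)^-1.
Proof.
have W0 := cweight_gt0 k y.
apply: (@le_trans _ _ ((s + 1) * w y)); last first.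
  by rewrite -mulrA ler_wpM2l ?weight_le// addr_ge0// ltW.
have -> : (s + 1) * w y = s * w y + w y by ring.
apply: (le_trans (ler_normD _ _)); apply: lerD.
  rewrite -mulrA normrM normrN (gtr0_norm s0) ler_wpM2l ?(ltW s0)// normrM.
  by rewrite (gtr0_norm (weight_gt0 k y)) ler_piMl ?sin_max// ltW ?weight_gt0.
rewrite normrM normrN; apply: (@le_trans _ _ `|k ^+ 2 * sh y * ch y / (2 * cweight k y ^+ 3)|).
  by rewrite ler_piMl ?cos_max.
have -> : k ^+ 2 * sh y * ch y / (2 * cweight k y ^+ 3) =
  (k * sh y / cweight k y) * (k * ch y / cweight k y) / 2 * w y.
  by rewrite /w /weight; field; rewrite gt_eqF.
rewrite normrM (gtr0_norm (weight_gt0 k y)) ler_piMl ?(ltW (weight_gt0 k y))//.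
have h1 : `|k * sh y / cweight k y| <= 1.
  by rewrite !normrM normfV (gtr0_norm k0) (gtr0_norm W0) ler_pdivrMr// mul1r cweight_ge_sh.
have h2 : `|k * ch y / cweight k y| <= 1.
  rewrite !normrM normfV (gtr0_norm k0) (gtr0_norm W0) ler_pdivrMr// mul1r.
  by rewrite (gtr0_norm (ch_gt0 y)) cweight_ge_ch.
rewrite normrM normfV (ger0_norm (ler0n _ 2)) ler_pdivrMr// mul1r normrM.
by apply: (le_trans (mulr_ile1 _ _ h1 h2)) => //; lra.
Qed.

Let ch1x (y x : R) : y <= x <= y + 1 -> (ch x)^-1 <= 2 * ch 1 * (ch y)^-1.
Proof.
move=> /andP[xy yx]; have -> : x = y + (x - y) by ring.
apply: (le_trans (invch_shift _ _)); rewrite ler_wpM2r ?(ltW (ich _))// ler_wpM2l//.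
by apply: ch_le_ch1; apply/andP; split; lra.
Qed.

Let lip (f g : R -> R) (N e y : R) : 0 <= N -> 0 < e <= 1 ->
  (forall x, is_derive (x : R) (1 : R) f (g x)) -> (forall x, `|g x| <= N * (ch x)^-1) ->
  `|f (y + e) - f y| <= N * (2 * ch 1) * e * (ch y)^-1.
Proof.
move=> N0 /andP[e0 e1] dfg gN.
have ye : y <= y + e by rewrite lerDl ltW.
have := @der_norm_le R f g y (y + e) (N * (2 * ch 1) * (ch y)^-1) ye (fun x _ => dfg x).
have -> : N * (2 * ch 1) / ch y * (y + e - y) = N * (2 * ch 1) * e / ch y by ring.
apply=> x /andP[x1 x2]; apply: (le_trans (gN x)); rewrite -mulrA ler_wpM2l// ch1x//.
by apply/andP; split; lra.
Qed.

Let mL (g : R -> R) : measurable_fun setT g -> measurable_fun setT (fun y => L (g y) y).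
Proof. by move=> mg; rewrite /L /logker /crossq /cweight; ms'. Qed.
Let mq : measurable_fun setT q. Proof. by rewrite /q; ms'. Qed.
Let mPs c : measurable_fun setT (fun y : R => P (y + c)).
Proof. by apply: (measurableT_comp mP); ms'. Qed.

Let E e y := L (y + e) y * (q (y + e) * P y - q y * P (y + e)).

(** Translating the first term by [e] and using the symmetry of the kernel puts the same factor
    [L (y + e) y] before both terms, and the remaining difference vanishes with [e]. *)
Let FE e : 0 < e -> \int[leb]_y F y e = \int[leb]_y E e y.
Proof.
move=> e0; have C0 : 0 <= 4 * K / k * (Num.sqrt (sh e))^-1.
  by clearbody K; rewrite !mulr_ge0 ?invr_ge0 ?sqrtr_ge0 ?(ltW k0).
have i2 : intg leb setT (fun y => q y * (L (y + e) y * P (y + e))).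
  apply: (integrable_le _ _ _ (integrableZr (4 * K / k * (Num.sqrt (sh e))^-1) _ isc)) => //.
    by ms'; by [apply: mL; ms'|exact: mPs].
  by move=> y _; exact: qLbound.
have i1 : intg leb setT (fun y => q y * (L (y - e) y * P (y - e))).
  apply: (integrable_le _ _ _ (integrableZr (4 * K / k * (Num.sqrt (sh e))^-1) _ isc)) => //.
    by ms'; by [apply: mL; ms'|exact: mPs].
  by move=> y _; exact: qLbound'.
have m1 := integrable_measurable mT i1.
transitivity (\int[leb]_y (q y * (L (y - e) y * P (y - e)) - q y * (L (y + e) y * P (y + e)))).
  by apply: eq_Rint => y _; rewrite /F; ring.
have i3 := (integrable_shift e m1).2 i1.
rewrite RintegralB// -(Rintegral_shift e m1) -RintegralB//.
apply: eq_Rint => y _.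
by rewrite /E addrK /L (logkerC k y); ring.
Qed.

(** The difference of products is of order [e] by the Lipschitz bounds on [q] and [P], while the
    kernel is at most of order [e^(-1/2)]; the boundary term is therefore of order [sqrt e]. *)
Let Ebound e y : 0 < e <= 1 ->
  `|E e y| <= (4 * Num.sqrt (2 * ch 1) * (2 * ch 1) * ((s + 1) / k * K + M / k)) * Num.sqrt (2 * e)
     * (ch y)^-1.
Proof.
move=> /[dup] ee /andP[e0 e1]; have S0 := sh_gt0 e0.
have s1k : 0 <= (s + 1) / k by rewrite divr_ge0// ?(ltW k0)// addr_ge0// ltW.
have c1 := ch_gt0 (1 : R).
have h1 := lip y s1k ee dq dqk; have h2 := lip y M0 ee dP pM.
have h3 : `|q (y + e) * P y - q y * P (y + e)| <=
    2 * ch 1 * ((s + 1) / k * K + M / k) * e * ((ch y)^-1 * (ch y)^-1).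
  have -> : q (y + e) * P y - q y * P (y + e) =
    (q (y + e) - q y) * P y - q y * (P (y + e) - P y) by ring.
  apply: (le_trans (ler_normB _ _)); rewrite normrM [X in _ + X]normrM.
  have h4 := ler_pM (normr_ge0 _) (normr_ge0 _) h1 (PK y).
  have h5 := ler_pM (normr_ge0 _) (normr_ge0 _) (qk y) h2.
  apply: (le_trans (lerD h4 h5)); clearbody K.
  by rewrite le_eqVlt; apply/orP; left; apply/eqP; ring.
have [ye1 ye2] := yv' y e0.
have h6 := norm_logker_le k0 k1 ye1; rewrite ye2 -/L in h6.
have h7 : Num.sqrt (ch (y + e)) <= Num.sqrt (2 * ch 1) * Num.sqrt (ch y).
  rewrite -sqrtrM ?mulr_ge0 ?(ltW c1)// ler_wsqrtr//.
  have ce : ch e <= ch 1 by apply: ch_le_ch1; rewrite (ltW e0).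
  have := invch_shift (y + e) (- e).
  rewrite addrK chN => h; have : (ch y)^-1 <= 2 * ch 1 * (ch (y + e))^-1.
    by apply: (le_trans h); rewrite ler_wpM2r ?(ltW (ich _))// ler_wpM2l.
  by rewrite ler_pdivlMr ?ch_gt0// ler_pdivrMl ?ch_gt0// mulrC.
have h8 : `|L (y + e) y| <= 4 * Num.sqrt (2 * ch 1) * ch y * (Num.sqrt (sh e))^-1.
  apply: (le_trans h6); rewrite ler_wpM2r ?invr_ge0 ?sqrtr_ge0// -{2}(scc y) !mulrA.
  by rewrite ler_wpM2r ?sqrtr_ge0// -mulrA ler_wpM2l.
have h9 : e / Num.sqrt (sh e) <= Num.sqrt (2 * e).
  rewrite ler_pdivrMr ?sqrtr_gt0// -sqrtrM ?mulr_ge0 ?(ltW e0)//.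
  rewrite -{1}(ger0_norm (ltW e0)) -sqrtr_sqr ler_wsqrtr//.
  have := sh_ge (ltW e0); rewrite expr2 => sge.
  have -> : 2 * e * sh e = e * (2 * sh e) by ring.
  by rewrite ler_wpM2l ?(ltW e0)//; lra.
rewrite normrM; apply: (le_trans (ler_pM (normr_ge0 _) (normr_ge0 _) h8 h3)).
have C0 : 0 <= 4 * Num.sqrt (2 * ch 1) * (2 * ch 1) * ((s + 1) / k * K + M / k).
  clearbody K; rewrite mulr_ge0// ?addr_ge0// ?mulr_ge0 ?invr_ge0 ?sqrtr_ge0 ?(ltW k0) ?(ltW c1)//.
  by rewrite addr_ge0// ltW.
have -> : 4 * Num.sqrt (2 * ch 1) * ch y / Num.sqrt (sh e) *
  (2 * ch 1 * ((s + 1) / k * K + M / k) * e * ((ch y)^-1 * (ch y)^-1)) =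
  (4 * Num.sqrt (2 * ch 1) * (2 * ch 1) * ((s + 1) / k * K + M / k)) *
  (e / Num.sqrt (sh e)) * (ch y)^-1.
  by clearbody K; field; rewrite !gt_eqF ?sqrtr_gt0// ch_gt0.
by rewrite ler_wpM2r ?(ltW (ich y))// ler_wpM2l.
Qed.

Let e n : R := n.+1%:R^-1.
Let e0 n : 0 < e n <= 1.
Proof. by rewrite /e invr_gt0 ltr0n /= invf_le1 ?ltr0n// ler1n. Qed.

Let Ecvg : \int[leb]_y F y (e n) @[n --> \oo] --> (0 : R).
Proof.
set C := 4 * Num.sqrt (2 * ch 1) * (2 * ch 1) * ((s + 1) / k * K + M / k).
have mE n : measurable_fun setT (E (e n)).
  have mqs : measurable_fun setT (fun y : R => q (y + e n)).
    by apply: (measurableT_comp mq); ms'.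
  apply: ms_M; first by apply: mL; ms'.
  by apply: ms_D; [apply: ms_M|apply: ms_N; apply: ms_M; [exact: mq|exact: mPs]].
have h n : `|\int[leb]_y F y (e n)| <= C * (2 * pi) * Num.sqrt (2 * e n).
  have /andP[en0 _] := e0 n; rewrite (FE en0).
  have ii : intg leb setT (fun y => C * Num.sqrt (2 * e n) * (ch y)^-1).
    by apply: integrableZr => //; exact: invch_integrable.
  have := norm_Rintegral_le mT (mE n) (fun y _ => Ebound y (e0 n)) ii.
  move/le_trans; apply; rewrite RintegralZl//; last exact: invch_integrable.
  by rewrite Rintegral_invch -/C le_eqVlt; clearbody C; apply/orP; left; apply/eqP; ring.
apply/cvgr0Pnorm_le => /= r r0.
have hc : C * (2 * pi) * Num.sqrt (2 * e n) @[n --> \oo] --> C * (2 * pi) * Num.sqrt (2 * 0).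
  apply: cvgM; first exact: cvg_cst.
  apply: (@cvg_comp _ _ _ (fun n => 2 * e n) (@Num.sqrt R) _ (nbhs (2 * 0 : R))).
    by apply: cvgM; [exact: cvg_cst|exact: cvg_harmonic].
  exact: sqrt_continuous.
rewrite mulr0 sqrtr0 mulr0 in hc.
move/cvgr0Pnorm_le : hc => /(_ r r0); apply: filterS => n hn.
by apply: (le_trans (h n)); apply: le_trans hn; exact: ler_norm.
Qed.

Let bb0 x y : D 0 x -> setT y ->
  `|b x y| <= (8 * M / k * (Num.sqrt (sh x))^-1) * (Num.sqrt (ch y))^-1.
Proof. by move=> /De xe _; exact: bbound. Qed.

Let betaE : \int[leb]_(v in D 0) beta v = - (pi * tanh (pi * s)) * Z.
Proof.
have ibeta : intg leb (D 0) beta.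
  exact: (tensor_integrable12 (mD 0) mT ib0 isc mb bb0).
have c1 := Rintegral_ray_cvg ibeta.
have c2 := Rintegral_ray_cvg (sin_over_sh_integrable s0).
rewrite (integral_sin_over_sh s0) in c2.
have c3 : \int[leb]_y F y (e n) @[n --> \oo] -->
    \int[leb]_(v in D 0) beta v + Z * (pi * tanh (pi * s)).
  have -> : (fun n => \int[leb]_y F y (e n)) = (fun n => \int[leb]_(v in D (e n)) beta v +
      Z * \int[leb]_(v in D (e n)) (sin (s * v) / sh v)).
    by apply/funext => n; rewrite Fint//; case/andP: (e0 n).
  apply: cvgD; first exact: c1.
  by apply: cvgM; [exact: cvg_cst|exact: c2].
have := cvg_unique _ c3 Ecvg => /(_ (@Rhausdorff R)) h.
by rewrite mulNr [pi * _ * Z]mulrC; apply/eqP; rewrite -addr_eq0 h.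
Qed.

Lemma logker_row_integrable y : intg leb setT (fun u => L u y * p u).
Proof.
have mLp : measurable_fun setT (fun u => L u y * p u).
  by rewrite /L /logker /crossq /cweight; ms'; exact: mp.
apply/(integrable_shift y mLp).
have i1 : intg leb (D 0) (fun v => 4 * M * Num.sqrt (ch y) * (Num.sqrt (sh v))^-1).
  by apply: integrableZr => //; exact: invsqrtsh_integrable.
have hb (u v : R) : 0 < v -> u != y -> `|u - y| = v ->
    `|L u y * p u| <= 4 * M * Num.sqrt (ch y) * (Num.sqrt (sh v))^-1.
  move=> v0 uy uv; have := Lbound uy (pM u); rewrite uv => /le_trans; apply.
  have S0 := sh_gt0 v0.
  rewrite ler_piMr ?invf_le1 ?sc1 ?sc//.
  by rewrite !mulr_ge0 ?invr_ge0 ?sqrtr_ge0.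
have mLp' : measurable_fun setT (fun u : R => L (u + y) y * p (u + y)).
  by apply: (measurableT_comp mLp); ms'.
apply: integrable_fold => //.
  apply: (integrable_le _ _ _ i1) => //; first exact: measurable_funTS.
  by move=> v /De v0; rewrite addrC; have [? ?] := yv' y v0; exact: hb.
apply: (integrable_le _ _ _ i1) => //.
  by apply: measurable_funTS; apply: (measurableT_comp mLp'); ms'.
by move=> v /De v0; rewrite addrC; have [? ?] := yv y v0; exact: hb.
Qed.

Lemma logker_potential :
  \int[leb]_y ((\int[leb]_u (L u y * p u)) * (cos (s * y + th) * w y)) =
  - (pi * tanh (pi * s)) * \int[leb]_y (prim p y * w y * sin (s * y + th)).
Proof.
rewrite -betaE /beta (tensor_Fubini (mD 0) mT ib0 isc mb bb0).
apply: eq_Rint => y _ /=.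
have iL := logker_row_integrable y; have mLp := integrable_measurable mT iL.
have iL' := (integrable_shift y mLp).2 iL.
rewrite -(Rintegral_shift y mLp) (Rintegral_fold iL') mulrC -/(q y).
rewrite -RintegralZl//; last first.
  apply: integrableDr => //; first exact: integrableS iL'.
  by apply: (integrableS measurableT) => //; exact/(integrable_opp (integrable_measurable mT iL')).
by apply: eq_Rint => v _; rewrite /b (addrC v) (addrC (- v)); ring.
Qed.

End PotentialRelation.

(** * The conical function *)

Section PowerSeriesIdentity.
Context (R : realType).
Implicit Types (c : nat -> R) (h r q : R) (H : R -> R).

Lemma geometric_tail_le q m n : 0 <= q <= 2^-1 -> (m <= n)%N ->
  \sum_(m <= k < n) q ^+ k <= 2 * q ^+ m - 2 * q ^+ n.
Proof.
move=> /andP[q0 q1]; elim: n => [|n IH]; first by rewrite leqn0 => /eqP ->; rewrite big_geq// subrr.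
rewrite leq_eqVlt => /orP[/eqP ->|]; first by rewrite big_geq// subrr.
rewrite ltnS => mn; rewrite big_nat_recr//=; have := IH mn.
have : q ^+ n * q <= q ^+ n * 2^-1 by rewrite ler_wpM2l// exprn_ge0.
by rewrite exprSr; lra.
Qed.

(** By strong induction: once all lower coefficients vanish, the term [c j h^j] is balanced by a
    tail of order [h^(j+1)]. Only positive [h] are used, so that vanishing on one side of a point
    suffices. *)
Lemma power_series_eq0 c r : 0 < r ->
  (forall h, 0 < h < r -> series (fun k => c k * h ^+ k) @ \oo --> (0 : R)) ->
  forall k, c k = 0.
Proof.
move=> r0 c0; pose h0 := r / 2.
have h00 : 0 < h0 by rewrite divr_gt0.
have h0r : 0 < h0 < r by rewrite h00 /h0; lra.
(* Convergence at [h0] bounds the terms there, and so bounds them geometrically at smaller [h]. *)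
have [B B0 hB] : exists2 B, 0 <= B & forall k, `|c k| * h0 ^+ k <= B.
  have : cvgn (series (fun k => c k * h0 ^+ k)) by apply/cvg_ex; exists 0; exact: c0.
  move/cvg_series_cvg_0 => cv.
  have : cvgn (fun k => c k * h0 ^+ k) by apply/cvg_ex; exists 0.
  move/cvg_seq_bounded => [M [_ hM]]; exists (`|M| + 1); first by rewrite addr_ge0.
  move=> k; rewrite -{1}(ger0_norm (exprn_ge0 k (ltW h00))) -normrM.
  by apply: (hM (`|M| + 1)) => //; rewrite (le_lt_trans (ler_norm M))// ltrDl.
elim/ltn_ind => j IH.
have bound h : 0 < h <= h0 / 2 -> `|c j| <= 2 * B / h0 ^+ j.+1 * h.
  move=> /andP[hpos hle]; pose q := h / h0.
  have q0 : 0 <= q by rewrite divr_ge0// ltW.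
  have q1 : q <= 2^-1 by rewrite ler_pdivrMr// mulrC.
  have hr : 0 < h < r by rewrite hpos /h0 in hle *; rewrite /h0 in hle; lra.
  have ck k : `|c k * h ^+ k| <= B * q ^+ k.
    rewrite normrM normrX (gtr0_norm hpos).
    have -> : h ^+ k = h0 ^+ k * q ^+ k by rewrite -exprMn /q mulrC divfK ?gt_eqF.
    by rewrite mulrA ler_wpM2r ?exprn_ge0.
  have part n : (j < n)%N -> `|series (fun k => c k * h ^+ k) n - c j * h ^+ j| <= 2 * B * q ^+ j.+1.
    move=> jn; rewrite seriesEnat /= (big_cat_nat (n := j))//=; last exact: ltnW.
    rewrite big_nat big1 ?add0r; last by move=> i /andP[_ ij]; rewrite IH// mul0r.
    rewrite (big_ltn jn) addrAC subrr add0r.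
    apply: (le_trans (ler_norm_sum _ _ _)).
    apply: (le_trans (ler_sum _ (fun k _ => ck k))); rewrite -mulr_sumr.
    have h1 : \sum_(j.+1 <= k < n) q ^+ k <= 2 * q ^+ j.+1.
      apply: (le_trans (geometric_tail_le _ jn)); first by rewrite q0.
      by rewrite gerBl mulr_ge0// exprn_ge0.
    by apply: (le_trans (ler_wpM2l B0 h1)); rewrite mulrCA mulrA.
  have cv : `|series (fun k => c k * h ^+ k) n - c j * h ^+ j| @[n --> \oo] --> `|0 - c j * h ^+ j|.
    by apply: cvg_norm; apply: cvgB; [exact: c0|exact: cvg_cst].
  have := @ler_cvg_to _ _ _ _ _ _ _ _ cv (cvg_cst (2 * B * q ^+ j.+1)).
  have nr : \forall n \near \oo, `|series (fun k => c k * h ^+ k) n - c j * h ^+ j| <= 2 * B * q ^+ j.+1.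
    by exists j.+1 => // n /= jn; exact: part.
  move=> /(_ _ _ nr); rewrite sub0r normrN normrM normrX (gtr0_norm hpos) => le1.
  rewrite -(ler_pM2r (exprn_gt0 j hpos)); apply: (le_trans le1).
  rewrite /q expr_div_n exprS le_eqVlt; apply/orP; left; apply/eqP; field.
  by apply: expf_neq0; rewrite gt_eqF.
apply/eqP; rewrite -normr_eq0; apply/negPn/negP => cj.
have cj0 : 0 < `|c j| by rewrite lt_neqAle eq_sym cj normr_ge0.
set K := 2 * B / h0 ^+ j.+1 in bound.
have K0 : 0 <= K by apply: divr_ge0; [rewrite mulr_ge0|rewrite exprn_ge0// ltW].
(* Small enough for [K h] to stay below the modulus of [c j]. *)
pose h := Num.min (h0 / 2) (`|c j| / (2 * (K + 1))).
have K1 : 0 < K + 1 by rewrite ltr_wpDl.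
have hh : 0 < h <= h0 / 2.
  by rewrite ge_min lexx /= lt_min !divr_gt0// mulr_gt0.
have := bound h hh; apply/negP; rewrite -ltNge.
apply: (@le_lt_trans _ _ (K * (`|c j| / (2 * (K + 1))))).
  by rewrite ler_wpM2l// ge_min lexx orbT.
rewrite mulrA ltr_pdivrMr ?mulr_gt0// mulrC ltr_pM2l//; lra.
Qed.

Definition analytic_lt (b : R) H := forall x, x < b ->
  exists r c, 0 < r /\ forall h, `|h| < r -> series (fun k => c k * h ^+ k) @ \oo --> H (x + h).

(** Continuation to the left. At the infimum [m] of the points from which [H] vanishes up to [x1],
    the expansion vanishes for small positive [h]; all its coefficients are then 0, and [H] vanishes
    also to the left of [m]. *)
Lemma analytic_lt_eq0 H b x0 x1 : analytic_lt b H -> x0 < x1 < b ->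
  (forall x, x0 <= x <= x1 -> H x = 0) -> forall x, x <= x1 -> H x = 0.
Proof.
move=> aH /andP[x01 x1b] H0 y yx1; apply: contrapT => /eqP Hy.
pose S := [set x | x <= x1 /\ forall t, x <= t <= x1 -> H t = 0].
have Sx0 : S x0 by split => //; exact: ltW.
have lbS : lbound S y.
  move=> x [_ Sx]; rewrite leNgt; apply/negP => xy; move: Hy.
  by rewrite Sx ?eqxx// (ltW xy).
have hlb : has_lbound S by exists y.
have hinf : has_inf S by split => //; exists x0.
set m := inf S.
have mx0 : m <= x0 by exact: (ge_inf hlb).
have mx1 : m < x1 := le_lt_trans mx0 x01.
have Hm t : m < t <= x1 -> H t = 0.
  move=> /andP[mt tx1]; have [|e [_ Se] et] := @inf_adherent R S (t - m) _ hinf.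
    by rewrite subr_gt0.
  by apply: Se; rewrite tx1 andbT ltW//; move: et; rewrite -/m addrC subrK.
have [r [c [r0 hc]]] := aH m (lt_trans mx1 x1b).
have c0 k : c k = 0.
  apply: (@power_series_eq0 c (Num.min r (x1 - m))); first by rewrite lt_min r0 subr_gt0.
  move=> h; rewrite lt_min => /and3P[h0 hr hx].
  have <- : H (m + h) = 0 by apply: Hm; rewrite ltrDl h0 /= -lerBrDl ltW.
  by apply: hc; rewrite gtr0_norm.
have Hr h : `|h| < r -> H (m + h) = 0.
  move=> hr; have := hc h hr.
  have -> : (fun k => c k * h ^+ k) = (fun=> 0) by apply/funext => k; rewrite c0 mul0r.
  have -> : series (fun _ : nat => 0 : R) = (fun=> 0).
    by apply/funext => n; rewrite seriesEnat /= big1.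
  move=> h1; have := cvg_unique _ h1 (cvg_cst (0 : R)).
  by apply; exact: Rhausdorff.
have : S (m - r / 2).
  split; first by lra.
  move=> t /andP[t1 t2]; have [tm|tm] := leP t m; last by apply: Hm; rewrite tm.
  have -> : t = m + (t - m) by rewrite addrC subrK.
  by apply: Hr; rewrite ler0_norm ?subr_le0//; lra.
by move/(ge_inf hlb); rewrite -/m; lra.
Qed.

End PowerSeriesIdentity.

(** * The binomial series of (1 - t)^(-1/2) *)

Section BinomialSeries.
Context (R : realType).
Implicit Types (t r : R) (n k : nat).

(** The coefficient (1/2)_k / k! of t^k in (1 - t)^(-1/2). *)
Definition bcoef k : R := \prod_(j < k) ((j%:R + 2^-1) / j.+1%:R).

Lemma bcoef0 : bcoef 0 = 1. Proof. by rewrite /bcoef big_ord0. Qed.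
Lemma bcoefS k : bcoef k.+1 = bcoef k * ((k%:R + 2^-1) / k.+1%:R).
Proof. by rewrite /bcoef big_ord_recr. Qed.

Lemma bcoef_ge0 k : 0 <= bcoef k.
Proof. by apply: prodr_ge0 => j _; rewrite divr_ge0// addr_ge0. Qed.

Lemma bcoef_le1 k : bcoef k <= 1.
Proof.
apply: prodr_ile1 => j _; rewrite divr_ge0 ?addr_ge0//= ler_pdivrMr// mul1r -[j.+1%:R]natr1 lerD2l.
by rewrite invf_le1// ler1n.
Qed.

Let S n t := \sum_(0 <= k < n) bcoef k * t ^+ k.

(** The recursion of the coefficients makes the derivative telescope to a single term, which
    controls the distance of the product from its value 1 at t = 0. *)
Let dS n t : t < 1 -> is_derive (t : R) (1 : R) (fun t => Num.sqrt (1 - t) * S n.+1 t)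
  (- (n.+1%:R * bcoef n.+1 * t ^+ n / Num.sqrt (1 - t))).
Proof.
move=> t1; have t0 : 0 < 1 - t by rewrite subr_gt0.
have q0 : Num.sqrt (1 - t) != 0 by rewrite gt_eqF ?sqrtr_gt0.
have q2 : Num.sqrt (1 - t) ^+ 2 = 1 - t by rewrite sqr_sqrtr// ltW.
have dq : is_derive (t : R) (1 : R) (fun t => Num.sqrt (1 - t)) (- (2 * Num.sqrt (1 - t))^-1).
  by derive_by; [der|field; rewrite q0].
elim: n => [|n IH].
  apply: (@der_eqfun _ _ (fun t => Num.sqrt (1 - t))).
    by move=> y; rewrite /S big_nat1 bcoef0 !mul1r expr0 mulr1.
  by derive_by; [exact: dq|rewrite bcoefS bcoef0 expr0; field; rewrite q0].
apply: (@der_eqfun _ _ (fun t => Num.sqrt (1 - t) * S n.+1 t + Num.sqrt (1 - t) * (bcoef n.+1 * t ^+ n.+1))).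
  by move=> y; rewrite /S [in RHS]big_nat_recr//= mulrDr.
derive_by; first by notypeclasses refine (derD IH _); der.
rewrite /= (bcoefS n.+1) exprS; set b := bcoef n.+1; set q := Num.sqrt (1 - t) in q0 q2 *.
have n0 : n.+2%:R != 0 :> R by rewrite pnatr_eq0.
have -> : t = 1 - q ^+ 2 by rewrite q2; ring.
rewrite -[n.+2%:R]natr1 in n0 *; set z := n.+1%:R in n0 *; clearbody z.
by field; rewrite q0 n0.
Qed.

Let S0 n : S n.+1 0 = 1.
Proof.
rewrite /S big_nat_recl//= bcoef0 expr0 mulr1 big1 ?addr0// => i _.
by rewrite expr0n /= mulr0.
Qed.

(** For nonnegative t the derivative in [dS] is at most 0, so the product starts at 1 and decreases.
    The bound is uniform in [n] and provides the majorant for termwise integration. *)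
Lemma binomial_sum_le n t : 0 <= t < 1 -> S n t <= (Num.sqrt (1 - t))^-1.
Proof.
move=> /andP[t0 t1]; have q0 : 0 < Num.sqrt (1 - t) by rewrite sqrtr_gt0 subr_gt0.
have : S n t <= S n.+1 t.
  by rewrite /S big_nat_recr//= lerDl mulr_ge0 ?bcoef_ge0 ?exprn_ge0.
move/le_trans; apply; rewrite -(ler_pM2l q0) mulfV ?gt_eqF//.
have h := @der_ge0_le R (fun t => - (Num.sqrt (1 - t) * S n.+1 t))
  (fun t => n.+1%:R * bcoef n.+1 * t ^+ n / Num.sqrt (1 - t)) 0 t t0.
rewrite -lerN2; have -> : - 1 = - (Num.sqrt (1 - 0) * S n.+1 0) :> R.
  by rewrite S0 subr0 sqrtr1 mulr1.
apply: h => x /andP[x0 xt].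
  by derive_by; [notypeclasses refine (derN (dS n _)); exact: le_lt_trans t1|rewrite opprK].
by rewrite !mulr_ge0 ?invr_ge0 ?sqrtr_ge0 ?bcoef_ge0 ?exprn_ge0// ltW.
Qed.

(** [n r^n] is at most 1 + r + ... + r^(n-1). *)
Lemma natr_expn_le n r : 0 <= r <= 1 -> n%:R * r ^+ n * (1 - r) <= 1 - r ^+ n.
Proof.
move=> /andP[r0 r1]; elim: n => [|n IH]; first by rewrite !mul0r expr0 subrr.
have a1 : r * (n%:R * r ^+ n * (1 - r)) <= r * (1 - r ^+ n) by rewrite ler_wpM2l.
have a2 : 0 <= (1 - r) * (1 - r * r ^+ n).
  by rewrite mulr_ge0 ?subr_ge0// -exprS exprn_ile1.
rewrite -natr1 exprS; move: a1 a2; set x := r ^+ n; set y := n%:R; nra.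
Qed.

Lemma cvg_natr_expn t : 0 <= t < 1 -> n%:R * t ^+ n @[n --> \oo] --> (0 : R).
Proof.
(* With t^n = r^n r^n, one factor absorbs [n] and the other tends to 0. *)
move=> /andP[t0 t1]; pose r := Num.sqrt t.
have r0 : 0 <= r by exact: sqrtr_ge0.
have r1 : r < 1 by rewrite /r -sqrtr1 ltr_sqrt.
have cg : (1 - r)^-1 * r ^+ n @[n --> \oo] --> (0 : R).
  by apply: cvg_geometric; rewrite ger0_norm.
apply: (@squeeze_cvgr _ _ _ _ (fun=> 0) (fun n => (1 - r)^-1 * r ^+ n)) => //; last exact: cvg_cst.
apply: nearW => n; rewrite mulr_ge0 ?exprn_ge0//=.
have -> : t ^+ n = r ^+ n * r ^+ n by rewrite -exprMn -expr2 sqr_sqrtr.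
rewrite mulrA ler_wpM2r ?exprn_ge0// -[X in _ <= X]mul1r ler_pdivlMr ?subr_gt0//.
apply: (le_trans (natr_expn_le _ _)); first by rewrite r0 ltW.
by rewrite gerBl exprn_ge0.
Qed.

(** By the mean value theorem and [dS], the product of [sqrt (1 - t)] and the partial sum differs
    from 1 by at most a constant times [n |t|^n]. *)
Lemma binomial_series t : `|t| < 1 ->
  series (fun k => bcoef k * t ^+ k) @ \oo --> (Num.sqrt (1 - t))^-1.
Proof.
move=> tt; have t1 : t < 1 := le_lt_trans (ler_norm t) tt.
have q0 : 0 < Num.sqrt (1 - t) by rewrite sqrtr_gt0 subr_gt0.
have p0 : 0 < Num.sqrt (1 - `|t|) by rewrite sqrtr_gt0 subr_gt0.
have bd n : `|Num.sqrt (1 - t) * S n.+1 t - 1| <= (Num.sqrt (1 - `|t|))^-1 * (n.+1%:R * `|t| ^+ n.+1).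
  pose f := fun t => Num.sqrt (1 - t) * S n.+1 t.
  have f0 : f 0 = 1 by rewrite /f S0 subr0 sqrtr1 mulr1.
  have fx x : `|x| <= `|t| -> `|- (n.+1%:R * bcoef n.+1 * x ^+ n / Num.sqrt (1 - x))| <=
      (Num.sqrt (1 - `|t|))^-1 * (n.+1%:R * `|t| ^+ n).
    move=> xt; have x1 : x < 1 := le_lt_trans (ler_norm x) (le_lt_trans xt tt).
    have s0 : 0 < Num.sqrt (1 - x) by rewrite sqrtr_gt0 subr_gt0.
    rewrite normrN !normrM normfV (gtr0_norm s0) normrX (ger0_norm (bcoef_ge0 _)) normr_nat mulrC.
    apply: ler_pM; rewrite ?invr_ge0 ?(ltW s0) ?mulr_ge0 ?bcoef_ge0 ?exprn_ge0//.
      rewrite lef_pV2 ?posrE// ler_wsqrtr// lerD2l lerN2.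
      exact: le_trans (ler_norm x) xt.
    rewrite -mulrA ler_wpM2l//; apply: (@le_trans _ _ (`|x| ^+ n)).
      by rewrite ler_piMl ?exprn_ge0 ?bcoef_le1.
    by rewrite lerXn2r ?nnegrE.
  have [t0|t0] := leP 0 t.
    have h := @der_norm_le R f _ 0 t ((Num.sqrt (1 - `|t|))^-1 * (n.+1%:R * `|t| ^+ n)) t0
      (fun x xt => dS n (le_lt_trans (proj2 (andP xt)) t1)).
    rewrite -{2}f0; apply: (le_trans (h _)).
      by move=> x /andP[x0 xt]; apply: fx; rewrite !ger0_norm// ltW.
    by rewrite subr0 (ger0_norm t0) exprSr !mulrA.
  have h := @der_norm_le R f _ t 0 ((Num.sqrt (1 - `|t|))^-1 * (n.+1%:R * `|t| ^+ n)) (ltW t0)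
    (fun x xt => dS n (le_lt_trans (proj2 (andP xt)) ltr01)).
  rewrite -{2}f0 distrC; apply: (le_trans (h _)).
    by move=> x /andP[x0 xt]; apply: fx; rewrite !ltr0_norm// lerN2 ltW.
  by rewrite sub0r (ltr0_norm t0) exprSr !mulrA.
have c1 : Num.sqrt (1 - t) * S n.+1 t @[n --> \oo] --> (1 : R).
  apply/subr_cvg0; apply: norm_cvg0.
  apply: (@squeeze_cvgr _ _ _ _ (fun=> 0) (fun n => (Num.sqrt (1 - `|t|))^-1 * (n.+1%:R * `|t| ^+ n.+1))).
  - by apply: nearW => n; rewrite normr_ge0 bd.
  - exact: cvg_cst.
  rewrite -[X in _ --> X](mulr0 (Num.sqrt (1 - `|t|))^-1); apply: cvgM; first exact: cvg_cst.
  have := @cvg_natr_expn `|t|; rewrite normr_ge0 tt => /(_ isT).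
  by rewrite -(@cvg_shiftS _ (fun n => n%:R * `|t| ^+ n)).
have c2 : (Num.sqrt (1 - t))^-1 * (Num.sqrt (1 - t) * S n.+1 t) @[n --> \oo] --> (Num.sqrt (1 - t))^-1 * 1.
  by apply: cvgM; [exact: cvg_cst|exact: c1].
rewrite mulr1 in c2; rewrite -cvg_shiftS; apply: cvg_trans c2; apply: near_eq_cvg.
by apply: nearW => n; rewrite /= seriesEnat /S mulKf ?gt_eqF.
Qed.

End BinomialSeries.

(** * An integral proportional to the conical function *)

Section ConicalIntegral.
Context (R : realType).
Local Notation leb := (@lebesgue_measure R).
Variable s : R.
Implicit Types (x h u : R) (k n : nat).

Definition conical_integral x : R := \int[leb]_u (cos (s * u) / Num.sqrt (ch u ^+ 2 - x)).

Let I := conical_integral.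

Let ch2_gt0 x u : x < 1 -> 0 < ch u ^+ 2 - x.
Proof.
move=> x1; have : 1 <= ch u ^+ 2 by rewrite -(expr1n _ 2) lerXn2r ?nnegrE ?ch_ge1// ltW ?ch_gt0.
by lra.
Qed.

Let invsqrt_le x u : x < 1 ->
  (Num.sqrt (ch u ^+ 2 - x))^-1 <= (Num.sqrt (1 - Num.max x 0))^-1 * (ch u)^-1.
Proof.
move=> x1; set y := Num.max x 0.
have y1 : 0 < 1 - y by rewrite subr_gt0 gt_max x1 ltr01.
have c0 := ch_gt0 u.
rewrite -invfM lef_pV2 ?posrE ?mulr_gt0 ?sqrtr_gt0 ?ch2_gt0//.
rewrite -[X in _ * X]gtr0_norm// -sqrtr_sqr -sqrtrM ?(ltW y1)// ler_wsqrtr//.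
have c1 : 1 <= ch u ^+ 2 by rewrite -(expr1n _ 2) lerXn2r ?nnegrE ?ch_ge1// ltW.
have y0 : 0 <= y by rewrite le_max lexx orbT.
have xy : x <= y by rewrite le_max lexx.
have : y * 1 <= y * ch u ^+ 2 by rewrite ler_wpM2l.
by rewrite mulrBl mul1r; lra.
Qed.

Let mintegrand (f : R -> R) : measurable_fun setT f -> measurable_fun setT (fun u => cos (s * u) * f u).
Proof. by move=> mf; ms'. Qed.

Let idom x : x < 1 -> intg leb setT (fun u => (Num.sqrt (ch u ^+ 2 - x))^-1).
Proof.
move=> x1; have i1 : intg leb setT (fun u => (Num.sqrt (1 - Num.max x 0))^-1 * (ch u)^-1).
  by apply: integrableZr => //; exact: invch_integrable.
apply: (integrable_le _ _ _ i1) => //; first by ms'.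
by move=> u _; rewrite ger0_norm ?invr_ge0 ?sqrtr_ge0// invsqrt_le.
Qed.

Let term x k u := cos (s * u) / Num.sqrt (ch u ^+ 2 - x) * ((ch u ^+ 2 - x)^-1) ^+ k.

Let mterm x k : measurable_fun setT (term x k).
Proof. by rewrite /term; ms'. Qed.

Let iterm x k : x < 1 -> intg leb setT (term x k).
Proof.
move=> x1; have x0 : 0 < 1 - x by rewrite subr_gt0.
apply: (integrable_le _ _ _ (integrableZr (((1 - x)^-1) ^+ k) measurableT (idom x1))) => //.
  exact: mterm.
move=> u _; have D0 := ch2_gt0 u x1; rewrite /term !normrM mulrC.
rewrite (ger0_norm (exprn_ge0 _ _)) ?invr_ge0 ?(ltW D0)//.
apply: ler_pM => //; rewrite ?exprn_ge0 ?invr_ge0 ?(ltW D0)//.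
  rewrite lerXn2r ?nnegrE ?invr_ge0 ?(ltW D0) ?(ltW x0)// lef_pV2 ?posrE// lerD2r.
  by rewrite -(expr1n _ 2) lerXn2r ?nnegrE ?ch_ge1// ltW ?ch_gt0.
by rewrite (ger0_norm (_ : 0 <= (Num.sqrt _)^-1)) ?invr_ge0 ?sqrtr_ge0// ler_piMl ?cos_max// invr_ge0 sqrtr_ge0.
Qed.

Definition conical_coef x k : R := bcoef R k * \int[leb]_u (term x k u).

(** Binomial expansion of (ch^2 u - x - h)^(-1/2) in powers of h / (ch^2 u - x), integrated term by
    term. The radius is 1 - x because ch^2 u >= 1, and the partial sums are dominated by the full
    sum at |h|. *)
Lemma conical_integral_series x h : x < 1 -> `|h| < 1 - x ->
  series (fun k => conical_coef x k * h ^+ k) @ \oo --> conical_integral (x + h).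
Proof.
move=> x1 hx; have xh : x + h < 1 by have := ler_norm h; lra.
have xh' : x + `|h| < 1 by lra.
have hD u : `|h / (ch u ^+ 2 - x)| < 1.
  have D0 := ch2_gt0 u x1; rewrite normrM normfV (gtr0_norm D0) ltr_pdivrMr// mul1r.
  by have := ch2_gt0 u xh'; lra.
have hD' u : 0 <= `|h| / (ch u ^+ 2 - x) < 1.
  have D0 := ch2_gt0 u x1; rewrite divr_ge0 ?(ltW D0)//= ltr_pdivrMr// mul1r.
  by have := ch2_gt0 u xh'; lra.
pose f n u := cos (s * u) / Num.sqrt (ch u ^+ 2 - x) * series (fun k => bcoef R k * (h / (ch u ^+ 2 - x)) ^+ k) n.
have fS n u : f n.+1 u = f n u + bcoef R n * h ^+ n * term x n u.
  by rewrite /f seriesS /term exprMn; ring.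
have f0 u : f 0%N u = 0 by rewrite /f /series /= big_geq// mulr0.
have fi n : intg leb setT (f n) /\
    \int[leb]_u f n u = series (fun k => conical_coef x k * h ^+ k) n.
  elim: n => [|n [IH1 IH2]].
    split.
      have -> : f 0%N = (fun=> 0) by apply/funext.
      apply: (integrable_le _ _ _ (@invch_integrable R)) => // u _.
      by rewrite normr0 invr_ge0 ltW ?ch_gt0.
    rewrite /series /= big_geq//; transitivity (\int[leb]_(x in setT) (0 : R)).
      by apply: eq_Rint => u _; exact: f0.
    by rewrite Rintegral_cst ?mul0r.
  have i1 : intg leb setT (fun u => bcoef R n * h ^+ n * term x n u).
    by apply: integrableZr => //; exact: iterm.
  split.
    by apply: (integrable_eq measurableT _ (integrableDr measurableT IH1 i1)) => u _; rewrite fS.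
  rewrite seriesS -IH2 addrC /conical_coef.
  have -> : bcoef R n * \int[leb]_u term x n u * h ^+ n = \int[leb]_u (bcoef R n * h ^+ n * term x n u).
    by rewrite RintegralZl//; [ring|exact: iterm].
  by rewrite -RintegralD//; apply: eq_Rint => u _; rewrite fS.
have mf n : measurable_fun setT (f n) by apply: integrable_measurable (proj1 (fi n)).
have mT : measurable [set: measurableTypeR R] by exact: measurableT.
have fcv (u : measurableTypeR R) : setT u -> f n u @[n --> \oo] --> cos (s * u) / Num.sqrt (ch u ^+ 2 - (x + h)).
  move=> _; have D0 := ch2_gt0 u x1; have D1 := ch2_gt0 u xh.
  have E : Num.sqrt (ch u ^+ 2 - (x + h)) = Num.sqrt (ch u ^+ 2 - x) * Num.sqrt (1 - h / (ch u ^+ 2 - x)).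
    rewrite -sqrtrM ?(ltW D0)//; congr Num.sqrt; field; exact: lt0r_neq0.
  rewrite E invfM mulrA; apply: cvgM; first exact: cvg_cst.
  exact: binomial_series.
have fb n (u : measurableTypeR R) : setT u -> `|f n u| <= (Num.sqrt (ch u ^+ 2 - (x + `|h|)))^-1.
  move=> _; have D0 := ch2_gt0 u x1; have D1 := ch2_gt0 u xh'.
  have E : Num.sqrt (ch u ^+ 2 - (x + `|h|)) = Num.sqrt (ch u ^+ 2 - x) * Num.sqrt (1 - `|h| / (ch u ^+ 2 - x)).
    rewrite -sqrtrM ?(ltW D0)//; congr Num.sqrt; field; exact: lt0r_neq0.
  rewrite E invfM /f normrM; apply: ler_pM => //.
    rewrite normrM (ger0_norm (_ : 0 <= (Num.sqrt _)^-1)) ?invr_ge0 ?sqrtr_ge0//.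
    by rewrite ler_piMl ?cos_max// invr_ge0 sqrtr_ge0.
  apply: le_trans (binomial_sum_le n (hD' u)).
  rewrite seriesEnat /=; apply: (le_trans (ler_norm_sum _ _ _)); apply: ler_sum => k _.
  rewrite normrM normrX normrM normfV (gtr0_norm D0) (ger0_norm (bcoef_ge0 _ _))//.
have [_] := dominated_cvg_Rintegral mT mf fcv (idom xh') fb.
by apply: cvg_trans; apply: near_eq_cvg; apply: nearW => n; exact: (proj2 (fi n)).
Qed.

Let M k := \int[leb]_u (cos (s * u) * ((ch u)^-1) ^+ (2 * k).+1).

Let coefM k : conical_coef 0 k = bcoef R k * M k.
Proof.
congr (_ * _); apply: eq_Rint => u _; rewrite /term subr0 sqrtr_sqr gtr0_norm ?ch_gt0//.
by rewrite [in RHS]exprS [in RHS]exprM [in RHS](exprVn (ch u)) mulrA.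
Qed.

Let invch_pow_le n u : `|((ch u)^-1) ^+ n.+1| <= (ch u)^-1.
Proof.
have c0 : 0 < (ch u)^-1 by rewrite invr_gt0 ch_gt0.
rewrite ger0_norm ?exprn_ge0 ?(ltW c0)// exprS ler_piMr ?(ltW c0)// exprn_ile1 ?(ltW c0)//.
by rewrite invf_le1 ?ch_gt0// ch_ge1.
Qed.

Let iM n : intg leb setT (fun u => cos (s * u) * ((ch u)^-1) ^+ n.+1).
Proof.
apply: (integrable_le _ _ _ (@invch_integrable R)) => //; first by ms'.
move=> u _; rewrite normrM; apply: le_trans (invch_pow_le n u).
by rewrite ler_piMl ?cos_max.
Qed.

Let N q := \int[leb]_u (cos (s * u) * ((ch u)^-1) ^+ q.+1).

(** With [g] a power of [1 / ch], the function [F = g' cos (s u) + s g sin (s u)] has derivative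
    [(g'' + s^2 g) cos (s u)] and tends to 0 at both ends; [g''] is a combination of two such
    powers. *)
Let Nrec q : q.+1%:R / 2 * (q.+2%:R / 2) * N q.+2 = ((q.+1%:R / 2) ^+ 2 + s ^+ 2) * N q.
Proof.
pose g (u : R) := (ch u)^-1 ^+ q.+1.
pose dg (u : R) := - (q.+1%:R / 2) * (sh u * (ch u)^-1 ^+ q.+2).
have q1 : q.+1%:R = q%:R + 1 :> R by rewrite natr1.
have q2 : q.+2%:R = q%:R + 2 :> R by rewrite -2!natr1; ring.
have dgE u : is_derive (u : R) (1 : R) g (dg u).
  have dch := der_ch1 u; have c0 := ch_neq0 u; rewrite /g /dg.
  by derive_by; [der|cbv beta; rewrite !(exprS (ch u)^-1); field].
have ddg u : is_derive (u : R) (1 : R) dg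
    (((q.+1%:R / 2) ^+ 2) * (ch u)^-1 ^+ q.+1 - q.+1%:R / 2 * (q.+2%:R / 2) * (ch u)^-1 ^+ q.+3).
  have dch := der_ch1 u; have dsh := der_sh1 u; have c0 := ch_neq0 u; rewrite /dg.
  derive_by; first by der.
  cbv beta; rewrite !(exprS (ch u)^-1).
  have e1 := chE u; set z := ((ch u)^-1) ^+ q; set c := ch u in c0 e1 *; set S := sh u in e1 *.
  clearbody z c S.
  have e2 : S ^+ 2 = c ^+ 2 - 1 by rewrite e1; ring.
  transitivity (q.+1%:R / 2 * (q.+2%:R / 2 * S ^+ 2 / c ^+ 3 * z - z / 2 / c)).
    by rewrite q1 q2; field.
  by rewrite e2 q1 q2; field.
pose F (u : R) := cos (s * u) * dg u + s * sin (s * u) * g u.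
pose f (u : R) := ((q.+1%:R / 2) ^+ 2 + s ^+ 2) * (cos (s * u) * (ch u)^-1 ^+ q.+1)
  - q.+1%:R / 2 * (q.+2%:R / 2) * (cos (s * u) * (ch u)^-1 ^+ q.+3).
have dF u : is_derive (u : R) (1 : R) F (f u).
  have d1 := dgE u; have d2 := ddg u.
  have -> : F = fun u => cos (s * u) * dg u + s * sin (s * u) * g u by [].
  derive_by; first by der.
  by cbv beta; rewrite /f /g; set z := dg u; clearbody z; ring.
have ifs : intg leb setT f.
  by apply: integrableBr => //; apply: integrableZr => //; exact: iM.
have cF : continuous f.
  move=> u; have dch := der_ch1 u; have c0 := ch_neq0 u.
  by rewrite /f; apply: der_continuous; der.
have shc u : `|sh u * (ch u)^-1| <= 1.
  rewrite normrM normfV (gtr0_norm (ch_gt0 u)) ler_pdivrMr ?ch_gt0// mul1r ltW//.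
  exact: sh_lt_ch.
have Fb u : `|F u| <= (q.+1%:R / 2 + `|s|) * (ch u)^-1.
  rewrite mulrDl; apply: (le_trans (ler_normD _ _)); apply: lerD.
    apply: (@le_trans _ _ `|dg u|); first by rewrite normrM ler_piMl ?cos_max.
    have q0 : 0 <= q.+1%:R / 2 :> R by rewrite divr_ge0.
    rewrite /dg normrM normrN (ger0_norm q0); apply: (ler_wpM2l q0).
    rewrite exprS mulrA normrM.
    by apply: le_trans (invch_pow_le q u); rewrite ler_piMl.
  rewrite -mulrA normrM ler_wpM2l// normrM.
  by apply: le_trans (invch_pow_le q u); rewrite ler_piMl ?sin_max.
have Fy : F u @[u --> +oo] --> (0 : R).
  apply: (@cvgr_pinfty0_sqrtsh _ _ (q.+1%:R / 2 + `|s|)) => v v0; apply: (le_trans (Fb v)).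
  rewrite ler_wpM2l ?addr_ge0 ?divr_ge0// lef_pV2 ?posrE ?sqrtr_gt0 ?ch_gt0 ?sh_gt0//.
  rewrite -[X in _ <= X]gtr0_norm ?ch_gt0// -sqrtr_sqr ler_wsqrtr// expr2.
  have := sh_lt_ch v; rewrite (gtr0_norm (sh_gt0 v0)) => /ltW/le_trans; apply.
  by rewrite ler_peMr ?ch_ge1// ltW ?ch_gt0.
have FN u : F (- u) = - F u.
  by rewrite /F /dg /g mulrN cosN sinN shN chN; ring.
have FNy : F u @[u --> -oo] --> (- 0 : R).
  apply/cvgNy_compNP; have -> : F \o -%R = (fun v => - F v) by apply/funext => v /=; exact: FN.
  exact: cvgN.
have := Rintegral_line_FTC dF cF ifs Fy FNy.
rewrite opprK addr0 /f RintegralB//; first last.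
- by apply: integrableZr => //; exact: iM.
- by apply: integrableZr => //; exact: iM.
rewrite (RintegralZl _ measurableT (iM q)) (RintegralZl _ measurableT (iM q.+2)).
by move/eqP; rewrite subr_eq0 => /eqP ->.
Qed.

Let Mrec k : (k%:R + 2^-1) * k.+1%:R * M k.+1 = ((k%:R + 2^-1) ^+ 2 + s ^+ 2) * M k.
Proof.
have e1 : (2 * k).+1%:R / 2 = k%:R + 2^-1 :> R by rewrite -natr1 natrM; field.
have e2 : (2 * k).+2%:R / 2 = k.+1%:R :> R by rewrite -[k.+1%:R]natr1 -2!natr1 natrM; field.
by have := Nrec (2 * k); rewrite e1 e2 /M mulnS.
Qed.

(** The recursion of the moments and that of [bcoef] combine to the ratio ((k + 1/2)^2 + s^2) / (k +
    1)^2 of consecutive coefficients, which is that of the Gauss series with parameters 1/2 + is,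
    1/2 - is and 1. *)
Lemma conical_coef0E k : conical_coef 0 k * k`!%:R ^+ 2 =
  (\prod_(j < k) ((j%:R + 2^-1) ^+ 2 + s ^+ 2)) * conical_integral 0.
Proof.
elim: k => [|k IH].
  rewrite big_ord0 mul1r fact0 expr1n mulr1 coefM bcoef0 mul1r.
  by apply: eq_Rint => u _; rewrite subr0 sqrtr_sqr gtr0_norm ?ch_gt0// muln0 expr1.
rewrite big_ord_recr /= [RHS]mulrAC -IH !coefM bcoefS factS natrM.
have := Mrec k; set m := k.+1%:R; set m1 := M k.+1; set m0 := M k => h.
have m0' : m != 0 by rewrite pnatr_eq0.
transitivity (bcoef R k * k`!%:R ^+ 2 * ((k%:R + 2^-1) * m * m1)); first by field.
by rewrite h; ring.
Qed.

End ConicalIntegral.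

(** * Zeros of the conical function as vanishing cosine integrals *)

Section ConicalZero.
Local Open Scope complex_scope.
Context (R : realType).
Local Notation leb := (@lebesgue_measure R).
Implicit Types (F : R -> R[i]) (x s eta : R).

Lemma Re_mul_realX (z : R[i]) (h : R) k : complex.Re (z * h%:C ^+ k) = complex.Re z * h ^+ k.
Proof. by rewrite -rmorphXn /=; case: z => a b /=; rewrite mulr0 subr0. Qed.

Lemma Im_mul_realX (z : R[i]) (h : R) k : complex.Im (z * h%:C ^+ k) = complex.Im z * h ^+ k.
Proof. by rewrite -rmorphXn /=; case: z => a b /=; rewrite mulr0 add0r. Qed.

Lemma analytic_below1_Re F : analytic_below1 F -> analytic_lt 1 (fun x => complex.Re (F x)).
Proof.
move=> aF x /aF[r [u [r0 hu]]]; exists r, (fun k => complex.Re (u k)); split=> // h /hu[h1 _].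
by move: h1; under eq_fun do rewrite Re_mul_realX.
Qed.

Lemma analytic_below1_Im F : analytic_below1 F -> analytic_lt 1 (fun x => complex.Im (F x)).
Proof.
move=> aF x /aF[r [u [r0 hu]]]; exists r, (fun k => complex.Im (u k)); split=> // h /hu[_ h1].
by move: h1; under eq_fun do rewrite Im_mul_realX.
Qed.

Lemma analytic_ltB (b : R) (H1 H2 : R -> R) : analytic_lt b H1 -> analytic_lt b H2 ->
  analytic_lt b (fun x => H1 x - H2 x).
Proof.
move=> a1 a2 x xb; have [r1 [c1 [r10 h1]]] := a1 x xb; have [r2 [c2 [r20 h2]]] := a2 x xb.
exists (Num.min r1 r2), (fun k => c1 k - c2 k); split; first by rewrite lt_min r10.
move=> h; rewrite lt_min => /andP[hr1 hr2].
have -> : series (fun k => (c1 k - c2 k) * h ^+ k) =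
    (fun n => series (fun k => c1 k * h ^+ k) n - series (fun k => c2 k * h ^+ k) n).
  apply/funext => n; rewrite !seriesEnat /= -sumrB; apply: eq_bigr => k _.
  by rewrite mulrBl.
by apply: cvgB; [exact: h1|exact: h2].
Qed.

(** Both functions are the sum of the same series near 0; analyticity carries the equality of real
    parts and of imaginary parts to the left. *)
Lemma gauss_continuation_unique (a b c : R[i]) F1 F2 x : gauss_continuation a b c F1 ->
  gauss_continuation a b c F2 -> x < 1 -> F1 x = F2 x.
Proof.
move=> [aF1 g1] [aF2 g2] x1.
have eq0 y : `|y| < 1 -> F1 y = F2 y.
  move=> y1; have [u1 v1] := g1 y y1; have [u2 v2] := g2 y y1.
  have e1 := cvg_unique (@Rhausdorff R) u1 u2.
  have e2 := cvg_unique (@Rhausdorff R) v1 v2.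
  by apply/eqP; rewrite eq_complex; apply/andP; split; apply/eqP; [exact: e1|exact: e2].
have b1 : ((- (2^-1 : R) < 2^-1) && ((2^-1 : R) < 1))%R by apply/andP; split; lra.
have inI (y : R) : -2^-1 <= y <= 2^-1 -> `|y| < 1.
  by move=> /andP[y1 y2]; rewrite ltr_norml; apply/andP; split; lra.
have [xh|xh] := leP x 2^-1; last by apply: eq0; rewrite gtr0_norm//; lra.
apply/eqP; rewrite eq_complex -subr_eq0 -[X in _ && X]subr_eq0; apply/andP; split; apply/eqP.
  apply: (analytic_lt_eq0 (analytic_ltB (analytic_below1_Re aF1) (analytic_below1_Re aF2)) b1) => //.
  by move=> y /inI/eq0 ->; rewrite subrr.
apply: (analytic_lt_eq0 (analytic_ltB (analytic_below1_Im aF1) (analytic_below1_Im aF2)) b1) => //.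
by move=> y /inI/eq0 ->; rewrite subrr.
Qed.

Lemma pochhammer1 k : pochhammer (1 : R[i]) k = k`!%:R.
Proof.
elim: k => [|k IH]; first by rewrite /pochhammer big_ord0.
by rewrite /pochhammer big_ord_recr -/(pochhammer _ _) IH /= factS mulnC natrM -natr1 addrC.
Qed.

Lemma pochhammer_conj s k : pochhammer (2^-1 +i* s) k * pochhammer (2^-1 -i* s) k =
  (\prod_(j < k) ((j%:R + 2^-1) ^+ 2 + s ^+ 2))%:C.
Proof.
rewrite /pochhammer -big_split /= rmorph_prod; apply: eq_bigr => j _.
rewrite -(rmorph_nat (real_complex R)) /=; apply/eqP; rewrite eq_complex /=.
by apply/andP; split; apply/eqP; ring.
Qed.

Lemma conical_gauss_term s x k : conical_integral s 0 != 0 ->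
  gauss_term (2^-1 +i* s) (2^-1 -i* s) 1 x k =
  (conical_coef s 0 k / conical_integral s 0 * x ^+ k)%:C.
Proof.
move=> I0; rewrite /gauss_term pochhammer_conj pochhammer1.
have f0 : k`!%:R != 0 :> R by rewrite pnatr_eq0 -lt0n fact_gt0.
rewrite -natrM -(rmorph_nat (real_complex R)) -rmorphXn -fmorphV -!rmorphM /=; congr (_%:C).
congr (_ * _); rewrite natrM.
have := conical_coef0E s k; set p := \prod_(j < k) _ => h.
have -> : p = conical_coef s 0 k * k`!%:R ^+ 2 / conical_integral s 0 by rewrite h mulfK.
by field; rewrite I0.
Qed.

Lemma conical_continuation s : conical_integral s 0 != 0 ->
  gauss_continuation (2^-1 +i* s) (2^-1 -i* s) 1
    (fun x => (conical_integral s x / conical_integral s 0)%:C).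
Proof.
move=> I0; have cs x h : x < 1 -> `|h| < 1 - x ->
    csums (fun k => (conical_coef s x k / conical_integral s 0)%:C * h%:C ^+ k)
      (conical_integral s (x + h) / conical_integral s 0)%:C.
  move=> x1 hx; split; last first.
    under eq_fun do rewrite Im_mul_realX /= mul0r.
    by rewrite seriesEnat /=; under eq_fun do rewrite big1//; exact: cvg_cst.
  have c1 := @conical_integral_series R s x h x1 hx.
  have c2 : series (fun k => conical_coef s x k * h ^+ k) n / conical_integral s 0 @[n --> \oo] -->
    conical_integral s (x + h) / conical_integral s 0.
    by apply: cvgM; [exact: c1|exact: cvg_cst].
  apply: cvg_trans c2; apply: near_eq_cvg; apply: nearW => n.
  rewrite !seriesEnat /= mulr_suml; apply: eq_bigr => k _; rewrite Re_mul_realX /=.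
  by rewrite mulrAC.
split=> [x x1|x x1].
  exists (1 - x), (fun k => (conical_coef s x k / conical_integral s 0)%:C).
  by split; [rewrite subr_gt0|move=> h; exact: cs].
have := cs 0 x ltr01; rewrite subr0 add0r => /(_ x1).
congr csums; apply/funext => k.
by rewrite conical_gauss_term// -rmorphXn -rmorphM.
Qed.

Lemma conicalP_integral_eq0 s eta : 0 < eta < 1 ->
  conicalP s ((1 + eta) / (1 - eta)) = 0 -> conical_integral s (- (eta / (1 - eta))) = 0.
Proof.
move=> /andP[e0 e1]; have e1' : 0 < 1 - eta by rewrite subr_gt0.
have z1 : - (eta / (1 - eta)) < 1.
  by rewrite (lt_trans _ ltr01)// oppr_lt0 divr_gt0.
have -> : conicalP s ((1 + eta) / (1 - eta)) =
    hyp2F1 (2^-1 +i* s) (2^-1 -i* s) 1 (- (eta / (1 - eta))).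
  by rewrite /conicalP; congr hyp2F1; field; rewrite gt_eqF.
rewrite /hyp2F1; set z := - (eta / (1 - eta)) in z1 *.
(* Proportionality to the Gauss series determines the continuation only if the value at 0 is
   nonzero. If it is 0, [conical_coef0E] makes every Taylor coefficient at 0 vanish, and the
   integral is 0 everywhere below 1. *)
have [I0|I0] := eqVneq (conical_integral s 0) 0; last first.
  have F0 := conical_continuation I0.
  (* Existence of a continuation ensures that [xget] does not return its default value 0. *)
  set S := (X in xget _ X); have ex : exists w, S w by eexists; eexists; split; [exact: F0|].
  have [F [gF Fz]] := xgetPex 0 ex; rewrite -Fz (gauss_continuation_unique gF F0 z1).
  by move/eqP; rewrite eq_complex /= eqxx andbT mulf_eq0 invr_eq0 (negbTE I0) orbF => /eqP.
move=> _; have z0 : z <= 0 by rewrite /z oppr_le0 divr_ge0 ?(ltW e0) ?(ltW e1').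
have a1 : analytic_lt 1 (conical_integral s).
  move=> x x1; exists (1 - x), (conical_coef s x); split; first by rewrite subr_gt0.
  by move=> h; exact: conical_integral_series.
have coef0 k : conical_coef s 0 k = 0.
  have f0 : k`!%:R != 0 :> R by rewrite pnatr_eq0 -lt0n fact_gt0.
  have := conical_coef0E s k; rewrite I0 mulr0 => /eqP.
  by rewrite mulf_eq0 expf_eq0 (negbTE f0) andbF orbF => /eqP.
have b1 : ((- (2^-1 : R) < 0) && ((0 : R) < 1))%R by apply/andP; split; lra.
apply: (analytic_lt_eq0 a1 b1) z0 => x /andP[x0 x1].
have := @conical_integral_series _ s 0 x ltr01; rewrite subr0 add0r => /(_ _) h.
have hx : `|x| < 1 by rewrite ler0_norm//; lra.
apply: (cvg_unique (@Rhausdorff R) (h hx)).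
have -> : series (fun k => conical_coef s 0 k * x ^+ k) = (fun=> 0).
  by apply/funext => n; rewrite seriesEnat /= big1// => k _; rewrite coef0 mul0r.
exact: cvg_cst.
Qed.

(** At x = -eta / (1 - eta) the radicand ch^2 u - x is (1 + (1 - eta) sh^2 u) / (1 - eta), so the
    integrand is a constant multiple of cos (s u) times the weight with k^2 = 1 - eta. *)
Lemma conicalP_weight_eq0 s eta : 0 < eta < 1 -> conicalP s ((1 + eta) / (1 - eta)) = 0 ->
  \int[leb]_u (cos (s * u) * weight (Num.sqrt (1 - eta)) u) = 0.
Proof.
move=> ee /(conicalP_integral_eq0 ee); have /andP[e0 e1] := ee.
have e1' : 0 < 1 - eta by rewrite subr_gt0.
have q0 : 0 < Num.sqrt (1 - eta) by rewrite sqrtr_gt0.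
have k1 : Num.sqrt (1 - eta) <= 1 by rewrite -[X in _ <= X]sqrtr1 ler_wsqrtr//; lra.
have iw : intg leb setT (fun u => cos (s * u) * weight (Num.sqrt (1 - eta)) u).
  apply: (integrable_le _ _ _ (integrableZr (Num.sqrt (1 - eta))^-1 measurableT (@invch_integrable R))) => //.
    by have mw := measurable_weight (Num.sqrt (1 - eta)); ms'.
  move=> u _; apply: le_trans (weight_le q0 k1 u).
  rewrite normrM (ger0_norm (ltW (weight_gt0 _ _))) ler_piMl ?cos_max//.
  exact: ltW (weight_gt0 _ _).
have -> : conical_integral s (- (eta / (1 - eta))) =
    Num.sqrt (1 - eta) * \int[leb]_u (cos (s * u) * weight (Num.sqrt (1 - eta)) u).
  rewrite -RintegralZl//; apply: eq_Rint => u _.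
  rewrite /weight /cweight sqr_sqrtr ?(ltW e1')//.
  have -> : ch u ^+ 2 - - (eta / (1 - eta)) = (1 + (1 - eta) * sh u ^+ 2) / (1 - eta).
    by rewrite chE; field; rewrite gt_eqF.
  have A0 : 0 < 1 + (1 - eta) * sh u ^+ 2 by rewrite ltr_wpDr// mulr_ge0 ?sqr_ge0 ?(ltW e1').
  rewrite sqrtrM ?(ltW A0)// sqrtrV ?(ltW e1')//; field.
  by rewrite !gt_eqF ?sqrtr_gt0.
by move/eqP; rewrite mulf_eq0 gt_eqF//= => /eqP.
Qed.

End ConicalZero.

(** * The covariance form of charges *)

Section Laplace.
Context (R : realType).
Local Notation leb := (@lebesgue_measure R).
Implicit Types (e d k x : R).

Lemma norm_sin_le x : `|sin x| <= `|x|.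
Proof.
have h (y : R) : 0 <= y -> `|sin y| <= y.
  move=> y0; have := @der_norm_le R (@sin R) (@cos R) 0 y 1 y0 (fun x _ => is_derive_sin x)
    (fun x _ => cos_max x).
  by rewrite sin0 !subr0 mul1r.
have [x0|x0] := leP 0 x; first by rewrite (ger0_norm x0) h.
by rewrite (ltr0_norm x0) -(normrN (sin x)) -sinN; apply: h; rewrite oppr_ge0 ltW.
Qed.

Lemma norm_1Bcos_le x : `|1 - cos x| <= `|x|.
Proof.
have h (y : R) : 0 <= y -> `|1 - cos y| <= y.
  move=> y0; have d0 (t : R) : is_derive (t : R) (1 : R) (fun t => 1 - cos t) (sin t).
    by derive_by; [der|ring].
  have := @der_norm_le R (fun t => 1 - cos t) (@sin R) 0 y 1 y0 (fun t _ => d0 t)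
    (fun t _ => sin_max t).
  by rewrite cos0 subrr !subr0 mul1r.
have [x0|x0] := leP 0 x; first by rewrite (ger0_norm x0) h.
by rewrite (ltr0_norm x0) -cosN; apply: h; rewrite oppr_ge0 ltW.
Qed.

Lemma invr_mul_le k x y : 0 < k -> `|y| <= `|k * x| -> `|y / k| <= `|x|.
Proof. by move=> k0; rewrite !normrM normfV (gtr0_norm k0) ler_pdivrMr// mulrC. Qed.

Variable e : R.
Hypothesis e0 : 0 < e.
Let D := (`]0, +oo[%classic : set (measurableTypeR R)).
Let mD : measurable D. Proof. exact: measurable_itv. Qed.
Let D0 k : D k -> 0 < k. Proof. by rewrite /D /= in_itv /= andbT. Qed.
Let E k := expR (- (e * k)).

Let dE k : is_derive (k : R) (1 : R) E (- e * E k).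
Proof. by rewrite /E; derive_by; [der|cbv beta; ring]. Qed.

Let E_pos k : 0 < E k. Proof. exact: expR_gt0. Qed.
Let E_le1 k : 0 <= k -> E k <= 1.
Proof. by move=> k0; rewrite /E -expR0 ler_expR oppr_le0 mulr_ge0// ltW. Qed.

Lemma expR_ray_integrable : intg leb D E.
Proof.
apply: (@ray_integrable R E (fun k => - (E k / e)) 0 e^-1).
- move=> k k0; have d := dE k.
  by derive_by; [der|cbv beta; field; rewrite gt_eqF].
- by move=> k _; exact: der_continuous (dE k).
- by move=> k _; exact: ltW.
- move=> k k0; rewrite normrN normrM normfV (gtr0_norm e0) (gtr0_norm (E_pos k)).
  by rewrite ler_piMl ?invr_ge0 ?(ltW e0)// E_le1// ltW.
Qed.

Let E0 : E k @[k --> +oo] --> (0 : R).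
Proof.
apply/cvgr0Pnorm_le => r r0; near=> k.
have k0 : 0 < k by near: k; apply: nbhs_pinfty_gt; exact: num_real.
rewrite gtr0_norm// /E expRN.
have kr : e^-1 * r^-1 <= k by near: k; apply: nbhs_pinfty_ge; exact: num_real.
have ek : 0 < 1 + e * k by rewrite addr_gt0// mulr_gt0.
apply: (@le_trans _ _ (1 + e * k)^-1).
  by rewrite lef_pV2 ?posrE ?expR_gt0// expR_ge1Dx.
rewrite -[X in _ <= X]invrK lef_pV2 ?posrE ?invr_gt0//.
apply: (@le_trans _ _ (e * k)); last by rewrite lerDr.
by rewrite -ler_pdivrMl.
Unshelve. all: by end_near. Qed.

Let bounded_integrable (g : R -> R) (B : R) : measurable_fun setT g ->
  (forall k, 0 < k -> `|g k| <= B) -> intg leb D (fun k => E k * g k).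
Proof.
move=> mg gB; apply: (integrable_le _ _ _ (integrableZr B mD expR_ray_integrable)) => //.
  by apply: measurable_funTS; rewrite /E; ms'.
move=> k /D0 k0; rewrite normrM (gtr0_norm (E_pos k)) mulrC ler_wpM2r ?(ltW (E_pos k))//.
exact: gB.
Qed.

Let ftc (g G : R -> R) (B : R) : (forall k, is_derive (k : R) (1 : R) (fun k => E k * G k) (E k * g k)) ->
  continuous g -> (forall k, `|g k| <= B) -> (forall k, `|G k| <= B) ->
  \int[leb]_(k in D) (E k * g k) = - G 0.
Proof.
move=> dG cg gB GB.
have mg : measurable_fun setT g by exact: continuous_measurable_fun.
have cEg k : 0 < k -> {for k, continuous (fun k => E k * g k)}.
  by move=> k0; apply: cvgM; [exact: der_continuous (dE k)|exact: cg].
have lim0 : E k * G k @[k --> +oo] --> (0 : R).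
  apply: norm_cvg0; apply: (@squeeze_cvgr _ _ _ _ (fun=> 0) (fun k => E k * B)).
  - apply: nearW => k; rewrite normr_ge0 normrM (gtr0_norm (E_pos k)) /=.
    by rewrite ler_wpM2l ?(ltW (E_pos k)).
  - exact: cvg_cst.
  - by rewrite -[X in _ --> X](mul0r B); apply: cvgM; [exact: E0|exact: cvg_cst].
have lim1 : E k * G k @[k --> 0^'+] --> G 0.
  have -> : G 0 = E 0 * G 0 by rewrite /E mulr0 oppr0 expR0 mul1r.
  by apply: cvg_at_right_filter; exact: der_continuous (dG 0).
have ii : intg leb D (fun k => E k * g k) by apply: (bounded_integrable mg) => k _; exact: gB.
by rewrite (@Rintegral_ray_FTC R (fun k => E k * g k) (fun k => E k * G k) 0 0 (G 0))// sub0r.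
Qed.

Let ed d : 0 < e ^+ 2 + d ^+ 2. Proof. by rewrite ltr_wpDr ?sqr_ge0// exprn_gt0. Qed.

Let trig_le (x y : R) k d : `|x * cos (k * d) + y * sin (k * d)| <= `|x| + `|y|.
Proof.
apply: (le_trans (ler_normD _ _)); apply: lerD; rewrite normrM ler_piMr//.
  exact: cos_max.
exact: sin_max.
Qed.

Lemma laplace_cos d : \int[leb]_(k in D) (E k * cos (k * d)) = e / (e ^+ 2 + d ^+ 2).
Proof.
pose c := e / (e ^+ 2 + d ^+ 2); pose c' := d / (e ^+ 2 + d ^+ 2).
transitivity (- (- c * cos (0 * d) + c' * sin (0 * d))); last first.
  by rewrite mul0r cos0 sin0 mulr0 addr0 mulr1 opprK.
apply: (@ftc (fun k => cos (k * d)) (fun k => - c * cos (k * d) + c' * sin (k * d)) (1 + (`|- c| + `|c'|))).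
- move=> k; have d1 := dE k; derive_by; first by der.
  by cbv beta; rewrite /c /c'; field; rewrite gt_eqF.
- by move=> k; apply: der_continuous; der.
- by move=> k; rewrite (le_trans (cos_max _))// lerDl addr_ge0.
- by move=> k; rewrite (le_trans (trig_le _ _ _ _))// lerDr.
Qed.

Lemma laplace_sin d : \int[leb]_(k in D) (E k * sin (k * d)) = d / (e ^+ 2 + d ^+ 2).
Proof.
pose c := e / (e ^+ 2 + d ^+ 2); pose c' := d / (e ^+ 2 + d ^+ 2).
transitivity (- (- c' * cos (0 * d) + - c * sin (0 * d))); last first.
  by rewrite mul0r cos0 sin0 mulr0 addr0 mulr1 opprK.
apply: (@ftc (fun k => sin (k * d)) (fun k => - c' * cos (k * d) + - c * sin (k * d)) (1 + (`|- c'| + `|- c|))).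
- move=> k; have d1 := dE k; derive_by; first by der.
  by cbv beta; rewrite /c /c'; field; rewrite gt_eqF.
- by move=> k; apply: der_continuous; der.
- by move=> k; rewrite (le_trans (sin_max _))// lerDl addr_ge0.
- by move=> k; rewrite (le_trans (trig_le _ _ _ _))// lerDr.
Qed.

(** Differentiation in [d] cancels the denominator [k], and both sides vanish at d = 0. *)
Let param (g dg : R -> R) (H h : R -> R) :
  (forall x, is_derive (x : R) (1 : R) g (dg x)) -> (forall x, `|g x| <= `|x|) ->
  (forall x, `|dg x| <= 1) -> g 0 = 0 ->
  (forall d, \int[leb]_(k in D) (E k * dg (k * d)) = h d) ->
  (forall d, is_derive (d : R) (1 : R) H (h d)) -> H 0 = 0 ->
  forall d, \int[leb]_(k in D) (E k * (g (k * d) / k)) = H d.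
Proof.
move=> dgE gx dg1 g0 Ih dH H0 d.
have mg : measurable_fun setT g by apply: continuous_measurable_fun => x; exact: der_continuous (dgE x).
pose I d := \int[leb]_(k in D) (E k * (g (k * d) / k)).
have iI d' : intg leb D (fun k => E k * (g (k * d') / k)).
  apply: (@bounded_integrable (fun k => g (k * d') / k) `|d'|).
    apply: ms_M; last exact: (ms_V (@measurable_id _ _ _)).
    by apply: (measurableT_comp mg); ms'.
  by move=> k k0; exact: invr_mul_le.
have dI d' : is_derive (d' : R) (1 : R) I (h d').
  rewrite -Ih.
  have k1 : d' - 1 < d' < d' + 1 by rewrite ltrDl ltrBlDr ltrDl ltr01.
  have k2 (x k : R) : d' - 1 < x < d' + 1 -> D k ->
      is_derive (x : R) (1 : R) (fun x => E k * (g (k * x) / k)) (E k * dg (k * x)).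
    move=> _ /D0 kp; have d1 := dgE (k * x).
    have d2 : is_derive (x : R) (1 : R) (fun x => g (k * x)) (dg (k * x) * k).
      have d3 : is_derive (x : R) (1 : R) (fun x : R => k * x) k by derive_by; [der|cbv beta; ring].
      exact: (@der_comp R x (fun x => k * x) g _ _ d1 d3).
    by derive_by; [der|cbv beta; field; rewrite gt_eqF].
  have k3 (x k : R) : d' - 1 < x < d' + 1 -> D k -> `|E k * dg (k * x)| <= E k.
    by move=> _ _; rewrite normrM (gtr0_norm (E_pos k)) ler_piMr ?(ltW (E_pos k)).
  exact: (@der_Rintegral _ _ _ leb D (fun x k => E k * (g (k * x) / k))
    (fun x k => E k * dg (k * x)) E _ _ d' mD k1 (fun x _ => iI x) k2 k3 expR_ray_integrable).
have I0 : I 0 = 0.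
  rewrite /I (@eq_Rint _ _ _ _ _ _ (fun=> 0)) ?Rintegral_cst ?mul0r//.
  by move=> k _; rewrite mulr0 g0 mul0r mulr0.
have dIH x : Num.min 0 d <= x <= Num.max 0 d -> is_derive (x : R) (1 : R) (fun d => I d - H d) 0.
  move=> _; have d1 := dI x; have d2 := dH x.
  by derive_by; [der|rewrite subrr].
have := der_0_const dIH; rewrite I0 H0 subrr => /esym/eqP.
by rewrite subr_eq0 => /eqP.
Qed.

Lemma laplace_sinc d : \int[leb]_(k in D) (E k * (sin (k * d) / k)) = atan (d / e).
Proof.
apply: (@param (@sin R) (@cos R) (fun d => atan (d / e)) (fun d => e / (e ^+ 2 + d ^+ 2))) => //.
- exact: norm_sin_le.
- exact: cos_max.
- exact: sin0.
- exact: laplace_cos.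
- move=> x; derive_by; first by der.
  have := ed x; cbv beta => h; field.
  by rewrite !gt_eqF// addrC.
- by rewrite mul0r atan0.
Qed.

Lemma laplace_1Bcosc d : \int[leb]_(k in D) (E k * ((1 - cos (k * d)) / k)) =
  2^-1 * ln (1 + d ^+ 2 / e ^+ 2).
Proof.
apply: (@param (fun x => 1 - cos x) (@sin R) (fun d => 2^-1 * ln (1 + d ^+ 2 / e ^+ 2))
  (fun d => d / (e ^+ 2 + d ^+ 2))) => //.
- by move=> x; derive_by; [der|ring].
- exact: norm_1Bcos_le.
- exact: sin_max.
- by rewrite cos0 subrr.
- exact: laplace_sin.
- move=> x; derive_by.
    by der; rewrite ltr_pwDl// divr_ge0 ?sqr_ge0.
  have := ed x; cbv beta => h; field.
  by rewrite !gt_eqF// addrC.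
- by rewrite expr0n /= mul0r addr0 ln1 mulr0.
Qed.

End Laplace.

(** * Integrals against a product measure *)

Section Product.
Context d1 d2 (T1 : measurableType d1) (T2 : measurableType d2) (R : realType).
Variables (m1 : {sigma_finite_measure set T1 -> \bar R})
  (m2 : {sigma_finite_measure set T2 -> \bar R}).

Lemma Rintegral_prod (F : T1 * T2 -> R) : intg (m1 \x m2)%E setT F ->
  \int[(m1 \x m2)%E]_z F z = \int[m1]_x \int[m2]_y F (x, y).
Proof.
move=> iF; rewrite /Rintegral; congr fine.
rewrite -(integral12_prod_meas1 iF); apply: ae_eq_integral => //.
- exact: measurable_int (integrable_fubini_F iF).
- apply/measurable_EFinP; apply: (measurableT_comp (fine_measurable measurableT)).
  exact: measurable_int (integrable_fubini_F iF).
- have := ae_integrable1 iF; apply: filterS => x iFx _ /=.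
  by rewrite fineK//; exact: integrable_fin_num.
Qed.

Lemma Rintegral_prod2 (F : T1 * T2 -> R) : intg (m1 \x m2)%E setT F ->
  \int[(m1 \x m2)%E]_z F z = \int[m2]_y \int[m1]_x F (x, y).
Proof.
move=> iF; rewrite /Rintegral; congr fine.
rewrite -(integral21_prod_meas1 iF); apply: ae_eq_integral => //.
- exact: measurable_fubini_G iF.
- apply/measurable_EFinP; apply: (measurableT_comp (fine_measurable measurableT)).
  exact: measurable_fubini_G iF.
- have := ae_integrable2 iF; apply: filterS => x iFx _ /=.
  by rewrite fineK//; exact: integrable_fin_num.
Qed.

Lemma Rintegral_tensor (a : T1 -> R) (b : T2 -> R) : intg m1 setT a -> intg m2 setT b ->
  \int[(m1 \x m2)%E]_z (a z.1 * b z.2) = (\int[m1]_x a x) * (\int[m2]_y b y).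
Proof.
move=> ia ib; rewrite Rintegral_prod; last exact: integrable_tensor_setT.
rewrite mulrC -RintegralZl//; apply: eq_Rint => x _ /=.
by rewrite RintegralZl// mulrC.
Qed.

End Product.

(* A second name for the product measure, on which the sigma-finite structure is found. *)
Section ProductSigmaFinite.
Context d1 d2 (T1 : measurableType d1) (T2 : measurableType d2) (R : realType).
Variables (m1 : {sigma_finite_measure set T1 -> \bar R})
  (m2 : {sigma_finite_measure set T2 -> \bar R}).

Definition product_sf (A : set (T1 * T2)%type) : \bar R := (m1 \x m2)%E A.

HB.instance Definition _ := Measure.copy product_sf (m1 \x m2)%E.

Lemma product_sf_sigma_finite : sigma_finite setT product_sf.
Proof.
have /sigma_finiteP[F [TF ndF Foo]] := sigma_finiteT m1.
have /sigma_finiteP[G [TG ndG Goo]] := sigma_finiteT m2.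
exists (fun n => F n `*` G n).
  rewrite -setXTT TF TG predeqE => -[x y]; split.
    move=> [/= [n _ Fnx] [k _ Gky]]; exists (maxn n k) => //; split.
      by move: x Fnx; exact/subsetPset/ndF/leq_maxl.
    by move: y Gky; exact/subsetPset/ndG/leq_maxr.
  by move=> [n _ []/= ? ?]; split; exists n.
move=> k; have [? ?] := Foo k; have [? ?] := Goo k; split; first exact: measurableX.
by rewrite /product_sf product_measure1E// lte_mul_pinfty// ge0_fin_numE.
Qed.

HB.instance Definition _ := Measure_isSigmaFinite.Build _ _ _ product_sf product_sf_sigma_finite.

End ProductSigmaFinite.
(** Diagonals are discarded in this form: a function carried by the diagonal has sections that are
    nonzero at one point at most. *)
Lemma Rintegral_singleton (R : realType) (h : R -> R) :
  (forall u v, h u != 0 -> h v != 0 -> u = v) -> \int[@lebesgue_measure R]_u h u = 0.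
Proof.
move=> h1; have [[u0 hu0]|hn] := pselect (exists u, h u != 0).
  have -> : h = h \_ [set u0].
    apply/funext => u; rewrite patchE; case: ifPn => // /negP uu; apply/eqP/negPn/negP => hu.
    by apply: uu; rewrite inE /=; exact: h1.
  by rewrite -Rintegral_mkcond Rintegral_set1.
rewrite (@eq_Rint _ _ _ _ _ _ (fun=> 0)) ?Rintegral_cst ?mul0r//.
by move=> u _; apply/eqP/negPn/negP => hu; apply: hn; exists u.
Qed.

(** * Charges, their logarithmic energy and their Fourier transforms *)

Section Charges.
Context (R : realType).
Local Notation leb := (@lebesgue_measure R).
Local Notation P := (leb \x leb)%E.
Variables (h : R -> R) (M : R).
Hypotheses (h0 : forall x, 0 <= h x)
  (hM : forall x, M < `|x| -> h x = 0) (M0 : 0 <= M) (ih : intg leb setT h)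
  (lh : intg P setT (fun z => ln `|z.1 - z.2| * (h z.1 * h z.2))).
Implicit Types (f g : R -> R) (k e : R).

(** Domination by one fixed [h] makes the charges a vector space with common bounded support, on
    which every double integral below converges absolutely. *)
Definition charge f := [/\ measurable_fun setT f,
  exists C, forall x, `|f x| <= C * h x & \int[leb]_x f x = 0].

Definition logform f g := \int[leb]_x \int[leb]_y (ln `|x - y| * (f x * g y)).
Definition cosint f k := \int[leb]_x (cos (k * x) * f x).
Definition sinint f k := \int[leb]_x (sin (k * x) * f x).

Let D := (`]0, +oo[%classic : set (measurableTypeR R)).
Let mD : measurable D. Proof. exact: measurable_itv. Qed.
Let D0 k : D k -> 0 < k. Proof. by rewrite /D /= in_itv /= andbT. Qed.

Let bnd f : charge f -> exists2 C, 0 <= C & forall x, `|f x| <= C * h x.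
Proof.
move=> [_ [C hC] _]; exists `|C| => // x; apply: (le_trans (hC x)).
by rewrite ler_wpM2r// ler_norm.
Qed.

Lemma charge_integrable f : charge f -> intg leb setT f.
Proof.
move=> [mf [C hC] _]; apply: (integrable_le _ _ _ (integrableZr C measurableT ih)) => //.
Qed.

Lemma chargeD f g : charge f -> charge g -> charge (fun x => f x + g x).
Proof.
move=> cf cg; have If := charge_integrable cf; have Ig := charge_integrable cg.
have [mf [C hC] f0] := cf; have [mg [C' hC'] g0] := cg; split.
- by ms'.
- exists (C + C') => x; rewrite mulrDl; apply: (le_trans (ler_normD _ _)).
  exact: lerD.
- by rewrite RintegralD// f0 g0 addr0.
Qed.

Lemma chargeZ c f : charge f -> charge (fun x => c * f x).
Proof.
move=> cf; have If := charge_integrable cf; have [mf [C hC] f0] := cf; split.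
- by ms'.
- by exists (`|c| * C) => x; rewrite normrM -mulrA ler_wpM2l.
- by rewrite RintegralZl// f0 mulr0.
Qed.

Let supp f x : charge f -> M < `|x| -> f x = 0.
Proof.
move=> /bnd[C _ hC] xM; apply/eqP; rewrite -normr_le0.
by apply: (le_trans (hC x)); rewrite hM// mulr0.
Qed.

Let mtens f g : charge f -> charge g ->
  measurable_fun setT (fun z : measurableTypeR R * measurableTypeR R => f z.1 * g z.2).
Proof.
move=> [mf _ _] [mg _ _].
by apply: ms_M; [apply: (measurableT_comp mf)|apply: (measurableT_comp mg)].
Qed.

Let itens f g : charge f -> charge g -> intg P setT (fun z => f z.1 * g z.2).
Proof. by move=> cf cg; apply: integrable_tensor_setT; exact: charge_integrable. Qed.

Let itens0 f g : charge f -> charge g -> \int[P]_z (f z.1 * g z.2) = 0.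
Proof.
move=> cf cg; rewrite Rintegral_tensor; [|exact: charge_integrable..].
by have [_ _ ->] := cf; rewrite mul0r.
Qed.

Let iB (B : R) (m : R * R -> R) f g : charge f -> charge g ->
  measurable_fun setT (m : measurableTypeR R * measurableTypeR R -> R) ->
  (forall z, `|m z| <= B) -> intg P setT (fun z => m z * (f z.1 * g z.2)).
Proof.
move=> cf cg mm mB; have B0 : 0 <= B by apply: le_trans (mB (0, 0)).
apply: (integrable_le _ _ _ (integrableZr B measurableT (integrable_norm (itens cf cg)))) => //.
  by apply: ms_M => //; exact: mtens.
by move=> z _; rewrite normrM ler_wpM2r.
Qed.

Lemma log_tensor_integrable f g : charge f -> charge g ->
  intg P setT (fun z => ln `|z.1 - z.2| * (f z.1 * g z.2)).
Proof.
move=> cf cg; have [C C0 hC] := bnd cf; have [C' C0' hC'] := bnd cg.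
apply: (integrable_le _ _ _ (integrableZr (C * C') measurableT (integrable_norm lh))) => //.
  by apply: ms_M; [ms'|exact: mtens].
move=> z _; rewrite /= !normrM.
have -> : C * C' * (`|ln `|z.1 - z.2| | * (`|h z.1| * `|h z.2|)) =
  `|ln `|z.1 - z.2| | * ((C * h z.1) * (C' * h z.2)).
  by rewrite !(ger0_norm (h0 _)); ring.
by rewrite ler_wpM2l// ler_pM.
Qed.

Lemma logform_prod f g : charge f -> charge g ->
  logform f g = \int[P]_z (ln `|z.1 - z.2| * (f z.1 * g z.2)).
Proof. by move=> cf cg; rewrite (Rintegral_prod (log_tensor_integrable cf cg)). Qed.

Lemma logformC f g : charge f -> charge g -> logform f g = logform g f.
Proof.
move=> cf cg; rewrite (logform_prod cg cf) (Rintegral_prod2 (log_tensor_integrable cg cf)).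
by apply: eq_Rint => x _; apply: eq_Rint => y _; rewrite /= distrC [f x * _]mulrC.
Qed.

Lemma logformDl f1 f2 g : charge f1 -> charge f2 -> charge g ->
  logform (fun x => f1 x + f2 x) g = logform f1 g + logform f2 g.
Proof.
move=> c1 c2 cg; rewrite (logform_prod (chargeD c1 c2) cg) (logform_prod c1 cg) (logform_prod c2 cg).
rewrite -(RintegralD measurableT (log_tensor_integrable c1 cg) (log_tensor_integrable c2 cg)).
by apply: eq_Rint => z _; ring.
Qed.

Lemma logformZl c f g : charge f -> charge g -> logform (fun x => c * f x) g = c * logform f g.
Proof.
move=> cf cg; rewrite (logform_prod (chargeZ c cf) cg) (logform_prod cf cg).
rewrite -(RintegralZl c measurableT (log_tensor_integrable cf cg)).
by apply: eq_Rint => z _; ring.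
Qed.

Lemma logformDr f g1 g2 : charge f -> charge g1 -> charge g2 ->
  logform f (fun x => g1 x + g2 x) = logform f g1 + logform f g2.
Proof.
move=> cf c1 c2; rewrite (logformC cf (chargeD c1 c2)) (logformDl c1 c2 cf).
by rewrite (logformC c1 cf) (logformC c2 cf).
Qed.

Lemma logformZr c f g : charge f -> charge g -> logform f (fun x => c * g x) = c * logform f g.
Proof.
move=> cf cg; rewrite (logformC cf (chargeZ c cg)) (logformZl c cg cf).
by rewrite (logformC cg cf).
Qed.

Let itrig f k : charge f ->
  intg leb setT (fun x => cos (k * x) * f x) /\ intg leb setT (fun x => sin (k * x) * f x).
Proof.
move=> cf; have If := charge_integrable cf; have [mf _ _] := cf.
split; apply: (integrable_le _ _ _ (integrable_norm If)) => //; try by ms'.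
  by move=> x _; rewrite normrM ler_piMl ?cos_max.
by move=> x _; rewrite normrM ler_piMl ?sin_max.
Qed.

Lemma cosint_cosint f g k : charge f -> charge g ->
  cosint f k * cosint g k + sinint f k * sinint g k =
  \int[P]_z (cos (k * (z.1 - z.2)) * (f z.1 * g z.2)).
Proof.
move=> cf cg; have [i1 i2] := itrig k cf; have [i3 i4] := itrig k cg.
rewrite /cosint /sinint -(Rintegral_tensor i1 i3) -(Rintegral_tensor i2 i4) -RintegralD//.
- by apply: eq_Rint => z _; rewrite mulrBr cosB; ring.
- exact: (integrable_tensor_setT i1 i3).
- exact: (integrable_tensor_setT i2 i4).
Qed.

Lemma sinint_cosint f g k : charge f -> charge g ->
  sinint f k * cosint g k - cosint f k * sinint g k =
  \int[P]_z (sin (k * (z.1 - z.2)) * (f z.1 * g z.2)).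
Proof.
move=> cf cg; have [i1 i2] := itrig k cf; have [i3 i4] := itrig k cg.
rewrite /cosint /sinint -(Rintegral_tensor i2 i3) -(Rintegral_tensor i1 i4) -RintegralB//.
- by apply: eq_Rint => z _; rewrite mulrBr sinB; ring.
- exact: (integrable_tensor_setT i2 i3).
- exact: (integrable_tensor_setT i1 i4).
Qed.

Let msin : measurable_fun setT (@sin R).
Proof. by apply: (ms_sin (f := fun x => x)); exact: measurable_id. Qed.

Let E e k := expR (- (e * k)).

(** Fubini's theorem for [k] against the pair (x, y). The bound |g0 x| <= |x| cancels the factor 1 /
    k, and the bounded support limits |x - y| to 2 M. *)
Let laplace_prod (g0 H : R -> R) e f g : 0 < e -> charge f -> charge g ->
  measurable_fun setT g0 -> (forall x, `|g0 x| <= `|x|) ->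
  (forall d, \int[leb]_(k in D) (E e k * (g0 (k * d) / k)) = H d) ->
  intg leb D (fun k => E e k / k * \int[P]_z (g0 (k * (z.1 - z.2)) * (f z.1 * g z.2))) /\
  \int[leb]_(k in D) (E e k / k * \int[P]_z (g0 (k * (z.1 - z.2)) * (f z.1 * g z.2))) =
    \int[P]_z (H (z.1 - z.2) * (f z.1 * g z.2)).
Proof.
move=> e0 cf cg mg0 g0x IH.
have mT : measurable [set: measurableTypeR R * measurableTypeR R] by exact: measurableT.
pose F (w : measurableTypeR R * (measurableTypeR R * measurableTypeR R)) :=
  E e w.1 * (g0 (w.1 * (w.2.1 - w.2.2)) / w.1) * (f w.2.1 * g w.2.2).
have m1 : measurable_fun setT (fun w : measurableTypeR R * (measurableTypeR R * measurableTypeR R) => w.2.1).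
  by apply: (measurableT_comp measurable_fst); exact: measurable_snd.
have m2 : measurable_fun setT (fun w : measurableTypeR R * (measurableTypeR R * measurableTypeR R) => w.2.2).
  by apply: (measurableT_comp measurable_snd); exact: measurable_snd.
have m3 : measurable_fun setT (fun w : measurableTypeR R * (measurableTypeR R * measurableTypeR R) => w.1).
  exact: measurable_fst.
have [mf _ _] := cf; have [mg _ _] := cg.
have mF : measurable_fun setT F.
  apply: ms_M; last first.
    by apply: ms_M; [exact: (measurableT_comp mf m1)|exact: (measurableT_comp mg m2)].
  apply: ms_M; first by apply: ms_exp; apply: ms_N; apply: ms_M.
  apply: ms_M; last exact: ms_V.
  apply: (measurableT_comp mg0); apply: ms_M => //.
  by apply: ms_D => //; exact: ms_N.
have iE := expR_ray_integrable e0.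
have ib : intg P setT (fun z => 2 * M * (`|f z.1| * `|g z.2|)).
  apply: (integrable_eq measurableT _ (integrableZr (2 * M) measurableT (integrable_norm (itens cf cg)))).
  by move=> z _; rewrite /= normrM.
have Fb k z : D k -> setT z -> `|F (k, z)| <= E e k * (2 * M * (`|f z.1| * `|g z.2|)).
  move=> /D0 k0 _; rewrite /F /= !normrM (gtr0_norm (expR_gt0 _)) -!mulrA ler_wpM2l ?expR_ge0//.
  rewrite -normrM mulrA mulrA.
  have [z1|z1] := ltP M `|z.1|; first by rewrite (supp cf z1) mul0r normr0 !mulr0.
  have [z2|z2] := ltP M `|z.2|; first by rewrite (supp cg z2) mulr0 normr0 !mulr0.
  rewrite ler_wpM2r// -normrM.
  apply: (le_trans (invr_mul_le k0 (g0x _))); apply: (le_trans (ler_normB _ _)).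
  by rewrite mulr_natl mulr2n lerD.
have kE k : D k -> E e k / k * \int[P]_z (g0 (k * (z.1 - z.2)) * (f z.1 * g z.2)) =
    \int[P]_z F (k, z).
  move=> /D0 k0; rewrite -RintegralZl//; first by apply: eq_Rint => z _; rewrite /F /=; ring.
  have ik : intg P setT (fun z => k / E e k * (F (k, z))).
    apply: integrableZr => //.
    have Dk : D k by rewrite /D /= in_itv /= andbT.
    apply: (integrable_le mT _ (fun z _ => Fb k z Dk I) (integrableZr (E e k) mT ib)).
    exact: (measurableT_comp mF (pair1_measurable k)).
  apply: (integrable_eq measurableT _ ik) => z _; rewrite /F /=; field.
  by rewrite (gt_eqF k0) gt_eqF ?expR_gt0.
split.
  have i12 : intg leb D (fun k => \int[P]_z F (k, z)).
    exact: (@tensor_integrable12 _ _ _ _ R leb (product_sf leb leb) D setT mD mT _ _ iE ib F mF Fb).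
  apply: (integrable_eq mD _ i12) => k Dk.
  by rewrite kE.
have FE : \int[leb]_(k in D) \int[P]_z F (k, z) = \int[P]_z \int[leb]_(k in D) F (k, z).
  exact: (@tensor_Fubini _ _ _ _ R leb (product_sf leb leb) D setT mD mT _ _ iE ib F mF Fb).
rewrite (@eq_Rint _ _ _ leb D _ _ kE) FE.
apply: eq_Rint => z _ /=; rewrite -IH mulrC -RintegralZl//.
  by apply: eq_Rint => k _; rewrite /F /=; ring.
have mg0' : measurable_fun setT (fun k : measurableTypeR R => E e k * (g0 (k * (z.1 - z.2)) / k)).
  apply: ms_M; first by rewrite /E; ms'.
  apply: ms_M; last exact: (ms_V (@measurable_id _ _ _)).
  by apply: (measurableT_comp mg0); ms'.
apply: (integrable_le _ _ _ (integrableZr `|z.1 - z.2| mD iE)) => //; first exact: measurable_funTS.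
move=> k /D0 k0; rewrite normrM (gtr0_norm (expR_gt0 _)) mulrC ler_wpM2r ?expR_ge0//.
exact: invr_mul_le.
Qed.

Let en n : R := n.+1%:R^-1.
Let en0 n : 0 < en n. Proof. by rewrite /en invr_gt0. Qed.
Let en1 n : en n <= 1. Proof. by rewrite /en invf_le1 ?ltr0n// ler1n. Qed.
Let encvg : en n @[n --> \oo] --> (0 : R). Proof. exact: cvg_harmonic. Qed.

Let X f g k := cosint f k * cosint g k + sinint f k * sinint g k.
Let Y f g k := sinint f k * cosint g k - cosint f k * sinint g k.

(** The argument of the logarithm lies between d^2, with d the difference of the two points, and 1 +
    (2 M)^2. The majorant is therefore uniform in [e]. *)
Let mln (z : R * R) (e : R) : 0 < e <= 1 -> `|z.1| <= M -> `|z.2| <= M -> z.1 - z.2 != 0 ->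
  `|ln (e ^+ 2 + (z.1 - z.2) ^+ 2)| <= 2 * `|ln `|z.1 - z.2| | + ln (1 + (2 * M) ^+ 2).
Proof.
move=> /andP[e0 e1] z1 z2 dn; set d := z.1 - z.2 in dn *.
have d2 : 0 < d ^+ 2 by rewrite lt_neqAle sqr_ge0 andbT eq_sym expf_neq0.
have dM : d ^+ 2 <= (2 * M) ^+ 2.
  rewrite -[X in X <= _]real_normK ?num_real// lerXn2r ?nnegrE ?mulr_ge0//.
  by apply: (le_trans (ler_normB _ _)); rewrite mulr_natl mulr2n lerD.
have e2 : e ^+ 2 <= 1 by rewrite exprn_ile1// ltW.
have e20 : 0 < e ^+ 2 by rewrite exprn_gt0.
have l1 : ln (e ^+ 2 + d ^+ 2) <= ln (1 + (2 * M) ^+ 2).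
  have p2 : 0 < 1 + (2 * M) ^+ 2 by rewrite ltr_wpDr ?sqr_ge0.
  by rewrite ler_ln ?posrE ?(addr_gt0 e20 d2)//; exact: lerD.
have l2 : ln (d ^+ 2) <= ln (e ^+ 2 + d ^+ 2).
  by rewrite ler_ln ?posrE ?(addr_gt0 e20 d2)// lerDr ltW.
have l3 : ln (d ^+ 2) = 2 * ln `|d|.
  by rewrite -[in LHS]real_normK ?num_real// expr2 lnM ?posrE ?normr_gt0//; ring.
have l4 : 0 <= ln (1 + (2 * M) ^+ 2) by rewrite ln_ge0// lerDl sqr_ge0.
rewrite l3 in l2; rewrite ler_norml; apply/andP; split.
  have := lerNnormlW (lexx `|ln `|d| |); lra.
have := normr_ge0 (ln `|d|); lra.
Qed.

(* The measure of the diagonal vanishes, so the junk value [ln 0 = 0] is harmless. *)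
Let diag0 f g : charge f -> charge g ->
  \int[P]_z ((z.1 == z.2)%:R * (f z.1 * g z.2)) = 0.
Proof.
move=> cf cg; have md : measurable_fun setT (fun z : measurableTypeR R * measurableTypeR R => (z.1 == z.2)%:R : R).
  have -> : (fun z : measurableTypeR R * measurableTypeR R => (z.1 == z.2)%:R : R) =
      (fun z => 1 - (Num.sg (z.1 - z.2)) ^+ 2).
    apply/funext => z; have [->|zz] := eqVneq z.1 z.2; first by rewrite subrr sgr0 expr0n /= subr0.
    by rewrite sqr_sg subr_eq0 zz subrr.
  by ms'.
rewrite Rintegral_prod; last first.
  by apply: (@iB 1) => // z; case: eqP => _; rewrite ?normr1 ?normr0.
rewrite (@eq_Rint _ _ _ _ _ _ (fun=> 0)) ?Rintegral_cst ?mul0r// => x _ /=.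
apply: Rintegral_singleton => u v.
case: (eqVneq x u) => [<-|]; last by rewrite mul0r eqxx.
by case: (eqVneq x v) => [<-|]; last by rewrite mul0r eqxx.
Qed.

(** As the charges have integral 0, the cosine may be replaced by cos - 1, which removes the
    singularity at k = 0. The transform is then (1/2) ln (1 + d^2/e^2) = (1/2) ln (e^2 + d^2) - ln
    e, where the divergent constant ln e again drops out on charges. *)
Let Xlim f g : charge f -> charge g ->
  (forall n, intg leb D (fun k => E (en n) k * (X f g k / k))) /\
  \int[leb]_(k in D) (E (en n) k * (X f g k / k)) @[n --> \oo] --> - logform f g.
Proof.
move=> cf cg; have mT : measurable [set: measurableTypeR R * measurableTypeR R] by exact: measurableT.
have XE k : X f g k = - \int[P]_z ((1 - cos (k * (z.1 - z.2))) * (f z.1 * g z.2)).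
  have i1 : intg P setT (fun z => cos (k * (z.1 - z.2)) * (f z.1 * g z.2)).
    by apply: (@iB 1 (fun z => cos (k * (z.1 - z.2)))) => //; [ms'|move=> z; exact: cos_max].
  have i2 : intg P setT (fun z => (1 - cos (k * (z.1 - z.2))) * (f z.1 * g z.2)).
    apply: (@iB 2 (fun z => 1 - cos (k * (z.1 - z.2)))) => //; first by ms'.
    by move=> z; rewrite (le_trans (ler_normB _ _))// normr1 -[2](natr1 1) lerD2l cos_max.
  rewrite /X cosint_cosint//; apply/eqP; rewrite -addr_eq0 -RintegralD//; apply/eqP.
  by rewrite -[RHS](itens0 cf cg); apply: eq_Rint => z _; ring.
have mc : measurable_fun setT (fun x : R => 1 - cos x).
  by apply: ms_D; [exact: ms_cst|apply: ms_N; apply: (ms_cos (f := fun x => x)); exact: measurable_id].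
have L n := laplace_prod (en0 n) cf cg mc (@norm_1Bcos_le R) (laplace_1Bcosc (en0 n)).
have kE n k : E (en n) k * (X f g k / k) =
    - (E (en n) k / k * \int[P]_z ((1 - cos (k * (z.1 - z.2))) * (f z.1 * g z.2))).
  by rewrite XE; ring.
split.
  move=> n; have [i1 _] := L n.
  by apply: (integrable_eq mD _ (integrableNr i1)) => k _; rewrite kE.
pose fn n (z : measurableTypeR R * measurableTypeR R) : R :=
  (z.1 != z.2)%:R * ln (en n ^+ 2 + (z.1 - z.2) ^+ 2) * (f z.1 * g z.2).
pose bd (z : measurableTypeR R * measurableTypeR R) : R :=
  2 * `|ln `|z.1 - z.2| * (f z.1 * g z.2)| + ln (1 + (2 * M) ^+ 2) * `|f z.1 * g z.2|.
have ibd : intg P setT bd.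
  apply: integrableDr => //; apply: integrableZr => //; apply: integrable_norm.
    exact: log_tensor_integrable.
  exact: itens.
have mne : measurable_fun setT (fun z : measurableTypeR R * measurableTypeR R => (z.1 != z.2)%:R : R).
  have -> : (fun z : measurableTypeR R * measurableTypeR R => (z.1 != z.2)%:R : R) =
      (fun z => (Num.sg (z.1 - z.2)) ^+ 2).
    by apply/funext => z; rewrite sqr_sg subr_eq0.
  by ms'.
have mfn n : measurable_fun setT (fn n).
  by apply: ms_M; [apply: ms_M => //; ms'|exact: mtens].
have fnb n z : setT z -> `|fn n z| <= bd z.
  move=> _; rewrite /fn /bd; have [zz|zz] := eqVneq z.1 z.2.
    rewrite !mul0r normr0 addr_ge0// ?mulr_ge0 ?normr_ge0//.
    by rewrite ln_ge0// lerDl sqr_ge0.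
  have [z1|z1] := ltP M `|z.1|; first by rewrite (supp cf z1) !mul0r !mulr0 normr0 !mulr0 addr0.
  have [z2|z2] := ltP M `|z.2|; first by rewrite (supp cg z2) !mulr0 normr0 !mulr0 addr0.
  rewrite mul1r normrM [X in 2 * X]normrM mulrA -mulrDl ler_wpM2r//.
  by apply: mln => //; rewrite ?en0 ?en1// subr_eq0.
have ifn n : intg P setT (fn n).
  exact: (integrable_le mT (mfn n) (fnb n) ibd).
have fnc (z : measurableTypeR R * measurableTypeR R) : setT z ->
    fn n z @[n --> \oo] --> 2 * (ln `|z.1 - z.2| * (f z.1 * g z.2)).
  move=> _; rewrite /fn; have [zz|zz] := eqVneq z.1 z.2.
    rewrite zz subrr normr0 ln0// mul0r mulr0.
    by under eq_fun do rewrite !mul0r; exact: cvg_cst.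
  rewrite mulrA; under eq_fun do rewrite mul1r; apply: cvgM; last exact: cvg_cst.
  have d0 : z.1 - z.2 != 0 by rewrite subr_eq0.
  have l3 : ln (0 ^+ 2 + (z.1 - z.2) ^+ 2) = 2 * ln `|z.1 - z.2|.
    rewrite expr0n /= add0r -[in LHS]real_normK ?num_real// expr2 lnM ?posrE ?normr_gt0//; ring.
  rewrite -l3; apply: (@cvg_comp _ _ _ (fun n => en n ^+ 2 + (z.1 - z.2) ^+ 2) (@ln R) _
    (nbhs (0 ^+ 2 + (z.1 - z.2) ^+ 2 : R))).
    by apply: cvgD; [rewrite !expr2; apply: cvgM|exact: cvg_cst].
  apply: continuous_ln; rewrite expr0n /= add0r lt_neqAle sqr_ge0 andbT eq_sym.
  by rewrite expf_neq0.
have [_] := dominated_cvg_Rintegral mT mfn fnc ibd fnb.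
rewrite RintegralZl//; last exact: log_tensor_integrable.
rewrite -logform_prod// => c1.
have c2 : - (2^-1 * \int[P]_z fn n z) @[n --> \oo] --> - logform f g.
  have -> : logform f g = 2^-1 * (2 * logform f g) by rewrite mulKf.
  by apply: cvgN; apply: cvgM; [exact: cvg_cst|exact: c1].
apply: cvg_trans c2; apply: near_eq_cvg; apply: nearW => n.
rewrite (@eq_Rint _ _ _ leb D _ _ (fun k _ => kE n k)) RintegralN//; last by have [] := L n.
have [_ ->] := L n; congr (- _).
have idg : intg P setT (fun z => (z.1 == z.2)%:R * (f z.1 * g z.2)).
  have : intg P setT (fun z => f z.1 * g z.2 - (z.1 != z.2)%:R * (f z.1 * g z.2)).
    apply: integrableBr => //; first exact: itens.
    by apply: (@iB 1) => // z; case: eqP => _; rewrite ?normr1 ?normr0.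
  by apply: integrable_eq => // z _; case: eqP => _; rewrite /=; ring.
(* [fn] is 0 on the diagonal, where the original integrand is 0 too; the last term compensates for
   the constant ln e there, and its integral is 0 by [diag0]. *)
transitivity (\int[P]_z (2^-1 * fn n z - ln (en n) * (f z.1 * g z.2) +
    ln (en n) * ((z.1 == z.2)%:R * (f z.1 * g z.2)))).
  rewrite RintegralD//; [|by apply: integrableBr => //; apply: integrableZr => //; exact: itens
    |exact: integrableZr].
  rewrite RintegralB//; [|exact: integrableZr|by apply: integrableZr => //; exact: itens].
  rewrite !RintegralZl//; last exact: itens.
  by rewrite diag0// itens0// !mulr0 subr0 addr0.
apply: eq_Rint => z _; rewrite /fn; have [zz|zz] := eqVneq z.1 z.2.
  by rewrite zz subrr expr0n /= !mul0r !addr0 ln1; ring.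
have e2 : 0 < en n ^+ 2 by rewrite exprn_gt0.
have -> : 1 + (z.1 - z.2) ^+ 2 / en n ^+ 2 = (en n ^+ 2 + (z.1 - z.2) ^+ 2) / en n ^+ 2.
  by field; rewrite gt_eqF.
have l : ln (en n ^+ 2) = 2 * ln (en n) by rewrite expr2 lnM ?posrE//; ring.
by rewrite ln_div ?posrE ?ltr_wpDr ?sqr_ge0// l /=; field.
Qed.

(** The damped integrands increase as the damping decreases. Nonnegativity of [N] is essential,
    which is why it is applied to a single charge first. *)
Let Nlim (N : R -> R) l : (forall k, 0 < k -> 0 <= N k) ->
  (forall n, intg leb D (fun k => E (en n) k * (N k / k))) ->
  \int[leb]_(k in D) (E (en n) k * (N k / k)) @[n --> \oo] --> l ->
  intg leb D (fun k => N k / k) /\ \int[leb]_(k in D) (N k / k) = l.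
Proof.
move=> N0 iN; apply: monotone_cvg_Rintegral => //.
- by move=> n k /D0 k0; rewrite mulr_ge0 ?expR_ge0// divr_ge0 ?N0// ltW.
- move=> k /D0 k0; apply/nondecreasing_seqP => n.
  rewrite ler_wpM2r ?divr_ge0 ?N0 ?(ltW k0)// ler_expR lerN2 ler_wpM2r ?(ltW k0)//.
  by rewrite /en lef_pV2 ?posrE// ler_nat.
- move=> k _; rewrite -[X in _ --> X]mul1r; apply: cvgM; last exact: cvg_cst.
  have -> : 1 = expR (- (0 * k)) by rewrite mul0r oppr0 expR0.
  apply: (@cvg_comp _ _ _ (fun n => - (en n * k)) (@expR R) _ (nbhs (- (0 * k) : R))).
    by apply: cvgN; apply: cvgM; [exact: encvg|exact: cvg_cst].
  exact: continuous_expR.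
Qed.

Let Xself f : charge f -> intg leb D (fun k => X f f k / k) /\
  \int[leb]_(k in D) (X f f k / k) = - logform f f.
Proof.
move=> cf; have [i c] := Xlim cf cf; apply: Nlim => // k _.
by rewrite /X -!expr2 addr_ge0 ?sqr_ge0.
Qed.

Let XD f g k : charge f -> charge g ->
  X (fun x => f x + g x) (fun x => f x + g x) k = X f f k + 2 * X f g k + X g g k.
Proof.
move=> cf cg; have [i1 i2] := itrig k cf; have [i3 i4] := itrig k cg.
rewrite {1}/X.
have -> : cosint (fun x => f x + g x) k = cosint f k + cosint g k.
  by rewrite /cosint -RintegralD//; apply: eq_Rint => x _; rewrite mulrDr.
have -> : sinint (fun x => f x + g x) k = sinint f k + sinint g k.
  by rewrite /sinint -RintegralD//; apply: eq_Rint => x _; rewrite mulrDr.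
by rewrite /X; ring.
Qed.

(** Polarization: the product of transforms of two charges has no sign, but it is a combination of
    the densities of [f], [g] and [f + g], all nonnegative. *)
Let Xpair f g : charge f -> charge g -> intg leb D (fun k => X f g k / k) /\
  \int[leb]_(k in D) (X f g k / k) = - logform f g.
Proof.
move=> cf cg; have [if1 If] := Xself cf; have [ig Ig] := Xself cg.
have [e1 c1] := Xlim cf cf; have [e2 c2] := Xlim cf cg; have [e3 c3] := Xlim cg cg.
pose N k := X f f k + 2 * X f g k + X g g k.
have N0 k : 0 < k -> 0 <= N k.
  by move=> _; rewrite /N -XD// {1}/X -!expr2 addr_ge0 ?sqr_ge0.
have NE n k : E (en n) k * (N k / k) = E (en n) k * (X f f k / k) +
    2 * (E (en n) k * (X f g k / k)) + E (en n) k * (X g g k / k) by rewrite /N; ring.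
have i2 n : intg leb D (fun k => 2 * (E (en n) k * (X f g k / k))) by exact: integrableZr.
have i12 n : intg leb D (fun k => E (en n) k * (X f f k / k) + 2 * (E (en n) k * (X f g k / k))).
  exact: integrableDr.
have iN n : intg leb D (fun k => E (en n) k * (N k / k)).
  by apply: (integrable_eq mD _ (integrableDr mD (i12 n) (e3 n))) => k _; rewrite NE.
have cN : \int[leb]_(k in D) (E (en n) k * (N k / k)) @[n --> \oo] -->
    - logform f f + 2 * - logform f g + - logform g g.
  have c0 : (2 : R) @[_ --> \oo] --> (2 : R) by exact: cvg_cst.
  have cc := cvgD (cvgD c1 (cvgM c0 c2)) c3.
  apply: cvg_trans (cc _ _ _); apply: near_eq_cvg; apply: nearW => n /=.
  have -> : \int[leb]_(k in D) (E (en n) k * (N k / k)) =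
      \int[leb]_(k in D) (E (en n) k * (X f f k / k)) +
      2 * \int[leb]_(k in D) (E (en n) k * (X f g k / k)) +
      \int[leb]_(k in D) (E (en n) k * (X g g k / k)).
    rewrite -(RintegralZl 2 mD (e2 n)) -(RintegralD mD (e1 n) (i2 n)).
    by rewrite -(RintegralD mD (i12 n) (e3 n)); apply: eq_Rint => k _; exact: NE.
  by [].
have [iNk INk] := Nlim N0 iN cN.
have i1 : intg leb D (fun k => N k / k - X f f k / k) by exact: integrableBr.
have XE k : X f g k / k = 2^-1 * (N k / k - X f f k / k - X g g k / k) by rewrite /N; set v := k^-1; field.
split.
  apply: (integrable_eq mD _ (integrableZr 2^-1 mD (integrableBr mD i1 ig))) => k _.
  by rewrite -XE.
rewrite (@eq_Rint _ _ _ leb D _ _ (fun k _ => XE k)) (RintegralZl _ mD (integrableBr mD i1 ig)).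
rewrite (RintegralB mD i1 ig) (RintegralB mD iNk if1) INk If Ig.
by move: (logform f f) (logform f g) (logform g g) => a b c; field.
Qed.

Lemma cosint_div_integral f g : charge f -> charge g ->
  intg leb D (fun k => (cosint f k * cosint g k + sinint f k * sinint g k) / k) /\
  \int[leb]_(k in D) ((cosint f k * cosint g k + sinint f k * sinint g k) / k) = - logform f g.
Proof. exact: Xpair. Qed.

(** Measurability is inherited from the damped integrand, which [laplace_prod] shows integrable. *)
Let mY f g : charge f -> charge g -> measurable_fun D (fun k => Y f g k / k).
Proof.
move=> cf cg.
have L := laplace_prod ltr01 cf cg msin (@norm_sin_le R) (laplace_sinc ltr01).
have [i _] := L; have := integrable_measurable mD i => mi.
have mV : measurable_fun D (fun k : R => (E 1 k)^-1) by apply: measurable_funTS; rewrite /E; ms'.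
apply: (eq_measurable_fun (fun k => (E 1 k)^-1 * (E 1 k / k * \int[P]_z (sin (k * (z.1 - z.2)) * (f z.1 * g z.2))))).
  move=> k /set_mem/D0 k0; rewrite /Y sinint_cosint//; field.
  by rewrite (gt_eqF k0) gt_eqF ?expR_gt0.
exact: ms_M.
Qed.

Lemma norm_sinint_cosint_le f g k : charge f -> charge g ->
  `|sinint f k * cosint g k - cosint f k * sinint g k| <= 2^-1 *
  ((cosint f k * cosint f k + sinint f k * sinint f k) +
   (cosint g k * cosint g k + sinint g k * sinint g k)).
Proof.
move=> cf cg; rewrite ler_norml; apply/andP; split.
  have := sqr_ge0 (sinint f k + cosint g k); have := sqr_ge0 (cosint f k - sinint g k).
  by rewrite !expr2; nra.
have := sqr_ge0 (sinint f k - cosint g k); have := sqr_ge0 (cosint f k + sinint g k).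
by rewrite !expr2; nra.
Qed.

Lemma sinint_div_integrable f g : charge f -> charge g ->
  intg leb D (fun k => (sinint f k * cosint g k - cosint f k * sinint g k) / k).
Proof.
move=> cf cg; have [if1 _] := Xself cf; have [ig _] := Xself cg.
apply: (integrable_le mD (mY cf cg) _ (integrableZr 2^-1 mD (integrableDr mD if1 ig))).
move=> k /D0 k0; rewrite normrM normfV (gtr0_norm k0) -mulrDl mulrA ler_wpM2r ?invr_ge0 ?(ltW k0)//.
exact: norm_sinint_cosint_le.
Qed.

(** The uncertainty relation. In Fourier space the sign form is the integral of the sine part
    divided by k, which is bounded pointwise by half the sum of the two spectral densities. With
    damping, the sine part has the kernel atan (d / e), with limit (pi/2) sg d. *)
Lemma sgform_le f g : charge f -> charge g ->
  pi * \int[leb]_x \int[leb]_y (Num.sg (x - y) * (f x * g y)) <= - logform f f - logform g g.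
Proof.
move=> cf cg; have mT : measurable [set: measurableTypeR R * measurableTypeR R] by exact: measurableT.
have [if1 If] := Xself cf; have [ig Ig] := Xself cg.
pose fn n (z : measurableTypeR R * measurableTypeR R) : R := atan ((z.1 - z.2) / en n) * (f z.1 * g z.2).
have p0 := pi_gt0 R.
have atb (x : R) : `|atan x| <= pi / 2.
  have h1 := atan_gtNpi2 x; have h2 := atan_ltpi2 x.
  by rewrite ler_norml (ltW h1) (ltW h2).
have isg : intg P setT (fun z => Num.sg (z.1 - z.2) * (f z.1 * g z.2)).
  apply: (@iB 1 (fun z => Num.sg (z.1 - z.2))) => //; first by ms'.
  by move=> z; rewrite normr_sg; case: eqP => _; rewrite /= ?ler01.
have mfn n : measurable_fun setT (fn n) by apply: ms_M; [ms'|exact: mtens].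
have fnb n z : setT z -> `|fn n z| <= pi / 2 * `|f z.1 * g z.2|.
  by move=> _; rewrite normrM ler_wpM2r.
have ib : intg P setT (fun z => pi / 2 * `|f z.1 * g z.2|).
  by apply: integrableZr => //; apply: integrable_norm; exact: itens.
have fnc (z : measurableTypeR R * measurableTypeR R) : setT z ->
    fn n z @[n --> \oo] --> pi / 2 * (Num.sg (z.1 - z.2) * (f z.1 * g z.2)).
  move=> _; rewrite mulrA; apply: cvgM; last exact: cvg_cst.
  set d := z.1 - z.2.
  (* [atan_compl_le] bounds the distance to the limit by [en n / x]. *)
  have pos (x : R) : 0 < x -> atan (x / en n) @[n --> \oo] --> pi / 2.
    move=> x0; have c : pi / 2 - (x / en n)^-1 @[n --> \oo] --> pi / 2 - x^-1 * 0.
      apply: cvgB; first exact: cvg_cst.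
      under eq_fun do rewrite invfM invrK.
      by apply: cvgM; [exact: cvg_cst|exact: encvg].
    rewrite mulr0 subr0 in c.
    apply: (@squeeze_cvgr _ _ _ _ (fun n => pi / 2 - (x / en n)^-1) (fun=> pi / 2)) => //; last exact: cvg_cst.
    apply: nearW => n; have y0 : 0 < x / en n by rewrite divr_gt0.
    rewrite (ltW (atan_ltpi2 _)) andbT lerBlDr -lerBlDl.
    rewrite -[X in _ <= X]mul1r ler_pdivlMr//; exact: atan_compl_le.
  have [d0|d0|->] := ltgtP d 0.
  - rewrite ltr0_sg// mulrN1.
    have := pos (- d); rewrite oppr_gt0 => /(_ d0) c.
    have -> : (fun n => atan (d / en n)) = (fun n => - atan (- d / en n)).
      by apply/funext => n; rewrite mulNr atanN opprK.
    exact: cvgN.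
  - by rewrite gtr0_sg// mulr1; exact: pos.
  - by rewrite sgr0 mulr0; under eq_fun do rewrite mul0r atan0; exact: cvg_cst.
have [_ c1] := dominated_cvg_Rintegral mT mfn fnc ib fnb.
rewrite RintegralZl// Rintegral_prod// in c1.
have hb n : \int[P]_z fn n z <= 2^-1 * (- logform f f - logform g g).
  have [i1 <-] := laplace_prod (en0 n) cf cg msin (@norm_sin_le R) (laplace_sinc (en0 n)).
  rewrite -If -Ig -(RintegralD mD if1 ig) -(RintegralZl 2^-1 mD (integrableDr mD if1 ig)).
  apply: ler_Rintegral => //; first by apply: integrableZr => //; exact: integrableDr.
  move=> k /D0 k0; rewrite -sinint_cosint// -mulrDl mulrA.
  rewrite mulrAC ler_wpM2r ?invr_ge0 ?(ltW k0)//.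
  apply: (le_trans (ler_norm _)); rewrite normrM (gtr0_norm (expR_gt0 _)).
  apply: le_trans (norm_sinint_cosint_le k cf cg); rewrite ler_piMl//.
  by rewrite /E -expR0 ler_expR oppr_le0 mulr_ge0// ltW.
have := @ler_cvg_to _ _ _ _ _ _ _ _ c1 (cvg_cst (2^-1 * (- logform f f - logform g g))).
move=> hh; have h2 : pi / 2 * \int[leb]_x \int[leb]_y (Num.sg (x - y) * (f x * g y)) <=
    2^-1 * (- logform f f - logform g g) by apply: hh; apply: nearW => n; exact: hb.
move: h2; move: (\int[leb]_x _) (logform f f) (logform g g) => I a b h2.
by rewrite -(ler_pM2l (_ : 0 < 2^-1))// mulrA [_^-1 * pi]mulrC.
Qed.

End Charges.

(** * The complex forms in terms of real double integrals *)

Section RealForms.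
Local Open Scope complex_scope.
Context (R : realType).
Local Notation leb := (@lebesgue_measure R).
Implicit Types (f g : R -> R).

Definition sgform f g : R := \int[leb]_x \int[leb]_y (Num.sg (x - y) * (f x * g y)).

Lemma sgform_integrable2 f g x : intg leb setT g ->
  intg leb setT (fun y => Num.sg (x - y) * (f x * g y)).
Proof.
move=> ig; have mg := integrable_measurable measurableT ig.
apply: (integrable_le _ _ _ (integrableZr `|f x| measurableT (integrable_norm ig))) => //; first by ms'.
by move=> y _; rewrite !normrM normr_sg ler_piMl ?mulr_ge0//; case: eqP.
Qed.

Lemma sgform_integrable12 f g : intg leb setT f -> intg leb setT g ->
  intg leb setT (fun x => \int[leb]_y (Num.sg (x - y) * (f x * g y))).
Proof.
move=> If ig; have mg := integrable_measurable measurableT ig.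
have mf := integrable_measurable measurableT If.
have mT : measurable [set: measurableTypeR R] by exact: measurableT.
have mF : measurable_fun setT (fun z : measurableTypeR R * measurableTypeR R =>
    Num.sg (z.1 - z.2) * (f z.1 * g z.2)).
  apply: ms_M; first by ms'.
  by apply: ms_M; [apply: (measurableT_comp mf)|apply: (measurableT_comp mg)].
have Fb x (y : measurableTypeR R) : [set: measurableTypeR R] x -> [set: measurableTypeR R] y ->
    `|Num.sg (x - y) * (f x * g y)| <= `|f x| * `|g y|.
  by move=> _ _; rewrite !normrM normr_sg ler_piMl ?mulr_ge0//; case: eqP.
exact: (@tensor_integrable12 _ _ _ _ R leb leb _ _ mT mT _ _ (integrable_norm If)
  (integrable_norm ig) _ mF Fb).
Qed.

Lemma eq_cintegral (E : set R) (f g : R -> R[i]) : f =1 g -> cintegral E f = cintegral E g.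
Proof. by move=> fg; congr cintegral; apply/funext. Qed.

Lemma Omega_sgform (f g : R -> R[i]) : cintegrable f -> cintegrable g ->
  Omega f g =
  (4^-1 * (sgform (fun x => complex.Re (f x)) (fun x => complex.Re (g x)) -
           sgform (fun x => complex.Im (f x)) (fun x => complex.Im (g x)))) +i*
  (4^-1 * (sgform (fun x => complex.Re (f x)) (fun x => complex.Im (g x)) +
           sgform (fun x => complex.Im (f x)) (fun x => complex.Re (g x)))).
Proof.
move=> [f1 f2] [g1 g2]; rewrite /Omega.
have -> : cintegral setT (fun x => cintegral setT (fun x' => (Num.sg (x - x'))%:C * f x * g x')) =
  (sgform (fun x => complex.Re (f x)) (fun x => complex.Re (g x)) -
           sgform (fun x => complex.Im (f x)) (fun x => complex.Im (g x))) +i*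
  (sgform (fun x => complex.Re (f x)) (fun x => complex.Im (g x)) +
           sgform (fun x => complex.Im (f x)) (fun x => complex.Re (g x))).
  rewrite [LHS](@eq_cintegral _ _ (fun x =>
    (\int[leb]_y (Num.sg (x - y) * (complex.Re (f x) * complex.Re (g y))) -
     \int[leb]_y (Num.sg (x - y) * (complex.Im (f x) * complex.Im (g y)))) +i*
    (\int[leb]_y (Num.sg (x - y) * (complex.Re (f x) * complex.Im (g y))) +
     \int[leb]_y (Num.sg (x - y) * (complex.Im (f x) * complex.Re (g y)))))); last first.
    move=> x; have j (u v : R -> R) := @sgform_integrable2 u v x.
    pose fr t := complex.Re (f t); pose fi t := complex.Im (f t).
    pose gr t := complex.Re (g t); pose gi t := complex.Im (g t).
    rewrite -RintegralB//; [|exact: (j fr gr g1)|exact: (j fi gi g2)].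
    rewrite -RintegralD//; [|exact: (j fr gi g2)|exact: (j fi gr g1)].
    rewrite /cintegral; congr (_ +i* _).
      by apply: eq_Rint => y _; case: (f x) (g y) => a b [c d] /=; ring.
    by apply: eq_Rint => y _; case: (f x) (g y) => a b [c d] /=; ring.
  have j := sgform_integrable12.
  rewrite /cintegral /= (RintegralB measurableT (j _ _ f1 g1) (j _ _ f2 g2)).
  by rewrite (RintegralD measurableT (j _ _ f1 g2) (j _ _ f2 g1)).
have -> : 4^-1 = (4^-1)%:C :> R[i] by rewrite fmorphV rmorph_nat.
have scale (r a b : R) : r%:C * (a +i* b) = (r * a) +i* (r * b).
  by apply/eqP; rewrite eq_complex /= !mul0r subr0 addr0 !eqxx.
exact: scale.
Qed.

Variables (h : R -> R) (M : R).
Hypotheses (h0 : forall x, 0 <= h x)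
  (hM : forall x, M < `|x| -> h x = 0) (M0 : 0 <= M) (ih : intg leb setT h)
  (lh : intg (leb \x leb)%E setT (fun z => ln `|z.1 - z.2| * (h z.1 * h z.2))).

Lemma cintegral_cexpi f g k : charge h f -> charge h g ->
  cintegral setT (fun x => cintegral setT (fun y => cexpi (k * (x - y)) * (f x)%:C * (g y)%:C)) =
  (cosint f k * cosint g k + sinint f k * sinint g k) +i*
  (sinint f k * cosint g k - cosint f k * sinint g k).
Proof.
move=> /(charge_integrable ih) If /(charge_integrable ih) Ig.
have it (u : R -> R) : intg leb setT u -> intg leb setT (fun x => cos (k * x) * u x) /\
    intg leb setT (fun x => sin (k * x) * u x).
  move=> iu; have mu := integrable_measurable measurableT iu.
  split; apply: (integrable_le _ _ _ (integrable_norm iu)) => //; try by ms'.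
    by move=> x _; rewrite normrM ler_piMl ?cos_max.
  by move=> x _; rewrite normrM ler_piMl ?sin_max.
have [i1 i2] := it f If; have [i3 i4] := it g Ig.
rewrite (@eq_cintegral _ _ (fun x =>
   (cos (k * x) * f x * cosint g k + sin (k * x) * f x * sinint g k) +i*
   (sin (k * x) * f x * cosint g k - cos (k * x) * f x * sinint g k))); last first.
  move=> x; rewrite /cosint /sinint -!(RintegralZl _ measurableT i3) -!(RintegralZl _ measurableT i4).
  rewrite -RintegralD// ?integrableZr// -RintegralB// ?integrableZr//.
  rewrite /cintegral /=; congr (_ +i* _).
    by apply: eq_Rint => y _; rewrite mulrBr cosB; ring.
  by apply: eq_Rint => y _; rewrite mulrBr sinB; ring.
have iZ (c : R) (u : R -> R) : intg leb setT u -> intg leb setT (fun x => u x * c).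
  by move=> iu; apply: (integrable_eq measurableT _ (integrableZr c measurableT iu)) => x _; rewrite mulrC.
have eZ (c : R) (u : R -> R) : intg leb setT u -> \int[leb]_x (u x * c) = (\int[leb]_x u x) * c.
  move=> iu; rewrite mulrC -(RintegralZl c measurableT iu).
  by apply: eq_Rint => x _; rewrite mulrC.
rewrite /cintegral /= RintegralD//; [|exact: iZ..]; rewrite RintegralB//; [|exact: iZ..].
by rewrite !eZ.
Qed.

Lemma cosintN f k : cosint f (- k) = cosint f k.
Proof. by apply: eq_Rint => x _; rewrite mulNr cosN. Qed.

Lemma sinintN f k : intg leb setT f -> sinint f (- k) = - sinint f k.
Proof.
move=> iu; have mu := integrable_measurable measurableT iu.
have i2 : intg leb setT (fun x => sin (k * x) * f x).
  apply: (integrable_le _ _ _ (integrable_norm iu)) => //; try by ms'.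
  by move=> x _; rewrite normrM ler_piMl ?sin_max.
by rewrite /sinint -RintegralN//; apply: eq_Rint => x _; rewrite mulNr sinN mulNr.
Qed.

Lemma even_ray_integral (u : R -> R) (c : R) : intg leb `]0, +oo[ (fun k : R => u k / k) ->
  measurable_fun setT (fun k : R => c * (2 * `|k|)^-1 * u k) ->
  (forall k, u (- k) = u k) ->
  \int[leb]_k (c * (2 * `|k|)^-1 * u k) = c * \int[leb]_(k in `]0, +oo[) (u k / k).
Proof.
move=> iu mu uN; have mD : measurable (`]0, +oo[%classic : set (measurableTypeR R)) by exact: measurable_itv.
have ic := integrableZr (c / 2) mD iu.
have e1 k : k \in `]0, +oo[ -> c / 2 * (u k / k) = c * (2 * `|k|)^-1 * u k.
  by rewrite in_itv /= andbT => k0; rewrite gtr0_norm//; field; rewrite gt_eqF.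
have i1 : intg leb `]0, +oo[ (fun k : R => c * (2 * `|k|)^-1 * u k).
  by apply: (integrable_eq mD _ ic) => k kD; apply: e1.
have i2 : intg leb setT (fun k : R => c * (2 * `|k|)^-1 * u k).
  apply: integrable_fold => //; apply: (integrable_eq mD _ i1) => k _.
  by rewrite normrN uN.
rewrite (Rintegral_fold i2) -(RintegralZl c mD iu).
apply: eq_Rint => k kD; rewrite normrN uN -e1//; first by set v := k^-1; field.
Qed.

Lemma odd_ray_integral (u : R -> R) (c : R) : intg leb `]0, +oo[ (fun k : R => u k / k) ->
  measurable_fun setT (fun k : R => c * (2 * `|k|)^-1 * u k) ->
  (forall k, u (- k) = - u k) -> \int[leb]_k (c * (2 * `|k|)^-1 * u k) = 0.
Proof.
move=> iu mu uN; have mD : measurable (`]0, +oo[%classic : set (measurableTypeR R)) by exact: measurable_itv.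
have ic := integrableZr (c / 2) mD iu.
have i1 : intg leb `]0, +oo[ (fun k : R => c * (2 * `|k|)^-1 * u k).
  apply: (integrable_eq mD _ ic) => k; rewrite /= in_itv /= andbT => k0.
  by rewrite gtr0_norm//; field; rewrite gt_eqF.
have i2 : intg leb setT (fun k : R => c * (2 * `|k|)^-1 * u k).
  apply: integrable_fold => //; apply: (integrable_eq mD _ (integrableNr i1)) => k _.
  by rewrite normrN uN mulrN.
rewrite (Rintegral_fold i2) (@eq_Rint _ _ _ leb _ _ (fun=> 0)) ?Rintegral_cst ?mul0r//.
by move=> k _; rewrite normrN uN mulrN subrr.
Qed.

(** Differentiation under the integral sign, with majorant [M |f|] because of the bounded support,
    gives continuity in [k]. *)
Let mtrig f : charge h f -> measurable_fun setT (cosint f) /\ measurable_fun setT (sinint f).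
Proof.
move=> cf; have If := charge_integrable ih cf; have mf := integrable_measurable measurableT If.
have mT : measurable [set: measurableTypeR R] by exact: measurableT.
have xf x : `|x * f x| <= M * `|f x|.
  have [_ [C hC] _] := cf; have [xM|xM] := ltP M `|x|; last by rewrite normrM ler_wpM2r.
  have -> : f x = 0 by apply/eqP; rewrite -normr_le0 (le_trans (hC x))// hM// mulr0.
  by rewrite mulr0 normr0 mulr0.
have iG : intg leb setT (fun x => M * `|f x|) by apply: integrableZr => //; exact: integrable_norm.
have der (F dF : R -> R) : (forall x, `|F x| <= 1) -> (forall x, `|dF x| <= 1) ->
    (forall x, is_derive (x : R) (1 : R) F (dF x)) ->
    measurable_fun setT (fun k : R => \int[leb]_x (F (k * x) * f x)).
  move=> F1 dF1 dFE; apply: continuous_measurable_fun => k0.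
  have mF : measurable_fun setT F.
    by apply: continuous_measurable_fun => x; exact: der_continuous (dFE x).
  have k1 : k0 - 1 < k0 < k0 + 1 by rewrite ltrDl ltrBlDr ltrDl ltr01.
  have i1 (k : R) : k0 - 1 < k < k0 + 1 -> intg leb setT (fun x => F (k * x) * f x).
    move=> _; apply: (integrable_le _ _ _ (integrable_norm If)) => //.
      by apply: ms_M => //; apply: (measurableT_comp mF); ms'.
    by move=> x _; rewrite normrM ler_piMl.
  have i2 (k x : R) : k0 - 1 < k < k0 + 1 -> setT x ->
      is_derive (k : R) (1 : R) (fun k => F (k * x) * f x) (dF (k * x) * (x * f x)).
    move=> _ _; have d1 : is_derive (k : R) (1 : R) (fun k : R => k * x) x.
      by derive_by; [der|cbv beta; ring].
    have d2 := @der_comp R k (fun k => k * x) F _ _ (dFE (k * x)) d1.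
    by derive_by; [der|cbv beta; ring].
  have i3 (k x : R) : k0 - 1 < k < k0 + 1 -> setT x -> `|dF (k * x) * (x * f x)| <= M * `|f x|.
    by move=> _ _; apply: le_trans (xf x); rewrite normrM ler_piMl.
  exact: der_continuous (@der_Rintegral _ _ _ leb setT (fun k x => F (k * x) * f x)
    (fun k x => dF (k * x) * (x * f x)) (fun x => M * `|f x|) _ _ k0 mT k1 i1 i2 i3 iG).
split.
  by apply: (der (@cos R) (fun x => - sin x)); [exact: cos_max|move=> x; rewrite normrN; exact: sin_max].
by apply: (der (@sin R) (@cos R)); [exact: sin_max|exact: cos_max].
Qed.

(** The cosine part is even in [k], so that 1 / (2 |k|) on the line becomes 1 / k on the positive
    ray and [cosint_div_integral] applies. The sine part is odd, and its integral vanishes. *)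
Lemma G_logform f g : charge h f -> charge h g ->
  G (fun x => (f x)%:C) (fun x => (g x)%:C) = (- (2 * pi)^-1 * logform f g)%:C.
Proof.
move=> cf cg; have If := charge_integrable ih cf; have Ig := charge_integrable ih cg.
have [ix Ix] := cosint_div_integral h0 hM M0 ih lh cf cg.
have iy := sinint_div_integrable h0 hM M0 ih lh cf cg.
have [mcf msf] := mtrig cf; have [mcg msg] := mtrig cg.
pose c : R := (2 * pi)^-1.
rewrite /G (@eq_cintegral _ _ (fun k =>
  (c * (2 * `|k|)^-1 * (cosint f k * cosint g k + sinint f k * sinint g k)) +i*
  (c * (2 * `|k|)^-1 * (sinint f k * cosint g k - cosint f k * sinint g k)))); last first.
  move=> k; rewrite (cintegral_cexpi k cf cg) /c; set r := _ * _^-1.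
  by apply/eqP; rewrite eq_complex /= !mul0r subr0 addr0 !eqxx.
rewrite /cintegral /= even_ray_integral//; first last.
- by move=> k; rewrite !cosintN !sinintN//; ring.
- by ms'.
rewrite Ix odd_ray_integral//; first last.
- by move=> k; rewrite !cosintN !sinintN//; ring.
- by ms'.
by rewrite mulrN mulNr.
Qed.

End RealForms.

(** * Sign form and kernel form of the modes *)

Section ProductCriterion.
Context d1 d2 (T1 : measurableType d1) (T2 : measurableType d2) (R : realType).
Variables (m1 : {sigma_finite_measure set T1 -> \bar R})
  (m2 : {sigma_finite_measure set T2 -> \bar R}).

Lemma iterated_integrable (F : T1 * T2 -> R) (g : T1 -> T2 -> R) (A : T1 -> R) :
  measurable_fun setT F -> (forall x y, `|F (x, y)| <= g x y) ->
  (forall x, intg m2 setT (g x)) -> (forall x, \int[m2]_y g x y <= A x) ->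
  intg m1 setT A -> intg (m1 \x m2)%E setT F.
Proof.
move=> mF Fg ig gA iA; apply/integrable12ltyP; first exact/measurable_EFinP.
have iF x : intg m2 setT (fun y => F (x, y)).
  apply: (integrable_le _ _ (fun y _ => Fg x y) (ig x)) => //.
  by apply: (measurableT_comp mF); exact: pair1_measurable.
have iA' : (\int[m1]_x (A x)%:E < +oo)%E by rewrite -EFin_Rintegral// ltry.
apply: le_lt_trans iA'; apply: ge0_le_integral => //.
- by move=> x _; exact: integral_ge0.
- apply: (@measurable_fun_fubini_tonelli_F _ _ _ _ _ _ (fun z => `|(F z)%:E|%E)) => //.
  by apply/measurableT_comp => //; exact/measurable_EFinP.
- by apply/measurable_EFinP; exact: integrable_measurable iA.
- move=> x _; apply: (@le_trans _ _ (\int[m2]_y (g x y)%:E)%E); last first.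
    by rewrite -EFin_Rintegral// lee_fin.
  apply: ge0_le_integral => //.
  + by apply/measurableT_comp => //; apply/measurable_EFinP; exact: integrable_measurable (iF x).
  + by apply/measurable_EFinP; exact: integrable_measurable (ig x).
  + by move=> y _; rewrite lee_fin.
Qed.

End ProductCriterion.

Section OffDiagonal.
Context (R : realType).
Local Notation leb := (@lebesgue_measure R).

Lemma indic1_integrable (x : measurableTypeR R) : intg leb setT (\1_[set x]).
Proof.
apply: ge0_integrable_lty => //.
rewrite integral_indic// setIT.
apply: (@le_lt_trans _ _ 0%E) => //.
by rewrite le_eqVlt; apply/orP; left; apply/eqP; exact: lebesgue_measure_set1.
Qed.

(** The value on the diagonal is added to the majorant as a multiple of the indicator of one point,
    which does not change the integrals of the sections. *)
Lemma iterated_integrable_offdiag (F : R * R -> R) (g : R -> R -> R) (A : R -> R) :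
  measurable_fun setT (F : measurableTypeR R * measurableTypeR R -> R) ->
  (forall x y, 0 <= g x y) -> (forall x y, x != y -> `|F (x, y)| <= g x y) ->
  (forall x, intg leb setT (g x)) -> (forall x, \int[leb]_y g x y <= A x) ->
  intg leb setT A -> intg (leb \x leb)%E setT F.
Proof.
move=> mF g0 Fg ig gA iA.
have mT : measurable [set: measurableTypeR R] by exact: measurableT.
have i1 x : intg leb setT (fun y => `|F (x, x)| * \1_[set x] y).
  by apply: integrableZr => //; exact: indic1_integrable.
apply: (@iterated_integrable _ _ _ _ R leb leb F (fun x y => g x y + `|F (x, x)| * \1_[set x] y) A) => //.
- move=> x y; have [->|xy] := eqVneq x y; last first.
    by rewrite (le_trans (Fg _ _ xy))// lerDl mulr_ge0// indicE; case: (_ \in _).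
  by rewrite indicE mem_set//= mulr1 lerDr.
- by move=> x; apply: integrableDr.
- move=> x; rewrite (RintegralD mT (ig x) (i1 x)).
  have -> : \int[leb]_y (`|F (x, x)| * \1_[set x] y) = 0.
    apply: Rintegral_singleton => u v; rewrite !indicE.
    case: (boolP (u \in [set x])) => [/set_mem -> _|_]; last by rewrite mulr0 eqxx.
    by case: (boolP (v \in [set x])) => [/set_mem -> //|_]; rewrite mulr0 eqxx.
  by rewrite addr0.
Qed.

End OffDiagonal.

(** * The sign form on the line *)

Section SignForm.
Context (R : realType).
Local Notation leb := (@lebesgue_measure R).
Implicit Types (f g : R -> R).

Let mT : measurable [set: measurableTypeR R]. Proof. exact: measurableT. Qed.

Let mF f g : intg leb setT f -> intg leb setT g ->
  measurable_fun setT (fun z : measurableTypeR R * measurableTypeR R =>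
    Num.sg (z.1 - z.2) * (f z.1 * g z.2)).
Proof.
move=> If ig; have mg := integrable_measurable measurableT ig.
have mf := integrable_measurable measurableT If.
apply: ms_M; first by ms'.
by apply: ms_M; [apply: (measurableT_comp mf)|apply: (measurableT_comp mg)].
Qed.

Lemma sgform_swap f g : intg leb setT f -> intg leb setT g ->
  sgform f g = \int[leb]_y \int[leb]_x (Num.sg (x - y) * (f x * g y)).
Proof.
move=> If ig.
have Fb (x y : measurableTypeR R) : [set: measurableTypeR R] x -> [set: measurableTypeR R] y ->
    `|Num.sg (x - y) * (f x * g y)| <= `|f x| * `|g y|.
  by move=> _ _; rewrite !normrM normr_sg ler_piMl ?mulr_ge0//; case: eqP.
exact: (@tensor_Fubini _ _ _ _ R leb leb _ _ mT mT _ _ (integrable_norm If)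
  (integrable_norm ig) _ (mF If ig) Fb).
Qed.

Lemma sgformC f g : intg leb setT f -> intg leb setT g -> sgform f g = - sgform g f.
Proof.
move=> If ig; rewrite sgform_swap// /sgform -RintegralN//; last exact: sgform_integrable12.
apply: eq_Rint => y _; rewrite -RintegralN//; last exact: sgform_integrable2.
by apply: eq_Rint => x _; rewrite -(opprB x y) sgrN mulNr [f x * _]mulrC opprK.
Qed.

Lemma sgformDl f1 f2 g : intg leb setT f1 -> intg leb setT f2 -> intg leb setT g ->
  sgform (fun x => f1 x + f2 x) g = sgform f1 g + sgform f2 g.
Proof.
move=> i1 i2 ig; rewrite /sgform -RintegralD//; [|exact: sgform_integrable12..].
apply: eq_Rint => x _; rewrite -RintegralD//; [|exact: sgform_integrable2..].
by apply: eq_Rint => y _; ring.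
Qed.

Lemma sgformZl c f g : intg leb setT f -> intg leb setT g ->
  sgform (fun x => c * f x) g = c * sgform f g.
Proof.
move=> i1 ig; rewrite /sgform -RintegralZl//; last exact: sgform_integrable12.
apply: eq_Rint => x _; rewrite -RintegralZl//; last exact: sgform_integrable2.
by apply: eq_Rint => y _; ring.
Qed.

Lemma sgformDr f g1 g2 : intg leb setT f -> intg leb setT g1 -> intg leb setT g2 ->
  sgform f (fun x => g1 x + g2 x) = sgform f g1 + sgform f g2.
Proof.
move=> i1 i2 i3; rewrite sgformC//; last exact: integrableDr.
by rewrite sgformDl// opprD -!sgformC.
Qed.

Lemma sgformZr c f g : intg leb setT f -> intg leb setT g ->
  sgform f (fun x => c * g x) = c * sgform f g.
Proof.
move=> i1 i2; rewrite sgformC//; last exact: integrableZr.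
by rewrite sgformZl// -mulrN -sgformC.
Qed.

Lemma sgform_opp f g : intg leb setT f -> intg leb setT g ->
  sgform (fun x => f (- x)) (fun x => g (- x)) = - sgform f g.
Proof.
move=> If ig; have mf := integrable_measurable measurableT If.
have mg := integrable_measurable measurableT ig.
have i2 := sgform_integrable12 If ig.
rewrite /sgform -RintegralN// -[RHS](Rintegral_opp); last first.
  by apply: ms_N; exact: (integrable_measurable measurableT i2).
apply: eq_Rint => x _; have i3 := @sgform_integrable2 R f g (- x) ig.
rewrite -RintegralN// -[RHS](Rintegral_opp); last first.
  by apply: ms_N; exact: (integrable_measurable measurableT i3).
by apply: eq_Rint => y _; rewrite -opprD sgrN mulNr opprK.
Qed.

(** sg (x - y) equals 1 - 2 on x <= y, 1 on x > y, corrected by 1 on the diagonal. Against a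
    function of integral 0, the constant part vanishes, the correction is carried by one point, and
    -2 times the primitive remains. *)
Lemma sgform_prim f g (M : R) : continuous f -> (forall u, `|f u| <= M * (ch u)^-1) ->
  \int[leb]_u f u = 0 -> intg leb setT g ->
  sgform f g = - 2 * \int[leb]_y (prim f y * g y).
Proof.
move=> cf fM f0 ig; have If := dominated_integrable cf fM.
have mg := integrable_measurable measurableT ig.
have mP : measurable_fun setT (prim f).
  by apply: continuous_measurable_fun => u; exact: der_continuous (der_prim cf fM u).
have Pb y : `|prim f y| <= M * (pi + 2).
  have M0 : 0 <= M.
    by have := le_trans (normr_ge0 _) (fM 0); rewrite pmulr_lge0// invr_gt0 ch_gt0.
  have Mp : 0 <= M * (pi + 2) by apply: mulr_ge0 => //; apply: addr_ge0 => //; exact: pi_ge0.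
  apply: (le_trans (norm_prim_le cf fM f0 y)); rewrite ler_piMr//.
  by rewrite invf_le1 ?ch_gt0 ?ch_ge1.
have iPg : intg leb setT (fun y => prim f y * g y).
  apply: (integrable_le _ _ _ (integrableZr (M * (pi + 2)) measurableT (integrable_norm ig))) => //.
    exact: ms_M.
  by move=> y _; rewrite normrM ler_wpM2r.
rewrite sgform_swap// -RintegralZl//; apply: eq_Rint => y _.
have is1 : intg leb setT (fun x => f x * \1_(`]-oo, y]%classic) x).
  apply: (integrable_le _ _ _ (integrable_norm If)) => //.
    apply: ms_M; first exact: (integrable_measurable measurableT If).
    exact: measurable_indic.
  by move=> x _; rewrite normrM ler_piMr// indicE; case: (_ \in _); rewrite ?normr1 ?normr0.
have is2 : intg leb setT (fun x => (x == y)%:R * f x).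
  have -> : (fun x : R => (x == y)%:R * f x) = (fun x => (1 - Num.sg (x - y) ^+ 2) * f x).
    apply/funext => x; rewrite sqr_sg subr_eq0.
    by case: eqP => _; rewrite /= ?subrr ?subr0.
  apply: (integrable_le _ _ _ (integrable_norm If)) => //.
    by apply: ms_M; [ms'|exact: (integrable_measurable measurableT If)].
  move=> x _; rewrite normrM ler_piMl// sqr_sg; case: (_ != _); rewrite ?subrr ?subr0 ?normr0 ?normr1//.
have e x : Num.sg (x - y) * (f x * g y) =
    g y * (f x - 2 * (f x * \1_(`]-oo, y]%classic) x) + (x == y)%:R * f x).
  rewrite indicE; have [xy|xy|->] := ltgtP x y.
  - rewrite ltr0_sg ?subr_lt0// mem_set /= ?in_itv /= ?(ltW xy)//; ring.
  - rewrite gtr0_sg ?subr_gt0// memNset /= ?in_itv /=; last by apply/negP; rewrite -ltNge.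
    ring.
  - rewrite subrr sgr0 mem_set /= ?in_itv /= ?lexx//; ring.
rewrite (@eq_Rint _ _ _ leb _ _ _ (fun x _ => e x)).
have i2 := integrableZr 2 measurableT is1.
have i3 := integrableBr measurableT If i2.
rewrite (RintegralZl _ measurableT (integrableDr measurableT i3 is2)).
rewrite (RintegralD measurableT i3 is2) (RintegralB measurableT If i2).
rewrite (RintegralZl _ measurableT is1) f0.
have -> : \int[leb]_x ((x == y)%:R * f x) = 0.
  apply: Rintegral_singleton => u v.
  by case: (eqVneq u y) => [->|]; [case: (eqVneq v y) => [->//|]|]; rewrite mul0r eqxx.
have -> : \int[leb]_x (f x * \1_(`]-oo, y]%classic) x) = prim f y.
  rewrite /prim [RHS]Rintegral_mkcond; apply: eq_Rint => x _; rewrite patchE indicE.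
  by case: (_ \in _); rewrite ?mulr1 ?mulr0.
ring.
Qed.

End SignForm.

(** * The form with the logarithmic kernel and the trigonometric modes *)

Section KernelForm.
Context (R : realType).
Local Notation leb := (@lebesgue_measure R).
Variable k : R.
Hypotheses (k0 : 0 < k) (k1 : k <= 1).
Implicit Types (f g : R -> R) (M s : R).

Definition kerform f g : R := \int[leb]_y ((\int[leb]_u (logker k u y * f u)) * g y).

(** Charges in the coordinate [u]. Continuity makes the primitive differentiable, and the bound by
    [1 / ch] makes it decay as well. *)
Definition ucharge f := [/\ continuous f, exists M, forall u, `|f u| <= M * (ch u)^-1 &
  \int[leb]_u f u = 0].

Lemma ucharge_integrable f : ucharge f -> intg leb setT f.
Proof. by move=> [cf [M fM] _]; exact: (dominated_integrable cf fM). Qed.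

Lemma uchargeD f g : ucharge f -> ucharge g -> ucharge (fun x => f x + g x).
Proof.
move=> uf ug; have If := ucharge_integrable uf; have Ig := ucharge_integrable ug.
have [cf [M fM] f0] := uf; have [cg [N gN] g0] := ug; split.
- by move=> x; apply: cvgD; [exact: cf|exact: cg].
- by exists (M + N) => u; rewrite mulrDl (le_trans (ler_normD _ _))// lerD.
- by rewrite RintegralD// f0 g0 addr0.
Qed.

Lemma uchargeZ c f : ucharge f -> ucharge (fun x => c * f x).
Proof.
move=> uf; have If := ucharge_integrable uf.
have [cf [M fM] f0] := uf; split.
- by move=> x; apply: cvgM; [exact: cvg_cst|exact: cf].
- by exists (`|c| * M) => u; rewrite normrM -mulrA ler_wpM2l.
- by rewrite RintegralZl// f0 mulr0.
Qed.

Let ism : measurable_fun setT (fun x : R => (Num.sqrt (sh `|x|))^-1).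
Proof. by ms'. Qed.

Let isi : intg leb setT (fun x => (Num.sqrt (sh `|x|))^-1).
Proof.
have i1 := @invsqrtsh_integrable R.
apply: integrable_fold => //.
  apply: (integrable_eq _ _ i1); first exact: measurable_itv.
  by move=> x; rewrite /= in_itv /= andbT => x0; rewrite gtr0_norm.
apply: (integrable_eq _ _ i1); first exact: measurable_itv.
by move=> x; rewrite /= in_itv /= andbT => x0; rewrite normrN gtr0_norm.
Qed.

Lemma sqrtsh_shift_integrable (u : R) :
  intg leb setT (fun y => (Num.sqrt (sh `|u - y|))^-1) /\
  \int[leb]_y (Num.sqrt (sh `|u - y|))^-1 = \int[leb]_x (Num.sqrt (sh `|x|))^-1.
Proof.
have e y : (Num.sqrt (sh `|u - y|))^-1 = (Num.sqrt (sh `|y + - u|))^-1 by rewrite -normrN opprB.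
split; last first.
  by rewrite -(Rintegral_shift (- u) ism); apply: eq_Rint => y _; rewrite e.
have := (integrable_shift (- u) ism).2 isi.
by apply: integrable_eq => // y _; rewrite -e.
Qed.

Let mker (f g : R -> R) : measurable_fun setT f -> measurable_fun setT g ->
  measurable_fun setT (fun z : measurableTypeR R * measurableTypeR R =>
    logker k z.1 z.2 * (f z.1 * g z.2)).
Proof.
move=> mf mg; apply: ms_M.
  by rewrite /logker /crossq /cweight; ms'; by [exact: measurable_fst|exact: measurable_snd].
by apply: ms_M; [apply: (measurableT_comp mf)|apply: (measurableT_comp mg)].
Qed.

Lemma norm_logker_tensor_le u y (r t M N : R) : 0 <= M -> 0 <= N -> u != y ->
  `|r| <= M * (ch u)^-1 -> `|t| <= N * (ch y)^-1 ->
  `|logker k u y * (r * t)| <=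
    4 * M * N * (Num.sqrt (ch u))^-1 * (Num.sqrt (sh `|u - y|))^-1.
Proof.
move=> M0 N0 uy rM tN; rewrite normrM [X in _ * X <= _]normrM.
have cc (x : R) : ch x = Num.sqrt (ch x) * Num.sqrt (ch x).
  by rewrite -expr2 sqr_sqrtr ?ltW ?ch_gt0.
have sc (x : R) : 0 < Num.sqrt (ch x) by rewrite sqrtr_gt0 ch_gt0.
have ss : 0 < Num.sqrt (sh `|u - y|) by rewrite sqrtr_gt0 sh_gt0// normr_gt0 subr_eq0.
have h1 := ler_pM (normr_ge0 _) (normr_ge0 _) rM tN.
have h2 := norm_logker_le k0 k1 uy.
apply: (le_trans (ler_pM (normr_ge0 _) (mulr_ge0 (normr_ge0 _) (normr_ge0 _)) h2 h1)).
have -> : 4 * Num.sqrt (ch u) * Num.sqrt (ch y) / Num.sqrt (sh `|u - y|) *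
    (M * (ch u)^-1 * (N * (ch y)^-1)) =
    4 * M * N * (Num.sqrt (ch u))^-1 * (Num.sqrt (sh `|u - y|))^-1 * (Num.sqrt (ch y))^-1.
  have zz (x : R) : (ch x)^-1 = (Num.sqrt (ch x))^-1 * (Num.sqrt (ch x))^-1 by rewrite -invfM -cc.
  by rewrite !zz; field; rewrite !gt_eqF.
rewrite ler_piMr ?mulr_ge0 ?invr_ge0 ?(ltW ss) ?(ltW (sc _))//.
rewrite invf_le1 ?sc//; rewrite -sqrtr1 ler_wsqrtr// ch_ge1//.
Qed.

(** The majorant depends on [y] through [u - y] only, so its integral over [y] is [(ch u)^(-1/2)]
    times a constant. *)
Lemma logker_tensor_integrable f g : ucharge f -> ucharge g ->
  intg (leb \x leb)%E setT (fun z => logker k z.1 z.2 * (f z.1 * g z.2)).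
Proof.
move=> uf ug; have If := ucharge_integrable uf; have Ig := ucharge_integrable ug.
have [_ [M fM] _] := uf; have [_ [N gN] _] := ug.
have M0 : 0 <= M by have := le_trans (normr_ge0 _) (fM 0); rewrite pmulr_lge0// invr_gt0 ch_gt0.
have N0 : 0 <= N by have := le_trans (normr_ge0 _) (gN 0); rewrite pmulr_lge0// invr_gt0 ch_gt0.
pose c := \int[leb]_x (Num.sqrt (sh `|x|))^-1.
have mT : measurable [set: measurableTypeR R] by exact: measurableT.
apply: (@iterated_integrable_offdiag R _
  (fun u y => 4 * M * N * (Num.sqrt (ch u))^-1 * (Num.sqrt (sh `|u - y|))^-1)
  (fun u => 4 * M * N * c * (Num.sqrt (ch u))^-1)).
- apply: mker; first exact: integrable_measurable If.
  exact: integrable_measurable Ig.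
- by move=> x y; rewrite !mulr_ge0 ?invr_ge0 ?sqrtr_ge0.
- by move=> x y xy /=; exact: norm_logker_tensor_le.
- by move=> x; apply: integrableZr => //; have [] := sqrtsh_shift_integrable x.
- move=> x; have [i1 i2] := sqrtsh_shift_integrable x.
  by rewrite (RintegralZl _ mT i1) i2 -/c le_eqVlt; apply/orP; left; apply/eqP; ring.
- by apply: integrableZr => //; exact: invsqrtch_integrable.
Qed.

Lemma kerform_prod f g : ucharge f -> ucharge g ->
  kerform f g = \int[(leb \x leb)%E]_z (logker k z.1 z.2 * (f z.1 * g z.2)).
Proof.
move=> uf ug; have [cf [M fM] _] := uf.
rewrite (Rintegral_prod2 (logker_tensor_integrable uf ug)) /kerform.
apply: eq_Rint => y _ /=; rewrite mulrC.
rewrite -(RintegralZl _ measurableT (logker_row_integrable k0 k1 cf fM y)).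
by apply: eq_Rint => u _; ring.
Qed.

Lemma kerformC f g : ucharge f -> ucharge g -> kerform f g = kerform g f.
Proof.
move=> uf ug; have [cg [M gM] _] := ug.
rewrite kerform_prod// (Rintegral_prod (logker_tensor_integrable uf ug)) /kerform.
apply: eq_Rint => y _ /=; rewrite mulrC.
rewrite -(RintegralZl _ measurableT (logker_row_integrable k0 k1 cg gM y)).
by apply: eq_Rint => u _; rewrite logkerC; ring.
Qed.

Lemma kerformDl f1 f2 g : ucharge f1 -> ucharge f2 -> ucharge g ->
  kerform (fun x => f1 x + f2 x) g = kerform f1 g + kerform f2 g.
Proof.
move=> u1 u2 ug; rewrite !kerform_prod//; last exact: uchargeD.
have i1 := logker_tensor_integrable u1 ug; have i2 := logker_tensor_integrable u2 ug.
by rewrite -RintegralD//; apply: eq_Rint => z _; ring.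
Qed.

Lemma kerformZl c f g : ucharge f -> ucharge g ->
  kerform (fun x => c * f x) g = c * kerform f g.
Proof.
move=> u1 ug; rewrite !kerform_prod//; last exact: uchargeZ.
have i1 := logker_tensor_integrable u1 ug.
by rewrite -RintegralZl//; apply: eq_Rint => z _; ring.
Qed.

Lemma kerformDr f g1 g2 : ucharge f -> ucharge g1 -> ucharge g2 ->
  kerform f (fun x => g1 x + g2 x) = kerform f g1 + kerform f g2.
Proof.
move=> uf u1 u2; rewrite kerformC//; last exact: uchargeD.
by rewrite kerformDl// kerformC// (kerformC u2).
Qed.

Lemma kerformZr c f g : ucharge f -> ucharge g ->
  kerform f (fun x => c * g x) = c * kerform f g.
Proof. by move=> uf ug; rewrite kerformC ?kerformZl//; [rewrite kerformC|exact: uchargeZ]. Qed.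

Definition cosmode s u := cos (s * u) * weight k u.
Definition sinmode s u := sin (s * u) * weight k u.

Let modeb (F : R -> R) s u : (forall x, `|F x| <= 1) ->
  `|F (s * u) * weight k u| <= k^-1 * (ch u)^-1.
Proof.
move=> F1; apply: le_trans (weight_le k0 k1 u).
by rewrite normrM (gtr0_norm (weight_gt0 k u)) ler_piMl// ltW// weight_gt0.
Qed.

Let modec s : continuous (cosmode s) /\ continuous (sinmode s).
Proof.
split=> u; have d := der_weight k u.
  by rewrite /cosmode; apply: der_continuous; der.
by rewrite /sinmode; apply: der_continuous; der.
Qed.

Lemma cosmode_ucharge s : \int[leb]_u cosmode s u = 0 -> ucharge (cosmode s).
Proof.
move=> h; split => //; first exact: (modec s).1.
by exists k^-1 => u; apply: modeb; exact: cos_max.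
Qed.

Lemma odd_integral0 (f : R -> R) : intg leb setT f -> (forall u, f (- u) = - f u) ->
  \int[leb]_u f u = 0.
Proof.
move=> If fN; have := Rintegral_opp (integrable_measurable measurableT If).
rewrite (@eq_Rint _ _ _ leb _ _ _ (fun u _ => fN u)) RintegralN// => h.
by move: h; set I := \int[leb]_u _; lra.
Qed.

Lemma sinmodeN s u : sinmode s (- u) = - sinmode s u.
Proof. by rewrite /sinmode mulrN sinN weightN mulNr. Qed.

Lemma cosmodeN s u : cosmode s (- u) = cosmode s u.
Proof. by rewrite /cosmode mulrN cosN weightN. Qed.

Lemma sinmode_ucharge s : ucharge (sinmode s).
Proof.
have b u : `|sinmode s u| <= k^-1 * (ch u)^-1 by apply: modeb; exact: sin_max.
split; [exact: (modec s).2|by exists k^-1|].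
apply: odd_integral0; first exact: (dominated_integrable (modec s).2 b).
exact: sinmodeN.
Qed.

Lemma kerform_cosmode f s : 0 < s -> ucharge f -> \int[leb]_u cosmode s u = 0 ->
  kerform f (cosmode s) = pi * tanh (pi * s) / 2 * sgform f (sinmode s).
Proof.
move=> s0 uf c0; have [cf [M fM] f0] := uf.
have := logker_potential 0 k0 k1 s0 cf fM f0; rewrite (sgform_prim cf fM f0); last first.
  exact: ucharge_integrable (sinmode_ucharge s).
have -> : \int[leb]_y (prim f y * weight k y * sin (s * y + 0)) = \int[leb]_y (prim f y * sinmode s y).
  by apply: eq_Rint => y _; rewrite addr0 /sinmode; ring.
set I := \int[leb]_y (prim f y * sinmode s y) => h.
transitivity (- (pi * tanh (pi * s)) * I); last by field.
by rewrite -h; apply: eq_Rint => y _; rewrite addr0.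
Qed.

(** The phase -pi/2 turns the cosine of [logker_potential] into a sine and its sine into minus a
    cosine; hence the sign. *)
Lemma kerform_sinmode f s : 0 < s -> ucharge f -> \int[leb]_u cosmode s u = 0 ->
  kerform f (sinmode s) = - (pi * tanh (pi * s) / 2 * sgform f (cosmode s)).
Proof.
move=> s0 uf c0; have [cf [M fM] f0] := uf.
have := logker_potential (- (pi / 2)) k0 k1 s0 cf fM f0; rewrite (sgform_prim cf fM f0); last first.
  exact: ucharge_integrable (cosmode_ucharge c0).
set I := \int[leb]_y (prim f y * cosmode s y) => h.
have e : \int[leb]_y (prim f y * weight k y * sin (s * y - pi / 2)) = - I.
  rewrite -RintegralN//; first by apply: eq_Rint => y _; rewrite sinBpihalf /cosmode; ring.
  have ic := ucharge_integrable (cosmode_ucharge c0).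
  have [C Cb] : exists C, forall y, `|prim f y| <= C.
    exists (M * (pi + 2)) => y; apply: (le_trans (norm_prim_le cf fM f0 y)).
    have M0 : 0 <= M by have := le_trans (normr_ge0 _) (fM 0); rewrite pmulr_lge0// invr_gt0 ch_gt0.
    have Mp : 0 <= M * (pi + 2) by apply: mulr_ge0 => //; apply: addr_ge0 => //; exact: pi_ge0.
    by rewrite ler_piMr// invf_le1 ?ch_gt0 ?ch_ge1.
  apply: (integrable_le _ _ _ (integrableZr C measurableT (integrable_norm ic))) => //.
    apply: ms_M; last exact: (integrable_measurable measurableT ic).
    by apply: continuous_measurable_fun => u; exact: der_continuous (der_prim cf fM u).
  by move=> y _; rewrite normrM ler_wpM2r.
transitivity (- (pi * tanh (pi * s)) * - I); last by field.
by rewrite -e -h; apply: eq_Rint => y _; rewrite cosBpihalf.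
Qed.

(** Reflection preserves the cosine modes and reverses the sign form. *)
Lemma sgform_cosmode s t : intg leb setT (cosmode s) -> intg leb setT (cosmode t) ->
  sgform (cosmode s) (cosmode t) = 0.
Proof.
move=> i1 i2; have := sgform_opp i1 i2.
have e r : (fun x => cosmode r (- x)) = cosmode r by apply/funext => x; exact: cosmodeN.
by rewrite !e; set I := sgform _ _; lra.
Qed.

Lemma sgform_sinmode s t : sgform (sinmode s) (sinmode t) = 0.
Proof.
have i1 := ucharge_integrable (sinmode_ucharge s); have i2 := ucharge_integrable (sinmode_ucharge t).
have := sgform_opp i1 i2.
have e r : (fun x => sinmode r (- x)) = (fun x => -1 * sinmode r x).
  by apply/funext => x; rewrite mulN1r; exact: sinmodeN.
rewrite !e sgformZl//; last exact: integrableZr.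
by rewrite sgformZr//; set I := sgform _ _; lra.
Qed.

Lemma tanh_gt0 (x : R) : 0 < x -> 0 < tanh x.
Proof.
by move=> x0; rewrite divr_gt0 ?subr_gt0 ?ltr_expR ?addr_gt0 ?expR_gt0//; lra.
Qed.

Lemma tanh_lt1 (x : R) : tanh x < 1.
Proof.
have h1 := expR_gt0 x; have h2 := expR_gt0 (- x).
by rewrite ltr_pdivrMr ?addr_gt0//; lra.
Qed.

Lemma tanh_inj : injective (@tanh R).
Proof.
move=> x y; rewrite /tanh !expRN; have := expR_gt0 x; have := expR_gt0 y.
set a := expR x; set b := expR y => b0 a0 h.
have ab : 0 < a + a^-1 by rewrite addr_gt0 ?invr_gt0.
have bb : 0 < b + b^-1 by rewrite addr_gt0 ?invr_gt0.
have : (a - a^-1) * (b + b^-1) = (b - b^-1) * (a + a^-1).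
  by move/eqP: h; rewrite (eqr_div _ _ (lt0r_neq0 ab) (lt0r_neq0 bb)) => /eqP.
have -> : (a - a^-1) * (b + b^-1) = (b - b^-1) * (a + a^-1) + 2 * (a ^+ 2 - b ^+ 2) / (a * b).
  by field; rewrite !gt_eqF.
move/eqP; rewrite -subr_eq0 addrAC subrr add0r mulf_eq0 invr_eq0 mulf_eq0.
rewrite pnatr_eq0 /= (gt_eqF (mulr_gt0 a0 b0)) orbF subr_eq0 eqrXn2 ?ltW// => /eqP.
by rewrite /a /b; exact: expR_inj.
Qed.

(** The hypotheses amount to [S a = T b] and [S b = T a], whence [S^2 a = T^2 a]. They are stated in
    the shape in which the symmetry of the kernel form delivers them. *)
Lemma two_relations (p T S a b : R) : p != 0 -> 0 < T -> 0 < S -> T != S ->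
  p * S / 2 * a = p * T / 2 * b -> - (p * S / 2 * - b) = - (p * T / 2 * - a) -> a = 0.
Proof.
move=> p0 T0 S0 TS e1 e3; rewrite !mulrN !opprK in e3.
have gen (A B C E : R) : p * A / 2 * B = p * C / 2 * E -> A * B = C * E.
  move=> h; apply: (mulfI p0); apply: (@mulIf _ 2^-1); first by rewrite invr_neq0.
  by transitivity (p * A / 2 * B); [ring|rewrite h; ring].
have h1 := gen _ _ _ _ e1; have h2 := gen _ _ _ _ e3.
have : (S ^+ 2 - T ^+ 2) * a = 0.
  transitivity (S * (S * a) - T * (T * a)); first by ring.
  by rewrite h1 -h2; ring.
move/eqP; rewrite mulf_eq0 subr_eq0 eqrXn2 ?ltW// eq_sym (negbTE TS) /=.
by move/eqP.
Qed.

(* The symmetry of the kernel form on cosines and on sines gives, with [T = tanh (pi s)] and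
   [S = tanh (pi t)], two linear relations whose determinant is [T^2 - S^2]. *)
Lemma sgform_orthogonal s t : 0 < s -> 0 < t -> s != t ->
  \int[leb]_u cosmode s u = 0 -> \int[leb]_u cosmode t u = 0 ->
  sgform (cosmode s) (sinmode t) = 0.
Proof.
move=> s0 t0 st cs ct; have us := cosmode_ucharge cs; have ut := cosmode_ucharge ct.
have vs := sinmode_ucharge s; have vt := sinmode_ucharge t.
have e1 := kerform_cosmode s0 ut cs; have e2 := kerform_cosmode t0 us ct.
have e3 := kerform_sinmode s0 vt cs; have e4 := kerform_sinmode t0 vs ct.
rewrite (kerformC ut us) e2 in e1; rewrite (kerformC vt vs) e4 in e3.
rewrite (sgformC (ucharge_integrable vs) (ucharge_integrable ut)) in e3.
rewrite (sgformC (ucharge_integrable vt) (ucharge_integrable us)) in e3.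
have T0 : 0 < tanh (pi * s) by exact: tanh_gt0 (mulr_gt0 (pi_gt0 R) s0).
have S0 : 0 < tanh (pi * t) by exact: tanh_gt0 (mulr_gt0 (pi_gt0 R) t0).
have TS : tanh (pi * s) != tanh (pi * t).
  by apply: contraNneq st => /tanh_inj/(mulfI (lt0r_neq0 (pi_gt0 R))) ->.
move: (sgform (cosmode s) (sinmode t)) (sgform (cosmode t) (sinmode s)) e1 e3 => a b e1 e3.
move: (tanh (pi * s)) (tanh (pi * t)) TS T0 S0 e1 e3 => T S TS T0 S0 e1 e3.
exact: (two_relations (lt0r_neq0 (pi_gt0 R)) T0 S0 TS e1 e3).
Qed.

(** The sum of the primitive at [v] and at [- v] is constant and tends to 0. The oddness makes the
    product of the primitive and the weight a charge, which is the test density in [sigma_lt0]. *)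
Lemma prim_cosmodeN s u : \int[leb]_u cosmode s u = 0 ->
  prim (cosmode s) (- u) = - prim (cosmode s) u.
Proof.
move=> c0; have [cc [M cM] _] := cosmode_ucharge c0.
pose F (v : R) := prim (cosmode s) v + prim (cosmode s) (- v).
have dF x : Num.min 0 u <= x <= Num.max 0 u -> is_derive (x : R) (1 : R) F 0.
  move=> _; have d1 := der_prim cc cM x.
  have d2 : is_derive (x : R) (1 : R) (fun x : R => - x) (-1) by derive_by; [der|].
  have d3 := @der_comp R x (fun x => - x) (prim (cosmode s)) _ _ (der_prim cc cM (- x)) d2.
  by rewrite /F; derive_by; [notypeclasses refine (derD d1 d3)|rewrite cosmodeN; ring].
have F0 : F 0 = 0.
  have dF' x : is_derive (x : R) (1 : R) F 0.
    have d1 := der_prim cc cM x.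
    have d2 : is_derive (x : R) (1 : R) (fun x : R => - x) (-1) by derive_by; [der|].
    have d3 := @der_comp R x (fun x => - x) (prim (cosmode s)) _ _ (der_prim cc cM (- x)) d2.
    by rewrite /F; derive_by; [notypeclasses refine (derD d1 d3)|rewrite cosmodeN; ring].
  have FE v : F 0 = F v by apply: der_0_const => x _; exact: dF'.
  have c1 : F v @[v --> +oo] --> (0 : R).
    apply: (@cvgr_pinfty0_sqrtsh _ _ (2 * (M * (pi + 2)))) => v v0.
    have M0 : 0 <= M by have := le_trans (normr_ge0 _) (cM 0); rewrite pmulr_lge0// invr_gt0 ch_gt0.
    have Mp : 0 <= M * (pi + 2) by apply: mulr_ge0 => //; apply: addr_ge0 => //; exact: pi_ge0.
    have h1 := norm_prim_le cc cM c0 v; have h2 := norm_prim_le cc cM c0 (- v).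
    rewrite chN in h2; apply: (le_trans (ler_normD _ _)); apply: (le_trans (lerD h1 h2)).
    move: Mp; set K := M * (pi + 2); clearbody K => Mp.
    have -> : K / ch v + K / ch v = 2 * K * (ch v)^-1 by ring.
    apply: ler_wpM2l; first by rewrite mulr_ge0.
    rewrite lef_pV2 ?posrE ?sqrtr_gt0 ?ch_gt0 ?sh_gt0//.
    rewrite -[X in _ <= X]gtr0_norm ?ch_gt0// -sqrtr_sqr ler_wsqrtr// expr2.
    have := sh_lt_ch v; rewrite (gtr0_norm (sh_gt0 v0)) => /ltW/le_trans; apply.
    by rewrite ler_peMr ?ch_ge1// ltW ?ch_gt0.
  have c2 : F v @[v --> +oo] --> F 0.
    by under eq_fun do rewrite -FE; exact: cvg_cst.
  by have := cvg_unique _ c2 c1; apply; exact: Rhausdorff.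
have := der_0_const dF; rewrite F0 /F => /esym/eqP.
by rewrite addr_eq0 -[X in X == _]opprK eqr_opp => /eqP.
Qed.

End KernelForm.

(** * Coordinates on the two intervals *)

Section Charts.
Context (R : realType).
Local Notation leb := (@lebesgue_measure R).
Variables (a1 a2 b1 b2 : R).
Hypotheses (ha : a1 < a2) (hab : a2 < b1) (hb : b1 < b2).

Let p1 := b1 - a1.
Let q1 := b1 - a2.
Let p2 := b2 - a1.
Let q2 := b2 - a2.
Let p1_gt0 : 0 < p1. Proof. by rewrite subr_gt0 (lt_trans ha). Qed.
Let q1_gt0 : 0 < q1. Proof. by rewrite subr_gt0. Qed.
Let p2_gt0 : 0 < p2. Proof. by rewrite subr_gt0 (lt_trans ha)// (lt_trans hab). Qed.
Let q2_gt0 : 0 < q2. Proof. by rewrite subr_gt0 (lt_trans hab). Qed.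
Let d_gt0 : 0 < a2 - a1. Proof. by rewrite subr_gt0. Qed.

Let eta := cross_ratio a1 a2 b1 b2.

Lemma cross_ratio_itv : 0 < eta < 1.
Proof.
have h : 0 < (b1 - a1) * (b2 - a2) by exact: mulr_gt0.
rewrite /eta /cross_ratio divr_gt0// ?mulr_gt0// ?subr_gt0//= ltr_pdivrMr// mul1r.
by have := mulr_gt0 q1_gt0 p2_gt0; rewrite /q1 /p2; nra.
Qed.

Definition kpar : R := Num.sqrt (1 - eta).
Local Notation k := kpar.

Lemma kpar2 : k ^+ 2 = q1 * p2 / (p1 * q2).
Proof.
have /andP[e0 e1] := cross_ratio_itv; rewrite sqr_sqrtr ?subr_ge0 ?(ltW e1)//.
rewrite /eta /cross_ratio /q1 /p2 /p1 /q2; field.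
by rewrite !gt_eqF.
Qed.

Lemma kpar_gt0 : 0 < k.
Proof. by have /andP[_ e1] := cross_ratio_itv; rewrite sqrtr_gt0 subr_gt0. Qed.

Lemma kpar_lt1 : k < 1.
Proof.
have /andP[e0 _] := cross_ratio_itv.
by rewrite -[X in _ < X]sqrtr1 ltr_sqrt// gtrBl.
Qed.

Let k0 := kpar_gt0.
Let k1 := ltW kpar_lt1.

(** With this scale the images -1/k and -k of [b1] and [b2] have product 1. The quadratic equation
    for [t] then has discriminant 4 e^u (1 + k^2 sinh^2 (u/2)), that is, the square of 2 e^(u/2)
    [cweight k u]. *)
Let y0 := k * p1 / q1.
Let y0_gt0 : 0 < y0. Proof. by rewrite divr_gt0// mulr_gt0. Qed.
Let q1y0 : q1 * y0 = k * p1. Proof. by rewrite /y0; field; rewrite gt_eqF. Qed.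
Let p2E : p2 = k * q2 * y0.
Proof.
transitivity (k ^+ 2 * q2 * p1 / q1); last by rewrite /y0; field; rewrite gt_eqF.
by rewrite kpar2; field; rewrite !gt_eqF.
Qed.

Let W := cweight k.
Let e u : R := expR (u / 2).
Let e_gt0 u : 0 < e u. Proof. exact: expR_gt0. Qed.
Let shE u : sh u = (e u - (e u)^-1) / 2.
Proof. by rewrite sh.unlock /e expRN. Qed.
Let chE' u : ch u = (e u + (e u)^-1) / 2.
Proof. by rewrite ch.unlock /e expRN. Qed.
Let e2 u : e u ^+ 2 = expR u.
Proof. by rewrite expr2 -expRD; congr expR; field. Qed.
Let eB u v : e (u - v) = e u / e v.
Proof. by rewrite /e mulrBl expRD expRN. Qed.

Let W_gt0 u : 0 < W u. Proof. exact: cweight_gt0. Qed.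
Let W2 u : W u ^+ 2 = 1 + k ^+ 2 * sh u ^+ 2. Proof. exact: cweight2. Qed.
Let W_gt_sh u : `|k * sh u| < W u.
Proof.
rewrite -(@ltr_pXn2r _ 2)// ?nnegrE ?(ltW (W_gt0 u))// W2 real_normK ?num_real//.
by rewrite exprMn ltrDr.
Qed.

(* The two roots [t] of [t (t + k) = e^u (1 + k t)], which is [omega (chart t) = u + upar0]. *)
Definition tparA u : R := e u * (W u + k * sh u).
Definition tparB u : R := e u * (k * sh u - W u).
Local Notation tA := tparA.
Local Notation tB := tparB.

Let tA_gt0 u : 0 < tA u.
Proof. by have := W_gt_sh u; rewrite ltr_norml => /andP[h1 h2]; rewrite mulr_gt0//; lra. Qed.

Let tB_lt0 u : tB u < 0.
Proof. by have := W_gt_sh u; rewrite ltr_norml => /andP[h1 h2]; rewrite pmulr_rlt0//; lra. Qed.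

Let tAB u : tA u * tB u = - expR u.
Proof.
rewrite /tA /tB -e2; transitivity (e u ^+ 2 * (k ^+ 2 * sh u ^+ 2 - W u ^+ 2)); first by ring.
by rewrite W2; ring.
Qed.

Let tADB u : tA u + tB u = k * (expR u - 1).
Proof.
rewrite /tA /tB -e2 shE; field; exact: lt0r_neq0.
Qed.

Let kt1 u : (1 + k * tA u) * (1 + k * tB u) = 1 - k ^+ 2.
Proof.
transitivity (1 + k * (tA u + tB u) + k ^+ 2 * (tA u * tB u)); first by ring.
by rewrite tAB tADB; ring.
Qed.

Let ktA u : 0 < 1 + k * tA u. Proof. by rewrite addr_gt0// mulr_gt0. Qed.

Let k2lt1 : 0 < 1 - k ^+ 2.
Proof. by rewrite subr_gt0 expr_lt1// ?kpar_lt1// ltW. Qed.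

Let ktB u : 0 < 1 + k * tB u.
Proof. by rewrite -(pmulr_rgt0 _ (ktA u)) kt1. Qed.

Let rootA u : tA u * (tA u + k) = expR u * (1 + k * tA u).
Proof.
have h : tB u = k * (expR u - 1) - tA u by rewrite -tADB; ring.
have := tAB u; rewrite h => h2; apply/eqP; rewrite -subr_eq0; apply/eqP.
transitivity (- (tA u * (k * (expR u - 1) - tA u)) - expR u); first by ring.
by rewrite h2; ring.
Qed.

Let rootB u : tB u * (tB u + k) = expR u * (1 + k * tB u).
Proof.
have h : tA u = k * (expR u - 1) - tB u by rewrite -tADB; ring.
have := tAB u; rewrite h => h2; apply/eqP; rewrite -subr_eq0; apply/eqP.
transitivity (- ((k * (expR u - 1) - tB u) * tB u) - expR u); first by ring.
by rewrite h2; ring.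
Qed.

Let tBk u : tB u + k < 0.
Proof.
have h : 0 < tB u * (tB u + k) by rewrite rootB mulr_gt0 ?expR_gt0.
by rewrite -(nmulr_rgt0 _ (tB_lt0 u)).
Qed.

Let ytA u : 0 < 1 + y0 * tA u. Proof. by rewrite addr_gt0// mulr_gt0. Qed.
Let y0k : 1 < y0 * k.
Proof.
have -> : y0 * k = p2 / q2 by rewrite p2E; field; rewrite gt_eqF.
by rewrite ltr_pdivlMr// mul1r /p2 /q2 ltrD2l ltrN2.
Qed.

Let ytB u : 1 + y0 * tB u < 0.
Proof.
have h : y0 * (tB u + k) < 0 by rewrite pmulr_rlt0.
by move: h y0k; rewrite mulrDr; lra.
Qed.

(* The Moebius coordinate in which [a1, a2, b1, b2] are [0, oo, -1/k, -k]. *)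
Definition chart t : R := (a1 + a2 * (y0 * t)) / (1 + y0 * t).
Definition chartA u := chart (tA u).
Definition chartB u := chart (tB u).

Section ChartAt.
Variable t : R.
Hypothesis yt : 1 + y0 * t != 0.

Let chart_a1 : chart t - a1 = (a2 - a1) * (y0 * t) / (1 + y0 * t).
Proof. by rewrite /chart; field. Qed.
Let chart_a2 : chart t - a2 = - ((a2 - a1) / (1 + y0 * t)).
Proof. by rewrite /chart; field. Qed.
Let chart_b1 : chart t - b1 = - (p1 * (1 + k * t) / (1 + y0 * t)).
Proof.
have -> : p1 * (1 + k * t) = p1 + (k * p1) * t by ring.
by rewrite -q1y0 /chart /p1 /q1; field.
Qed.
Let chart_b2 : chart t - b2 = - (q2 * y0 * (t + k) / (1 + y0 * t)).
Proof.
have -> : q2 * y0 * (t + k) = q2 * y0 * t + k * q2 * y0 by ring.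
by rewrite -p2E /chart /p2 /q2; field.
Qed.

Lemma chart_itvA : 0 < t -> chart t \in `]a1, a2[.
Proof.
move=> t0; have h : 0 < 1 + y0 * t by rewrite addr_gt0// mulr_gt0.
rewrite in_itv /= -subr_gt0 chart_a1 (divr_gt0 (mulr_gt0 d_gt0 (mulr_gt0 y0_gt0 t0)) h)/=.
by rewrite -subr_lt0 chart_a2 oppr_lt0 divr_gt0.
Qed.

Lemma chart_itvB : 0 < 1 + k * t -> t + k < 0 -> 1 + y0 * t < 0 -> chart t \in `]b1, b2[.
Proof.
move=> h1 h2 h3; rewrite in_itv /= -subr_gt0 chart_b1 -mulrN -invrN divr_gt0 ?mulr_gt0 ?oppr_gt0//=.
rewrite -subr_lt0 chart_b2 oppr_lt0.
have -> : q2 * y0 * (t + k) / (1 + y0 * t) = q2 * y0 * (- (t + k)) / (- (1 + y0 * t)).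
  by rewrite mulrN invrN mulrNN.
have g2 : 0 < - (t + k) by rewrite oppr_gt0.
have g3 : 0 < - (1 + y0 * t) by rewrite oppr_gt0.
exact: (divr_gt0 (mulr_gt0 (mulr_gt0 q2_gt0 y0_gt0) g2) g3).
Qed.

Variable E : R.
Hypotheses (E0 : 0 < E) (tE : t * (t + k) = E * (1 + k * t)) (kt : 0 < 1 + k * t).

Lemma omega_arg : - ((chart t - a1) / (chart t - a2) * ((chart t - b2) / (chart t - b1))) = p2 / q1 * E.
Proof.
have t0 : t != 0.
  by apply/eqP => t0; move: tE; rewrite t0 mul0r mulr0 addr0 mulr1 => /esym/eqP; rewrite gt_eqF.
have h := lt0r_neq0 kt.
have -> : E = t * (t + k) / (1 + k * t) by rewrite tE mulfK.
rewrite chart_a1 chart_a2 chart_b1 chart_b2 p2E.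
have -> : q1 = k * p1 / y0 by rewrite -q1y0 mulfK// gt_eqF.
field; rewrite h yt !gt_eqF//.
Qed.

(** Up to the factors of the Moebius map the radicand is [t (t + k) (1 + k t)], which [tE] turns
    into [E (1 + k t)^2]. *)
Lemma Dfun_chart : Dfun a1 a2 b1 b2 (chart t) =
  (a2 - a1) / (1 + y0 * t) ^+ 2 * y0 * Num.sqrt (p1 * q2) * Num.sqrt E * (1 + k * t).
Proof.
have pq : 0 < p1 * q2 by rewrite mulr_gt0.
rewrite /Dfun -mulrN; set Z := (X in _ = X).
have Z0 : 0 <= Z.
  apply: mulr_ge0 (ltW kt); apply: mulr_ge0 (sqrtr_ge0 _); apply: mulr_ge0 (sqrtr_ge0 _).
  by apply: mulr_ge0 (ltW y0_gt0); apply: divr_ge0 (ltW d_gt0) (sqr_ge0 _).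
rewrite -[Z]ger0_norm// -sqrtr_sqr; congr Num.sqrt.
have -> : Z ^+ 2 = ((a2 - a1) / (1 + y0 * t) ^+ 2 * y0 * (1 + k * t)) ^+ 2 *
    (Num.sqrt (p1 * q2) ^+ 2) * (Num.sqrt E ^+ 2) by rewrite /Z; ring.
rewrite !sqr_sqrtr ?(ltW pq) ?(ltW E0)//.
transitivity (((a2 - a1) / (1 + y0 * t) ^+ 2 * y0) ^+ 2 * (1 + k * t) * (p1 * q2) * (E * (1 + k * t))); last by ring.
rewrite -tE chart_a1 chart_a2 chart_b1 chart_b2; field.
exact: yt.
Qed.

End ChartAt.

Let ytA0 u : 1 + y0 * tA u != 0. Proof. exact: lt0r_neq0. Qed.
Let ytB0 u : 1 + y0 * tB u != 0. Proof. exact: ltr0_neq0. Qed.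

Lemma chartA_itv u : chartA u \in `]a1, a2[.
Proof. exact: chart_itvA. Qed.

Lemma chartB_itv u : chartB u \in `]b1, b2[.
Proof. exact: chart_itvB. Qed.

(** The shift is the same for both roots, because [omega_arg] depends on [t] through the quadratic
    equation only. *)
Definition upar0 : R := ln (p2 / q1).
Local Notation u0 := upar0.

Let E0_gt0 : 0 < p2 / q1. Proof. by rewrite divr_gt0. Qed.

Lemma omega_chartA u : omega a1 a2 b1 b2 (chartA u) = u + u0.
Proof.
rewrite /omega (omega_arg (ytA0 u) (expR_gt0 u) (rootA u) (ktA u)) lnM ?posrE ?expR_gt0// expRK.
by rewrite addrC.
Qed.

Lemma omega_chartB u : omega a1 a2 b1 b2 (chartB u) = u + u0.
Proof.
rewrite /omega (omega_arg (ytB0 u) (expR_gt0 u) (rootB u) (ktB u)) lnM ?posrE ?expR_gt0// expRK.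
by rewrite addrC.
Qed.

Definition kappa : R := (2 * Num.sqrt (p1 * q2))^-1.

Lemma kappa_gt0 : 0 < kappa.
Proof. by rewrite invr_gt0 mulr_gt0// sqrtr_gt0 mulr_gt0. Qed.

Definition densA u : R := kappa * Dfun a1 a2 b1 b2 (chartA u) * weight k u.
Definition densB u : R := kappa * Dfun a1 a2 b1 b2 (chartB u) * weight k u.

Let sqrtE u : Num.sqrt (expR u) = e u.
Proof. by rewrite -e2 sqrtr_sqr gtr0_norm. Qed.

Let pq_neq0 : Num.sqrt (p1 * q2) != 0.
Proof. by rewrite gt_eqF// sqrtr_gt0 mulr_gt0. Qed.

Lemma densAE u : densA u = (a2 - a1) * y0 / (1 + y0 * tA u) ^+ 2 * (e u * (1 + k * tA u) / (2 * W u)).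
Proof.
rewrite /densA /chartA (Dfun_chart (ytA0 u) (expR_gt0 u) (rootA u) (ktA u)) sqrtE /kappa /weight -/W.
by field; rewrite pq_neq0 ytA0 gt_eqF.
Qed.

Lemma densBE u : densB u = (a2 - a1) * y0 / (1 + y0 * tB u) ^+ 2 * (e u * (1 + k * tB u) / (2 * W u)).
Proof.
rewrite /densB /chartB (Dfun_chart (ytB0 u) (expR_gt0 u) (rootB u) (ktB u)) sqrtE /kappa /weight -/W.
by field; rewrite pq_neq0 ytB0 gt_eqF.
Qed.

Let de u : is_derive (u : R) (1 : R) e (e u / 2).
Proof. by rewrite /e; derive_by; [der|cbv beta; field]. Qed.

Let dW u : is_derive (u : R) (1 : R) W (k ^+ 2 * sh u * ch u / (2 * W u)).
Proof. exact: der_cweight. Qed.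

Let ech u : e u = ch u + sh u.
Proof. by rewrite chE' shE; field; exact: lt0r_neq0. Qed.

Let dtA u : is_derive (u : R) (1 : R) tA (e u * (1 + k * tA u) / (2 * W u)).
Proof.
have d1 := de u; have d2 := dW u; have d3 := der_sh1 u; have w0 := lt0r_neq0 (W_gt0 u).
rewrite /tparA; derive_by; first by der.
cbv beta; have h := W2 u; rewrite ech.
transitivity ((ch u + sh u) / (2 * W u) * (W u ^+ 2 + k * W u * (ch u + sh u) + k ^+ 2 * sh u * ch u)).
  by field.
by rewrite h; field.
Qed.

Let dtB u : is_derive (u : R) (1 : R) tB (- (e u * (1 + k * tB u) / (2 * W u))).
Proof.
have d1 := de u; have d2 := dW u; have d3 := der_sh1 u; have w0 := lt0r_neq0 (W_gt0 u).
rewrite /tparB; derive_by; first by der.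
cbv beta; have h := W2 u; rewrite ech.
transitivity (- (ch u + sh u) / (2 * W u) * (W u ^+ 2 - k * W u * (ch u + sh u) + k ^+ 2 * sh u * ch u)).
  by field.
by rewrite h; field.
Qed.

Lemma der_chartA u : is_derive (u : R) (1 : R) chartA (densA u).
Proof.
have d1 := dtA u; have h := ytA0 u; rewrite /chartA /chart.
by derive_by; [der|cbv beta; rewrite densAE; field; rewrite h gt_eqF].
Qed.

Lemma der_chartB u : is_derive (u : R) (1 : R) chartB (- densB u).
Proof.
have d1 := dtB u; have h := ytB0 u; rewrite /chartB /chart.
by derive_by; [der|cbv beta; rewrite densBE; field; rewrite h gt_eqF].
Qed.

Lemma continuous_densA : continuous densA.
Proof.
have -> : densA = fun u => (a2 - a1) * y0 / (1 + y0 * tA u) ^+ 2 * (e u * (1 + k * tA u) / (2 * W u)).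
  by apply/funext => u; exact: densAE.
move=> u; have c1 : continuous_at u tA by exact: der_continuous (dtA u).
have c2 : continuous_at u e by exact: der_continuous (de u).
have c3 : continuous_at u W by exact: der_continuous (dW u).
apply: cvgM; first (apply: cvgM; first exact: cvg_cst).
  apply: cvgV; first by rewrite expf_neq0.
  by apply: cvgM; (apply: cvgD; [exact: cvg_cst|apply: cvgM => //; exact: cvg_cst]).
apply: cvgM.
  by apply: cvgM => //; apply: cvgD; [exact: cvg_cst|apply: cvgM => //; exact: cvg_cst].
apply: cvgV; first by rewrite mulf_neq0// gt_eqF.
by apply: cvgM => //; exact: cvg_cst.
Qed.

Lemma continuous_densB : continuous densB.
Proof.
have -> : densB = fun u => (a2 - a1) * y0 / (1 + y0 * tB u) ^+ 2 * (e u * (1 + k * tB u) / (2 * W u)).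
  by apply/funext => u; exact: densBE.
move=> u; have c1 : continuous_at u tB by exact: der_continuous (dtB u).
have c2 : continuous_at u e by exact: der_continuous (de u).
have c3 : continuous_at u W by exact: der_continuous (dW u).
apply: cvgM; first (apply: cvgM; first exact: cvg_cst).
  apply: cvgV; first by rewrite expf_neq0.
  by apply: cvgM; (apply: cvgD; [exact: cvg_cst|apply: cvgM => //; exact: cvg_cst]).
apply: cvgM.
  by apply: cvgM => //; apply: cvgD; [exact: cvg_cst|apply: cvgM => //; exact: cvg_cst].
apply: cvgV; first by rewrite mulf_neq0// gt_eqF.
by apply: cvgM => //; exact: cvg_cst.
Qed.

Lemma densA_gt0 u : 0 < densA u.
Proof.
rewrite densAE; apply: mulr_gt0; first exact: divr_gt0 (mulr_gt0 d_gt0 y0_gt0) (exprn_gt0 _ (ytA u)).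
by rewrite divr_gt0 ?mulr_gt0.
Qed.

Lemma densB_gt0 u : 0 < densB u.
Proof.
rewrite densBE; apply: mulr_gt0.
  apply: divr_gt0 (mulr_gt0 d_gt0 y0_gt0) _.
  by rewrite -sqrrN exprn_gt0// oppr_gt0.
by rewrite divr_gt0 ?mulr_gt0.
Qed.

Let chart_inj x : x != a2 -> x != a1 -> chart ((x - a1) / (a2 - x) / y0) = x.
Proof.
move=> xa2 xa1; have h : a2 - x != 0 by rewrite subr_eq0 eq_sym.
have y0n := lt0r_neq0 y0_gt0.
have yE : y0 * ((x - a1) / (a2 - x) / y0) = (x - a1) / (a2 - x) by rewrite mulrC divfK.
rewrite /chart yE.
have h2 : a2 - a1 != 0 by rewrite gt_eqF.
have -> : 1 + (x - a1) / (a2 - x) = (a2 - a1) / (a2 - x) by field.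
by field; rewrite h h2.
Qed.

Let root_cases u t : t * (t + k) = expR u * (1 + k * t) -> t = tA u \/ t = tB u.
Proof.
move=> tE; have : (t - tA u) * (t - tB u) = 0.
  transitivity (t * t - (tA u + tB u) * t + tA u * tB u); first by ring.
  rewrite tADB tAB.
  transitivity (t * (t + k) - expR u * (1 + k * t)); first by ring.
  by rewrite tE subrr.
by move/eqP; rewrite mulf_eq0 !subr_eq0 => /orP[] /eqP; [left|right].
Qed.

Let omega_root x (t := (x - a1) / (a2 - x) / y0) : x != a1 -> x != a2 -> x != b1 ->
  0 < - ((x - a1) / (x - a2) * ((x - b2) / (x - b1))) ->
  t * (t + k) = expR (omega a1 a2 b1 b2 x - u0) * (1 + k * t).
Proof.
move=> xa1 xa2 xb1 pos.
have h1 : a2 - x != 0 by rewrite subr_eq0 eq_sym.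
have h2 : x - a2 != 0 by rewrite subr_eq0.
have h3 : x - b1 != 0 by rewrite subr_eq0.
have y0n := lt0r_neq0 y0_gt0; have p1n := lt0r_neq0 p1_gt0.
rewrite expRD expRN /omega lnK ?posrE// /u0 lnK ?posrE//.
have -> : t * (t + k) = (x - a1) * (y0 * t + y0 * k) / ((a2 - x) * y0 ^+ 2).
  by rewrite /t; field; rewrite h1 y0n.
have ky : k = q1 * y0 / p1 by rewrite q1y0 mulfK.
have -> : y0 * k = p2 / q2 by rewrite p2E; field; rewrite gt_eqF.
have -> : y0 ^+ 2 = p1 * p2 / (q1 * q2).
  have -> : y0 ^+ 2 = k ^+ 2 * p1 ^+ 2 / q1 ^+ 2 by rewrite /y0; field; rewrite gt_eqF.
  by rewrite kpar2; field; rewrite !gt_eqF.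
rewrite [in RHS]ky.
have -> : y0 * t = (x - a1) / (a2 - x) by rewrite /t; field; rewrite h1 y0n.
have -> : q1 * y0 / p1 * t = q1 * ((x - a1) / (a2 - x)) / p1 by rewrite /t; field; rewrite h1 y0n p1n.
rewrite /p1 /q1 /p2 /q2 in p1n *; field.
have g1 := lt0r_neq0 q1_gt0; have g2 := lt0r_neq0 p2_gt0; have g3 := lt0r_neq0 q2_gt0.
by rewrite /q1 /p2 /q2 in g1 g2 g3; rewrite h1 h2 h3 p1n g1 g2 g3.
Qed.

(** The Moebius coordinate of [x] solves the quadratic equation by [omega_root], and its sign,
    positive on A and negative on B, selects the root. *)
Lemma chartAK x : x \in `]a1, a2[ -> chartA (omega a1 a2 b1 b2 x - u0) = x.
Proof.
rewrite in_itv /= => /andP[x1 x2].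
have xa1 := negbT (gt_eqF x1); have xa2 := negbT (lt_eqF x2).
have xb1 : x != b1 by rewrite lt_eqF// (lt_trans x2).
have t0 : 0 < (x - a1) / (a2 - x) / y0.
  by apply: divr_gt0 y0_gt0; rewrite divr_gt0// subr_gt0.
have pos : 0 < - ((x - a1) / (x - a2) * ((x - b2) / (x - b1))).
  have -> : - ((x - a1) / (x - a2) * ((x - b2) / (x - b1))) = (x - a1) / (a2 - x) * ((b2 - x) / (b1 - x)).
    by field; rewrite !subr_eq0 xa2 xb1 [a2 == x]eq_sym [b1 == x]eq_sym xa2 xb1.
  by rewrite mulr_gt0// divr_gt0// subr_gt0// (lt_trans x2)// (lt_trans hab).
have [tE|tE] := root_cases (omega_root xa1 xa2 xb1 pos); first by rewrite /chartA -tE chart_inj.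
by have := tB_lt0 (omega a1 a2 b1 b2 x - u0); rewrite -tE => /lt_trans/(_ t0); rewrite ltxx.
Qed.

Lemma chartBK x : x \in `]b1, b2[ -> chartB (omega a1 a2 b1 b2 x - u0) = x.
Proof.
rewrite in_itv /= => /andP[x1 x2].
have xa2' : a2 < x := lt_trans hab x1; have xa1' : a1 < x := lt_trans ha xa2'.
have xa1 := negbT (gt_eqF xa1'); have xa2 := negbT (gt_eqF xa2').
have xb1 := negbT (gt_eqF x1).
have t0 : (x - a1) / (a2 - x) / y0 < 0.
  rewrite pmulr_llt0 ?invr_gt0// pmulr_rlt0 ?subr_gt0// invr_lt0 subr_lt0//.
have pos : 0 < - ((x - a1) / (x - a2) * ((x - b2) / (x - b1))).
  rewrite -mulrN -mulNr opprB mulr_gt0// divr_gt0// subr_gt0//.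
have [tE|tE] := root_cases (omega_root xa1 xa2 xb1 pos); last by rewrite /chartB -tE chart_inj.
by have := tA_gt0 (omega a1 a2 b1 b2 x - u0); rewrite -tE => /(lt_trans t0); rewrite ltxx.
Qed.

(* A rational identity once [p^2] and [q^2] are expressed through [t] and [t']. *)
Let kernel_identity (t t' p q w w' : R) : p != 0 -> q != 0 -> t' != 0 ->
  1 + k * t != 0 -> 1 + k * t' != 0 ->
  t * (t + k) = p ^+ 2 * (1 + k * t) -> t' * (t' + k) = q ^+ 2 * (1 + k * t') ->
  w = t / p - k * ((p - p^-1) / 2) -> w' = t' / q - k * ((q - q^-1) / 2) ->
  (t - t') * (w * w' + ((p + p^-1) / 2 * ((q + q^-1) / 2) -
     (1 - k ^+ 2) * ((p - p^-1) / 2 * ((q - q^-1) / 2)))) =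
  (p / q - (p / q)^-1) / 2 * (1 + k * t') * (t + q ^+ 2 / t').
Proof.
move=> p0 q0 t0 kt kt' hp hq -> ->.
have P : p ^+ 2 = t * (t + k) / (1 + k * t) by rewrite hp mulfK.
have Q : q ^+ 2 = t' * (t' + k) / (1 + k * t') by rewrite hq mulfK.
transitivity ((t - t') * ((2 * t - k * p ^+ 2 + k) * (2 * t' - k * q ^+ 2 + k) +
  (p ^+ 2 + 1) * (q ^+ 2 + 1) - (1 - k ^+ 2) * (p ^+ 2 - 1) * (q ^+ 2 - 1)) / (4 * p * q)).
  by field; rewrite p0 q0.
transitivity (2 * (p ^+ 2 - q ^+ 2) * (1 + k * t') * (t + q ^+ 2 / t') / (4 * p * q)); last first.
  by field; rewrite p0 q0 t0.
by congr (_ / _); rewrite P Q; field; rewrite kt kt' t0.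
Qed.

Let crossqE u v : crossq k u v =
  (e u + (e u)^-1) / 2 * ((e v + (e v)^-1) / 2) -
     (1 - k ^+ 2) * ((e u - (e u)^-1) / 2 * ((e v - (e v)^-1) / 2)).
Proof. by rewrite /crossq !chE' !shE. Qed.

(** Both points are roots of their quadratic equations, which eliminates e^u and [cweight]. [kerB]
    is the same identity with the other sign of the square root. *)
Let kerA u v : (tA u - tA v) * (W u * W v + crossq k u v) =
  sh (u - v) * (1 + k * tA v) * (tA u - tB v).
Proof.
have en x : e x != 0 by exact: lt0r_neq0.
have wA x : W x = tA x / e x - k * ((e x - (e x)^-1) / 2).
  by rewrite -shE /tparA; field; exact: en.
have rA x : tA x * (tA x + k) = e x ^+ 2 * (1 + k * tA x) by rewrite e2; exact: rootA.
rewrite crossqE (kernel_identity (en u) (en v) (lt0r_neq0 (tA_gt0 v)) (lt0r_neq0 (ktA u))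
  (lt0r_neq0 (ktA v)) (rA u) (rA v) (wA u) (wA v)).
rewrite shE eB e2; congr (_ * (_ + _)).
have -> : expR v = - (tA v * tB v) by rewrite tAB opprK.
by field; exact: lt0r_neq0.
Qed.

Let kerB u v : (tB u - tB v) * (W u * W v + crossq k u v) =
  sh (u - v) * (1 + k * tB v) * (tB u - tA v).
Proof.
have en x : e x != 0 by exact: lt0r_neq0.
have wB x : - W x = tB x / e x - k * ((e x - (e x)^-1) / 2).
  by rewrite -shE /tparB; field; exact: en.
have rB x : tB x * (tB x + k) = e x ^+ 2 * (1 + k * tB x) by rewrite e2; exact: rootB.
rewrite crossqE -[W u * W v]mulrNN.
rewrite (kernel_identity (en u) (en v) (ltr0_neq0 (tB_lt0 v)) (lt0r_neq0 (ktB u))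
  (lt0r_neq0 (ktB v)) (rB u) (rB v) (wB u) (wB v)).
rewrite shE eB e2; congr (_ * (_ + _)).
have -> : expR v = - (tA v * tB v) by rewrite tAB opprK.
by field; exact: ltr0_neq0.
Qed.

(** The part of the logarithm that depends on [v] alone: the factor [1 + k tA v] of [kerA] and the
    two denominators of the Moebius map at [v]. *)
Definition driftA v : R := ln `|(1 + k * tA v) * (1 + y0 * tB v) / (1 + y0 * tA v)|.
Definition driftB v : R := ln `|(1 + k * tB v) * (1 + y0 * tA v) / (1 + y0 * tB v)|.

Let chartB_sub t t' : 1 + y0 * t != 0 -> 1 + y0 * t' != 0 ->
  chart t - chart t' = (a2 - a1) * y0 * (t - t') / ((1 + y0 * t) * (1 + y0 * t')).
Proof. by move=> h1 h2; rewrite /chart; field; rewrite h1 h2. Qed.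

Let log_split (D D' S Q B : R) : S != 0 -> 0 < Q -> B != 0 -> D' != 0 ->
  D = D' * (S / Q) * B -> ln `|D| = ln `|D'| + (ln `|S| - ln Q) + ln `|B|.
Proof.
move=> S0 Q0 B0 D0 ->; rewrite !normrM normfV (gtr0_norm Q0).
rewrite lnM ?posrE ?mulr_gt0 ?normr_gt0 ?invr_gt0//.
by rewrite lnM ?posrE ?mulr_gt0 ?normr_gt0 ?invr_gt0// ln_div ?posrE ?normr_gt0.
Qed.

Let chartAB_neq0 u v : chartA u - chartB v != 0.
Proof.
have := chartA_itv u; have := chartB_itv v; rewrite !in_itv /= => /andP[h1 _] /andP[_ h2].
by rewrite lt_eqF// subr_lt0 (lt_trans h2)// (lt_trans hab).
Qed.

Lemma ln_chartA u v : u != v -> ln `|chartA u - chartA v| =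
  ln `|chartA u - chartB v| + logker k u v + driftA v.
Proof.
move=> uv; have Q0 := crossq_gt0 k0 u v; rewrite -/W in Q0.
have S0 : sh (u - v) != 0 by apply: sh_neq0; rewrite subr_eq0.
have AB : tA u - tB v != 0 by rewrite gt_eqF// subr_gt0 (lt_trans (tB_lt0 v)).
have dn := lt0r_neq0 d_gt0; have yn := lt0r_neq0 y0_gt0.
apply: log_split => //.
- by rewrite !mulf_neq0// ?invr_neq0// lt0r_neq0.
rewrite /chartA /chartB !chartB_sub//.
have -> : tA u - tA v = sh (u - v) * (1 + k * tA v) * (tA u - tB v) / (W u * W v + crossq k u v).
  by rewrite -kerA mulfK// gt_eqF.
by rewrite -/W; field; rewrite !ytA0 ytB0 gt_eqF.
Qed.

Lemma ln_chartB u v : u != v -> ln `|chartB u - chartB v| =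
  ln `|chartB u - chartA v| + logker k u v + driftB v.
Proof.
move=> uv; have Q0 := crossq_gt0 k0 u v; rewrite -/W in Q0.
have S0 : sh (u - v) != 0 by apply: sh_neq0; rewrite subr_eq0.
have AB : tB u - tA v != 0 by rewrite lt_eqF// subr_lt0 (lt_trans (tB_lt0 u)).
have dn := lt0r_neq0 d_gt0; have yn := lt0r_neq0 y0_gt0.
apply: log_split => //.
- by rewrite !mulf_neq0// ?invr_neq0// lt0r_neq0.
- by rewrite -oppr_eq0 opprB; exact: chartAB_neq0.
rewrite /chartA /chartB !chartB_sub//.
have -> : tB u - tB v = sh (u - v) * (1 + k * tB v) * (tB u - tA v) / (W u * W v + crossq k u v).
  by rewrite -kerB mulfK// gt_eqF.
by rewrite -/W; field; rewrite !ytB0 ytA0 gt_eqF.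
Qed.

Let norm_ln_itv (a b x : R) : 0 < a -> a <= x -> x <= b -> `|ln x| <= `|ln a| + `|ln b|.
Proof.
move=> a0 ax xb; have x0 := lt_le_trans a0 ax.
have h1 : ln a <= ln x by rewrite ler_ln.
have h2 : ln x <= ln b by rewrite ler_ln// posrE (lt_le_trans x0).
have h3 := ler_norm (ln b); have h4 := lerNnormlW (lexx `|ln a|).
have n1 := normr_ge0 (ln a); have n2 := normr_ge0 (ln b).
by rewrite ler_norml; apply/andP; split; lra.
Qed.

Let sq1 (v : R) : 1 <= Num.sqrt (ch v).
Proof. by rewrite -sqrtr1 ler_wsqrtr// ch_ge1. Qed.

(** The argument is at most [(1 + 4 c) ch^2 v], and [ch^2 v] is the fourth power of [sqrt (ch v)],
    whence the summand 4. A bound by [sqrt (ch v)] has the same form as that on the kernel. *)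
Let norm_ln_tA c v : 0 < c -> `|ln (1 + c * tA v)| <= (ln (1 + 4 * c) + 4) * Num.sqrt (ch v).
Proof.
move=> c0; have t0 := mulr_gt0 c0 (tA_gt0 v).
have c1 : 1 <= 1 + 4 * c by rewrite lerDl mulr_ge0// ltW.
have lc : 0 <= ln (1 + 4 * c) by exact: ln_ge0.
have h1 : 1 <= 1 + c * tA v by rewrite lerDl ltW.
rewrite ger0_norm ?ln_ge0//.
have e2ch : e v <= 2 * ch v by have := ch_ge_exp v; rewrite -/(e v); lra.
have wch : W v + k * sh v <= 2 * ch v.
  have h0 : W v <= ch v by exact: cweight_le_ch.
  have := sh_lt_ch v; rewrite ltr_norml => /andP[_ h];
  have h' : k * sh v <= ch v.
    apply: le_trans (ler_piMl (ltW (ch_gt0 v)) k1); rewrite ler_pM2l//; exact: ltW.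
  by lra.
have tch : tA v <= 4 * ch v ^+ 2.
  have -> : 4 * ch v ^+ 2 = 2 * ch v * (2 * ch v) by ring.
  apply: ler_pM => //; first exact: ltW.
  by have := W_gt_sh v; rewrite ltr_norml => /andP[h _]; lra.
have ub : 1 + c * tA v <= (1 + 4 * c) * ch v ^+ 2.
  have : 1 <= ch v ^+ 2 by rewrite expr_ge1 ?ch_ge1// ltW ?ch_gt0.
  by have := ler_wpM2l (ltW c0) tch; lra.
have s0 : 0 < Num.sqrt (ch v) by exact: lt_le_trans (sq1 v).
have chE4 : ch v ^+ 2 = Num.sqrt (ch v) ^+ 4.
  by rewrite -[in LHS](sqr_sqrtr (ltW (ch_gt0 v))) -exprM.
have r1 : 0 < 1 + c * tA v by exact: lt_le_trans h1.
have r2 : 0 < 1 + 4 * c by exact: lt_le_trans c1.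
have : ln (1 + c * tA v) <= ln ((1 + 4 * c) * ch v ^+ 2).
  by rewrite ler_ln// posrE mulr_gt0// exprn_gt0// ch_gt0.
rewrite chE4 lnM ?posrE ?exprn_gt0// lnXn// => /le_trans; apply.
have h3 : ln (Num.sqrt (ch v)) <= Num.sqrt (ch v) by rewrite ltW// ln_sublinear.
have h4 := ler_peMr lc (sq1 v).
rewrite (mulrDl (ln (1 + 4 * c))) -[X in _ + X <= _]mulr_natl.
exact: lerD h4 (ler_wpM2l (ler0n _ 4) h3).
Qed.

(** [tB] stays between -1/k and -k, so [- (1 + y0 * tB v)] stays between the arguments of these two
    logarithms. *)
Let cB : R := `|ln (y0 * k - 1)| + `|ln (y0 / k - 1)|.

Let norm_ln_tB v : `|ln `|1 + y0 * tB v| | <= cB.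
Proof.
rewrite (ltr0_norm (ytB v)) /cB; apply: norm_ln_itv; first by rewrite subr_gt0.
  have : y0 * (tB v + k) < 0 by rewrite pmulr_rlt0.
  by rewrite mulrDr; lra.
have : 0 < y0 / k * (1 + k * tB v) by apply: mulr_gt0 => //; exact: divr_gt0.
have -> : y0 / k * (1 + k * tB v) = y0 / k + y0 * tB v by field; rewrite gt_eqF.
by lra.
Qed.

Let norm_ln_ktB v : `|ln (1 + k * tB v)| <= `|ln (1 - k ^+ 2)| + `|ln (1 + k * tA v)|.
Proof.
have -> : 1 + k * tB v = (1 - k ^+ 2) / (1 + k * tA v) by rewrite -(kt1 v) mulrAC mulfV ?mul1r// gt_eqF.
by rewrite ln_div ?posrE// ler_normB.
Qed.

Definition chart_bound : R := (ln (1 + 4 * k) + 4) + (ln (1 + 4 * y0) + 4) + cB +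
  `|ln (1 - k ^+ 2)| + (`|ln q1| + `|ln p2|).

Let bound_ge0 : [/\ 0 <= ln (1 + 4 * k) + 4, 0 <= ln (1 + 4 * y0) + 4, 0 <= cB,
  0 <= `|ln (1 - k ^+ 2)| & 0 <= `|ln q1| + `|ln p2|].
Proof.
have h (c : R) : 0 < c -> 0 <= ln (1 + 4 * c) + 4.
  by move=> c0; rewrite addr_ge0// ln_ge0// lerDl mulr_ge0// ltW.
by split; [exact: h|exact: h|exact: addr_ge0|exact: normr_ge0|exact: addr_ge0].
Qed.

Let ln_prod (x y z : R) : x != 0 -> y != 0 -> z != 0 ->
  `|ln `|x * y / z| | <= `|ln `|x| | + `|ln `|y| | + `|ln `|z| |.
Proof.
move=> x0 y0' z0; rewrite !normrM normfV ln_div ?lnM ?posrE ?mulr_gt0 ?normr_gt0//.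
by rewrite (le_trans (ler_normB _ _))// lerD2r ler_normD.
Qed.

Lemma driftA_le v : `|driftA v| <= chart_bound * Num.sqrt (ch v).
Proof.
apply: (le_trans (ln_prod _ _ _)) => //; first exact: lt0r_neq0.
rewrite (gtr0_norm (ktA v)) (gtr0_norm (ytA v)).
have h1 := norm_ln_tA v k0; have h2 := norm_ln_tA v y0_gt0; have h3 := norm_ln_tB v.
have [g1 g2 g3 g4 g5] := bound_ge0; rewrite /chart_bound.
by have := ler_peMr g3 (sq1 v); have := ler_peMr g4 (sq1 v); have := ler_peMr g5 (sq1 v); lra.
Qed.

Lemma driftB_le v : `|driftB v| <= chart_bound * Num.sqrt (ch v).
Proof.
apply: (le_trans (ln_prod _ _ _)) => //; first exact: lt0r_neq0.
rewrite (gtr0_norm (ktB v)) (gtr0_norm (ytA v)).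
have h1 := norm_ln_tA v k0; have h2 := norm_ln_tA v y0_gt0; have h3 := norm_ln_tB v.
have h4 := norm_ln_ktB v; have [g1 g2 g3 g4 g5] := bound_ge0; rewrite /chart_bound.
by have := ler_peMr g3 (sq1 v); have := ler_peMr g4 (sq1 v); have := ler_peMr g5 (sq1 v); lra.
Qed.

Lemma ln_chartAB_le u v : `|ln `|chartA u - chartB v| | <= chart_bound.
Proof.
have := chartA_itv u; have := chartB_itv v; rewrite !in_itv /= => /andP[h1 h2] /andP[h3 h4].
have [g1 g2 g3 g4 g5] := bound_ge0.
apply: (@le_trans _ _ (`|ln q1| + `|ln p2|)); last by rewrite /chart_bound; lra.
have d0 : 0 <= chartB v - chartA u.
  by rewrite subr_ge0 (le_trans (ltW h4))// (le_trans (ltW hab))// ltW.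
rewrite distrC (ger0_norm d0).
by apply: norm_ln_itv => //; rewrite /q1 /p2; apply: lerB; exact: ltW.
Qed.

Let mtA : measurable_fun setT tA.
Proof. by apply: continuous_measurable_fun => u; exact: der_continuous (dtA u). Qed.
Let mtB : measurable_fun setT tB.
Proof. by apply: continuous_measurable_fun => u; exact: der_continuous (dtB u). Qed.

Lemma measurable_driftA : measurable_fun setT driftA.
Proof. by rewrite /driftA; ms. Qed.

Lemma measurable_driftB : measurable_fun setT driftB.
Proof. by rewrite /driftB; ms. Qed.

Lemma measurable_omega : measurable_fun setT (omega a1 a2 b1 b2).
Proof. by rewrite /omega; ms. Qed.

Lemma measurable_Dfun : measurable_fun setT (Dfun a1 a2 b1 b2).
Proof. by rewrite /Dfun; ms. Qed.

Lemma chartA_is_chart : is_chart chartA densA `]a1, a2[.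
Proof.
apply: (@increasing_chart _ _ _ (fun x => omega a1 a2 b1 b2 x - u0)).
- exact: chartA_itv.
- by move=> u; rewrite omega_chartA addrK.
- exact: chartAK.
- by apply: ms_D; [exact: measurable_omega|exact: ms_cst].
- exact: der_chartA.
- exact: continuous_densA.
- by move=> u; exact: ltW (densA_gt0 u).
Qed.

Let reflected_itv x : (b1 + b2 - x \in `]b1, b2[) = (x \in `]b1, b2[).
Proof. by rewrite !in_itv /= ltrBrDl ltrBlDr [b1 + b2]addrC ltrD2l ltrD2r andbC. Qed.

(** The reflection of the second interval is built into [tvB]; in this increasing chart [tvB] takes
    the form of a mode on the first interval, up to the sign. *)
Definition chartR u := b1 + b2 - chartB u.

Lemma chartR_is_chart : is_chart chartR densB `]b1, b2[.
Proof.
apply: (@increasing_chart _ _ _ (fun x => omega a1 a2 b1 b2 (b1 + b2 - x) - u0)).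
- by move=> u; rewrite /chartR reflected_itv chartB_itv.
- by move=> u; rewrite /chartR subKr omega_chartB addrK.
- by move=> x xI; rewrite /chartR chartBK ?subKr// reflected_itv.
- apply: ms_D; last exact: ms_cst.
  by apply: (measurableT_comp measurable_omega); ms.
- move=> u; have d := der_chartB u; rewrite /chartR.
  by derive_by; [der|cbv beta; ring].
- exact: continuous_densB.
- by move=> u; exact: ltW (densB_gt0 u).
Qed.

Lemma chartB_is_chart : is_chart chartB densB `]b1, b2[.
Proof.
have -> : chartB = fun u => chartB (- - u) by apply/funext => u; rewrite opprK.
have -> : densB = fun u => densB (- - u) by apply/funext => u; rewrite opprK.
(* [chartB] is decreasing. With [u] reflected it is an increasing chart, and a second reflection
   restores it. *)
apply: (@chart_opp _ (fun u => chartB (- u)) (fun u => densB (- u))).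
apply: (@increasing_chart _ _ _ (fun x => - (omega a1 a2 b1 b2 x - u0))).
- by move=> u; exact: chartB_itv.
- by move=> u; rewrite omega_chartB addrK opprK.
- by move=> x xI; rewrite opprK chartBK.
- by apply: ms_N; apply: ms_D; [exact: measurable_omega|exact: ms_cst].
- move=> u; have d := der_chartB (- u); have d2 : is_derive (u : R) (1 : R) (fun u : R => - u) (-1).
    by derive_by; der.
  by derive_by; [exact: (@der_comp R u (fun u : R => - u) chartB _ _ d d2)|ring].
- move=> u; apply: (@continuous_comp _ _ _ (fun u : R => - u) densB); last exact: continuous_densB.
  exact: continuousN.
- by move=> u; exact: ltW (densB_gt0 _).
Qed.

Lemma chartA_mono u v : (chartA u < chartA v) = (u < v).
Proof.
suff h : {mono chartA : x y / x <= y} by rewrite (leW_mono h).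
apply: le_mono => x y xy; apply: (@der_gt0_lt R _ densA) xy _ _ => z _; first exact: der_chartA.
exact: densA_gt0.
Qed.

Lemma chartB_mono u v : (chartB u < chartB v) = (v < u).
Proof.
suff h : {mono chartR : x y / x <= y}.
  by rewrite -[RHS](leW_mono h) /chartR ltrD2l ltrN2.
apply: le_mono => x y xy; apply: (@der_gt0_lt R _ densB) xy _ _ => z _; last exact: densB_gt0.
by have d := der_chartB z; rewrite /chartR; derive_by; [der|cbv beta; ring].
Qed.

End Charts.

(** * Densities read in a chart *)

Section Lifts.
Context (R : realType).
Local Notation leb := (@lebesgue_measure R).
Implicit Types (X Y dX dY f g p q : R -> R) (I J : interval R).

Lemma measurable_Rintegral (F : R * R -> R) :
  measurable_fun setT (F : measurableTypeR R * measurableTypeR R -> R) ->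
  measurable_fun setT (fun x : measurableTypeR R => \int[leb]_y F (x, y)).
Proof.
move=> mF; have mF' : measurable_fun setT (EFin \o (F : measurableTypeR R * measurableTypeR R -> R)).
  exact/measurable_EFinP.
have m1 : measurable_fun setT (fun x : measurableTypeR R => \int[leb]_y ((EFin \o F)^\+ (x, y)))%E.
  apply: (@measurable_fun_fubini_tonelli_F _ _ _ _ _ leb ((EFin \o F)^\+)%E) => //.
  exact: measurable_funepos.
have m2 : measurable_fun setT (fun x : measurableTypeR R => \int[leb]_y ((EFin \o F)^\- (x, y)))%E.
  apply: (@measurable_fun_fubini_tonelli_F _ _ _ _ _ leb ((EFin \o F)^\-)%E) => //.
  exact: measurable_funeneg.
have := emeasurable_funB m1 m2; have mf := @fine_measurable R setT measurableT.
move=> m3; have := measurableT_comp mf m3; apply: eq_measurable_fun => x _ /=.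
rewrite /Rintegral [in RHS]integralE; congr (fine (_ - _)%E); apply: eq_integral => y _.
  by rewrite !funeposE.
by rewrite !funenegE.
Qed.

Let nonintegrable_Rintegral f : measurable_fun setT f -> ~ intg leb setT f -> \int[leb]_x f x = 0.
Proof.
move=> mf nf; have mf' : measurable_fun setT (EFin \o f) by exact/measurable_EFinP.
have P : (\int[leb]_x `|(f x)%:E| = \int[leb]_x ((EFin \o f)^\+ x) + \int[leb]_x ((EFin \o f)^\- x))%E.
  rewrite -ge0_integralD//; [|exact: measurable_funepos|exact: measurable_funeneg].
  by apply: eq_integral => x _; rewrite -[LHS]/((abse \o (EFin \o f)) x) fune_abse.
have p0 : (0 <= \int[leb]_x ((EFin \o f)^\+ x))%E by exact: integral_ge0.
have n0 : (0 <= \int[leb]_x ((EFin \o f)^\- x))%E by exact: integral_ge0.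
have : ~ (\int[leb]_x `|(f x)%:E| < +oo)%E by move=> h; apply: nf; exact/integrableP.
rewrite P /Rintegral integralE; move: p0 n0.
case: (integral _ _ _) => [a| |]; case: (integral _ _ _) => [b| |] //=.
by move=> _ _ h; exfalso; apply: h; rewrite -EFinD ltry.
Qed.

(** If [f] is not integrable, neither is [c * f] for nonzero [c], and both real integrals take the
    default value 0. *)
Let RintegralZ_total c f : measurable_fun setT f -> \int[leb]_x (c * f x) = c * \int[leb]_x f x.
Proof.
move=> mf; have [->|c0] := eqVneq c 0.
  by under eq_Rintegral do rewrite mul0r; rewrite Rintegral_cst// mul0r mul0r.
have [h|h] := pselect (intg leb setT f); first exact: RintegralZl.
rewrite (nonintegrable_Rintegral mf h) mulr0; apply: nonintegrable_Rintegral.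
  exact: ms_M.
move=> h2; apply: h; apply: (integrable_eq _ _ (integrableZr c^-1 measurableT h2)) => // x _.
by rewrite mulKf.
Qed.

(* In the coordinate [u], the charge density [f] on [I] is [p u du]. *)
Definition lifts X dX I f p : Prop :=
  [/\ measurable_fun setT f, forall x, x \notin I -> f x = 0 & forall u, f (X u) * dX u = p u].

Lemma lifts_measurable X dX I f p : is_chart X dX I -> lifts X dX I f p -> measurable_fun setT p.
Proof.
move=> [mX mdX _ _ _] [mf _ fp].
have -> : p = fun u => f (X u) * dX u by apply/funext => u.
by apply: ms_M => //; exact: (measurableT_comp mf).
Qed.

Let supp I f : (forall x, x \notin I -> f x = 0) -> f = f \_ [set` I].
Proof.
move=> f0; apply/funext => x; rewrite patchE mem_setE.
by case: (boolP (x \in I)) => [//|h]; rewrite f0// /point.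
Qed.

Lemma lifts_integrable X dX I f p : is_chart X dX I -> lifts X dX I f p ->
  intg leb setT f <-> intg leb setT p.
Proof.
move=> cX [mf f0 fp]; have mI : measurable ([set` I] : set (measurableTypeR R)) by exact: measurable_itv.
have -> : p = fun u => f (X u) * dX u by apply/funext => u.
rewrite (integrable_chart cX mf) [in X in X <-> _](supp f0) -restrict_EFin.
by split => h; [apply/(integrable_mkcond _ _).2|apply/(integrable_mkcond _ _).1].
Qed.

Lemma lifts_Rintegral1 X dX I f p : is_chart X dX I -> lifts X dX I f p ->
  \int[leb]_x f x = \int[leb]_u p u.
Proof.
move=> cX [mf f0 fp].
rewrite (supp f0) -Rintegral_mkcond (Rintegral_chart cX mf).
by apply: eq_Rint => u _; rewrite fp.
Qed.

Lemma lifts_mul X dX I f p (m : R -> R) : lifts X dX I f p -> measurable_fun setT m ->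
  lifts X dX I (fun x => m x * f x) (fun u => m (X u) * p u).
Proof.
move=> [mf f0 fp] mm; split; first exact: ms_M.
  by move=> x xI; rewrite f0// mulr0.
by move=> u; rewrite -mulrA fp.
Qed.

(** The variables are changed one after the other. The outer Jacobian is moved into the inner
    integral by [RintegralZ_total], so that default values of inner integrals agree. *)
Lemma lifts_form X dX I Y dY J f g p q (K : R * R -> R) :
  is_chart X dX I -> is_chart Y dY J -> lifts X dX I f p -> lifts Y dY J g q ->
  measurable_fun setT (K : measurableTypeR R * measurableTypeR R -> R) ->
  \int[leb]_x \int[leb]_y (K (x, y) * (f x * g y)) =
  \int[leb]_u \int[leb]_v (K (X u, Y v) * (p u * q v)).
Proof.
move=> cX cY lf lg mK; have [mX _ _ _ _] := cX; have [mY _ _ _ _] := cY.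
have [mf f0 fp] := lf; have [mg _ _] := lg.
have mq := lifts_measurable cY lg.
have E x : \int[leb]_y (K (x, y) * (f x * g y)) = \int[leb]_v (K (x, Y v) * (f x * q v)).
  have mKx : measurable_fun setT (fun y => K (x, y) * f x).
    apply: measurable_funM => //; exact: (measurableT_comp mK).
  have := lifts_Rintegral1 cY (lifts_mul lg mKx).
  under eq_Rintegral do rewrite -mulrA; under [in RHS]eq_Rintegral do rewrite -mulrA.
  by [].
under eq_Rintegral do rewrite E.
transitivity (\int[leb]_(x in [set` I]) \int[leb]_v (K (x, Y v) * (f x * q v))).
  rewrite [RHS]Rintegral_mkcond; apply: eq_Rint => x _; rewrite patchE mem_setE.
  case: (boolP (x \in I)) => [//|h]; rewrite f0// /point.
  by under eq_Rintegral do rewrite mul0r mulr0; rewrite Rintegral_cst// mul0r.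
rewrite (Rintegral_chart cX (f := fun x => \int[leb]_v (K (x, Y v) * (f x * q v)))); last first.
  apply: (@measurable_Rintegral (fun z => K (z.1, Y z.2) * (f z.1 * q z.2))).
  apply: ms_M; last by apply: ms_M; [apply: (measurableT_comp mf)|apply: (measurableT_comp mq)].
  apply: (measurableT_comp mK); apply/measurable_fun_pairP; split; first exact: measurable_fst.
  by apply: (measurableT_comp mY); exact: measurable_snd.
apply: eq_Rint => u _; rewrite mulrC.
rewrite -RintegralZ_total; last first.
  apply: ms_M; last by apply: ms_M.
  have m1 : measurable_fun setT (fun v : measurableTypeR R => (X u, Y v) : measurableTypeR R * measurableTypeR R).
    by apply: measurable_fun_pair => //; exact: measurable_cst.
  exact: (measurableT_comp mK m1).
by apply: eq_Rint => v _; rewrite -fp; ring.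
Qed.

End Lifts.

(** * Energies within one chart and across two charts *)

Section ChartPair.
Context (R : realType).
Local Notation leb := (@lebesgue_measure R).
Variables (X Y dX dY : R -> R) (I J : interval R) (k C : R) (drift : R -> R).
Hypotheses (cX : is_chart X dX I) (cY : is_chart Y dY J) (k0 : 0 < k) (k1 : k <= 1).
Hypotheses (XX : forall u v, u != v ->
    ln `|X u - X v| = ln `|X u - Y v| + logker k u v + drift v)
  (XY : forall u v, `|ln `|X u - Y v| | <= C)
  (mdrift : measurable_fun setT drift)
  (drift_le : forall v, `|drift v| <= C * Num.sqrt (ch v)).
Implicit Types (f g p q : R -> R).

Let C0 : 0 <= C. Proof. exact: le_trans (normr_ge0 _) (XY 0 0). Qed.
Let mX : measurable_fun setT X. Proof. by have [] := cX. Qed.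
Let mY : measurable_fun setT Y. Proof. by have [] := cY. Qed.
Let sq (x : R) : 1 <= Num.sqrt (ch x).
Proof. by rewrite -sqrtr1 ler_wsqrtr// ch_ge1. Qed.
Let sq_gt0 (x : R) : 0 < Num.sqrt (ch x). Proof. exact: lt_le_trans (sq x). Qed.
Let cc (x : R) : ch x = Num.sqrt (ch x) * Num.sqrt (ch x).
Proof. by rewrite -expr2 sqr_sqrtr ?ltW ?ch_gt0. Qed.
Let mT : measurable [set: measurableTypeR R]. Proof. exact: measurableT. Qed.

Let bound M u v : R := M * (2 * C * (Num.sqrt (ch v))^-1 + 4 * (Num.sqrt (sh `|u - v|))^-1).

Let bound_integrable M u : intg leb setT (bound M u).
Proof.
apply: integrableZr => //; apply: integrableDr => //.
  by apply: integrableZr => //; exact: invsqrtch_integrable.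
by apply: integrableZr => //; have [] := sqrtsh_shift_integrable u.
Qed.

Let bound_int M u : \int[leb]_v bound M u v = \int[leb]_v bound M 0 v.
Proof.
have i1 := integrableZr (2 * C) mT (@invsqrtch_integrable R).
have [i2 e2] := sqrtsh_shift_integrable u; have [i3 e3] := sqrtsh_shift_integrable (0 : R).
have i2' := integrableZr 4 mT i2; have i3' := integrableZr 4 mT i3.
rewrite (RintegralZl M mT (integrableDr mT i1 i2')) (RintegralZl M mT (integrableDr mT i1 i3')).
rewrite (RintegralD mT i1 i2') (RintegralD mT i1 i3').
by rewrite (RintegralZl 4 mT i2) (RintegralZl 4 mT i3) e2 e3.
Qed.

(** Off the diagonal the three terms of [XX] are bounded separately; on it the default value ln 0 =
    0 makes the left side vanish. The factor [sqrt (ch u)] is split off so that what remains has an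
    integral over [v] independent of [u]. *)
Let row_le M u v (r : R) : 0 <= M -> `|r| <= M * (ch v)^-1 ->
  `|ln `|X u - X v| * r| <= Num.sqrt (ch u) * bound M u v.
Proof.
move=> M0 rM; have b0 : 0 <= bound M u v.
  apply: mulr_ge0 => //; apply: addr_ge0; apply: mulr_ge0; rewrite ?invr_ge0 ?sqrtr_ge0//.
  by rewrite mulr_ge0.
have [uv|uv] := eqVneq u v.
  have -> : X u - X v = 0 by rewrite uv subrr.
  by rewrite normr0 ln0// mul0r normr0 mulr_ge0 ?sqrtr_ge0.
have h := norm_logker_le k0 k1 uv; rewrite (XX uv) normrM.
have h1 : `|ln `|X u - Y v| + logker k u v + drift v| <=
    C + 4 * Num.sqrt (ch u) * Num.sqrt (ch v) / Num.sqrt (sh `|u - v|) + C * Num.sqrt (ch v).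
  by rewrite (le_trans (ler_normD _ _))// lerD// (le_trans (ler_normD _ _))// lerD.
apply: (le_trans (ler_pM _ _ h1 rM)) => //.
have s0 : 0 < Num.sqrt (sh `|u - v|) by rewrite sqrtr_gt0 sh_gt0// normr_gt0 subr_eq0.
rewrite /bound; move: (cc v) (sq u) (sq v) s0 C0 M0 => {h h1 rM b0}.
move: (Num.sqrt (ch u)) (Num.sqrt (ch v)) (Num.sqrt (sh _)) => a b s -> a1 b1 s0 c0 M0.
have b_gt0 : 0 < b by exact: lt_le_trans b1.
have i0 : 0 <= b^-1 by rewrite invr_ge0 ltW.
have i1 : b^-1 <= 1 by rewrite invf_le1.
have j0 : 0 <= s^-1 by rewrite invr_ge0 ltW.
have -> : (C + 4 * a * b / s + C * b) * (M * (b * b)^-1) =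
    M * (C * b^-1 * b^-1 + 4 * a * b^-1 * s^-1 + C * b^-1) by field; rewrite !gt_eqF.
have -> : a * (M * (2 * C * b^-1 + 4 * s^-1)) = M * (a * (C * b^-1) + 4 * a * s^-1 + a * (C * b^-1)) by ring.
rewrite ler_wpM2l//.
have cb : 0 <= C * b^-1 by exact: mulr_ge0.
have as0 : 0 <= 4 * a * s^-1.
  by apply: mulr_ge0 => //; apply: mulr_ge0 => //; apply: le_trans a1.
apply: lerD; first apply: lerD.
- by rewrite (le_trans (ler_piMr cb i1))// ler_peMl.
- by rewrite mulrAC ler_piMr.
- by rewrite ler_peMl.
Qed.

Let mlog (f : R -> R) x : measurable_fun setT f -> measurable_fun setT (fun y => ln `|x - f y|).
Proof.
move=> mf; apply: (measurableT_comp (@measurable_ln R)).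
by apply: measurableT_comp => //; apply: measurable_funB.
Qed.

Let mlogM (f : R -> R) x : measurable_fun setT f -> measurable_fun setT (fun y => `|ln `|x - f y| |).
Proof. by move=> mf; apply: measurableT_comp => //; exact: mlog. Qed.

(** Tonelli's criterion with the rows estimated in the coordinate: they grow at most like
    [sqrt (ch u)], which the decay of [p] compensates. *)
Lemma lifts_log_integrable f p (M : R) : (forall x, 0 <= f x) -> lifts X dX I f p ->
  (forall u, `|p u| <= M * (ch u)^-1) ->
  intg (leb \x leb)%E setT (fun z => ln `|z.1 - z.2| * (f z.1 * f z.2)).
Proof.
move=> f0 lf pM; have M0 : 0 <= M.
  by have := le_trans (normr_ge0 _) (pM 0); rewrite pmulr_lge0// invr_gt0 ch_gt0.
have mp := lifts_measurable cX lf; have [mf fI fp] := lf.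
pose B x := \int[leb]_y (`|ln `|x - y| | * f y).
pose K := \int[leb]_v bound M 0 v.
have lB x : lifts X dX I (fun y => `|ln `|x - y| | * f y) (fun v => `|ln `|x - X v| | * p v).
  exact: lifts_mul lf (mlogM x (@measurable_id _ R setT)).
have irow u : intg leb setT (fun v => `|ln `|X u - X v| | * p v).
  apply: (integrable_le _ _ _ (integrableZr (Num.sqrt (ch u)) mT (bound_integrable M u))) => //.
    by apply: ms_M => //; exact: mlogM.
  by move=> v _; rewrite normrM normr_id -normrM row_le.
have iB x : x \in I -> intg leb setT (fun y => `|ln `|x - y| | * f y).
  move=> xI; have [_ _ _ /(_ x xI)[u <-] _] := cX.
  by apply/(lifts_integrable cX (lB _)).
have mB : measurable_fun setT B.
  apply: (@measurable_Rintegral R (fun z => `|ln `|z.1 - z.2| | * f z.2)).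
  apply: ms_M; last exact: (measurableT_comp mf).
  by apply: measurableT_comp => //; ms'.
apply: (@iterated_integrable _ _ _ _ R leb leb _ (fun x y => f x * (`|ln `|x - y| | * f y))
  (fun x => B x * f x)).
- apply: ms_M; first by ms'.
  by apply: ms_M; apply: (measurableT_comp mf).
- move=> x y /=; rewrite !normrM !(ger0_norm (f0 _)) le_eqVlt; apply/orP; left; apply/eqP; ring.
- move=> x; case: (boolP (x \in I)) => xI; first exact: integrableZr (iB _ xI).
  apply: (integrable_eq _ _ (@integrable0 _ _ _ _ _)) => // y _; rewrite fI// mul0r//.
- move=> x; case: (boolP (x \in I)) => xI.
    by rewrite (RintegralZl _ mT (iB _ xI)) mulrC.
  rewrite fI// mulr0; under eq_Rintegral do rewrite mul0r.
  by rewrite Rintegral_cst// mul0r.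
- apply/(lifts_integrable cX (lifts_mul lf mB)).
  apply: (integrable_le _ _ _ (integrableZr (K * M) mT (@invsqrtch_integrable R))) => //.
    by apply: ms_M => //; exact: (measurableT_comp mB).
  move=> u _; rewrite normrM.
  have h : `|B (X u)| <= Num.sqrt (ch u) * K.
    rewrite /B (lifts_Rintegral1 cX (lB _)).
    rewrite /K -(bound_int M u) -(RintegralZl _ mT (bound_integrable M u)).
    apply: norm_Rintegral_le => //; first exact: integrable_measurable (irow u).
      by move=> v _; rewrite normrM normr_id -normrM row_le.
    exact: integrableZr (bound_integrable M u).
  apply: (le_trans (ler_pM _ _ h (pM u))) => //.
  have := cc u; move: (sq_gt0 u); move: (Num.sqrt (ch u)) => a a0 ->.
  by rewrite le_eqVlt; apply/orP; left; apply/eqP; field; rewrite gt_eqF.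
Qed.

Let logker_row q u : ucharge q -> intg leb setT (fun v => logker k u v * q v).
Proof.
move=> [cq [M qM] _]; apply: (integrable_eq _ _ (logker_row_integrable k0 k1 cq qM u)) => // v _.
by rewrite logkerC.
Qed.

(** The splitting of the logarithm is integrated against [p u q v]. The first term is the energy
    across the charts, the second the kernel form, and the drift contributes a multiple of the
    integral of [p], which is 0. *)
Lemma logform_lifts f g g' p q : lifts X dX I f p -> lifts X dX I g q -> lifts Y dY J g' q ->
  ucharge p -> ucharge q -> logform f g = logform f g' + kerform k p q.
Proof.
move=> lf lg lg' up uq.
have ip := ucharge_integrable up; have iq := ucharge_integrable uq.
have mp := integrable_measurable mT ip; have mq := integrable_measurable mT iq.
have mK : measurable_fun setT (fun z : measurableTypeR R * measurableTypeR R => ln `|z.1 - z.2|) by ms'.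
have [cq [M qM] _] := uq; have [_ _ p0] := up.
have M0 : 0 <= M by have := le_trans (normr_ge0 _) (qM 0); rewrite pmulr_lge0// invr_gt0 ch_gt0.
have id : intg leb setT (fun v => drift v * q v).
  apply: (integrable_le _ _ _ (integrableZr (C * M) mT (@invsqrtch_integrable R))) => //.
    exact: ms_M.
  move=> v _; rewrite normrM (le_trans (ler_pM _ _ (drift_le v) (qM v)))//.
  have := cc v; move: (sq_gt0 v); move: (Num.sqrt (ch v)) => a a0 ->.
  by rewrite le_eqVlt; apply/orP; left; apply/eqP; field; rewrite gt_eqF.
pose c := \int[leb]_v (drift v * q v).
pose a u := \int[leb]_v (ln `|X u - Y v| * (p u * q v)).
pose b u := \int[leb]_v (logker k u v * (p u * q v)).
have iaR u : intg leb setT (fun v => ln `|X u - Y v| * (p u * q v)).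
  apply: (integrable_le _ _ _ (integrableZr (C * `|p u|) mT (integrable_norm iq))) => //.
    by apply: ms_M; [exact: mlog|exact: ms_M].
  by move=> v _; rewrite !normrM -mulrA ler_wpM2r// mulr_ge0.
have ibR u : intg leb setT (fun v => logker k u v * (p u * q v)).
  apply: (integrable_eq _ _ (integrableZr (p u) mT (logker_row u uq))) => // v _; ring.
have idR u : intg leb setT (fun v => p u * (drift v * q v)) by exact: integrableZr.
have E u : \int[leb]_v (ln `|X u - X v| * (p u * q v)) = a u + b u + p u * c.
  have iab := integrableDr mT (iaR u) (ibR u).
  have iabd := integrableDr mT iab (idR u).
  rewrite /a /b /c -(RintegralD mT (iaR u) (ibR u)) -(RintegralZl _ mT id) -(RintegralD mT iab (idR u)).
  set r := fun v => _ + _ + _; pose h v := ln `|X u - X v| * (p u * q v).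
  (* The splitting holds only for v different from u; the discrepancy is a multiple of the indicator
     of one point. *)
  have ie : intg leb setT (fun v => (h u - r u) * \1_[set u] v).
    by apply: integrableZr => //; exact: indic1_integrable.
  have e0 : \int[leb]_v ((h u - r u) * \1_[set u] v) = 0.
    have z v : (h u - r u) * \1_[set u] v != 0 -> v = u.
      rewrite indicE; case: (boolP (v \in [set u])) => [|_]; first by rewrite inE => /= ->.
      by rewrite mulr0 eqxx.
    by apply: Rintegral_singleton => v v' /z -> /z ->.
  rewrite -[RHS]addr0 -e0 -(RintegralD mT iabd ie); apply: eq_Rint => v _.
  rewrite indicE -/(h v) -/(r v); have [<-|uv] := eqVneq u v.
    by rewrite mem_set//= mulr1 addrC subrK.
  rewrite memNset ?mulr0 ?addr0; last by move=> /= vu; rewrite vu eqxx in uv.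
  by rewrite /h /r XX//; ring.
rewrite /logform (@lifts_form R X dX I X dX I f g p q (fun z => ln `|z.1 - z.2|))//.
rewrite (@lifts_form R X dX I Y dY J f g' p q (fun z => ln `|z.1 - z.2|))//=.
under eq_Rintegral do rewrite E.
have ia : intg leb setT a.
  have mF : measurable_fun setT (fun z : measurableTypeR R * measurableTypeR R =>
      ln `|X z.1 - Y z.2| * (p z.1 * q z.2)).
    apply: ms_M; last by apply: ms_M; [apply: (measurableT_comp mp)|apply: (measurableT_comp mq)].
    apply: (measurableT_comp (@measurable_ln R)); apply: measurableT_comp => //.
    by apply: measurable_funB; [apply: (measurableT_comp mX)|apply: (measurableT_comp mY)].
  have Fb x (y : measurableTypeR R) : [set: measurableTypeR R] x -> [set: measurableTypeR R] y ->
      `|ln `|X x - Y y| * (p x * q y)| <= (C * `|p x|) * `|q y|.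
    by move=> _ _; rewrite !normrM -mulrA ler_wpM2r// mulr_ge0.
  exact: (@tensor_integrable12 _ _ _ _ R leb leb _ _ mT mT _ _ (integrableZr C mT (integrable_norm ip))
    (integrable_norm iq) _ mF Fb).
have iL := logker_tensor_integrable k0 k1 up uq.
have ib : intg leb setT b.
  have := integrable_fubini_F iL; apply: eq_integrable => // u _.
  by rewrite /fubini_F /= EFin_Rintegral.
have ic : intg leb setT (fun u => p u * c).
  by apply: (integrable_eq _ _ (integrableZr c mT ip)) => // u _; rewrite mulrC.
rewrite (RintegralD mT (integrableDr mT ia ib) ic) (RintegralD mT ia ib).
rewrite kerform_prod// (Rintegral_prod iL).
have -> : \int[leb]_u (p u * c) = 0; last by rewrite addr0.
by under eq_Rintegral do rewrite mulrC; rewrite (RintegralZl _ mT ip) p0 mulr0.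
Qed.

End ChartPair.

(** * Charges carried by the two intervals *)

Section TwoIntervalForms.
Context (R : realType).
Local Notation leb := (@lebesgue_measure R).
Variables (a1 a2 b1 b2 : R).
Hypotheses (ha : a1 < a2) (hab : a2 < b1) (hb : b1 < b2).
Implicit Types (f g p q : R -> R) (s u x : R).

Local Notation k := (kpar a1 a2 b1 b2).
Local Notation A := (chartA a1 a2 b1 b2).
Local Notation B := (chartB a1 a2 b1 b2).
Local Notation dA := (densA a1 a2 b1 b2).
Local Notation dB := (densB a1 a2 b1 b2).
Local Notation kap := (kappa a1 a2 b1 b2).
Local Notation liftsA := (lifts A dA `]a1, a2[).
Local Notation liftsB := (lifts B dB `]b1, b2[).
Let k0 : 0 < k := kpar_gt0 ha hab hb.
Let k1 : k <= 1 := ltW (kpar_lt1 ha hab hb).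
Let cA := chartA_is_chart ha hab hb.
Let cB := chartB_is_chart ha hab hb.
Let mT : measurable [set: measurableTypeR R]. Proof. exact: measurableT. Qed.

Lemma measurable_on (I : interval R) f : measurable_fun setT f ->
  measurable_fun setT (fun x => if x \in I then f x else 0).
Proof.
move=> mf; have mI : measurable ([set` I] : set (measurableTypeR R)) by exact: measurable_itv.
have := (measurable_restrictT f mI).1 (measurable_funTS mf).
by apply: eq_measurable_fun => x _; rewrite patchE mem_setE.
Qed.

Definition density_on (I : interval R) x : R := if x \in I then (Dfun a1 a2 b1 b2 x)^-1 else 0.
(** The function 1 / D on both intervals: the common majorant with respect to which charges are
    defined. *)
Definition density x : R := density_on `]a1, a2[ x + density_on `]b1, b2[ x.
Local Notation h := density.

Lemma Dfun_ge0 x : 0 <= Dfun a1 a2 b1 b2 x. Proof. exact: sqrtr_ge0. Qed.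

Lemma Dfun_chartA_gt0 u : 0 < Dfun a1 a2 b1 b2 (A u).
Proof.
have := densA_gt0 ha hab hb u; rewrite /densA pmulr_lgt0 ?weight_gt0//.
by rewrite pmulr_rgt0// kappa_gt0.
Qed.

Lemma Dfun_chartB_gt0 u : 0 < Dfun a1 a2 b1 b2 (B u).
Proof.
have := densB_gt0 ha hab hb u; rewrite /densB pmulr_lgt0 ?weight_gt0//.
by rewrite pmulr_rgt0// kappa_gt0.
Qed.

Let density_on_ge0 I x : 0 <= density_on I x.
Proof. by rewrite /density_on; case: ifP => // _; rewrite invr_ge0 Dfun_ge0. Qed.

Let density_on_measurable I : measurable_fun setT (density_on I).
Proof. by apply: measurable_on; apply: ms_V; exact: measurable_Dfun. Qed.

Let lifts_densityA : liftsA (density_on `]a1, a2[) (fun u => kap * weight k u).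
Proof.
split => //; first by move=> x xI; rewrite /density_on (negbTE xI).
move=> u; rewrite /density_on chartA_itv// /densA.
by field; exact: lt0r_neq0 (Dfun_chartA_gt0 u).
Qed.

Let lifts_densityB : liftsB (density_on `]b1, b2[) (fun u => kap * weight k u).
Proof.
split => //; first by move=> x xI; rewrite /density_on (negbTE xI).
move=> u; rewrite /density_on chartB_itv// /densB.
by field; exact: lt0r_neq0 (Dfun_chartB_gt0 u).
Qed.

Let AB_disjoint x : x \in `]a1, a2[ -> x \notin `]b1, b2[.
Proof.
rewrite !in_itv /= negb_and -!leNgt => /andP[_ h].
by rewrite (ltW (lt_trans h hab)).
Qed.

Let densityA x : x \in `]a1, a2[ -> h x = density_on `]a1, a2[ x.
Proof. by move=> xA; rewrite /density {2}/density_on (negbTE (AB_disjoint xA)) addr0. Qed.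

Let densityB x : x \in `]b1, b2[ -> h x = density_on `]b1, b2[ x.
Proof.
move=> xB; rewrite /density {1}/density_on ifN ?add0r//.
by apply: contraL xB; exact: AB_disjoint.
Qed.

Let kw_le u : `|kap * weight k u| <= kap / k * (ch u)^-1.
Proof.
have kap0 := kappa_gt0 ha hab hb.
rewrite ger0_norm ?(mulr_ge0 (ltW kap0) (ltW (weight_gt0 k u)))//.
by rewrite -mulrA ler_wpM2l ?(ltW kap0)// weight_le.
Qed.

Let kw_integrable : intg leb setT (fun u => kap * weight k u).
Proof.
apply: (integrable_le _ _ _ (integrableZr (kap / k) mT (@invch_integrable R))) => //.
by apply: ms_M; [exact: ms_cst|exact: measurable_weight].
Qed.

Lemma density_ge0 x : 0 <= h x. Proof. exact: addr_ge0. Qed.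

Lemma density_supp x : `|a1| + `|b2| < `|x| -> h x = 0.
Proof.
move=> xM; have n1 := ler_norm (- a1); have n2 := ler_norm b2; rewrite normrN in n1.
have p1 := normr_ge0 a1; have p2 := normr_ge0 b2.
have nI : ~~ ((a1 < x) && (x < b2)).
  apply: contraL xM => /andP[x1 x2]; rewrite -leNgt ler_norml; apply/andP; split; lra.
rewrite /density /density_on !ifN ?addr0//.
- by apply: contra nI; rewrite in_itv /= => /andP[x1 ->]; rewrite andbT (lt_trans _ x1)// (lt_trans ha).
- by apply: contra nI; rewrite in_itv /= => /andP[-> x2]; rewrite (lt_trans x2)// (lt_trans hab).
Qed.

Lemma density_integrable : intg leb setT h.
Proof.
by apply: integrableDr => //; [apply/(lifts_integrable cA lifts_densityA)
                             |apply/(lifts_integrable cB lifts_densityB)].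
Qed.

Lemma ln_chartBA_le u v : `|ln `|B u - A v| | <= chart_bound a1 a2 b1 b2.
Proof. by rewrite distrC ln_chartAB_le. Qed.

(** The logarithm is unbounded above or below only within one interval, where the charts apply;
    between the intervals the distance lies between b1 - a2 and b2 - a1. *)
Lemma density_log_integrable :
  intg (leb \x leb)%E setT (fun z => ln `|z.1 - z.2| * (h z.1 * h z.2)).
Proof.
have iA := (lifts_integrable cA lifts_densityA).2 kw_integrable.
have iB := (lifts_integrable cB lifts_densityB).2 kw_integrable.
have AA := lifts_log_integrable cA k0 k1 (fun u v => @ln_chartA _ _ _ _ _ ha hab hb u v)
  (ln_chartAB_le ha hab hb) (driftA_le ha hab hb) (density_on_ge0 _) lifts_densityA kw_le.
have BB := lifts_log_integrable cB k0 k1 (fun u v => @ln_chartB _ _ _ _ _ ha hab hb u v)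
  ln_chartBA_le (driftB_le ha hab hb) (density_on_ge0 _) lifts_densityB kw_le.
pose c : R := `|ln (b1 - a2)| + `|ln (b2 - a1)|.
have cross I J : (forall x y, x \in I -> y \in J -> b1 - a2 <= `|x - y| <= b2 - a1) ->
    intg leb setT (density_on I) -> intg leb setT (density_on J) ->
    intg (leb \x leb)%E setT (fun z => ln `|z.1 - z.2| * (density_on I z.1 * density_on J z.2)).
  move=> hIJ iI iJ.
  have iT := integrable_tensor_setT iI iJ.
  apply: (integrable_le _ _ _ (integrableZr c measurableT (integrable_norm iT))) => //.
    by apply: ms_M; [ms'|exact: integrable_measurable iT].
  move=> [x y] _ /=; rewrite normrM.
  have [xI|xI] := boolP (x \in I); last first.
    have -> : density_on I x = 0 by rewrite /density_on (negbTE xI).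
    by rewrite mul0r normr0 !mulr0.
  have [yJ|yJ] := boolP (y \in J); last first.
    have -> : density_on J y = 0 by rewrite /density_on (negbTE yJ).
    by rewrite mulr0 normr0 !mulr0.
  rewrite ler_wpM2r//; have /andP[h1 h2] := hIJ _ _ xI yJ.
  have g1 : 0 < b1 - a2 by rewrite subr_gt0.
  have g2 : 0 < `|x - y| by exact: lt_le_trans h1.
  have l1 : ln (b1 - a2) <= ln `|x - y| by rewrite ler_ln.
  have l2 : ln `|x - y| <= ln (b2 - a1) by rewrite ler_ln// posrE (lt_le_trans g2).
  have n1 := ler_norm (ln (b2 - a1)); have n2 := lerNnormlW (lexx `|ln (b1 - a2)|).
  have n3 := normr_ge0 (ln (b2 - a1)); have n4 := normr_ge0 (ln (b1 - a2)).
  by rewrite /c ler_norml; apply/andP; split; lra.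
have dAB x y : x \in `]a1, a2[ -> y \in `]b1, b2[ -> b1 - a2 <= `|x - y| <= b2 - a1.
  rewrite !in_itv /= => /andP[x1 x2] /andP[y1 y2].
  have xy : x < y by rewrite (lt_trans x2)// (lt_trans hab).
  rewrite distrC gtr0_norm ?subr_gt0//.
  by apply/andP; split; apply: lerB; exact: ltW.
have AB := cross _ _ dAB iA iB.
have BA : intg (leb \x leb)%E setT (fun z => ln `|z.1 - z.2| *
    (density_on `]b1, b2[ z.1 * density_on `]a1, a2[ z.2)).
  by apply: (cross _ _ _ iB iA) => x y xB yA; rewrite distrC dAB.
have D := fun F G => @integrableDr _ _ _ (leb \x leb)%E setT F G measurableT.
apply: (integrable_eq _ _ (D _ _ (D _ _ AA AB) (D _ _ BA BB))) => // z _.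
by rewrite /density; ring.
Qed.

(** By [cweight_le_ch] the weight is at least [1 / ch], so a bound by [1 / ch] in the coordinate is
    a bound by a multiple of 1 / D on the interval. *)
Let lifts_charge X dX I f p : is_chart X dX I -> (forall u, h (X u) * dX u = kap * weight k u) ->
  (forall u, 0 < dX u) -> lifts X dX I f p -> ucharge p -> charge h f.
Proof.
move=> cX hX dX0 lf [_ [M pM] p0]; have [mf fI fp] := lf.
have M0 : 0 <= M by have := le_trans (normr_ge0 _) (pM 0); rewrite pmulr_lge0// invr_gt0 ch_gt0.
have kap0 := kappa_gt0 ha hab hb.
split => //; last by rewrite (lifts_Rintegral1 cX lf).
exists (M / kap) => x; have [xI|xI] := boolP (x \in I); last first.
  by rewrite fI// normr0 mulr_ge0 ?density_ge0// divr_ge0// ltW.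
have [_ _ _ /(_ x xI)[u <-] _] := cX.
rewrite -(ler_pM2r (dX0 u)) -[X in _ * X <= _](gtr0_norm (dX0 u)) -normrM fp.
rewrite -[X in _ <= X]mulrA hX mulrA divfK ?gt_eqF//; apply: le_trans (pM u) _.
rewrite ler_wpM2l// /weight lef_pV2 ?posrE ?ch_gt0 ?cweight_gt0//.
exact: cweight_le_ch.
Qed.

Lemma liftsA_charge f p : liftsA f p -> ucharge p -> charge h f.
Proof.
apply: lifts_charge => //; last exact: densA_gt0.
by move=> u; rewrite densityA ?chartA_itv//; have [_ _ ->] := lifts_densityA.
Qed.

Lemma liftsB_charge f p : liftsB f p -> ucharge p -> charge h f.
Proof.
apply: lifts_charge => //; last exact: densB_gt0.
by move=> u; rewrite densityB ?chartB_itv//; have [_ _ ->] := lifts_densityB.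
Qed.

Lemma logform_AA f g g' p q : liftsA f p -> liftsA g q -> liftsB g' q -> ucharge p -> ucharge q ->
  logform f g = logform f g' + kerform k p q.
Proof.
move=> l1 l2 l3 u1 u2.
apply: (@logform_lifts R A B dA dB _ _ k _ (driftA a1 a2 b1 b2) cA cB k0 k1 _ _ _ _ f g g' p q) => //.
- by move=> u v; exact: ln_chartA.
- exact: ln_chartAB_le.
- exact: measurable_driftA.
- exact: driftA_le.
Qed.

Lemma logform_BB f g g' p q : liftsB f p -> liftsB g q -> liftsA g' q -> ucharge p -> ucharge q ->
  logform f g = logform f g' + kerform k p q.
Proof.
move=> l1 l2 l3 u1 u2.
apply: (@logform_lifts R B A dB dA _ _ k _ (driftB a1 a2 b1 b2) cB cA k0 k1 _ _ _ _ f g g' p q) => //.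
- by move=> u v; exact: ln_chartB.
- exact: ln_chartBA_le.
- exact: measurable_driftB.
- exact: driftB_le.
Qed.

End TwoIntervalForms.

(** * The sign form in a chart *)

Section SignFormLifts.
Context (R : realType).
Local Notation leb := (@lebesgue_measure R).
Implicit Types (X Y dX dY f g p q : R -> R) (I J : interval R).

Let lifts_sgform X dX I Y dY J f g p q : is_chart X dX I -> is_chart Y dY J ->
  lifts X dX I f p -> lifts Y dY J g q ->
  sgform f g = \int[leb]_u \int[leb]_v (Num.sg (X u - Y v) * (p u * q v)).
Proof.
move=> cX cY lf lg.
apply: (@lifts_form R X dX I Y dY J f g p q (fun z => Num.sg (z.1 - z.2)) cX cY lf lg).
by ms'.
Qed.

Lemma sgform_increasing X dX I f g p q : is_chart X dX I ->
  (forall u v, (X u < X v) = (u < v)) -> lifts X dX I f p -> lifts X dX I g q ->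
  sgform f g = sgform p q.
Proof.
move=> cX Xlt lf lg; rewrite (lifts_sgform cX cX lf lg).
apply: eq_Rint => u _; apply: eq_Rint => v _; congr (_ * _).
have := Xlt u v; have := Xlt v u.
case: (ltrgtP u v) => [uv h1 h2|vu h1 h2|-> _ _]; last by rewrite !subrr.
  by rewrite !ltr0_sg ?subr_lt0.
by rewrite !gtr0_sg ?subr_gt0.
Qed.

Lemma sgform_decreasing X dX I f g p q : is_chart X dX I ->
  (forall u v, (X u < X v) = (v < u)) -> intg leb setT p -> intg leb setT q ->
  lifts X dX I f p -> lifts X dX I g q ->
  sgform f g = - sgform p q.
Proof.
move=> cX Xlt ip iq lf lg; rewrite (lifts_sgform cX cX lf lg).
rewrite /sgform -RintegralN//; last exact: sgform_integrable12.
apply: eq_Rint => u _; rewrite -RintegralN//; last exact: sgform_integrable2.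
apply: eq_Rint => v _; rewrite -mulNr; congr (_ * _).
have := Xlt u v; have := Xlt v u.
case: (ltrgtP u v) => [uv h1 h2|vu h1 h2|-> _ _]; last by rewrite !subrr sgr0 oppr0.
  by rewrite gtr0_sg ?subr_gt0// ltr0_sg ?subr_lt0// opprK.
by rewrite ltr0_sg ?subr_lt0// gtr0_sg ?subr_gt0.
Qed.

(** The sign is constant between separated intervals, and the second density has integral 0. *)
Lemma sgform_separated X dX I Y dY J f g p q (e : R) : is_chart X dX I -> is_chart Y dY J ->
  (forall u v, Num.sg (X u - Y v) = e) -> intg leb setT q -> \int[leb]_u q u = 0 ->
  lifts X dX I f p -> lifts Y dY J g q -> sgform f g = 0.
Proof.
move=> cX cY XY iq q0 lf lg; rewrite (lifts_sgform cX cY lf lg).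
have E u : \int[leb]_v (Num.sg (X u - Y v) * (p u * q v)) = 0.
  under eq_Rintegral do rewrite XY mulrA.
  by rewrite (RintegralZl _ measurableT iq) q0 mulr0.
by under eq_Rintegral do rewrite E; rewrite Rintegral_cst// mul0r.
Qed.

End SignFormLifts.

(** * The symplectic spectrum of a pair *)

Section SymplecticSpectrum.
Local Open Scope complex_scope.

(** Entries come from a function on all natural numbers, so that the expansion [det_expand] can be
    iterated by rewriting. *)
Definition det_upto (S : comNzRingType) n (F : nat -> nat -> S) : S :=
  \det (\matrix_(i < n, j < n) F i j).

Lemma det_expand (S : comNzRingType) n (F : nat -> nat -> S) :
  det_upto n.+1 F =
  \sum_(j < n.+1) F 0%N j * ((-1) ^+ j * det_upto n (fun i l => F i.+1 (bump j l))).
Proof.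
rewrite /det_upto (expand_det_row _ ord0); apply: eq_bigr => j _; rewrite mxE /cofactor.
by congr (_ * (_ * \det _)); apply/matrixP => i l; rewrite !mxE.
Qed.

(** The matrix commutes with the exchange of the indices within each pair. On (1, 1) in both pairs
    it acts with determinant X^2 + T^2; on (1, -1) it gives the second factor. *)
Lemma det_4 (S : comNzRingType) (x y m T X : S) :
  det_upto 4 (fun i j => nth 0 (nth [::] [:: [:: X - m; m; - y; - (T - y)];
    [:: m; X - m; - (T - y); - y]; [:: x; T - x; X + m; - m]; [:: T - x; x; - m; X + m]] i) j) =
  (X ^+ 2 + T ^+ 2) * (X ^+ 2 + ((2 * x - T) * (2 * y - T) - 4 * m ^+ 2)).
Proof.
have d0 (F : nat -> nat -> S) : det_upto 0 F = 1 by rewrite /det_upto det_mx00.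
rewrite !(det_expand, big_ord_recl, big_ord0, d0) /=.
ring.
Qed.

Variable R : realType.

Lemma Omega_canE (i l : 'I_(2 + 2)) :
  @Omega_can R i l = (l == i + 2 :> nat)%N%:R - (i == l + 2 :> nat)%N%:R.
Proof.
rewrite /Omega_can !mxE; case: (splitP i) => i' ii; rewrite !mxE; case: (splitP l) => l' ll; rewrite !mxE ii ll.
- have -> : (l' == i' + 2 :> nat)%N = false by apply/eqP => e; have := ltn_ord l'; rewrite e ltnNge leq_addl.
  have -> : (i' == l' + 2 :> nat)%N = false by apply/eqP => e; have := ltn_ord i'; rewrite e ltnNge leq_addl.
  by rewrite subrr.
- have -> : (i' == (2 + l') + 2 :> nat)%N = false by apply/eqP => e; have := ltn_ord i'; rewrite e ltnNge leq_addl.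
  by rewrite addnC eqn_add2r eq_sym subr0.
- have -> : (l' == (2 + i') + 2 :> nat)%N = false by apply/eqP => e; have := ltn_ord l'; rewrite e ltnNge leq_addl.
  by rewrite addnC eqn_add2r sub0r.
- have h (a b : 'I_2) : (2 + a == 2 + b + 2 :> nat)%N = false.
    by rewrite -addnA eqn_add2l; apply/eqP => e; have := ltn_ord a; rewrite e ltnNge leq_addl.
  by rewrite !h subrr.
Qed.

(** The partially transposed Gram matrix of a pair: [x] and [y] are the variances of the two
    quadratures and [m] their covariance, the same on both intervals. *)
Definition pair_gram (x y m T : R) (i j : nat) : R :=
  nth 0 (nth [::] [:: [:: x; T - x; m; - m]; [:: T - x; x; - m; m];
    [:: m; - m; y; T - y]; [:: - m; m; T - y; y]] i) j.

Lemma quadratic_conj (nu : R) :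
  ('X - (0 +i* nu)%:P) * ('X - (0 -i* nu)%:P) = 'X^2 + ((nu ^+ 2)%:C)%:P :> {poly R[i]}.
Proof.
have -> : 0 -i* nu = - (0 +i* nu) :> R[i] by apply/eqP; rewrite eq_complex /= oppr0 !eqxx.
have -> : (nu ^+ 2)%:C = - (0 +i* nu) ^+ 2 :> R[i].
  by apply/eqP; rewrite eq_complex expr2 /=; apply/andP; split; apply/eqP; ring.
by rewrite !polyCN polyC_exp; ring.
Qed.

Lemma symplectic_pair_gram (M : 'M[R[i]]_(2 + 2)) (x y m T nu : R) :
  (forall i j, M i j = (pair_gram x y m T i j)%:C) -> 0 < T -> 0 < nu ->
  nu ^+ 2 = (2 * x - T) * (2 * y - T) - 4 * m ^+ 2 ->
  symplectic_eigenvalues M (fun j : 'I_2 => if j == ord0 then T else nu).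
Proof.
move=> ME T0 nu0 nuE; split; first by move=> j; case: ifP.
rewrite !big_ord_recl big_ord0 mulr1 /= !quadratic_conj nuE.
pose c (r : R) : {poly R[i]} := (r%:C)%:P.
have CE n (N : 'M[R[i]]_n) i j : char_poly_mx N i j = 'X *+ (i == j) - (N i j)%:P.
  by rewrite /char_poly_mx !mxE.
have cB a b : c (a - b) = c a - c b by rewrite /c rmorphB polyCB.
have cM a b : c (a * b) = c a * c b by rewrite /c rmorphM polyCM.
have cN a : c (- a) = - c a by rewrite /c rmorphN polyCN.
have cn n : c n%:R = n%:R by rewrite /c !rmorph_nat.
have c0 : c 0 = 0 by exact: (cn 0).
rewrite -!/(c _) !expr2 !(cB, cM, cn).
have := @det_4 _ (c x) (c y) (c m) (c T) 'X; rewrite !expr2 => <-.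
rewrite /char_poly /det_upto; congr (\det _).
have E i j : (Omega_can *m M) i j = (\sum_(l < 4) (((l == i + 2 :> nat)%N%:R - (i == l + 2 :> nat)%N%:R) * pair_gram x y m T l j))%:C.
  rewrite mxE rmorph_sum; apply: eq_bigr => l _.
  by rewrite Omega_canE ME rmorphM rmorphB !rmorph_nat.
apply/matrixP => i j; rewrite CE E [RHS]mxE !big_ord_recl big_ord0 -/(c _).
case: i => -[|[|[|[|i]]]] Hi //; case: j => -[|[|[|[|j]]]] Hj //;
  rewrite /pair_gram /= !(subr0, sub0r, mul1r, mul0r, mulN1r, addr0, add0r, cN, cB) ?mulr1n ?mulr0n;
  ring.

Qed.

(** Subtracting [t] times the identity leaves a positive semidefinite form, so
    [4 m^2 <= (p - t) (r - t)]; moreover [p] and [r] are at least [t]. *)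
Lemma discriminant_ge (p r m t : R) : 0 <= t ->
  (forall c d : R, t * (c ^+ 2 + d ^+ 2) <= p * c ^+ 2 + 4 * m * c * d + r * d ^+ 2) ->
  t ^+ 2 <= p * r - 4 * m ^+ 2.
Proof.
move=> t0 H.
have h1 := H 1 0; have h2 := H 0 1; have pt : 0 <= p - t by lra.
have rt : 0 <= r - t by lra.
suff : 4 * m ^+ 2 <= (p - t) * (r - t) by nra.
have [p0|pp] := eqVneq (p - t) 0.
  have m0 : m = 0.
    (* For p = t the inequality is affine in [c] when d = 1; this [c] violates it by 1. *)
    apply/eqP/negP => /negP m0; have := H (- (r - t + 1) / (4 * m)) 1.
    have -> : 4 * m * (- (r - t + 1) / (4 * m)) = - (r - t + 1) by field.
    have -> : p = t by lra.
    by move: (_ ^+ 2) => e; lra.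
  by rewrite m0 p0 mul0r expr0n mulr0.
have p1 : 0 < p - t by rewrite lt_neqAle eq_sym pp.
(* The direction that minimizes the reduced form in [c] for fixed [d], up to scaling. *)
have := H (- 2 * m) (p - t).
rewrite -subr_ge0.
have -> : p * (- 2 * m) ^+ 2 + 4 * m * (- 2 * m) * (p - t) + r * (p - t) ^+ 2 -
  t * ((- 2 * m) ^+ 2 + (p - t) ^+ 2) = (p - t) * ((p - t) * (r - t) - 4 * m ^+ 2) by ring.
by rewrite pmulr_rge0// subr_ge0.
Qed.

End SymplecticSpectrum.

(** The covariance form on real charges, by [G_logform]. It is locked so that its values act as
    atoms in the computation of the matrix. *)
HB.lock Definition vacuum_form (R : realType) (f g : R -> R) : R := - (2 * pi)^-1 * logform f g.

(** * Forms on the plane spanned by the cosine and the sine mode *)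

Section ModeForms.
Context (R : realType).
Local Notation leb := (@lebesgue_measure R).
Variable k : R.
Hypotheses (k0 : 0 < k) (k1 : k <= 1).
Implicit Types (s t x y : R).

Definition mode s x y u : R := x * cosmode k s u + y * sinmode k s u.
Local Notation admissible s := (\int[leb]_u cosmode k s u = 0).
Local Notation sigma s := (sgform (cosmode k s) (sinmode k s)).

Lemma mode_ucharge s x y : admissible s -> ucharge (mode s x y).
Proof.
move=> As; apply: uchargeD; apply: uchargeZ; [exact: cosmode_ucharge|exact: sinmode_ucharge].
Qed.

Lemma sgform_mode s t x y x' y' : 0 < s -> 0 < t -> admissible s -> admissible t ->
  sgform (mode s x y) (mode t x' y') = (x * y' - y * x') * ((s == t)%:R * sigma s).
Proof.
move=> s0 t0 As At.
have ic r : admissible r -> intg leb setT (cosmode k r).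
  by move=> Ar; exact: ucharge_integrable (cosmode_ucharge k0 k1 Ar).
have iS r : intg leb setT (sinmode k r).
  exact: ucharge_integrable (sinmode_ucharge k0 k1 r).
have mT : measurable [set: measurableTypeR R] by exact: measurableT.
have Z c (f : R -> R) : intg leb setT f -> intg leb setT (fun u => c * f u) by exact: integrableZr.
have i1 := ic _ As; have i2 := iS s; have j1 := ic _ At; have j2 := iS t.
have jt : intg leb setT (mode t x' y') by exact: ucharge_integrable (mode_ucharge x' y' At).
have E r : sgform (cosmode k r) (sinmode k r) = sigma r by [].
have C : sgform (cosmode k s) (sinmode k t) = (s == t)%:R * sigma s.
  have [<-|st] := eqVneq s t; first by rewrite mul1r.
  by rewrite mul0r sgform_orthogonal.
have D : sgform (sinmode k s) (cosmode k t) = - ((s == t)%:R * sigma s).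
  rewrite (sgformC i2 j1); congr (- _).
  have [<-|st] := eqVneq s t; first by rewrite mul1r.
  by rewrite mul0r sgform_orthogonal// eq_sym.
rewrite [LHS](sgformDl (Z x _ i1) (Z y _ i2) jt) (sgformZl x i1 jt) (sgformZl y i2 jt).
rewrite (sgformDr i1 (Z x' _ j1) (Z y' _ j2)) (sgformDr i2 (Z x' _ j1) (Z y' _ j2)).
rewrite (sgformZr x' i1 j1) (sgformZr y' i1 j2) (sgformZr x' i2 j1) (sgformZr y' i2 j2).
by rewrite (sgform_cosmode i1 j1) (sgform_sinmode k0 k1) C D; ring.
Qed.

Lemma kerform_mode s x y x' y' : 0 < s -> admissible s ->
  kerform k (mode s x y) (mode s x' y') =
  pi * tanh (pi * s) / 2 * (sigma s * (x * x' + y * y')).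
Proof.
move=> s0 As; have uc := cosmode_ucharge k0 k1 As; have us := sinmode_ucharge k0 k1 s.
have um := mode_ucharge x y As.
have mc : mode s 1 0 = cosmode k s by apply/funext => u; rewrite /mode mul1r mul0r addr0.
have ms : mode s 0 1 = sinmode k s by apply/funext => u; rewrite /mode mul1r mul0r add0r.
rewrite [LHS](kerformDr k0 k1 um (uchargeZ x' uc) (uchargeZ y' us)).
rewrite (kerformZr k0 k1 x' um uc) (kerformZr k0 k1 y' um us).
rewrite (kerform_cosmode k0 k1 s0 um As) (kerform_sinmode k0 k1 s0 um As).
have e1 : sgform (mode s x y) (sinmode k s) = x * sigma s.
  have := sgform_mode x y 0 1 s0 s0 As As; rewrite eqxx ms => ->.
  by rewrite mul1r mulr1 mulr0 subr0.
have e2 : sgform (mode s x y) (cosmode k s) = - (y * sigma s).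
  have := sgform_mode x y 1 0 s0 s0 As As; rewrite eqxx mc => ->.
  by rewrite mul1r mulr1 mulr0 sub0r mulNr.
by rewrite e1 e2; move: (sigma s) (pi * tanh _ / 2) => a b; ring.
Qed.

End ModeForms.

(** * Covariances of the modes on the two intervals *)

Section ModeCovariance.
Context (R : realType).
Local Notation leb := (@lebesgue_measure R).
Variables (a1 a2 b1 b2 s : R).
Hypotheses (ha : a1 < a2) (hab : a2 < b1) (hb : b1 < b2) (s0 : 0 < s).
Local Notation k := (kpar a1 a2 b1 b2).
Hypothesis As : \int[leb]_u cosmode k s u = 0.
Implicit Types (f g p q : R -> R) (x y u : R).

Local Notation A := (chartA a1 a2 b1 b2).
Local Notation B := (chartB a1 a2 b1 b2).
Local Notation dA := (densA a1 a2 b1 b2).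
Local Notation dB := (densB a1 a2 b1 b2).
Local Notation liftsA := (lifts A dA `]a1, a2[).
Local Notation liftsB := (lifts B dB `]b1, b2[).
Local Notation h := (density a1 a2 b1 b2).
Local Notation T := (tanh (pi * s)).
Local Notation sigma := (sgform (cosmode k s) (sinmode k s)).
Let k0 : 0 < k. Proof. exact: kpar_gt0. Qed.
Let k1 : k <= 1. Proof. exact: ltW (kpar_lt1 ha hab hb). Qed.
Let cA : is_chart A dA `]a1, a2[. Proof. exact: chartA_is_chart. Qed.
Let cB : is_chart B dB `]b1, b2[. Proof. exact: chartB_is_chart. Qed.
Let h0 x : 0 <= h x. Proof. exact: density_ge0. Qed.
Let hM x : `|a1| + `|b2| < `|x| -> h x = 0. Proof. exact: density_supp. Qed.
Let M0 : 0 <= `|a1| + `|b2|. Proof. exact: addr_ge0. Qed.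
Let ih : intg leb setT h. Proof. exact: density_integrable. Qed.
Let lh : intg (leb \x leb)%E setT (fun z => ln `|z.1 - z.2| * (h z.1 * h z.2)).
Proof. exact: density_log_integrable. Qed.

Lemma liftsA_exists p : measurable_fun setT p -> exists f, liftsA f p.
Proof.
move=> mp; pose v x := omega a1 a2 b1 b2 x - upar0 a1 a2 b1 b2.
have mv : measurable_fun setT v by apply: ms_D; [exact: measurable_omega|exact: ms_cst].
exists (fun x => if x \in `]a1, a2[ then p (v x) / dA (v x) else 0); split.
- apply: (@measurable_on R _ (fun x => p (v x) / dA (v x))); apply: ms_M.
    exact: (measurableT_comp mp).
  by apply: ms_V; apply: (measurableT_comp _ mv); have [] := cA.
- by move=> x /negbTE ->.
- move=> u; rewrite chartA_itv// /v omega_chartA// addrK divfK//.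
  by rewrite gt_eqF// densA_gt0.
Qed.

Lemma liftsB_exists p : measurable_fun setT p -> exists f, liftsB f p.
Proof.
move=> mp; pose v x := omega a1 a2 b1 b2 x - upar0 a1 a2 b1 b2.
have mv : measurable_fun setT v by apply: ms_D; [exact: measurable_omega|exact: ms_cst].
exists (fun x => if x \in `]b1, b2[ then p (v x) / dB (v x) else 0); split.
- apply: (@measurable_on R _ (fun x => p (v x) / dB (v x))); apply: ms_M.
    exact: (measurableT_comp mp).
  by apply: ms_V; apply: (measurableT_comp _ mv); have [] := cB.
- by move=> x /negbTE ->.
- move=> u; rewrite chartB_itv// /v omega_chartB// addrK divfK//.
  by rewrite gt_eqF// densB_gt0.
Qed.

Let measurable_ucharge p : ucharge p -> measurable_fun setT p.
Proof. by move=> /ucharge_integrable; exact: integrable_measurable. Qed.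

Section Pair.
Variables (p fA fB : R -> R).
Hypotheses (up : ucharge p) (lA : liftsA fA p) (lB : liftsB fB p).
Let chA : charge h fA. Proof. exact: liftsA_charge lA up. Qed.
Let chB : charge h fB. Proof. exact: liftsB_charge lB up. Qed.
Let AA : logform fA fA = logform fA fB + kerform k p p. Proof. exact: logform_AA. Qed.
Let BB : logform fB fB = logform fB fA + kerform k p p. Proof. exact: logform_BB. Qed.
Let BA : logform fB fA = logform fA fB. Proof. exact: (logformC h0 lh). Qed.

(** By [AA], [BB] and [BA] the two intervals carry equal energies, so one unknown energy remains. *)
Lemma logform_add : logform (fun x => fA x + fB x) (fun x => fA x + fB x) =
  4 * logform fA fA - 2 * kerform k p p.
Proof.
have chS := chargeD ih chA chB.
rewrite (logformDl h0 ih lh chA chB chS) (logformDr h0 ih lh chA chA chB) (logformDr h0 ih lh chB chA chB).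
by rewrite BB BA AA; ring.
Qed.

(** The unknown energies cancel, and only the kernel form is left. *)
Lemma logform_sub : logform (fun x => fA x + -1 * fB x) (fun x => fA x + -1 * fB x) =
  2 * kerform k p p.
Proof.
have chN := chargeZ ih (-1) chB; have chS := chargeD ih chA chN.
rewrite (logformDl h0 ih lh chA chN chS) (logformZl h0 ih lh (-1) chB chS).
rewrite (logformDr h0 ih lh chA chA chN) (logformDr h0 ih lh chB chA chN).
rewrite (logformZr h0 ih lh (-1) chA chB) (logformZr h0 ih lh (-1) chB chB).
by rewrite BB BA AA; ring.
Qed.

End Pair.

Let uncertainty f g (c : R) : charge h f -> charge h g ->
  pi * (c * sgform f g) <= - logform f f - c ^+ 2 * logform g g.
Proof.
move=> cf cg; have := sgform_le h0 hM M0 ih lh cf (chargeZ ih c cg).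
rewrite -/(sgform _ _) (sgformZr c (charge_integrable ih cf) (charge_integrable ih cg)).
rewrite (logformZl h0 ih lh c cg (chargeZ ih c cg)) (logformZr h0 ih lh c cg cg).
by rewrite [c * (c * _)]mulrA expr2.
Qed.

Let sgform_AA f g p q : liftsA f p -> liftsA g q -> sgform f g = sgform p q.
Proof. exact: sgform_increasing cA (chartA_mono ha hab hb). Qed.

Let sgform_BB f g p q : ucharge p -> ucharge q -> liftsB f p -> liftsB g q -> sgform f g = - sgform p q.
Proof.
by move=> /ucharge_integrable ip /ucharge_integrable iq;
  exact: sgform_decreasing cB (chartB_mono ha hab hb) ip iq.
Qed.

Let sgAB u v : Num.sg (A u - B v) = -1.
Proof.
have := chartA_itv ha hab hb u; have := chartB_itv ha hab hb v.
rewrite !in_itv /= => /andP[h1 _] /andP[_ h2].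
by rewrite ltr0_sg// subr_lt0 (lt_trans h2)// (lt_trans hab).
Qed.

Let sgBA u v : Num.sg (B u - A v) = 1.
Proof. by rewrite -opprB sgrN sgAB opprK. Qed.

Let sgform_AB f g p q : ucharge q -> liftsA f p -> liftsB g q -> sgform f g = 0.
Proof.
move=> uq; have [_ _ q0] := uq.
exact: sgform_separated cA cB sgAB (ucharge_integrable uq) q0.
Qed.

Let sgform_BA f g p q : ucharge q -> liftsB f p -> liftsA g q -> sgform f g = 0.
Proof.
move=> uq; have [_ _ q0] := uq.
exact: sgform_separated cB cA sgBA (ucharge_integrable uq) q0.
Qed.

(** For the difference of the two copies of the cosine charge [logform] is [pi T sigma], so
    positivity of the variance gives [sigma <= 0]. If [sigma] were 0, the uncertainty relation would
    make the sign form of this difference with every charge vanish. Tested against [P w], with [P]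
    the primitive of the cosine mode, it is -2 times the integral of [P^2 w]; then [P], and with it
    the mode, would be 0, contrary to the value of the mode at 0. *)
Lemma sigma_lt0 : sigma < 0.
Proof.
have T0 : 0 < T by apply: tanh_gt0; exact: mulr_gt0 (pi_gt0 R) s0.
have up := cosmode_ucharge k0 k1 As; have mp := measurable_ucharge up.
have [fA lA] := liftsA_exists mp; have [fB lB] := liftsB_exists mp.
have chA := liftsA_charge ha hab hb lA up; have chB := liftsB_charge ha hab hb lB up.
pose f x := fA x + -1 * fB x; have chf : charge h f := chargeD ih chA (chargeZ ih (-1) chB).
have If := charge_integrable ih chf.
have ff : logform f f = pi * T * sigma.
  rewrite (logform_sub up lA lB).
  have mc : mode k s 1 0 = cosmode k s by apply/funext => u; rewrite /mode mul1r mul0r addr0.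
  by rewrite -{1 2}mc kerform_mode//; move: sigma => e; field.
have pT : 0 < pi * T by exact: mulr_gt0 (pi_gt0 R) T0.
have le0 : sigma <= 0.
  have h1 := uncertainty 1 chf chf.
  have h2 : sgform f f = 0 by have := sgformC If If; move=> /eqP; rewrite -addr_eq0 -mulr2n mulrn_eq0 => /eqP.
  move: h1; rewrite h2 mulr0 mulr0 ff expr1n mul1r => h1.
  by move: h1; rewrite -opprD oppr_ge0 -mulr2n pmulrn_lle0// (pmulr_rle0 _ pT).
rewrite lt_neqAle le0 andbT; apply/eqP => sigma0.
have [cp [M pM] p0] := up.
(* The test density [P w] is odd, hence has integral 0 and is a charge. *)
pose P := prim (cosmode k s); pose w := weight k.
have PM := norm_prim_le cp pM p0.
have cP : continuous P by move=> u; exact: der_continuous (der_prim cp pM u).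
have M1 : 0 <= M * (pi + 2).
  by have := le_trans (normr_ge0 _) (PM 0); rewrite pmulr_lge0// invr_gt0 ch_gt0.
have w1 u : w u <= k^-1.
  apply: le_trans (weight_le k0 k1 u) _.
  by rewrite ler_piMr ?invr_ge0 ?(ltW k0)// invf_le1 ?ch_gt0// ch_ge1.
have ur : ucharge (fun u => P u * w u).
  have cr : continuous (fun u => P u * w u).
    by move=> u; apply: cvgM; [exact: cP|exact: continuous_weight].
  have br u : `|P u * w u| <= M * (pi + 2) * k^-1 * (ch u)^-1.
    rewrite normrM mulrAC (ger0_norm (ltW (weight_gt0 k u))).
    by apply: ler_pM (PM u) (w1 u) => //; exact: ltW (weight_gt0 k u).
  split => //; first by exists (M * (pi + 2) * k^-1).
  apply: odd_integral0.
    exact: dominated_integrable cr br.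
  by move=> u; rewrite /P /w prim_cosmodeN// weightN mulNr.
have [g lg] := liftsA_exists (measurable_ucharge ur).
have chg := liftsA_charge ha hab hb lg ur.
have Ig := charge_integrable ih chg.
have pi0 := pi_gt0 R.
have ffg : sgform f g = 0.
  pose V := - logform g g; have h1 c : pi * (c * sgform f g) <= c ^+ 2 * V.
    by have := uncertainty c chf chg; rewrite ff sigma0 mulr0 oppr0 add0r /V mulrN.
  apply/eqP/negP => /negP z0; move: h1; set z := sgform f g; rewrite -/z in z0 => h1.
  have zz : 0 < z ^+ 2 by rewrite exprn_even_gt0.
  (* With [c = t z] the linear side is [pi t z^2] and the quadratic one [t^2 z^2 V]; this [t] is so
     small that [t V < pi]. *)
  pose t := pi / (2 * (`|V| + 1)); have v1 : 0 < 2 * (`|V| + 1) by rewrite mulr_gt0// ltr_wpDl.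
  have t0 : 0 < t by exact: divr_gt0.
  have : t * z ^+ 2 * pi <= t * z ^+ 2 * (t * V).
    by have := h1 (t * z); congr (_ <= _); ring.
  rewrite (ler_pM2l (mulr_gt0 t0 zz)) => piV.
  have tV : t * V <= t * `|V| by rewrite ler_wpM2l ?ler_norm// ltW.
  have tE : t * `|V| + t = pi / 2 by rewrite /t; field; rewrite gt_eqF// ltr_wpDl.
  move: pi0 t0 tV tE piV; move: (t * V) (t * `|V|) (pi : R); clearbody t.
  by move=> c d e; lra.
have {}ffg : sgform (cosmode k s) (fun u => P u * w u) = 0.
  move: ffg; rewrite /f.
  rewrite (sgformDl (charge_integrable ih chA) (charge_integrable ih (chargeZ ih (-1) chB)) Ig).
  rewrite (sgformZl (-1) (charge_integrable ih chB) Ig) (sgform_BA ur lB lg) mulr0 addr0.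
  by rewrite (sgform_AA lA lg).
have [cr [N rN] _] := ur; have ir := ucharge_integrable ur.
pose F u := P u * (P u * w u).
have cF : continuous F by move=> u; apply: cvgM; [exact: cP|exact: cr].
have F0 u : 0 <= F u by rewrite /F mulrA mulr_ge0 ?sqr_ge0// ltW// weight_gt0.
have FM u : `|F u| <= M * (pi + 2) * N * (ch u)^-1.
  rewrite normrM; apply: le_trans (ler_pM _ _ (PM u) (rN u)) _ => //.
  have N0 : 0 <= N by have := le_trans (normr_ge0 _) (rN 0); rewrite pmulr_lge0// invr_gt0 ch_gt0.
  have c1 : (ch u)^-1 <= 1 by rewrite invf_le1 ?ch_gt0// ch_ge1.
  have c0 : 0 <= (ch u)^-1 by rewrite invr_ge0 ltW// ch_gt0.
  have -> : M * (pi + 2) * (ch u)^-1 * (N * (ch u)^-1) = M * (pi + 2) * N * (ch u)^-1 * (ch u)^-1 by ring.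
  by rewrite ler_piMr// mulr_ge0// mulr_ge0.
have iF := dominated_integrable cF FM.
have intF : \int[leb]_u F u = 0.
  by have := sgform_prim cp pM p0 ir; rewrite ffg => /esym/eqP; rewrite mulf_eq0 oppr_eq0 pnatr_eq0 => /eqP.
have primF u : prim F u = 0.
  apply/eqP; rewrite eq_le /prim; apply/andP; split; last by apply: Rintegral_ge0.
  rewrite -intF Rintegral_mkcond; apply: ler_Rintegral => //.
  - by rewrite -restrict_EFin; apply/(integrable_mkcond _ _).1 => //; exact: integrableS iF.
  - by move=> x _; rewrite patchE; case: ifP.
have Fz u : F u = 0.
  have [_ <-] := der_prim cF FM u.
  by have -> : prim F = cst 0; [apply/funext|rewrite derive_cst].
have Pz u : P u = 0.
  have := Fz u; rewrite /F => /eqP; rewrite !mulf_eq0 (gt_eqF (weight_gt0 k u)) orbF orbb.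
  by move/eqP.
have : cosmode k s 0 = 0.
  have [_ <-] := der_prim cp pM 0.
  by have -> : prim (cosmode k s) = cst 0; [apply/funext|rewrite derive_cst].
by rewrite /cosmode mulr0 cos0 mul1r => /eqP; rewrite gt_eqF// weight_gt0.
Qed.

Let T0 : 0 < T. Proof. by apply: tanh_gt0; exact: mulr_gt0 (pi_gt0 R) s0. Qed.

(* The uncertainty relation between [v] on both intervals and its conjugate mode, taken with
   opposite signs, whose variance involves [kerform] only. *)
Lemma logformA_ge f x y : liftsA f (mode k s x y) ->
  pi / 4 * (T + T^-1) * (- sigma) * (x ^+ 2 + y ^+ 2) <= - logform f f.
Proof.
move=> lf; have uv := mode_ucharge k0 k1 x y As; have uw := mode_ucharge k0 k1 y (- x) As.
have [fB lB] := liftsB_exists (measurable_ucharge uv).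
have [gA lgA] := liftsA_exists (measurable_ucharge uw).
have [gB lgB] := liftsB_exists (measurable_ucharge uw).
have chf := liftsA_charge ha hab hb lf uv; have chB := liftsB_charge ha hab hb lB uv.
have chgA := liftsA_charge ha hab hb lgA uw; have chgB := liftsB_charge ha hab hb lgB uw.
have chN := chargeZ ih (-1) chgB; have chg := chargeD ih chgA chN.
(* The bound is proportional to [2 c + T - c^2 T], which is largest at c = 1/T, with value
   [T + 1/T]. *)
have := uncertainty T^-1 (chargeD ih chf chB) chg.
have I := fun F => @charge_integrable R h ih F.
have -> : sgform (fun x => f x + fB x) (fun x => gA x + -1 * gB x) = 2 * (- (x ^+ 2 + y ^+ 2) * sigma).
  have S : sgform (mode k s x y) (mode k s y (- x)) = - (x ^+ 2 + y ^+ 2) * sigma.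
    by rewrite sgform_mode// eqxx mul1r; move: sigma => e; ring.
  rewrite (sgformDl (I _ chf) (I _ chB) (I _ chg)).
  rewrite (sgformDr (I _ chf) (I _ chgA) (I _ chN)) (sgformDr (I _ chB) (I _ chgA) (I _ chN)).
  rewrite (sgformZr (-1) (I _ chf) (I _ chgB)) (sgformZr (-1) (I _ chB) (I _ chgB)).
  rewrite (sgform_AA lf lgA) (sgform_AB uw lf lgB) (sgform_BA uw lB lgA) (sgform_BB uv uw lB lgB) S.
  by move: sigma => e; ring.
rewrite (logform_add uv lf lB) (logform_sub uw lgA lgB) !kerform_mode//.
have := lt0r_neq0 T0; move: (tanh (pi * s)) => t tn.
move: (logform f f) sigma (pi : R) => a e P H.
have E : P / 4 * (t + t^-1) * (- e) * (x ^+ 2 + y ^+ 2) =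
  4^-1 * (P * (t^-1 * (2 * (- (x ^+ 2 + y ^+ 2) * e))) + 2 * (P * t / 2 * (e * (x * x + y * y))) * -1
    + t^-1 ^+ 2 * (2 * (P * t / 2 * (e * (y * y + - x * - x))))) by field.
rewrite E; move: H; move: (P * _) (P * t / 2 * _) (t^-1 ^+ 2 * _) => X Y Z; lra.
Qed.

Section Covariance.
Variables (x1 y1 : R) (fA1 fA2 fB1 fB2 : R -> R).
(** The canonical normalization: it says that [sgform fA1 fA2] is 4, that is, that the commutator
    form of the two quadratures on A is 1. *)
Hypothesis norm1 : (x1 ^+ 2 + y1 ^+ 2) * - sigma = 4.
Hypotheses (lA1 : liftsA fA1 (mode k s x1 y1)) (lA2 : liftsA fA2 (mode k s y1 (- x1)))
  (lB1 : liftsB fB1 (mode k s x1 y1)) (lB2 : liftsB fB2 (mode k s y1 (- x1))).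
Let u1 : ucharge (mode k s x1 y1). Proof. exact: mode_ucharge. Qed.
Let u2 : ucharge (mode k s y1 (- x1)). Proof. exact: mode_ucharge. Qed.
Let cA1 : charge h fA1. Proof. exact: liftsA_charge lA1 u1. Qed.
Let cA2 : charge h fA2. Proof. exact: liftsA_charge lA2 u2. Qed.
Let cB1 : charge h fB1. Proof. exact: liftsB_charge lB1 u1. Qed.
Let cB2 : charge h fB2. Proof. exact: liftsB_charge lB2 u2. Qed.

Local Notation V := vacuum_form.
Local Notation X := (V fA1 fA1).
Local Notation Y := (V fA2 fA2).
Local Notation m := (V fA1 fA2).

Let pi_neq0 : (pi : R) != 0. Proof. exact: lt0r_neq0 (pi_gt0 R). Qed.

Let ker11 : kerform k (mode k s x1 y1) (mode k s x1 y1) = - (2 * pi * T).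
Proof.
rewrite kerform_mode// -!expr2; move: norm1; move: sigma => e h.
have -> : e * (x1 ^+ 2 + y1 ^+ 2) = - 4 by rewrite -h; ring.
by move: (pi : R) (tanh _) => P t; field.
Qed.

Let ker22 : kerform k (mode k s y1 (- x1)) (mode k s y1 (- x1)) = - (2 * pi * T).
Proof.
rewrite kerform_mode// mulrNN -!expr2; move: norm1; move: sigma => e h.
have -> : e * (y1 ^+ 2 + x1 ^+ 2) = - 4 by rewrite -h; ring.
by move: (pi : R) (tanh _) => P t; field.
Qed.

Let ker12 : kerform k (mode k s x1 y1) (mode k s y1 (- x1)) = 0.
Proof. by rewrite kerform_mode// mulrN [y1 * _]mulrC subrr !mulr0. Qed.

Let ker21 : kerform k (mode k s y1 (- x1)) (mode k s x1 y1) = 0.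
Proof. by rewrite kerform_mode// mulNr [y1 * _]mulrC subrr !mulr0. Qed.

Let VE f g : V f g = - (2 * pi)^-1 * logform f g. Proof. by rewrite vacuum_form.unlock. Qed.

Let VC f g : charge h f -> charge h g -> V f g = V g f.
Proof. by move=> cf cg; rewrite !VE (logformC h0 lh cf cg). Qed.

Let VZl c f g : charge h f -> charge h g -> V (fun x => c * f x) g = c * V f g.
Proof. by move=> cf cg; rewrite !VE (logformZl h0 ih lh c cf cg) mulrCA. Qed.

Let VZr c f g : charge h f -> charge h g -> V f (fun x => c * g x) = c * V f g.
Proof. by move=> cf cg; rewrite !VE (logformZr h0 ih lh c cf cg) mulrCA. Qed.

Let vT (a b : R) : a = b + - (2 * pi * T) -> - (2 * pi)^-1 * b = - (2 * pi)^-1 * a - T.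
Proof. by move=> ->; move: pi_neq0; move: (pi : R) (tanh _) => P t Pn; field. Qed.

Let V_A1B1 : V fA1 fB1 = X - T.
Proof. by rewrite !VE; apply: vT; rewrite (logform_AA ha hab hb lA1 lA1 lB1 u1 u1) ker11. Qed.

Let V_A2B2 : V fA2 fB2 = Y - T.
Proof. by rewrite !VE; apply: vT; rewrite (logform_AA ha hab hb lA2 lA2 lB2 u2 u2) ker22. Qed.

Let V_A1B2 : V fA1 fB2 = m.
Proof. by rewrite !VE (logform_AA ha hab hb lA1 lA2 lB2 u1 u2) ker12 addr0. Qed.

Let V_A2B1 : V fA2 fB1 = m.
Proof. by rewrite (VC cA1 cA2) !VE (logform_AA ha hab hb lA2 lA1 lB1 u2 u1) ker21 addr0. Qed.

Let V_B1B1 : V fB1 fB1 = X.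
Proof.
have E : V fB1 fA1 = V fB1 fB1 - T.
  by rewrite !VE; apply: vT; rewrite (logform_BB ha hab hb lB1 lB1 lA1 u1 u1) ker11.
by apply: (addIr (- T)); rewrite -E -V_A1B1 (VC cA1 cB1).
Qed.

Let V_B2B2 : V fB2 fB2 = Y.
Proof.
have E : V fB2 fA2 = V fB2 fB2 - T.
  by rewrite !VE; apply: vT; rewrite (logform_BB ha hab hb lB2 lB2 lA2 u2 u2) ker22.
by apply: (addIr (- T)); rewrite -E -V_A2B2 (VC cA2 cB2).
Qed.

Let V_B1B2 : V fB1 fB2 = m.
Proof.
by rewrite -V_A2B1 (VC cA2 cB1) !VE (logform_BB ha hab hb lB1 lB2 lA2 u1 u2) ker12 addr0.
Qed.

(** The amplitudes of [c fA1 + d fA2] are (x1, y1) rotated and scaled, with squared length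
    multiplied by c^2 + d^2. Hence [logformA_ge] bounds the variance by (T + 1/T)/2 times c^2 + d^2,
    and doubling and subtracting T leaves 1/T. *)
Let quad c d : T^-1 * (c ^+ 2 + d ^+ 2) <= (2 * X - T) * c ^+ 2 + 4 * m * c * d + (2 * Y - T) * d ^+ 2.
Proof.
have lf : liftsA (fun x => c * fA1 x + d * fA2 x) (mode k s (c * x1 + d * y1) (c * y1 - d * x1)).
  have [m1 z1 e1] := lA1; have [m2 z2 e2] := lA2; split.
  - by apply: ms_D; apply: ms_M => //; exact: ms_cst.
  - by move=> x xI; rewrite (z1 x xI) (z2 x xI) !mulr0 addr0.
  - by move=> u; rewrite mulrDl -!mulrA e1 e2 /mode; ring.
have := logformA_ge lf.
have c1 := chargeZ ih c cA1; have c2 := chargeZ ih d cA2; have c3 := chargeD ih c1 c2.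
have -> : - logform (fun x => c * fA1 x + d * fA2 x) (fun x => c * fA1 x + d * fA2 x) =
    2 * pi * (c ^+ 2 * X + 2 * c * d * m + d ^+ 2 * Y).
  rewrite (logformDl h0 ih lh c1 c2 c3) (logformZl h0 ih lh c cA1 c3) (logformZl h0 ih lh d cA2 c3).
  rewrite (logformDr h0 ih lh cA1 c1 c2) (logformDr h0 ih lh cA2 c1 c2).
  rewrite (logformZr h0 ih lh c cA1 cA1) (logformZr h0 ih lh d cA1 cA2).
  rewrite (logformZr h0 ih lh c cA2 cA1) (logformZr h0 ih lh d cA2 cA2) (logformC h0 lh cA2 cA1).
  rewrite !VE; move: pi_neq0; move: (logform _ _) (logform _ _) (logform _ _) (pi : R) => a b e P Pn.
  by field.
have -> : pi / 4 * (T + T^-1) * - sigma * ((c * x1 + d * y1) ^+ 2 + (c * y1 - d * x1) ^+ 2) =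
    2 * pi * ((T + T^-1) / 2 * (c ^+ 2 + d ^+ 2)).
  transitivity (pi / 4 * (T + T^-1) * (((x1 ^+ 2 + y1 ^+ 2) * - sigma) * (c ^+ 2 + d ^+ 2))).
    by move: (pi : R) (T + T^-1) sigma => P t e; ring.
  by rewrite norm1; move: (pi : R) (T + T^-1) => P t; field.
rewrite ler_pM2l; last exact: mulr_gt0 (pi_gt0 R).
by move: (tanh _) (V _ _) (V _ _) (V _ _) => t a b e; move: (t^-1) => t'; lra.
Qed.

(** The complex conjugation in [vB] reverses one quadrature relative to A, and partial transposition
    reverses it back. Both entries on B thus become minus the densities with the same coordinates as
    those on A, which gives the matrix the shape [pair_gram]. *)
Lemma covariance_spectrum (M : 'M[R[i]]_(2 + 2)) :
  M = gram (fun i => nth (fun=> 0)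
    [:: (fun x => (fA1 x)%:C%C); (fun x => (-1 * fB1 x)%:C%C); (fun x => (fA2 x)%:C%C);
        (fun x => (-1 * fB2 x)%:C%C)] i) ->
  exists nu : 'I_2 -> R, [/\ symplectic_eigenvalues M nu, exists j, nu j = T &
    log_negativity nu = - log2 T].
Proof.
move=> ->; have T1 : T < 1 := tanh_lt1 _.
have ti : 0 <= T^-1 by rewrite invr_ge0 ltW.
have D := discriminant_ge ti quad.
have [e e0] : exists e, X = e by exists X.
have [e' e0'] : exists e', Y = e' by exists Y.
have [r r0] : exists r, m = r by exists m.
(* All entries are expressed through [e], [e'], [r] and T, so that comparison with [pair_gram] is a
   case analysis closed by [ring]. *)
have val : (X = e) * (V fA1 fB1 = e - T) * (V fB1 fA1 = e - T) * (V fB1 fB1 = e) *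
    ((Y = e') * (V fA2 fB2 = e' - T) * (V fB2 fA2 = e' - T) * (V fB2 fB2 = e')) *
    ((m = r) * (V fA1 fB2 = r) * (V fA2 fB1 = r) * (V fB1 fB2 = r)) *
    ((V fA2 fA1 = r) * (V fB2 fA1 = r) * (V fB1 fA2 = r) * (V fB2 fB1 = r)).
  rewrite (VC cB1 cA1) (VC cB2 cA2) (VC cA2 cA1) (VC cB2 cA1) (VC cB1 cA2) (VC cB2 cB1).
  by rewrite V_A1B1 V_A2B2 V_A1B2 V_A2B1 V_B1B1 V_B2B2 V_B1B2 e0 e0' r0.
rewrite !val in D.
pose d := (2 * e - T) * (2 * e' - T) - 4 * r ^+ 2; rewrite -/d in D.
(* [d] is at least 1/T^2 and T < 1: the second eigenvalue [sqrt d] exceeds 1 and does not enter the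
   negativity. *)
have d1 : 1 < d.
  by apply: lt_le_trans D; rewrite exprn_egt1// (invf_gt1 T0).
have d0 : 0 < d := lt_trans ltr01 d1.
exists (fun j : 'I_2 => if j == ord0 then T else Num.sqrt d); split.
- apply: (@symplectic_pair_gram R _ e e' r T (Num.sqrt d) _ T0).
  + move=> i j; rewrite mxE.
    have cN1 := chargeZ ih (-1) cB1; have cN2 := chargeZ ih (-1) cB2.
    have GE f g : charge h f -> charge h g -> G (fun x => (f x)%:C%C) (fun x => (g x)%:C%C) = (V f g)%:C%C.
      by move=> cf cg; rewrite VE (G_logform h0 hM M0 ih lh cf cg).
    have Z c : (charge h c -> V (fun x => -1 * fB1 x) c = -1 * V fB1 c) *
        (charge h c -> V (fun x => -1 * fB2 x) c = -1 * V fB2 c) *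
        (charge h c -> V c (fun x => -1 * fB1 x) = -1 * V c fB1) *
        (charge h c -> V c (fun x => -1 * fB2 x) = -1 * V c fB2).
      by do ?split; move=> cc; rewrite ?(VZl (-1) cB1 cc) ?(VZl (-1) cB2 cc) ?(VZr (-1) cc cB1) ?(VZr (-1) cc cB2).
    by case: i => -[|[|[|[|i]]]] Hi //; case: j => -[|[|[|[|j]]]] Hj //=;
      rewrite GE//; congr (_%:C%C); rewrite ?Z// ?val /pair_gram /=; ring.
  + by rewrite sqrtr_gt0.
  + by rewrite (sqr_sqrtr (ltW d0)).
- by exists ord0; rewrite eqxx.
- rewrite /log_negativity big_mkcond !big_ord_recl big_ord0 /= T1 ltNge.
  by rewrite -[X in X <= _]sqrtr1 (ler_wsqrtr (ltW d1)) !addr0.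
Qed.

End Covariance.

End ModeCovariance.

(** * Complex modes *)

Section ComplexProfiles.
Local Open Scope complex_scope.
Context (R : realType).
Local Notation leb := (@lebesgue_measure R).
Local Notation Re := complex.Re.
Local Notation Im := complex.Im.
Variables (a1 a2 b1 b2 : R).
Hypotheses (ha : a1 < a2) (hab : a2 < b1) (hb : b1 < b2).
Local Notation k := (kpar a1 a2 b1 b2).
Local Notation kap := (kappa a1 a2 b1 b2).
Local Notation admissible s := (\int[leb]_u cosmode k s u = 0).
Local Notation sigma s := (sgform (cosmode k s) (sinmode k s)).
Implicit Types (F H : R -> R[i]) (X dX : R -> R) (I J : interval R) (s t x y z w : R) (c : R[i]).
Let k0 : 0 < k. Proof. exact: kpar_gt0. Qed.
Let k1 : k <= 1. Proof. exact: ltW (kpar_lt1 ha hab hb). Qed.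
Let mT : measurable [set: measurableTypeR R]. Proof. exact: measurableT. Qed.

Definition profile X dX I s F x y z w : Prop :=
  lifts X dX I (fun v => Re (F v)) (mode k s x y) /\
  lifts X dX I (fun v => Im (F v)) (mode k s z w).

Lemma liftsZ_mode X dX I s f x y (e : R) : lifts X dX I f (mode k s x y) ->
  lifts X dX I (fun v => e * f v) (mode k s (e * x) (e * y)).
Proof.
move=> [mf f0 fp]; split; first by apply: ms_M => //; exact: ms_cst.
- by move=> v vI; rewrite f0// mulr0.
- by move=> u; rewrite -mulrA fp /mode; ring.
Qed.

Lemma profile_conj X dX I s F x y z w : profile X dX I s F x y z w ->
  profile X dX I s (conjf F) x y (- z) (- w).
Proof.
move=> [l1 l2]; split.
  by rewrite (_ : (fun v => _) = (fun v => Re (F v)))//; apply/funext => v; rewrite /conjf; case: (F v).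
rewrite -[- z]mulN1r -[- w]mulN1r; have := liftsZ_mode (-1) l2; congr (lifts _ _ _ _ _).
by apply/funext => v; rewrite /conjf mulN1r; case: (F v).
Qed.

Lemma profile_cintegrable X dX I s F x y z w : is_chart X dX I -> admissible s ->
  profile X dX I s F x y z w -> cintegrable F.
Proof.
move=> cX As [l1 l2]; have um a b := ucharge_integrable (mode_ucharge k0 k1 a b As).
by split; [exact: (lifts_integrable cX l1).2|exact: (lifts_integrable cX l2).2].
Qed.

(** The constant [e] is the orientation of the chart, 1 or -1 in the applications. *)
Lemma Omega_profile (e : R) X dX I s t F H x y z w x' y' z' w' : is_chart X dX I ->
  (forall f g p q, intg leb setT p -> intg leb setT q -> lifts X dX I f p -> lifts X dX I g q ->
    sgform f g = e * sgform p q) ->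
  0 < s -> 0 < t -> admissible s -> admissible t ->
  profile X dX I s F x y z w -> profile X dX I t H x' y' z' w' ->
  Omega F H = (e / 4 * ((x * y' - y * x') - (z * w' - w * z')) * ((s == t)%:R * sigma s)) +i*
              (e / 4 * ((x * w' - y * z') + (z * y' - w * x')) * ((s == t)%:R * sigma s)).
Proof.
move=> cX sg s0 t0 As At pF pH.
rewrite (Omega_sgform (profile_cintegrable cX As pF) (profile_cintegrable cX At pH)).
have [f1 f2] := pF; have [g1 g2] := pH.
have um r a b (Ar : admissible r) := ucharge_integrable (mode_ucharge k0 k1 a b Ar).
rewrite (sg _ _ _ _ (um _ _ _ As) (um _ _ _ At) f1 g1) (sg _ _ _ _ (um _ _ _ As) (um _ _ _ At) f2 g2).
rewrite (sg _ _ _ _ (um _ _ _ As) (um _ _ _ At) f1 g2) (sg _ _ _ _ (um _ _ _ As) (um _ _ _ At) f2 g1).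
rewrite !(sgform_mode k0 k1 _ _ _ _ s0 t0 As At).
by move: (_%:R * sigma s) => d; congr (_ +i* _); ring.
Qed.

Lemma OmegaD F1 F2 H1 H2 : cintegrable F1 -> cintegrable F2 -> cintegrable H1 -> cintegrable H2 ->
  Omega (fun v => F1 v + F2 v) (fun v => H1 v + H2 v) =
  Omega F1 H1 + Omega F1 H2 + (Omega F2 H1 + Omega F2 H2).
Proof.
have RD (a b : R[i]) : Re (a + b) = Re a + Re b by case: a; case: b.
have ID (a b : R[i]) : Im (a + b) = Im a + Im b by case: a; case: b.
have cD (F H : R -> R[i]) : cintegrable F -> cintegrable H -> cintegrable (fun v => F v + H v).
  move=> [r1 i1] [r2 i2]; split.
    by apply: (integrable_eq _ _ (integrableDr mT r1 r2)) => // v _; rewrite RD.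
  by apply: (integrable_eq _ _ (integrableDr mT i1 i2)) => // v _; rewrite ID.
move=> c1 c2 d1 d2; rewrite (Omega_sgform (cD _ _ c1 c2) (cD _ _ d1 d2)).
rewrite !Omega_sgform//; have [r1 i1] := c1; have [r2 i2] := c2; have [r3 i3] := d1; have [r4 i4] := d2.
have fR (F H : R -> R[i]) : (fun v => Re (F v + H v)) = (fun v => Re (F v) + Re (H v)) by apply/funext.
have fI (F H : R -> R[i]) : (fun v => Im (F v + H v)) = (fun v => Im (F v) + Im (H v)) by apply/funext.
rewrite !fR !fI.
have S f1 f2 g1 g2 : intg leb setT f1 -> intg leb setT f2 -> intg leb setT g1 -> intg leb setT g2 ->
    sgform (fun v => f1 v + f2 v) (fun v => g1 v + g2 v) =
    sgform f1 g1 + sgform f1 g2 + (sgform f2 g1 + sgform f2 g2).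
  move=> j1 j2 j3 j4; rewrite (sgformDl j1 j2 (integrableDr mT j3 j4)).
  by rewrite (sgformDr j1 j3 j4) (sgformDr j2 j3 j4).
rewrite (S _ _ _ _ r1 r2 r3 r4) (S _ _ _ _ i1 i2 i3 i4) (S _ _ _ _ r1 r2 i3 i4) (S _ _ _ _ i1 i2 r3 r4).
do 16! (move: (sgform _ _) => ?).
by apply/eqP; rewrite eq_complex /=; apply/andP; split; apply/eqP; ring.
Qed.

Lemma Omega_separated (e : R) X dX I Y dY J s F H x y z w x' y' z' w' :
  is_chart X dX I -> is_chart Y dY J -> (forall u v, Num.sg (X u - Y v) = e) -> admissible s ->
  profile X dX I s F x y z w -> profile Y dY J s H x' y' z' w' -> Omega F H = 0.
Proof.
move=> cX cY XY As pF pH.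
rewrite (Omega_sgform (profile_cintegrable cX As pF) (profile_cintegrable cY As pH)).
have [f1 f2] := pF; have [g1 g2] := pH.
have um a b := mode_ucharge k0 k1 a b As.
have S f p a b g : lifts X dX I f p -> lifts Y dY J g (mode k s a b) -> sgform f g = 0.
  have [_ _ m0] := um a b.
  exact: (sgform_separated cX cY XY (ucharge_integrable (um a b)) m0).
rewrite (S _ _ _ _ _ f1 g1) (S _ _ _ _ _ f2 g2) (S _ _ _ _ _ f1 g2) (S _ _ _ _ _ f2 g1).
by apply/eqP; rewrite eq_complex /= addr0 subr0 mulr0 eqxx.
Qed.

Lemma profile_cintegral X dX I s F x y z w : is_chart X dX I -> admissible s ->
  profile X dX I s F x y z w -> cintegral [set` I] F = 0.
Proof.
move=> cX As [l1 l2]; have um a b := mode_ucharge k0 k1 a b As.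
have S f a b : lifts X dX I f (mode k s a b) -> \int[leb]_(v in [set` I]) f v = 0.
  move=> l; have [_ _ m0] := um a b; have [_ f0 _] := l.
  rewrite -[RHS]m0 -(lifts_Rintegral1 cX l) Rintegral_mkcond; apply: eq_Rint => v _.
  by rewrite patchE mem_setE; case: (boolP (v \in I)) => [//|vI]; rewrite f0.
by rewrite /cintegral (S _ _ _ l1) (S _ _ _ l2).
Qed.

Lemma cintegral0 J F : (forall v, v \in J -> F v = 0) -> cintegral [set` J] F = 0.
Proof.
move=> F0; rewrite /cintegral.
rewrite (@eq_Rint _ _ _ leb _ (fun v => Re (F v)) (fun=> 0)); last by move=> v vJ; rewrite F0.
rewrite (@eq_Rint _ _ _ leb _ (fun v => Im (F v)) (fun=> 0)); last by move=> v vJ; rewrite F0.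
by rewrite !Rintegral_cst ?mul0r//; exact: measurable_itv.
Qed.

(** [omega] is [u] shifted by [upar0]; the shift is absorbed into the constant, so that the mode
    becomes the phase times e^(-isu). *)
Definition phase s c : R[i] := c * cexpi (- (s * upar0 a1 a2 b1 b2)).

Lemma phase_profile X dX I s c (om D : R -> R) : is_chart X dX I ->
  measurable_fun setT om -> measurable_fun setT D ->
  (forall u, om (X u) = u + upar0 a1 a2 b1 b2) ->
  (forall u, dX u = kap * D (X u) * weight k u) -> (forall u, D (X u) != 0) ->
  profile X dX I s (fun v => if v \in I then c * cexpi (- (s * om v)) / (D v)%:C else 0)
    (kap * Re (phase s c)) (kap * Im (phase s c)) (kap * Im (phase s c)) (- (kap * Re (phase s c))).
Proof.
move=> cX mom mD omX dXE D0; have [_ _ XI _ _] := cX.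
have E (d t : R) : c * cexpi (- t) / d%:C =
    ((Re c * cos t + Im c * sin t) / d) +i* ((Im c * cos t - Re c * sin t) / d).
  rewrite -(fmorphV (real_complex R)) /=; case: c => cr ci; rewrite /cexpi cosN sinN.
  by apply/eqP; rewrite eq_complex /=; apply/andP; split; apply/eqP; ring.
have ph : phase s c = (Re c * cos (s * upar0 a1 a2 b1 b2) + Im c * sin (s * upar0 a1 a2 b1 b2)) +i*
    (Im c * cos (s * upar0 a1 a2 b1 b2) - Re c * sin (s * upar0 a1 a2 b1 b2)).
  rewrite /phase {E}; case: c => cr ci; rewrite /cexpi cosN sinN.
  by apply/eqP; rewrite eq_complex /=; apply/andP; split; apply/eqP; ring.
rewrite ph /=.
have mc : measurable_fun setT (fun v => cos (s * om v)).
  by apply: ms_cos; apply: ms_M => //; exact: ms_cst.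
have msn : measurable_fun setT (fun v => sin (s * om v)).
  by apply: ms_sin; apply: ms_M => //; exact: ms_cst.
have mV := ms_V mD.
split; split.
- have -> : (fun v => Re (if v \in I then c * cexpi (- (s * om v)) / (D v)%:C else 0)) =
      (fun v => if v \in I then (Re c * cos (s * om v) + Im c * sin (s * om v)) / D v else 0).
    by apply/funext => v; case: ifP => // _; rewrite E.
  by apply: measurable_on; apply: ms_M => //; apply: ms_D; apply: ms_M => //; exact: ms_cst.
- by move=> v /negbTE ->.
- move=> u; rewrite (XI u).1 E /= dXE omX mulrDr cosD sinD /mode /cosmode /sinmode.
  by field.
- have -> : (fun v => Im (if v \in I then c * cexpi (- (s * om v)) / (D v)%:C else 0)) =
      (fun v => if v \in I then (Im c * cos (s * om v) - Re c * sin (s * om v)) / D v else 0).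
    by apply/funext => v; case: ifP => // _; rewrite E.
  apply: measurable_on; apply: ms_M => //; apply: ms_D; first by apply: ms_M => //; exact: ms_cst.
  by apply: ms_N; apply: ms_M => //; exact: ms_cst.
- by move=> v /negbTE ->.
- move=> u; rewrite (XI u).1 E /= dXE omX mulrDr cosD sinD /mode /cosmode /sinmode.
  by field.
Qed.

End ComplexProfiles.

(** * Normalization and pairings of the modes *)

Section TwoIntervalModes.
Local Open Scope complex_scope.
Context (R : realType).
Local Notation leb := (@lebesgue_measure R).
Local Notation Re := complex.Re.
Local Notation Im := complex.Im.
Variables (a1 a2 b1 b2 : R).
Hypotheses (ha : a1 < a2) (hab : a2 < b1) (hb : b1 < b2).
Local Notation k := (kpar a1 a2 b1 b2).
Local Notation kap := (kappa a1 a2 b1 b2).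
Local Notation admissible s := (\int[leb]_u cosmode k s u = 0).
Local Notation sigma s := (sgform (cosmode k s) (sinmode k s)).
Local Notation profA := (profile a1 a2 b1 b2 (chartA a1 a2 b1 b2) (densA a1 a2 b1 b2) `]a1, a2[).
Local Notation profB := (profile a1 a2 b1 b2 (chartB a1 a2 b1 b2) (densB a1 a2 b1 b2) `]b1, b2[).
Local Notation profR := (profile a1 a2 b1 b2 (chartR a1 a2 b1 b2) (densB a1 a2 b1 b2) `]b1, b2[).
Implicit Types (s t : R) (c : R[i]).
Let cA : is_chart (chartA a1 a2 b1 b2) (densA a1 a2 b1 b2) `]a1, a2[.
Proof. exact: chartA_is_chart. Qed.
Let cB : is_chart (chartB a1 a2 b1 b2) (densB a1 a2 b1 b2) `]b1, b2[.
Proof. exact: chartB_is_chart. Qed.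
Let cR : is_chart (chartR a1 a2 b1 b2) (densB a1 a2 b1 b2) `]b1, b2[.
Proof. exact: chartR_is_chart. Qed.

(** In the coordinate, up to the weight, the real part of a mode is [al cos (s u) + be sin (s u)]
    and its imaginary part [be cos (s u) - al sin (s u)]. *)
Let al s c : R := kap * Re (phase a1 a2 b1 b2 s c).
Let be s c : R := kap * Im (phase a1 a2 b1 b2 s c).
Let sqnorm c : R := Re c ^+ 2 + Im c ^+ 2.

Let alM s (e : R) c : al s (e%:C * c) = e * al s c /\ be s (e%:C * c) = e * be s c.
Proof.
by rewrite /al /be /phase -mulrA; case: (c * _) => x y /=; split; ring.
Qed.

Let al_be2 s c : al s c ^+ 2 + be s c ^+ 2 = kap ^+ 2 * sqnorm c.
Proof.
rewrite /al /be /phase /sqnorm; case: c => x y /=; rewrite cosN sinN.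
set u := s * _; have h := cos2Dsin2 u.
transitivity (kap ^+ 2 * ((x ^+ 2 + y ^+ 2) * (cos u ^+ 2 + sin u ^+ 2))); first by ring.
by rewrite h mulr1.
Qed.

(** The half on B of a core mode has the conjugate constant and the frequency [- s]; its amplitudes
    are read off from here. *)
Let alN s c : al (- s) c^*%C = al s c /\ be (- s) c^*%C = - be s c.
Proof.
rewrite /al /be /phase; case: c => x y /=; rewrite mulNr opprK cosN sinN; split; ring.
Qed.

Lemma tvA_profile s c : profA s (tvA a1 a2 b1 b2 s c) (al s c) (be s c) (be s c) (- al s c).
Proof.
apply: phase_profile => //; [exact: measurable_omega|exact: measurable_Dfun|exact: omega_chartA|].
by move=> u; exact: lt0r_neq0 (Dfun_chartA_gt0 ha hab hb u).
Qed.

Lemma vA_profile s c (r : R := Num.sqrt 2) : profA s (vA a1 a2 b1 b2 s c)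
  (r * al s c) (r * be s c) (r * be s c) (- (r * al s c)).
Proof. by have [<- <-] := alM s r c; exact: tvA_profile. Qed.

Let reflected_measurable (f : R -> R) : measurable_fun setT f ->
  measurable_fun setT (fun x : R => f (b1 + b2 - x)).
Proof. by move=> mf; apply: (measurableT_comp mf); ms. Qed.

Lemma tvB_profile s c : profR s (tvB a1 a2 b1 b2 s c) (- al s c) (- be s c) (- be s c) (al s c).
Proof.
have [e1 e2] := alM s (-1) c; rewrite !mulN1r in e1 e2.
rewrite -[X in profR _ _ _ _ _ X]opprK -e1 -e2.
have -> : tvB a1 a2 b1 b2 s c = fun x => if x \in `]b1, b2[ then
    ((-1)%:C * c) * cexpi (- (s * omega a1 a2 b1 b2 (b1 + b2 - x))) /
    (Dfun a1 a2 b1 b2 (b1 + b2 - x))%:C else 0.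
  by apply/funext => x; rewrite /tvB rmorphN mulN1r !mulNr.
apply: (@phase_profile R a1 a2 b1 b2 _ _ _ _ _ (fun x => omega a1 a2 b1 b2 (b1 + b2 - x))
  (fun x => Dfun a1 a2 b1 b2 (b1 + b2 - x))) => //.
- exact: reflected_measurable (@measurable_omega R a1 a2 b1 b2).
- exact: reflected_measurable (@measurable_Dfun R a1 a2 b1 b2).
- by move=> u; rewrite /chartR subKr omega_chartB.
- by move=> u; rewrite /chartR subKr.
- by move=> u; rewrite /chartR subKr; exact: lt0r_neq0 (Dfun_chartB_gt0 ha hab hb u).
Qed.

Lemma vB_profile s c (r : R := Num.sqrt 2) : profB s (vB a1 a2 b1 b2 s c)
  (- (r * al s c)) (- (r * be s c)) (r * be s c) (- (r * al s c)).
Proof.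
have [e1 e2] := alM (- s) (- r) c^*%C; have [e3 e4] := alN s c; rewrite e3 e4 in e1 e2.
have mN x y : mode k (- s) x y = mode k s x (- y).
  by apply/funext => u; rewrite /mode /cosmode /sinmode mulNr cosN sinN; ring.
have -> : vB a1 a2 b1 b2 s c = fun x => if x \in `]b1, b2[ then
    ((- r)%:C * c^*%C) * cexpi (- (- s * omega a1 a2 b1 b2 x)) / (Dfun a1 a2 b1 b2 x)%:C else 0.
  by apply/funext => x; rewrite /vB rmorphN !mulNr opprK.
have : profB (- s) (fun x => if x \in `]b1, b2[ then
    ((- r)%:C * c^*%C) * cexpi (- (- s * omega a1 a2 b1 b2 x)) / (Dfun a1 a2 b1 b2 x)%:C else 0)
    (al (- s) ((- r)%:C * c^*%C)) (be (- s) ((- r)%:C * c^*%C))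
    (be (- s) ((- r)%:C * c^*%C)) (- al (- s) ((- r)%:C * c^*%C)).
  apply: phase_profile => //; [exact: measurable_omega|exact: measurable_Dfun|exact: omega_chartB|].
  by move=> u; exact: lt0r_neq0 (Dfun_chartB_gt0 ha hab hb u).
rewrite e1 e2 /profile !mN !mulrNN !mulNr opprK.
by [].
Qed.

Let sgA f g p q : intg leb setT p -> intg leb setT q ->
  lifts (chartA a1 a2 b1 b2) (densA a1 a2 b1 b2) `]a1, a2[ f p ->
  lifts (chartA a1 a2 b1 b2) (densA a1 a2 b1 b2) `]a1, a2[ g q -> sgform f g = 1 * sgform p q.
Proof. by move=> _ _ lf lg; rewrite mul1r (sgform_increasing cA (chartA_mono ha hab hb) lf lg). Qed.

Let sgB f g p q : intg leb setT p -> intg leb setT q ->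
  lifts (chartB a1 a2 b1 b2) (densB a1 a2 b1 b2) `]b1, b2[ f p ->
  lifts (chartB a1 a2 b1 b2) (densB a1 a2 b1 b2) `]b1, b2[ g q -> sgform f g = -1 * sgform p q.
Proof.
by move=> ip iq lf lg; rewrite mulN1r (sgform_decreasing cB (chartB_mono ha hab hb) ip iq lf lg).
Qed.

Let sgR f g p q : intg leb setT p -> intg leb setT q ->
  lifts (chartR a1 a2 b1 b2) (densB a1 a2 b1 b2) `]b1, b2[ f p ->
  lifts (chartR a1 a2 b1 b2) (densB a1 a2 b1 b2) `]b1, b2[ g q -> sgform f g = 1 * sgform p q.
Proof.
move=> _ _ lf lg; rewrite mul1r; apply: (sgform_increasing cR _ lf lg) => u v.
by rewrite /chartR ltrD2l ltrN2 (chartB_mono ha hab hb).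
Qed.

Let sgAR u v : Num.sg (chartA a1 a2 b1 b2 u - chartR a1 a2 b1 b2 v) = -1.
Proof.
have := chartA_itv ha hab hb u; have := chartB_itv ha hab hb v.
rewrite !in_itv /= => /andP[h1 h3] /andP[h4 h2].
by rewrite ltr0_sg// /chartR subr_lt0 (lt_trans h2)// (lt_trans hab)// ltrBrDr ltrD2l.
Qed.

Let sgRA u v : Num.sg (chartR a1 a2 b1 b2 u - chartA a1 a2 b1 b2 v) = 1.
Proof. by rewrite -opprB sgrN sgAR opprK. Qed.

Let sqrt2 : Num.sqrt 2 * Num.sqrt 2 = 2 :> R.
Proof. by rewrite -expr2 sqr_sqrtr. Qed.

Let two_sqrt : 2 = (Num.sqrt 2 * Num.sqrt 2)%:C :> R[i].
Proof. by rewrite sqrt2 rmorph_nat. Qed.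

Section Pairings.
Variables (s t : R) (c d : R[i]).
Hypotheses (s0 : 0 < s) (t0 : 0 < t) (As : admissible s) (At : admissible t).
Local Notation dl := ((s == t)%:R * sigma s).

Lemma Omega_tvA : Omega (tvA a1 a2 b1 b2 s c) (tvA a1 a2 b1 b2 t d) = 0.
Proof.
rewrite (Omega_profile ha hab hb cA sgA s0 t0 As At (tvA_profile s c) (tvA_profile t d)).
by apply/eqP; rewrite eq_complex /=; apply/andP; split; apply/eqP; move: dl => e; ring.
Qed.

Lemma Omega_tvB : Omega (tvB a1 a2 b1 b2 s c) (tvB a1 a2 b1 b2 t d) = 0.
Proof.
rewrite (Omega_profile ha hab hb cR sgR s0 t0 As At (tvB_profile s c) (tvB_profile t d)).
by apply/eqP; rewrite eq_complex /=; apply/andP; split; apply/eqP; move: dl => e; ring.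
Qed.

Lemma Omega_vA : Omega (vA a1 a2 b1 b2 s c) (vA a1 a2 b1 b2 t d) = 0.
Proof.
rewrite (Omega_profile ha hab hb cA sgA s0 t0 As At (vA_profile s c) (vA_profile t d)).
by apply/eqP; rewrite eq_complex /=; apply/andP; split; apply/eqP; move: dl => e; ring.
Qed.

Lemma Omega_vB : Omega (vB a1 a2 b1 b2 s c) (vB a1 a2 b1 b2 t d) = 0.
Proof.
rewrite (Omega_profile ha hab hb cB sgB s0 t0 As At (vB_profile s c) (vB_profile t d)).
by apply/eqP; rewrite eq_complex /=; apply/andP; split; apply/eqP; move: dl => e; ring.
Qed.

(* The common value of [Omega (conjf f) g] for the halves on [A], or on [B], of two modes. *)
Definition pairing : R[i] :=
  ((al s c * be t d - be s c * al t d) / 2 * dl) +i*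
  (- (al s c * al t d + be s c * be t d) / 2 * dl).

Lemma Omega_conj_tvA : Omega (conjf (tvA a1 a2 b1 b2 s c)) (tvA a1 a2 b1 b2 t d) = pairing.
Proof.
rewrite (Omega_profile ha hab hb cA sgA s0 t0 As At (profile_conj (tvA_profile s c)) (tvA_profile t d)).
by apply/eqP; rewrite eq_complex /=; apply/andP; split; apply/eqP; move: dl => e; field.
Qed.

Lemma Omega_conj_tvB : Omega (conjf (tvB a1 a2 b1 b2 s c)) (tvB a1 a2 b1 b2 t d) = pairing.
Proof.
rewrite (Omega_profile ha hab hb cR sgR s0 t0 As At (profile_conj (tvB_profile s c)) (tvB_profile t d)).
by apply/eqP; rewrite eq_complex /=; apply/andP; split; apply/eqP; move: dl => e; field.
Qed.

Lemma Omega_conj_vA : Omega (conjf (vA a1 a2 b1 b2 s c)) (vA a1 a2 b1 b2 t d) = 2 * pairing.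
Proof.
rewrite (Omega_profile ha hab hb cA sgA s0 t0 As At (profile_conj (vA_profile s c)) (vA_profile t d)).
rewrite [X in _ = X * _]two_sqrt.
by apply/eqP; rewrite eq_complex /=; apply/andP; split; apply/eqP; move: dl => e; field.
Qed.

(** Conjugation of the mode conjugates the pairing, and the decreasing chart reverses its sign; the
    two changes cancel in the imaginary part. *)
Lemma Omega_conj_vB : Omega (conjf (vB a1 a2 b1 b2 s c)) (vB a1 a2 b1 b2 t d) =
  2 * (- Re pairing +i* Im pairing).
Proof.
rewrite (Omega_profile ha hab hb cB sgB s0 t0 As At (profile_conj (vB_profile s c)) (vB_profile t d)).
rewrite [X in _ = X * _]two_sqrt.
by apply/eqP; rewrite eq_complex /=; apply/andP; split; apply/eqP; move: dl => e; field.
Qed.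

End Pairings.

Lemma pairingE s c : pairing s s c c = 0 +i* (- (kap ^+ 2 * sqnorm c * sigma s) / 2).
Proof.
by rewrite /pairing eqxx mul1r -!expr2 al_be2 [be s c * _]mulrC subrr !mul0r; congr (_ +i* _); ring.
Qed.

(** The cross terms vanish because the intervals are separated, and the two intervals contribute
    equally. *)
Lemma Omega_tv s c : 0 < s -> admissible s ->
  Omega (conjf (tv a1 a2 b1 b2 s c)) (tv a1 a2 b1 b2 s c) =
  0 +i* (- (kap ^+ 2 * sqnorm c * sigma s)).
Proof.
move=> s0 As.
have -> : conjf (tv a1 a2 b1 b2 s c) =
    fun v => conjf (tvA a1 a2 b1 b2 s c) v + conjf (tvB a1 a2 b1 b2 s c) v.
  by apply/funext => v; rewrite /conjf /tv rmorphD.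
have pA := tvA_profile s c; have pB := tvB_profile s c.
have qA := profile_conj pA; have qB := profile_conj pB.
have ci X dX I F x y z w := @profile_cintegrable R a1 a2 b1 b2 ha hab hb X dX I s F x y z w.
rewrite (OmegaD (ci _ _ _ _ _ _ _ _ cA As qA) (ci _ _ _ _ _ _ _ _ cR As qB)
  (ci _ _ _ _ _ _ _ _ cA As pA) (ci _ _ _ _ _ _ _ _ cR As pB)).
rewrite (Omega_separated ha hab hb cA cR sgAR As qA pB) (Omega_separated ha hab hb cR cA sgRA As qB pA).
rewrite Omega_conj_tvA// Omega_conj_tvB// pairingE addr0 add0r.
by apply/eqP; rewrite eq_complex /=; apply/andP; split; apply/eqP; field.
Qed.

Let normc_sqr c : `|c| ^+ 2 = (sqnorm c)%:C.
Proof.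
rewrite sqr_normc /sqnorm; case: c => x y.
by apply/eqP; rewrite eq_complex /=; apply/andP; split; apply/eqP; ring.
Qed.

(** The condition prescribes the squared modulus of [c] and nothing else. Its value [r] is positive
    by [sigma_lt0], so the real square root is a solution. *)
Lemma normalization_exists s : 0 < s -> admissible s -> exists c, [/\ c != 0,
  Omega (conjf (tv a1 a2 b1 b2 s c)) (tv a1 a2 b1 b2 s c) = 0 +i* 1 &
  forall c', c' != 0 -> (Omega (conjf (tv a1 a2 b1 b2 s c')) (tv a1 a2 b1 b2 s c') = 0 +i* 1 <->
    exists u : R[i], `|u| = 1 /\ c' = u * c)].
Proof.
move=> s0 As; have sg := sigma_lt0 ha hab hb s0 As.
have kp := kappa_gt0 ha hab hb.
have r0 : 0 < (kap ^+ 2 * - sigma s)^-1.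
  by rewrite invr_gt0 mulr_gt0 ?oppr_gt0// exprn_gt0.
pose r := (kap ^+ 2 * - sigma s)^-1; rewrite -/r in r0.
have nE c : Omega (conjf (tv a1 a2 b1 b2 s c)) (tv a1 a2 b1 b2 s c) = 0 +i* 1 <-> `|c| ^+ 2 = r%:C.
  rewrite Omega_tv// normc_sqr; have -> : - (kap ^+ 2 * sqnorm c * sigma s) = sqnorm c / r.
    by rewrite /r invrK; ring.
  split => [[] h|[] h]; last by rewrite h divff// gt_eqF.
  by congr (_%:C); rewrite -[LHS](divfK (lt0r_neq0 r0)) h mul1r.
have c0 : (Num.sqrt r)%:C != 0 :> R[i].
  by rewrite eq_complex /= eqxx andbT gt_eqF// sqrtr_gt0.
have nc : `|(Num.sqrt r)%:C : R[i]| ^+ 2 = r%:C.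
  by rewrite normc_sqr /sqnorm /= expr0n addr0 sqr_sqrtr// ltW.
exists (Num.sqrt r)%:C; split => //; first by apply/nE.
move=> c' c'0; rewrite nE; split => [h|[u [u1 ->]]]; last by rewrite normrM u1 mul1r.
exists (c' / (Num.sqrt r)%:C); split; last by rewrite divfK.
rewrite normf_div; have -> : `|c'| = `|(Num.sqrt r)%:C : R[i]|; last by rewrite divff// normr_eq0.
by apply/eqP; rewrite -(@eqrXn2 _ 2)// h nc.
Qed.

Section Normalized.
Variables (s : R) (c : R[i]).
Hypotheses (s0 : 0 < s) (As : admissible s)
  (nc : Omega (conjf (tv a1 a2 b1 b2 s c)) (tv a1 a2 b1 b2 s c) = 0 +i* 1).

Let sq1 : kap ^+ 2 * sqnorm c * - sigma s = 1.
Proof. by have := nc; rewrite Omega_tv// => -[]; rewrite mulrN. Qed.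

Lemma pairing_normalized : pairing s s c c = (0 +i* 1) / 2.
Proof.
rewrite pairingE -mulrN sq1 mul1r; apply: (mulIf (x := 2)); first by rewrite pnatr_eq0.
rewrite divfK ?pnatr_eq0//.
by apply/eqP; rewrite eq_complex /=; apply/andP; split; apply/eqP; field.
Qed.

(** One factor sqrt 2 comes from the core modes and one from the quadratures; together they double
    the amplitudes and turn the normalization into the value 4 of [covariance_spectrum]. *)
Lemma vA_vB_negativity : exists nu : 'I_2 -> R,
  [/\ symplectic_eigenvalues (covariance_pt (vA a1 a2 b1 b2 s c) (vB a1 a2 b1 b2 s c)) nu,
      exists j : 'I_2, nu j = tanh (pi * s) & log_negativity nu = - log2 (tanh (pi * s))].
Proof.
have [lA1 lA2] := vA_profile s c; have [lB1 lB2] := vB_profile s c.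
have {}lA1 := liftsZ_mode (Num.sqrt 2) lA1; have {}lA2 := liftsZ_mode (Num.sqrt 2) lA2.
have {}lB1 := liftsZ_mode (- Num.sqrt 2) lB1; have {}lB2 := liftsZ_mode (Num.sqrt 2) lB2.
have e (x : R) : Num.sqrt 2 * (Num.sqrt 2 * x) = 2 * x by rewrite mulrA sqrt2.
rewrite ?mulrNN ?mulrN !e in lA1 lA2 lB1 lB2.
apply: (@covariance_spectrum R a1 a2 b1 b2 s ha hab hb s0 As (2 * al s c) (2 * be s c)
  _ _ _ _ _ lA1 lA2 lB1 lB2).
  transitivity (4 * ((al s c ^+ 2 + be s c ^+ 2) * - sigma s)); first by ring.
  by rewrite al_be2 sq1 mulr1.
rewrite /covariance_pt; congr (gram _); apply/funext => i; congr (nth _ _ _).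
congr [:: _; _; _; _]; apply/funext => x; rewrite /quadQ /quadP.
  by rewrite mulN1r mulNr opprK.
by rewrite mulN1r rmorphN.
Qed.

End Normalized.

Lemma pairing_orthogonal s t c d : s != t -> pairing s t c d = 0.
Proof. by move=> /negbTE st; rewrite /pairing st mul0r !mulr0. Qed.

Lemma vA_observable s c : admissible s -> observable `]a1, a2[ `]b1, b2[ (vA a1 a2 b1 b2 s c).
Proof.
move=> As; have p := vA_profile s c; cbv zeta in p; split.
- by move=> x /negbTE xA _; rewrite /vA xA.
- exact: (@profile_cintegrable R a1 a2 b1 b2 ha hab hb _ _ _ s _ _ _ _ _ cA As p).
- exact: (@profile_cintegral R a1 a2 b1 b2 ha hab hb _ _ _ s _ _ _ _ _ cA As p).
- apply: cintegral0 => x; rewrite in_itv /= => /andP[x1 _].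
  by rewrite /vA in_itv /= [x < a2]ltNge (ltW (lt_trans hab x1)) andbF.
Qed.

Lemma vB_observable s c : admissible s -> observable `]a1, a2[ `]b1, b2[ (vB a1 a2 b1 b2 s c).
Proof.
move=> As; have p := vB_profile s c; cbv zeta in p; split.
- by move=> x _ /negbTE xB; rewrite /vB xB.
- exact: (@profile_cintegrable R a1 a2 b1 b2 ha hab hb _ _ _ s _ _ _ _ _ cB As p).
- apply: cintegral0 => x; rewrite in_itv /= => /andP[_ x2].
  by rewrite /vB in_itv /= ltNge (ltW (lt_trans x2 hab)).
- exact: (@profile_cintegral R a1 a2 b1 b2 ha hab hb _ _ _ s _ _ _ _ _ cB As p).
Qed.

End TwoIntervalModes.

Local Open Scope complex_scope.

(* s n is the zero numbered n + 1. *)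
Theorem mainTheorem3 (R : realType) (a1 a2 b1 b2 : R)
    (ha : a1 < a2) (hab : a2 < b1) (hb : b1 < b2)
    (s : nat -> R)
    (s_incr : forall m n : nat, (m < n)%N -> s m < s n)
    (s_zeros : forall t : R,
      let eta := cross_ratio a1 a2 b1 b2 in
      (0 < t /\ conicalP t ((1 + eta) / (1 - eta)) = 0) <->
      (exists n : nat, s n = t)) :
  let tvAn (C : nat -> R[i]) n := tvA a1 a2 b1 b2 (s n) (C n) in
  let tvBn (C : nat -> R[i]) n := tvB a1 a2 b1 b2 (s n) (C n) in
  let vAn (C : nat -> R[i]) n := vA a1 a2 b1 b2 (s n) (C n) in
  let vBn (C : nat -> R[i]) n := vB a1 a2 b1 b2 (s n) (C n) in
  let normalizes n (c : R[i]) :=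
    Omega (conjf (tv a1 a2 b1 b2 (s n) c)) (tv a1 a2 b1 b2 (s n) c) = 0 +i* 1 in
  (forall n, exists c : R[i],
     [/\ c != 0, normalizes n c &
         forall c' : R[i], c' != 0 ->
           (normalizes n c' <-> exists u : R[i], `|u| = 1 /\ c' = u * c)]) /\
  (forall C : nat -> R[i],
     (forall n, C n != 0) -> (forall n, normalizes n (C n)) ->
     (* (1) local symplectic orthogonality *)
     (forall n n' : nat,
        [/\ Omega (conjf (tvAn C n)) (tvAn C n') = (0 +i* 1) / 2 * (n == n')%:R,
            Omega (conjf (tvBn C n)) (tvBn C n') = (0 +i* 1) / 2 * (n == n')%:R,
            Omega (tvAn C n) (tvAn C n') = 0 &
            Omega (tvBn C n) (tvBn C n') = 0]) /\
     (* (2) core mode pairs *)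
     [/\ forall n : nat,
           observable `]a1, a2[ `]b1, b2[ (vAn C n) /\
           observable `]a1, a2[ `]b1, b2[ (vBn C n),
         forall n n' : nat,
           [/\ Omega (conjf (vAn C n)) (vAn C n') = (0 +i* 1) * (n == n')%:R,
               Omega (conjf (vBn C n)) (vBn C n') = (0 +i* 1) * (n == n')%:R,
               Omega (vAn C n) (vAn C n') = 0 &
               Omega (vBn C n) (vBn C n') = 0] &
         forall n : nat, exists nu : 'I_2 -> R,
           [/\ symplectic_eigenvalues (covariance_pt (vAn C n) (vBn C n)) nu,
               exists j : 'I_2, nu j = tanh (pi * s n) &
               log_negativity nu = - log2 (tanh (pi * s n))]]).
Proof.
move=> tvAn tvBn vAn vBn normalizes.
have e01 := cross_ratio_itv ha hab hb.
(* The zeros of the conical function enter as positive frequencies for which the cosine mode has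
   vanishing charge. *)
have Hs n : 0 < s n /\ \int[@lebesgue_measure R]_u cosmode (kpar a1 a2 b1 b2) (s n) u = 0.
  have [sn0 z] : 0 < s n /\ _ := (s_zeros (s n)).2 (ex_intro _ n erefl).
  by split => //; exact: conicalP_weight_eq0 e01 z.
have s0 n : 0 < s n := (Hs n).1; have As n := (Hs n).2.
have sE m n : (s m == s n) = (m == n).
  apply/eqP/eqP => [e|-> //]; have [h|h|//] := ltngtP m n;
    by have := s_incr _ _ h; rewrite e ltxx.
split; first by move=> n; exact: normalization_exists.
move=> C C0 nC.
have P n n' : pairing a1 a2 b1 b2 (s n) (s n') (C n) (C n') = (0 +i* 1) / 2 * (n == n')%:R.
  have [<-|nn] := eqVneq n n'; first by rewrite mulr1; exact: pairing_normalized (s0 n) (As n) (nC n).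
  by rewrite mulr0 pairing_orthogonal// sE.
have two : (2 : R[i]) != 0 by rewrite pnatr_eq0.
split; last split.
- move=> n n'; split.
  + by rewrite Omega_conj_tvA.
  + by rewrite Omega_conj_tvB.
  + exact: Omega_tvA.
  + exact: Omega_tvB.
- by move=> n; split; [exact: vA_observable|exact: vB_observable].
- move=> n n'; split.
  + by rewrite Omega_conj_vA// P mulrA [2 * _]mulrC divfK.
  + rewrite Omega_conj_vB// P.
    have [_|_] := eqVneq n n'; last by rewrite !mulr0 /= oppr0 -[0 +i* 0]/(0 : R[i]) mulr0.
    rewrite !mulr1; have -> : (0 +i* 1) / 2 = 0 +i* 2^-1 :> R[i].
      apply: (mulIf two); rewrite divfK//.
      by apply/eqP; rewrite eq_complex /=; apply/andP; split; apply/eqP; field.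
    by apply/eqP; rewrite eq_complex /=; apply/andP; split; apply/eqP; field.
  + exact: Omega_vA.
  + exact: Omega_vB.
- by move=> n; exact: vA_vB_negativity (nC n).
Qed.
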